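(* Let $N$ be a positive integer and $h$ an integer with $h\geq N/2$. Let $x>0$ and $0<a\leq 1$. Put $A_{N,j}(y):=\pi(2\pi y)^{\frac{1}{N}}e^{\frac{i\pi j}{N}}$. If $\frac{N-2h+1}{N}\neq -2\left\lfloor\frac{h}{N}-\frac{1}{2}\right\rfloor$, then \[ \sum_{n=1}^{\infty}n^{N-2h}\frac{\exp(-an^{N}x)}{1-\exp(-n^{N}x)}=P(x,a)+S(x,a), \] where \begin{align*} P(x,a)&:=-\left(a-\tfrac{1}{2}\right)\zeta(-N+2h)+\frac{\zeta(2h)}{x}+\frac{1}{N}\Gamma\!\left(\tfrac{N-2h+1}{N}\right)\zeta\!\left(\tfrac{N-2h+1}{N},a\right)x^{-\frac{N-2h+1}{N}}\\ &\quad-\sum_{j=1}^{\left\lfloor\frac{h}{N}-\frac{1}{2}\right\rfloor}\frac{B_{2j+1}(a)}{(2j+1)!}\zeta\big(2h-(2j+1)N\big)x^{2j} +\frac{(-1)^{h+1}}{2}(2\pi)^{2h}\sum_{j=1}^{\left\lfloor\frac{h}{N}\right\rfloor}\left(\frac{-1}{4\pi^2}\right)^{jN}\frac{B_{2j}(a)B_{2h-2jN}}{(2j)!(2h-2jN)!}x^{2j-1}, \end{align*} and where, for $N$ odd, \begin{align*} S(x,a)&:=\frac{(-1)^{h+1}}{N}\left(\frac{2\pi}{x}\right)^{\frac{N-2h+1}{N}}\sum_{j=-\frac{N-1}{2}}^{\frac{N-1}{2}}e^{\frac{i\pi(1-2h)j}{N}}\Bigg\{\sum_{n=1}^{\infty}\frac{\cos(2\pi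 na)}{n^{\frac{2h-1}{N}}\left(\exp\left(2A_{N,j}\left(\frac{n}{x}\right)\right)-1\right)}\\ &\quad+\frac{(-1)^{j+\frac{N+1}{2}}}{\pi}\sum_{n=1}^{\infty}\frac{\sin(2\pi na)}{n^{\frac{2h-1}{N}}}\left\{\log\left(\tfrac{1}{\pi}A_{N,j}\left(\tfrac{n}{x}\right)\right)-\tfrac{1}{2}\left(\psi\left(\tfrac{i}{\pi}A_{N,j}\left(\tfrac{n}{x}\right)\right)+\psi\left(-\tfrac{i}{\pi}A_{N,j}\left(\tfrac{n}{x}\right)\right)\right)\right\}\Bigg\}, \end{align*} and, for $N$ even, \[ S(x,a):=\frac{(-1)^{h+1}}{N}\left(\frac{2\pi}{x}\right)^{\frac{N-2h+1}{N}}\sum_{j=-\frac{N}{2}}^{\frac{N}{2}-1}e^{\frac{i\pi(1-2h)(j+\frac{1}{2})}{N}}\sum_{n=1}^{\infty}\frac{\cos(2\pi na)+i(-1)^{j+\frac{N}{2}+1}\sin(2\pi na)}{n^{\frac{2h-1}{N}}\left(\exp\left(2A_{N,j+\frac{1}{2}}\left(\frac{n}{x}\right)\right)-1\right)}. \]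
   Context: $\zeta(s)$ is the Riemann zeta function and $\zeta(s,a)$ the Hurwitz zeta function (analytically continued). $B_j(a)$ are Bernoulli polynomials defined by $\sum_{j\ge0}B_j(a)z^j/j!=ze^{az}/(e^z-1)$, and $B_j=B_j(1)$ are Bernoulli numbers. $\psi=\Gamma'/\Gamma$ is the digamma function; $\log$ denotes the principal branch. Sums over $j$ run through integers between the stated limits (for $N$ even, $A_{N,j+1/2}$ means $A_{N,j}$ with $j$ replaced by $j+\tfrac12$). Empty sums are $0$. *)

(* Defs.v *)
From Stdlib Require Import Reals ZArith.
From Coquelicot Require Export Coquelicot.
Open Scope R_scope.

Definition Cexp (z : C) : C := (exp (Re z) * cos (Im z), exp (Re z) * sin (Im z)).

Definition Carg (z : C) : R :=
  let x := Re z in let y := Im z in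
  if Rlt_dec 0 x then atan (y / x)
  else if Rlt_dec x 0 then
         (if Rle_dec 0 y then atan (y / x) + PI else atan (y / x) - PI)
  else if Rlt_dec 0 y then PI / 2
  else if Rlt_dec y 0 then - (PI / 2) else 0.

Definition Clog (z : C) : C := (ln (Cmod z), Carg z).

Definition CSeries (f : nat -> C) : C := (Series (fun n => Re (f n)), Series (fun n => Im (f n))).

Fixpoint csum (f : nat -> C) (n : nat) : C :=
  match n with O => RtoC 0 | S k => Cplus (csum f k) (f k) end.

Fixpoint rsum (f : nat -> R) (n : nat) : R :=
  match n with O => 0 | S k => rsum f k + f k end.

Definition sgnZ (m : Z) : R := if Z.even m then 1 else -1.

(* Bernoulli numbers with generating function z/(e^z-1) (so B_1(0) = -1/2),
   via  sum_{k=0}^{n} C(n+1,k) b_k = 0  (n >= 1), b_0 = 1. *)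
Fixpoint bern_list (n : nat) : list R :=
  match n with
  | O => 1 :: nil
  | S m =>
      let l := bern_list m in
      let s := List.fold_right Rplus 0
                 (List.map (fun k => Binomial.C (S m + 1) k * List.nth k l 0) (List.seq 0 (S m))) in
      l ++ ((- s) / INR (S m + 1)) :: nil
  end.
Definition bern0 (n : nat) : R := List.nth n (bern_list n) 0.

Definition bernpoly (n : nat) (a : R) : R :=
  sum_f_R0 (fun k => Binomial.C n k * bern0 k * a ^ (n - k)) n.

Definition bernnum (n : nat) : R := bernpoly n 1.

(* Hurwitz zeta function, analytically continued to all real s <> 1 (a > 0),
   via Hasse's globally convergent series:
   zeta(s,a) = 1/(s-1) sum_{n>=0} 1/(n+1) sum_{k=0}^n (-1)^k C(n,k) (a+k)^(1-s). *)
Definition hurwitz_zeta (s a : R) : R :=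
  / (s - 1) * Series (fun n =>
      / INR (n + 1) * sum_f_R0 (fun k => (-1) ^ k * Binomial.C n k * Rpower (a + INR k) (1 - s)) n).

Definition riemann_zeta (s : R) : R := hurwitz_zeta s 1.

(* Gamma function on reals (not a non-positive integer), Gauss' limit formula:
   Gamma(s) = lim n! n^s / (s (s+1) ... (s+n)). *)
Definition Gamma (s : R) : R :=
  real (Lim_seq (fun n => INR (fact n) * Rpower (INR n) s /
                          prod_f_R0 (fun k => s + INR k) n)).

(* digamma function on complex z (not a non-positive integer):
   psi(z) = lim_{n->oo} ( log n - sum_{k=0}^{n} 1/(z+k) ). *)
Definition digamma (z : C) : C :=
  let t := fun n => csum (fun k => Cinv (Cplus z (RtoC (INR k)))) (S n) in
  (real (Lim_seq (fun n => ln (INR n) - Re (t n))),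
   real (Lim_seq (fun n => - Im (t n)))).

Definition A_N (N : nat) (j y : R) : C :=
  Cmult (RtoC (PI * Rpower (2 * PI * y) (1 / INR N))) (Cexp (0, PI * j / INR N)).

Section Sides.
Variables (N : nat) (h : Z) (x a : R).

Definition s_exp : R := IZR (Z.of_nat N - 2 * h + 1) / INR N.
Definition floor_hN_half : Z := floor (IZR h / INR N - 1 / 2).
Definition floor_hN : Z := floor (IZR h / INR N).

Definition P_term : R :=
  - (a - 1 / 2) * riemann_zeta (IZR (- Z.of_nat N + 2 * h))
  + riemann_zeta (IZR (2 * h)) / x
  + / INR N * Gamma s_exp * hurwitz_zeta s_exp a * Rpower x (- s_exp)
  - rsum (fun i => let j := S i in
        bernpoly (2 * j + 1) a / INR (fact (2 * j + 1))
        * riemann_zeta (IZR (2 * h - (2 * Z.of_nat j + 1) * Z.of_nat N)) * x ^ (2 * j))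
      (Z.to_nat floor_hN_half)
  + sgnZ (h + 1) / 2 * powerRZ (2 * PI) (2 * h)
    * (rsum (fun i => let j := S i in
        let m := Z.to_nat (2 * h - 2 * Z.of_nat j * Z.of_nat N) in
        (-1 / (4 * PI ^ 2)) ^ (j * N)
        * bernpoly (2 * j) a * bernnum m / (INR (fact (2 * j)) * INR (fact m))
        * x ^ (2 * j - 1))
      (Z.to_nat floor_hN)).

Definition npow (n : nat) : R := Rpower (INR n) (IZR (2 * h - 1) / INR N).

(* N odd: index k = 0..N-1, j = k - (N-1)/2 *)
Definition jodd (k : nat) : Z := (Z.of_nat k - Z.of_nat ((N - 1) / 2))%Z.

Definition odd_series1 (k : nat) (n : nat) : C :=
  let n1 := S n in
  Cdiv (RtoC (cos (2 * PI * INR n1 * a)))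
       (Cmult (RtoC (npow n1))
              (Cminus (Cexp (Cmult (RtoC 2) (A_N N (IZR (jodd k)) (INR n1 / x)))) (RtoC 1))).

Definition odd_series2 (k : nat) (n : nat) : C :=
  let n1 := S n in
  let Aj := A_N N (IZR (jodd k)) (INR n1 / x) in
  Cmult (RtoC (sin (2 * PI * INR n1 * a) / npow n1))
        (Cminus (Clog (Cmult (RtoC (/ PI)) Aj))
                (Cmult (RtoC (1 / 2))
                       (Cplus (digamma (Cmult (Cmult Ci (RtoC (/ PI))) Aj))
                              (digamma (Cmult (Cmult (Copp Ci) (RtoC (/ PI))) Aj))))).

Definition S_odd : C :=
  Cmult (RtoC (sgnZ (h + 1) / INR N * Rpower (2 * PI / x) s_exp))
   (csum (fun k =>
      Cmult (Cexp (0, PI * IZR (1 - 2 * h) * IZR (jodd k) / INR N))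
        (Cplus (CSeries (odd_series1 k))
               (Cmult (RtoC (sgnZ (jodd k + Z.of_nat ((N + 1) / 2)) / PI))
                      (CSeries (odd_series2 k))))) N).

(* N even: index k = 0..N-1, j = k - N/2 *)
Definition jeven (k : nat) : Z := (Z.of_nat k - Z.of_nat (N / 2))%Z.

Definition even_series (k : nat) (n : nat) : C :=
  let n1 := S n in
  Cdiv (Cplus (RtoC (cos (2 * PI * INR n1 * a)))
              (Cmult Ci (RtoC (sgnZ (jeven k + Z.of_nat (N / 2) + 1)
                               * sin (2 * PI * INR n1 * a)))))
       (Cmult (RtoC (npow n1))
              (Cminus (Cexp (Cmult (RtoC 2) (A_N N (IZR (jeven k) + 1 / 2) (INR n1 / x))))
                      (RtoC 1))).

Definition S_even : C :=
  Cmult (RtoC (sgnZ (h + 1) / INR N * Rpower (2 * PI / x) s_exp))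
   (csum (fun k =>
      Cmult (Cexp (0, PI * IZR (1 - 2 * h) * (IZR (jeven k) + 1 / 2) / INR N))
            (CSeries (even_series k))) N).

Definition S_term : C := if Nat.odd N then S_odd else S_even.

Definition lhs_term (n : nat) : R :=
  let n1 := S n in
  powerRZ (INR n1) (Z.of_nat N - 2 * h)
  * exp (- a * INR n1 ^ N * x) / (1 - exp (- INR n1 ^ N * x)).

End Sides.

(* Main.v *)
(** Put sigma = (2h-1)/N, so that 1 - sigma = (N-2h+1)/N, and t = n^N x.

    Expanding e^(-at)/(1-e^(-t)), as a function of a in [0,1], in a Fourier series and peeling off
    Taylor terms in t writes the n-th summand as a polynomial part, whose sums over n are the values
    zeta(2h-lN), plus two series over m of cosines or sines of 2 pi m a times n^p/(n^(2N)+y^2) with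
    y = 2 pi m/x: the remainders in the even and in the odd powers of t, which lead to the cosine and
    the sine sums.  After exchanging the sums, the inner sum over n is the integral of u^p/(u^(2N)+y^2)
    plus the defect between sum and integral.  Partial fractions over the N roots A_(N,j)/pi of
    z^(2N) = (-1)^(N-1) y^2 with positive real part reduce the defect to that of 1/(u^2+z^2) or
    u/(u^2+z^2), which 1/(exp(2 pi z)-1) or digamma values express.  The integrals add up to a Mellin
    transform, which Hasse's series integrated termwise identifies as Gamma(1-sigma) zeta(1-sigma,a).
    If 2h = N, the first remainder series converges only conditionally; there the formula follows
    from the case 2h = 2N by differentiating in a. *)

Require Import Defs.
From Stdlib Require Import Reals ZArith Lra Lia List Classical.
From Coquelicot Require Import Coquelicot.
Open Scope R_scope.

(** * Limits and series of real functions *)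

(** The integral of u^p/(u^(2N)+y^2) enters only as an abstract constant [beta]: after scaling, the
    same constant occurs in the inner sums over n and in the Mellin transforms of the remainders,
    and uniqueness of an improper integral matches the two. The hypothesis on (N-2h+1)/N says
    exactly that sigma is not an integer, that is, that the Gamma factor has no pole: since 2h is
    even, an integral sigma would be odd. With J = ceil(sigma), peeling J Taylor terms leaves
    remainders of orders J-1 and J; for sigma > 1 these are the only orders with 0 <= p <= 2N-2, the
    range in which partial fractions apply and both sum and integral over n converge. One of the two
    orders is odd and gives cosines, the other is even and gives sines. The Fourier expansion is
    proved for complex t, although t = n^N x is real, because its case a = 0, t = 2 pi z is also
    what produces 1/(exp(2 pi z)-1) at the complex roots z. *)

Lemma mean_value_bound (f f' : R -> R) (a b K : R) :
  (forall x, Rmin a b <= x <= Rmax a b -> is_derive f x (f' x)) ->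
  (forall x, Rmin a b <= x <= Rmax a b -> Rabs (f' x) <= K) ->
  Rabs (f b - f a) <= K * Rabs (b - a).
Proof.
  intros Hd HK.
  destruct (MVT_gen f a b f') as [c [Hc ->]].
  - intros x Hx. apply Hd. lra.
  - intros x Hx. apply continuity_pt_filterlim.
    apply @ex_derive_continuous. exists (f' x). now apply Hd.
  - rewrite Rabs_mult. apply Rmult_le_compat_r; [apply Rabs_pos|now apply HK].
Qed.

Lemma sum_n_S (u : nat -> R) (n : nat) : sum_n u (S n) = sum_n u n + u (S n).
Proof. now rewrite sum_Sn. Qed.

Lemma sum_n_ext_R (u v : nat -> R) (n : nat) :
  (forall k, u k = v k) -> sum_n u n = sum_n v n.
Proof. intros H. now apply sum_n_ext. Qed.

Lemma is_derive_ext_R (f g : R -> R) (x l : R) :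
  (forall u, f u = g u) -> is_derive f x l -> is_derive g x l.
Proof. intros H. now apply is_derive_ext. Qed.

Lemma is_derive_Rscal (f : R -> R) (k x l : R) :
  is_derive f x l -> is_derive (fun u => k * f u) x (k * l).
Proof. intros H. exact (is_derive_scal f x k l H). Qed.

Lemma ex_series_Rscal (c : R) (u : nat -> R) :
  ex_series u -> ex_series (fun n => c * u n).
Proof. intros H. exact (ex_series_scal_l (K := R_AbsRing) c u H). Qed.

Lemma ex_series_dominated (u c : nat -> R) :
  ex_series c -> (forall n, Rabs (u n) <= c n) -> ex_series u.
Proof.
  intros Hc H. apply (ex_series_le (K := R_AbsRing) (V := R_CompleteNormedModule) u c); auto.
Qed.

Lemma Series_abs_le (u c : nat -> R) :
  ex_series c -> (forall n, Rabs (u n) <= c n) -> Rabs (Series u) <= Series c.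
Proof.
  intros Hc H.
  apply Rle_trans with (Series (fun n => Rabs (u n))).
  - apply Series_Rabs. apply ex_series_dominated with c; auto.
    intros n. rewrite Rabs_Rabsolu. auto.
  - apply Series_le; auto. intros n; split; [apply Rabs_pos|auto].
Qed.

Lemma Series_split (u : nat -> R) (M : nat) :
  ex_series u -> Series u = sum_n u M + Series (fun k => u (S M + k)%nat).
Proof.
  intros H. rewrite (Series_incr_n u (S M)); auto with arith.
  simpl pred. now rewrite sum_n_Reals.
Qed.

Lemma ex_series_shift (u : nat -> R) (M : nat) :
  ex_series u -> ex_series (fun k => u (M + k)%nat).
Proof. intros H. now apply ex_series_incr_n. Qed.

Lemma tail_lim (c : nat -> R) :
  ex_series c -> is_lim_seq (fun M => Series (fun k => c (S M + k)%nat)) 0.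
Proof.
  intros H.
  apply is_lim_seq_ext with (fun M => Series c - sum_n c M).
  - intros M. rewrite (Series_split c M H). ring.
  - replace 0 with (Series c - Series c) by ring.
    apply is_lim_seq_minus'; [apply is_lim_seq_const|].
    apply (Series_correct c H).
Qed.

Lemma filterlim_R_eps {T} (F : (T -> Prop) -> Prop) {FF : Filter F} (f : T -> R) (l : R) :
  (forall eps, 0 < eps -> F (fun t => Rabs (f t - l) < eps)) <-> filterlim f F (locally l).
Proof.
  split.
  - intros H. apply filterlim_locally. intros eps. apply (H eps). apply cond_pos.
  - intros H eps Heps. apply (proj1 (filterlim_locally f l) H (mkposreal eps Heps)).
Qed.

Lemma filterlim_Rplus {T} (F : (T -> Prop) -> Prop) {FF : Filter F} (f g : T -> R) (a b : R) :
  filterlim f F (locally a) -> filterlim g F (locally b) ->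
  filterlim (fun t => f t + g t) F (locally (a + b)).
Proof.
  intros Hf Hg. apply (filterlim_comp_2 (G := locally a) (H := locally b) f g Rplus); auto.
  apply (filterlim_plus (V := R_NormedModule)).
Qed.

Lemma filterlim_Rmult {T} (F : (T -> Prop) -> Prop) {FF : Filter F} (f g : T -> R) (a b : R) :
  filterlim f F (locally a) -> filterlim g F (locally b) ->
  filterlim (fun t => f t * g t) F (locally (a * b)).
Proof.
  intros Hf Hg. apply (filterlim_comp_2 (G := locally a) (H := locally b) f g Rmult); auto.
  apply (filterlim_mult (K := R_AbsRing)).
Qed.

Lemma filterlim_Rscal {T} (F : (T -> Prop) -> Prop) {FF : Filter F} (f : T -> R) (c a : R) :
  filterlim f F (locally a) -> filterlim (fun t => c * f t) F (locally (c * a)).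
Proof. intros Hf. apply filterlim_Rmult; auto. apply filterlim_const. Qed.

Lemma filterlim_Rminus {T} (F : (T -> Prop) -> Prop) {FF : Filter F} (f g : T -> R) (a b : R) :
  filterlim f F (locally a) -> filterlim g F (locally b) ->
  filterlim (fun t => f t - g t) F (locally (a - b)).
Proof.
  intros Hf Hg. apply filterlim_Rplus; auto.
  apply (filterlim_comp _ _ _ g Ropp F (locally b)); auto.
  apply (filterlim_opp (V := R_NormedModule)).
Qed.

Lemma sum_n_filterlim {T} (F : (T -> Prop) -> Prop) {FF : Filter F}
  (v : T -> nat -> R) (l : nat -> R) :
  (forall m, filterlim (fun t => v t m) F (locally (l m))) ->
  forall M, filterlim (fun t => sum_n (v t) M) F (locally (sum_n l M)).
Proof.
  intros H M. induction M as [|M IH].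
  - rewrite sum_O. apply filterlim_ext with (fun t => v t O); [|apply H].
    intros t. now rewrite sum_O.
  - rewrite sum_Sn. apply filterlim_ext with (fun t => plus (sum_n (v t) M) (v t (S M))).
    { intros t. now rewrite sum_Sn. }
    eapply filterlim_comp_2; [apply IH|apply H|].
    apply (filterlim_plus (V := R_NormedModule)).
Qed.

(** Dominated convergence for series: the majorant cuts off the tail, and a finite sum passes to the
    limit. An arbitrary proper filter is allowed because the filter is in turn a neighbourhood
    (continuity), a punctured neighbourhood (derivatives), [eventually] (double series) and
    [line_filter] (improper integrals). *)
Theorem tannery {T} (F : (T -> Prop) -> Prop) {FF : ProperFilter F}
  (v : T -> nat -> R) (l c : nat -> R) :
  ex_series c ->
  F (fun t => forall m, Rabs (v t m) <= c m) ->
  (forall m, filterlim (fun t => v t m) F (locally (l m))) ->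
  (forall m, Rabs (l m) <= c m) /\ ex_series l /\
  filterlim (fun t => Series (v t)) F (locally (Series l)).
Proof.
  intros Hc Hv Hl.
  assert (Hlc : forall m, Rabs (l m) <= c m).
  { intros m. apply Rnot_lt_le. intros Hlt.
    assert (Hpos : 0 < Rabs (l m) - c m) by lra.
    assert (H := proj2 (filterlim_R_eps F (fun t => v t m) (l m)) (Hl m) _ Hpos).
    destruct (filter_ex _ (filter_and _ _ H Hv)) as [t [H1 H2]].
    specialize (H2 m).
    assert (Rabs (l m) <= Rabs (v t m) + Rabs (v t m - l m)).
    { replace (l m) with (v t m + - (v t m - l m)) at 1 by ring.
      eapply Rle_trans; [apply Rabs_triang|]. rewrite Rabs_Ropp. lra. }
    lra. }
  assert (Hexl : ex_series l) by (apply ex_series_dominated with c; auto).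
  split; [assumption|split; [assumption|]].
  apply (proj1 (filterlim_R_eps F _ _)). intros eps Heps.
  assert (Htail := tail_lim c Hc).
  apply is_lim_seq_spec in Htail.
  destruct (Htail (mkposreal (eps / 4) ltac:(lra))) as [M HM].
  specialize (HM M (le_n M)). cbn [pos] in HM. rewrite Rminus_0_r in HM.
  assert (H := proj2 (filterlim_R_eps F _ _) (sum_n_filterlim F v l Hl M) (eps / 4) ltac:(lra)).
  generalize (filter_and _ _ H Hv). apply filter_imp. intros t [H1 H2].
  assert (Hext : ex_series (v t)) by (apply ex_series_dominated with c; auto).
  rewrite (Series_split (v t) M Hext), (Series_split l M Hexl).
  assert (Hcs := ex_series_shift c (S M) Hc).
  assert (Ht1 := Series_abs_le (fun k => v t (S M + k)%nat) _ Hcs (fun k => H2 (S M + k)%nat)).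
  assert (Ht2 := Series_abs_le (fun k => l (S M + k)%nat) _ Hcs (fun k => Hlc (S M + k)%nat)).
  apply Rabs_def2 in H1. apply Rabs_def2 in HM.
  apply Rabs_le_between in Ht1. apply Rabs_le_between in Ht2.
  apply Rabs_def1; lra.
Qed.

(** Difference quotients converge termwise, and the mean value theorem bounds each of them by [d],
    so [tannery] applies along the punctured neighbourhood of 0. *)
Lemma derive_Series (u v : nat -> R -> R) (d : nat -> R) (x0 r : R) :
  0 < r -> ex_series d ->
  (forall m x, Rabs (x - x0) < r -> is_derive (u m) x (v m x)) ->
  (forall m x, Rabs (x - x0) < r -> Rabs (v m x) <= d m) ->
  (forall x, Rabs (x - x0) < r -> ex_series (fun m => u m x)) ->
  is_derive (fun x => Series (fun m => u m x)) x0 (Series (fun m => v m x0)).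
Proof.
  intros Hr Hd Hder Hbd Hex.
  assert (Hnear : locally' 0 (fun h : R => Rabs h < r /\ h <> 0)).
  { exists (mkposreal r Hr). intros h Hh Hne. split; auto.
    change (Rabs (h - 0) < r) in Hh. now rewrite Rminus_0_r in Hh. }
  destruct (@tannery R (locally' 0) (Rbar_locally'_filter 0) (fun (h : R) m => (u m (x0 + h) - u m x0) / h)
              (fun m => v m x0) d Hd) as [_ [_ Hlim]].
  - revert Hnear. apply filter_imp. intros h [Hh Hne] m. change R in h.
    assert (Hb := mean_value_bound (u m) (v m) x0 (x0 + h) (d m)).
    replace (x0 + h - x0) with h in Hb by ring.
    unfold Rdiv. rewrite Rabs_mult, Rabs_inv.
    apply Rmult_le_reg_r with (Rabs h); [now apply Rabs_pos_lt|].
    rewrite Rmult_assoc, Rinv_l, Rmult_1_r by (now apply Rabs_no_R0).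
    assert (Hin : forall x, Rmin x0 (x0 + h) <= x <= Rmax x0 (x0 + h) -> Rabs (x - x0) < r).
    { intros x Hx. apply Rabs_def2 in Hh. revert Hx. unfold Rmin, Rmax.
      destruct (Rle_dec x0 (x0 + h)); intros; apply Rabs_def1; lra. }
    apply Hb; intros x Hx; [apply Hder|apply Hbd]; auto.
  - intros m. apply filterlim_R_eps; [apply _|]. intros eps Heps.
    assert (H : is_derive (u m) x0 (v m x0)).
    { apply Hder. rewrite Rminus_diag. now rewrite Rabs_R0. }
    apply is_derive_Reals in H. destruct (H eps Heps) as [delta Hdel].
    exists delta. intros h Hh Hne. apply Hdel; auto.
    change (Rabs (h - 0) < delta) in Hh. now rewrite Rminus_0_r in Hh.
  - apply is_derive_Reals. intros eps Heps.
    assert (H := proj2 (@filterlim_R_eps _ (locally' 0) (filter_filter (ProperFilter := Rbar_locally'_filter 0)) _ _) Hlim eps Heps).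
    destruct (filter_and _ _ H Hnear) as [delta Hdel].
    exists delta. intros h Hne Hh.
    destruct (Hdel h) as [H1 [H2 _]]; auto.
    { change (Rabs (h - 0) < delta). now rewrite Rminus_0_r. }
    rewrite <- Series_minus.
    + unfold Rdiv at 1. rewrite <- Series_scal_r. exact H1.
    + apply Hex. apply Rabs_def2 in H2. apply Rabs_def1; lra.
    + apply Hex. rewrite Rminus_diag. now rewrite Rabs_R0.
Qed.

Definition freq (m : nat) : R := 2 * PI * INR (S m).

Lemma freq_pos m : 0 < freq m.
Proof.
  unfold freq. apply Rmult_lt_0_compat; [generalize PI_RGT_0; lra|].
  apply lt_0_INR. lia.
Qed.

Lemma is_series_nonneg_bounded (u : nat -> R) (B : R) :
  (forall n, 0 <= u n) -> (forall n, sum_n u n <= B) -> ex_series u.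
Proof.
  intros H0 HB.
  destruct (ex_finite_lim_seq_incr (sum_n u) B) as [l Hl].
  - intros n. rewrite sum_n_S. specialize (H0 (S n)). lra.
  - exact HB.
  - exists l. exact Hl.
Qed.

(** * Fourier series of e^(-at)/(1-e^(-t)) *)

Lemma Rpower_nonneg x y : 0 < Rpower x y.
Proof. apply exp_pos. Qed.

Lemma Rpower_neg_pow x (n : nat) : 0 < x -> Rpower x (- INR n) = / x ^ n.
Proof. intros Hx. now rewrite Rpower_Ropp, Rpower_pow. Qed.

(** One step of the integral test: the mean value theorem for x^(1-sigma)/(1-sigma) on [x, x+1]. The
    right side telescopes when summed. *)
Lemma p_series_step (sigma x : R) :
  1 < sigma -> 0 < x ->
  Rpower (x + 1) (- sigma) <=
  / (sigma - 1) * (Rpower x (1 - sigma) - Rpower (x + 1) (1 - sigma)).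
Proof.
  intros Hs Hx.
  destruct (MVT_gen (fun x => - / (sigma - 1) * exp ((1 - sigma) * ln x)) x (x + 1)
              (fun x => exp ((- sigma) * ln x))) as [c [Hc Heq]].
  - intros y Hy. rewrite Rmin_left, Rmax_right in Hy by lra.
    auto_derive; [lra|].
    replace (exp (- sigma * ln y)) with (exp ((1 - sigma) * ln y) * / y).
    + field. lra.
    + replace (/ y) with (exp (- ln y)) by (rewrite exp_Ropp, exp_ln; lra).
      rewrite <- exp_plus. f_equal. ring.
  - intros y Hy. rewrite Rmin_left, Rmax_right in Hy by lra.
    apply derivable_continuous_pt, ex_derive_Reals_0. auto_derive. lra.
  - rewrite Rmin_left, Rmax_right in Hc by lra.
    unfold Rpower.
    replace (/ (sigma - 1) * (exp ((1 - sigma) * ln x) - exp ((1 - sigma) * ln (x + 1))))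
      with (exp (- sigma * ln c)).
    2:{ rewrite <- (Rmult_1_r (exp (- sigma * ln c))).
        replace 1 with (x + 1 - x) at 1 by ring. rewrite <- Heq. ring. }
    destruct (Rle_lt_or_eq_dec c (x + 1)) as [Hlt|He]; [lra| |].
    + left. apply exp_increasing.
      assert (ln c < ln (x + 1)) by (apply ln_increasing; lra). nra.
    + rewrite He. lra.
Qed.

Lemma ex_series_Rpower (sigma : R) :
  1 < sigma -> ex_series (fun m => Rpower (INR (S m)) (- sigma)).
Proof.
  intros Hs. apply ex_series_incr_1.
  apply is_series_nonneg_bounded with (/ (sigma - 1)).
  - intros n. left. apply Rpower_nonneg.
  - assert (Hp : 0 < / (sigma - 1)) by (apply Rinv_0_lt_compat; lra).
    assert (H : forall n, sum_n (fun k => Rpower (INR (S (S k))) (- sigma)) n <=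
              / (sigma - 1) * (1 - Rpower (INR (S (S n))) (1 - sigma))).
    { induction n as [|n IH].
      - rewrite sum_O. replace (INR 2) with (1 + 1) by (simpl; ring).
        eapply Rle_trans; [apply p_series_step; lra|].
        replace (Rpower 1 (1 - sigma)) with 1; [lra|].
        unfold Rpower. rewrite ln_1, Rmult_0_r, exp_0. reflexivity.
      - rewrite sum_n_S.
        assert (Hstep := p_series_step sigma (INR (S (S n))) Hs ltac:(apply lt_0_INR; lia)).
        rewrite <- S_INR in Hstep. simpl in *. lra. }
    intros n. eapply Rle_trans; [apply H|].
    assert (0 < Rpower (INR (S (S n))) (1 - sigma)) by apply Rpower_nonneg. nra.
Qed.

Lemma ex_series_inv_pow (k : nat) :
  (2 <= k)%nat -> ex_series (fun m => / INR (S m) ^ k).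
Proof.
  intros Hk. apply ex_series_ext with (fun m => Rpower (INR (S m)) (- INR k)).
  - intros m. apply Rpower_neg_pow. apply lt_0_INR; lia.
  - apply ex_series_Rpower. apply (lt_INR 1 k). lia.
Qed.

Lemma ex_series_inv_freq_pow (k : nat) :
  (2 <= k)%nat -> ex_series (fun m => / freq m ^ k).
Proof.
  intros Hk.
  apply ex_series_ext with (fun m => / (2 * PI) ^ k * / INR (S m) ^ k).
  - intros m. unfold freq. rewrite !Rpow_mult_distr, !Rinv_mult. reflexivity.
  - apply ex_series_Rscal. now apply ex_series_inv_pow.
Qed.

(** Termwise integral of the sawtooth series, normalised to vanish at a = 0, so that continuity at 0
    alone fixes the constant of integration. *)
Definition cos_defect (m : nat) (a : R) : R := 2 * (1 - cos (freq m * a)) / freq m ^ 2.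

Lemma cos_defect_bound m a : Rabs (cos_defect m a) <= 4 * / freq m ^ 2.
Proof.
  unfold cos_defect, Rdiv. assert (H := freq_pos m).
  assert (0 < / freq m ^ 2) by (apply Rinv_0_lt_compat, pow_lt; auto).
  assert (Hc := COS_bound (freq m * a)).
  apply Rabs_le. split; nra.
Qed.

Lemma ex_series_cos_defect_bound : ex_series (fun m => 4 * / freq m ^ 2).
Proof. apply ex_series_Rscal. now apply ex_series_inv_freq_pow. Qed.

Definition dirichlet (M : nat) (u : R) : R := 1 + sum_n (fun m => 2 * cos (freq m * u)) M.

(** The product-to-sum formula makes the sum telescope. Since [sum_n] includes the index M and
    [freq m] belongs to m+1, this is the Dirichlet kernel of order M+1, whence 2M+3. *)
Lemma dirichlet_eq M u :
  sin (PI * u) * dirichlet M u = sin (INR (2 * M + 3) * PI * u).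
Proof.
  induction M as [|M IH]; unfold dirichlet in *.
  - rewrite sum_O. unfold freq. simpl INR.
    assert (H : forall A B, 2 * sin A * cos B = sin (B + A) - sin (B - A)).
    { intros A B. rewrite sin_plus, sin_minus. ring. }
    replace (sin (PI * u) * (1 + 2 * cos (2 * PI * 1 * u))) with
      (sin (PI * u) + 2 * sin (PI * u) * cos (2 * PI * 1 * u)) by ring.
    rewrite H.
    replace (2 * PI * 1 * u - PI * u) with (PI * u) by ring.
    replace (2 * PI * 1 * u + PI * u) with ((1 + 1 + 1) * PI * u) by ring. ring.
  - rewrite sum_n_S.
    assert (H : forall A B, 2 * sin A * cos B = sin (B + A) - sin (B - A)).
    { intros A B. rewrite sin_plus, sin_minus. ring. }
    rewrite <- Rplus_assoc, Rmult_plus_distr_l, IH.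
    replace (sin (PI * u) * (2 * cos (freq (S M) * u))) with
      (2 * sin (PI * u) * cos (freq (S M) * u)) by ring.
    rewrite H. unfold freq.
    replace (INR (2 * M + 3)) with (2 * INR M + 3) by (rewrite plus_INR, mult_INR; simpl; ring).
    replace (INR (2 * S M + 3)) with (2 * INR M + 5) by (rewrite plus_INR, mult_INR, (S_INR M); simpl; ring).
    rewrite !S_INR.
    replace (2 * PI * (INR M + 1 + 1) * u - PI * u) with ((2 * INR M + 3) * PI * u) by ring.
    replace (2 * PI * (INR M + 1 + 1) * u + PI * u) with ((2 * INR M + 5) * PI * u) by ring.
    ring.
Qed.

Lemma is_derive_sum_n_R (u v : nat -> R -> R) (x : R) :
  (forall m, is_derive (u m) x (v m x)) ->
  forall M, is_derive (fun x => sum_n (fun m => u m x) M) x (sum_n (fun m => v m x) M).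
Proof.
  intros H M. apply (is_derive_sum_n (V := R_NormedModule) u M x (fun m => v m x)).
  intros k _. apply H.
Qed.

Lemma sin_PI_pos u : 0 < u < 1 -> 0 < sin (PI * u).
Proof.
  intros Hu. assert (H := PI_RGT_0). apply sin_gt_0; nra.
Qed.

(** Together with [freq_half] this makes u = 1/2 a point where the sawtooth error and its correction
    both vanish, so that it can serve as base point of a mean value estimate. *)
Lemma sin_half_odd M : cos (INR (2 * M + 3) * PI * (1 / 2)) = 0.
Proof.
  replace (INR (2 * M + 3) * PI * (1 / 2)) with (3 * (PI / 2) + INR M * PI).
  2:{ rewrite plus_INR, mult_INR. simpl. field. }
  rewrite neg_cos_aux || idtac.
  induction M as [|M IH].
  - simpl. rewrite Rmult_0_l, Rplus_0_r. apply cos_3PI2.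
  - rewrite S_INR. replace (3 * (PI / 2) + (INR M + 1) * PI) with (3 * (PI / 2) + INR M * PI + PI) by ring.
    rewrite neg_cos, IH. ring.
Qed.

Lemma freq_half m : sin (freq m * (1 / 2)) = 0.
Proof.
  unfold freq. apply sin_eq_0_1. exists (Z.of_nat (S m)). rewrite <- INR_IZR_INZ. field.
Qed.

Definition sawtooth_error (M : nat) (u : R) : R :=
  sum_n (fun m => 2 * sin (freq m * u) / freq m) M - (1 / 2 - u).

Lemma is_derive_sawtooth_error M u :
  is_derive (sawtooth_error M) u (dirichlet M u).
Proof.
  unfold sawtooth_error, dirichlet.
  evar_last.
  - apply @is_derive_minus.
    + apply (is_derive_sum_n_R (fun m x => 2 * sin (freq m * x) / freq m)
               (fun m x => 2 * cos (freq m * x))).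
      intros m. assert (H := freq_pos m). auto_derive; trivial. field. lra.
    + auto_derive; trivial.
  - unfold minus, plus, opp; simpl. ring.
Qed.

(* Adding cos((2M+3)pi u)/((2M+3)pi sin pi u) cancels the main oscillation of the Dirichlet kernel. *)
Lemma sawtooth_error_bound (delta u : R) (M : nat) :
  0 < delta -> delta <= u <= 1 / 2 ->
  Rabs (sawtooth_error M u) <= 2 / sin (PI * delta) ^ 2 / INR (2 * M + 3).
Proof.
  intros Hd Hu.
  set (n := INR (2 * M + 3)).
  assert (Hn : 0 < n) by (apply lt_0_INR; lia).
  assert (HPI := PI_RGT_0).
  assert (HPI3 : 1 < PI) by (generalize PI2_1; lra).
  set (sd := sin (PI * delta)).
  assert (Hsd : 0 < sd) by (apply sin_PI_pos; lra).
  assert (Hmono : forall x, delta <= x <= 1 / 2 -> sd <= sin (PI * x) <= 1).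
  { intros x Hx. split; [|apply SIN_bound]. unfold sd.
    apply sin_incr_1; nra. }
  assert (Hsd1 : sd <= 1) by (specialize (Hmono delta ltac:(lra)); lra).
  assert (Hinv : forall x, delta <= x <= 1 / 2 -> 0 < / sin (PI * x) <= / sd).
  { intros x Hx. specialize (Hmono x Hx). split; [apply Rinv_0_lt_compat; lra|].
    apply Rinv_le_contravar; lra. }
  assert (Hisd : 1 <= / sd) by (rewrite <- Rinv_1; apply Rinv_le_contravar; lra).
  assert (Hin : 0 < / n) by (apply Rinv_0_lt_compat; auto).
  pose (E := fun x => sawtooth_error M x + cos (n * PI * x) / (n * PI * sin (PI * x))).
  pose (E' := fun x => - (cos (n * PI * x) * cos (PI * x)) * (/ n * (/ sin (PI * x) * / sin (PI * x)))).
  assert (HE : Rabs (E (1 / 2) - E u) <= (/ n * (/ sd * / sd)) * Rabs (1 / 2 - u)).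
  { apply mean_value_bound with E'; intros x Hx;
      rewrite Rmin_left, Rmax_right in Hx by lra;
      assert (Hx' : delta <= x <= 1 / 2) by lra; clear Hx;
      specialize (Hmono x Hx'); specialize (Hinv x Hx').
    - evar_last.
      + apply @is_derive_plus; [apply is_derive_sawtooth_error|].
        auto_derive; [|reflexivity]. apply Rgt_not_eq. apply Rmult_lt_0_compat; nra.
      + unfold plus, E'; simpl.
        assert (Hdir := dirichlet_eq M x). fold n in Hdir.
        replace (dirichlet M x) with (sin (n * PI * x) / sin (PI * x)).
        2:{ rewrite <- Hdir. field. lra. }
        field. repeat split; lra.
    - unfold E'. rewrite Rabs_mult, Rabs_Ropp, Rabs_mult.
      rewrite (Rabs_pos_eq (/ n * _)) by (apply Rmult_le_pos; [lra|nra]).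
      assert (H1 : Rabs (cos (n * PI * x)) <= 1) by (apply Rabs_le, COS_bound).
      assert (H2 : Rabs (cos (PI * x)) <= 1) by (apply Rabs_le, COS_bound).
      assert (H3 := Rabs_pos (cos (n * PI * x))). assert (H4 := Rabs_pos (cos (PI * x))).
      assert (Rabs (cos (n * PI * x)) * Rabs (cos (PI * x)) <= 1) by nra.
      assert (/ sin (PI * x) * / sin (PI * x) <= / sd * / sd) by nra.
      assert (0 <= / sin (PI * x) * / sin (PI * x)) by nra.
      assert (0 <= / n * (/ sin (PI * x) * / sin (PI * x))) by nra.
      assert (/ n * (/ sin (PI * x) * / sin (PI * x)) <= / n * (/ sd * / sd)) by nra.
      nra. }
  assert (HE0 : E (1 / 2) = 0).
  { unfold E, sawtooth_error, n. rewrite sin_half_odd.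
    rewrite (sum_n_ext_R _ (fun _ => 0)).
    - rewrite sum_n_const. unfold Rdiv. ring.
    - intros m. rewrite freq_half. unfold Rdiv. ring. }
  rewrite HE0 in HE.
  rewrite (Rabs_pos_eq (1 / 2 - u)) in HE by lra.
  assert (Hc : Rabs (cos (n * PI * u) / (n * PI * sin (PI * u))) <= / n * / sd).
  { unfold Rdiv. rewrite Rabs_mult.
    assert (Rabs (cos (n * PI * u)) <= 1) by (apply Rabs_le, COS_bound).
    specialize (Hmono u Hu).
    assert (Hnp : n * sd <= n * PI * sin (PI * u)).
    { rewrite Rmult_assoc. apply Rmult_le_compat_l; nra. }
    assert (0 < n * sd) by (apply Rmult_lt_0_compat; auto).
    rewrite Rabs_inv, (Rabs_pos_eq (n * PI * sin (PI * u))) by lra.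
    assert (Hk : / (n * PI * sin (PI * u)) <= / (n * sd)) by (apply Rinv_le_contravar; auto).
    assert (0 < / (n * PI * sin (PI * u))) by (apply Rinv_0_lt_compat; lra).
    rewrite (Rinv_mult n sd) in Hk.
    assert (H3 := Rabs_pos (cos (n * PI * u))). nra. }
  replace (2 / sd ^ 2 / n) with (2 * (/ n * (/ sd * / sd))).
  2:{ field. lra. }
  assert (H1 : / n * / sd <= / n * (/ sd * / sd)) by (apply Rmult_le_compat_l; nra).
  assert (H2 : 0 <= / n * (/ sd * / sd)) by nra.
  assert (HE2 : Rabs (0 - E u) <= / n * (/ sd * / sd)) by nra.
  replace (sawtooth_error M u) with (- (0 - E u) - cos (n * PI * u) / (n * PI * sin (PI * u)))
    by (unfold E; ring).
  eapply Rle_trans; [apply Rabs_triang|]. rewrite !Rabs_Ropp. lra.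
Qed.

Lemma cos_defect_0 m : cos_defect m 0 = 0.
Proof. unfold cos_defect. rewrite Rmult_0_r, cos_0. unfold Rdiv. ring. Qed.

Lemma ex_series_cos_defect a : ex_series (fun m => cos_defect m a).
Proof.
  apply ex_series_dominated with (fun m => 4 * / freq m ^ 2).
  - apply ex_series_cos_defect_bound.
  - intros; apply cos_defect_bound.
Qed.

Lemma is_derive_cos_defect m a : is_derive (cos_defect m) a (2 * sin (freq m * a) / freq m).
Proof.
  unfold cos_defect. assert (H := freq_pos m). auto_derive; trivial. field. lra.
Qed.

Lemma continuous_cos_defect_series (a : R) :
  filterlim (fun a => Series (fun m => cos_defect m a)) (locally a)
    (locally (Series (fun m => cos_defect m a))).
Proof.
  apply (tannery (locally a) (fun a m => cos_defect m a) (fun m => cos_defect m a)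
          (fun m => 4 * / freq m ^ 2)).
  - apply ex_series_cos_defect_bound.
  - apply filter_forall. intros; apply cos_defect_bound.
  - intros m. apply (ex_derive_continuous (cos_defect m)).
    eexists; apply is_derive_cos_defect.
Qed.

(** On [a, 1/2] the partial sums minus (x-x^2)/2 have derivative [sawtooth_error], which tends to 0
    uniformly there; hence the limit takes the same value at both ends. *)
Lemma cos_defect_series_half_interval (a : R) :
  0 < a <= 1 / 2 ->
  Series (fun m => cos_defect m a) - (a - a ^ 2) / 2 =
  Series (fun m => cos_defect m (1 / 2)) - 1 / 8.
Proof.
  intros Ha.
  set (r := fun M x => sum_n (fun m => cos_defect m x) M - (x - x ^ 2) / 2).
  assert (Hr : forall M, Rabs (r M (1 / 2) - r M a) <= 2 / sin (PI * a) ^ 2 / INR (2 * M + 3)).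
  { intros M.
    apply Rle_trans with (2 / sin (PI * a) ^ 2 / INR (2 * M + 3) * Rabs (1 / 2 - a)).
    - apply mean_value_bound with (sawtooth_error M); intros x Hx;
        rewrite Rmin_left, Rmax_right in Hx by lra.
      + unfold r, sawtooth_error. evar_last.
        * apply @is_derive_minus.
          -- apply (is_derive_sum_n_R cos_defect (fun m x => 2 * sin (freq m * x) / freq m)).
             intros; apply is_derive_cos_defect.
          -- auto_derive; trivial.
        * unfold minus, plus, opp; simpl. field.
      + apply sawtooth_error_bound; lra.
    - rewrite Rabs_pos_eq by lra.
      assert (0 <= 2 / sin (PI * a) ^ 2 / INR (2 * M + 3)); [|nra].
      assert (0 < sin (PI * a)) by (apply sin_PI_pos; lra).
      apply Rlt_le, Rdiv_lt_0_compat; [|apply lt_0_INR; lia].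
      apply Rdiv_lt_0_compat; [lra|]. now apply pow_lt. }
  assert (Hlim : is_lim_seq (fun M => r M (1 / 2) - r M a) 0).
  { apply is_lim_seq_abs_0.
    apply is_lim_seq_le_le with (fun _ => 0) (fun M => 2 / sin (PI * a) ^ 2 / INR (2 * M + 3)).
    - intros M. split; [apply Rabs_pos|apply Hr].
    - apply is_lim_seq_const.
    - unfold Rdiv. replace (Finite 0) with (Finite (2 * / sin (PI * a) ^ 2 * 0)) by (f_equal; ring).
      apply is_lim_seq_mult'; [apply is_lim_seq_const|].
      apply is_lim_seq_le_le with (fun _ => 0) (fun M => / INR (S M)).
      + intros M. split.
        * left. apply Rinv_0_lt_compat, lt_0_INR; lia.
        * apply Rinv_le_contravar; [apply lt_0_INR; lia|apply le_INR; lia].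
      + apply is_lim_seq_const.
      + apply (is_lim_seq_incr_1 (fun n => / INR n)).
        evar_last. apply is_lim_seq_inv. apply is_lim_seq_INR. easy. reflexivity. }
  assert (Hlim2 : is_lim_seq (fun M => r M (1 / 2) - r M a)
     ((Series (fun m => cos_defect m (1 / 2)) - (1 / 2 - (1 / 2) ^ 2) / 2) -
      (Series (fun m => cos_defect m a) - (a - a ^ 2) / 2))).
  { unfold r.
    repeat apply is_lim_seq_minus'; try apply is_lim_seq_const;
      apply Series_correct, ex_series_cos_defect. }
  apply is_lim_seq_unique in Hlim. apply is_lim_seq_unique in Hlim2.
  rewrite Hlim in Hlim2. injection Hlim2. intros. lra.
Qed.

(** The constant left open on (0, 1/2] is 0, because the series is continuous at 0 and vanishes
    there. The symmetry a -> 1-a covers the other half. *)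
Lemma Series_cos_defect (a : R) :
  0 <= a <= 1 -> Series (fun m => cos_defect m a) = (a - a ^ 2) / 2.
Proof.
  assert (Hhalf : Series (fun m => cos_defect m (1 / 2)) - 1 / 8 = 0).
  { set (k := Series (fun m => cos_defect m (1 / 2)) - 1 / 8).
    assert (H1 : filterlim (fun a => Series (fun m => cos_defect m a) - (a - a ^ 2) / 2)
                   (at_right 0) (locally 0)).
    { apply (filterlim_filter_le_1 (F := locally 0)).
      { intros P [d Hd]. exists d. intros y Hy _. now apply Hd. }
      replace 0 with (Series (fun m => cos_defect m 0) - (0 - 0 ^ 2) / 2) at 2.
      - apply (filterlim_Rminus (locally 0)).
        + apply continuous_cos_defect_series.
        + apply (ex_derive_continuous (fun a => (a - a ^ 2) / 2)). auto_derive. trivial.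
      - rewrite (Series_ext _ (fun _ => 0 * 0)) by (intros; rewrite cos_defect_0; ring).
        rewrite Series_scal_l. field. }
    assert (H2 : filterlim (fun a => Series (fun m => cos_defect m a) - (a - a ^ 2) / 2)
                   (at_right 0) (locally k)).
    { apply filterlim_ext_loc with (fun _ => k).
      - exists (mkposreal (1 / 2) ltac:(lra)). intros y Hy Hpos.
        symmetry. apply cos_defect_series_half_interval.
        change (Rabs (y - 0) < 1 / 2) in Hy. apply Rabs_def2 in Hy. lra.
      - apply filterlim_const. }
    symmetry. eapply (filterlim_locally_unique (F := at_right 0)); eassumption. }
  intros Ha.
  destruct (Rle_lt_or_eq_dec 0 a) as [Hp|<-]; [lra| |].
  - destruct (Rle_dec a (1 / 2)).
    + generalize (cos_defect_series_half_interval a ltac:(lra)). lra.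
    + destruct (Rle_lt_or_eq_dec a 1) as [Hl| ->]; [lra| |].
      * rewrite (Series_ext _ (fun m => cos_defect m (1 - a))).
        -- generalize (cos_defect_series_half_interval (1 - a) ltac:(lra)). lra.
        -- intros m. unfold cos_defect. do 2 f_equal. f_equal.
           rewrite <- (cos_neg (freq m * (1 - a))). unfold freq.
           rewrite <- (cos_period (- _) (S m)). f_equal. ring.
      * rewrite (Series_ext _ (fun m => cos_defect m 0)).
        -- rewrite (Series_ext _ (fun _ => 0 * 0)) by (intros; rewrite cos_defect_0; ring).
           rewrite Series_scal_l. field.
        -- intros m. unfold cos_defect. do 2 f_equal. f_equal.
           unfold freq. rewrite Rmult_0_r. rewrite <- (cos_period 0 (S m)). f_equal. ring.
  - rewrite (Series_ext _ (fun _ => 0 * 0)) by (intros; rewrite cos_defect_0; ring).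
    rewrite Series_scal_l. field.
Qed.

(** * Limits, derivatives and finite sums of complex-valued functions *)

Definition Clim (u : nat -> C) (l : C) : Prop :=
  is_lim_seq (fun n => Cmod (u n - l)%C) 0.

Lemma Cmod_le_parts (z : C) : Cmod z <= Rabs (Re z) + Rabs (Im z).
Proof.
  unfold Cmod. rewrite <- (sqrt_Rsqr (Rabs (Re z) + Rabs (Im z))).
  - apply sqrt_le_1_alt. unfold Rsqr. rewrite <- (pow2_abs (fst z)), <- (pow2_abs (snd z)).
    unfold Re, Im. generalize (Rabs_pos (fst z)) (Rabs_pos (snd z)). nra.
  - generalize (Rabs_pos (Re z)) (Rabs_pos (Im z)). lra.
Qed.

Lemma Re_abs_le (z : C) : Rabs (Re z) <= Cmod z.
Proof. eapply Rle_trans; [|apply Rmax_Cmod]. apply Rmax_l. Qed.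

Lemma Im_abs_le (z : C) : Rabs (Im z) <= Cmod z.
Proof. eapply Rle_trans; [|apply Rmax_Cmod]. apply Rmax_r. Qed.

Lemma Clim_squeeze (u : nat -> C) (l : C) (e : nat -> R) :
  (forall n, Cmod (u n - l)%C <= e n) -> is_lim_seq e 0 -> Clim u l.
Proof.
  intros H He. unfold Clim. apply is_lim_seq_le_le with (fun _ => 0) e; auto.
  - intros n. split; [apply Cmod_ge_0|auto].
  - apply is_lim_seq_const.
Qed.

Lemma is_lim_seq_squeeze0 (u e : nat -> R) :
  (forall n, Rabs (u n) <= e n) -> is_lim_seq e 0 -> is_lim_seq u 0.
Proof.
  intros H He. apply is_lim_seq_abs_0.
  apply is_lim_seq_le_le with (fun _ => 0) e; auto.
  - intros n. split; [apply Rabs_pos|auto].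
  - apply is_lim_seq_const.
Qed.

Lemma is_lim_seq_minus_0 (u : nat -> R) (l : R) :
  is_lim_seq u l <-> is_lim_seq (fun n => u n - l) 0.
Proof.
  split; intros H.
  - replace 0 with (l - l) by ring. apply is_lim_seq_minus'; [assumption|apply is_lim_seq_const].
  - apply is_lim_seq_ext with (fun n => (u n - l) + l); [intros; ring|].
    evar_last; [apply is_lim_seq_plus'; [eassumption|apply is_lim_seq_const]|].
    f_equal; ring.
Qed.

Lemma Clim_Re u l : Clim u l -> is_lim_seq (fun n => Re (u n)) (Re l).
Proof.
  intros H. apply is_lim_seq_minus_0.
  apply is_lim_seq_squeeze0 with (2 := H). intros n.
  replace (Re (u n) - Re l) with (Re (u n - l)%C) by reflexivity. apply Re_abs_le.
Qed.

Lemma Clim_Im u l : Clim u l -> is_lim_seq (fun n => Im (u n)) (Im l).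
Proof.
  intros H. apply is_lim_seq_minus_0.
  apply is_lim_seq_squeeze0 with (2 := H). intros n.
  replace (Im (u n) - Im l) with (Im (u n - l)%C) by reflexivity. apply Im_abs_le.
Qed.

Lemma Clim_parts u l :
  is_lim_seq (fun n => Re (u n)) (Re l) -> is_lim_seq (fun n => Im (u n)) (Im l) -> Clim u l.
Proof.
  intros H1 H2. apply is_lim_seq_minus_0 in H1. apply is_lim_seq_minus_0 in H2.
  apply Clim_squeeze with (fun n => Rabs (Re (u n) - Re l) + Rabs (Im (u n) - Im l)).
  - intros n. apply (Cmod_le_parts (u n - l)%C).
  - replace 0 with (0 + 0) by ring.
    apply is_lim_seq_plus'; apply (proj1 (is_lim_seq_abs_0 _)); assumption.
Qed.

Lemma Clim_ext u v l : (forall n, u n = v n) -> Clim u l -> Clim v l.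
Proof.
  intros H. apply is_lim_seq_ext. intros n. now rewrite H.
Qed.

Lemma Clim_const l : Clim (fun _ => l) l.
Proof. apply Clim_parts; apply is_lim_seq_const. Qed.

Lemma Clim_plus u v l k : Clim u l -> Clim v k -> Clim (fun n => u n + v n)%C (l + k)%C.
Proof.
  intros H1 H2. apply Clim_parts.
  - apply is_lim_seq_plus'; now apply Clim_Re.
  - apply is_lim_seq_plus'; now apply Clim_Im.
Qed.

Lemma Clim_mult u v l k : Clim u l -> Clim v k -> Clim (fun n => u n * v n)%C (l * k)%C.
Proof.
  intros H1 H2. apply Clim_parts; simpl.
  - apply is_lim_seq_minus'; apply is_lim_seq_mult'; first [now apply Clim_Re|now apply Clim_Im].
  - apply is_lim_seq_plus'; apply is_lim_seq_mult'; first [now apply Clim_Re|now apply Clim_Im].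
Qed.

Lemma Clim_scal c u l : Clim u l -> Clim (fun n => c * u n)%C (c * l)%C.
Proof. intros H. apply Clim_mult; [apply Clim_const|assumption]. Qed.

Lemma Clim_minus u v l k : Clim u l -> Clim v k -> Clim (fun n => u n - v n)%C (l - k)%C.
Proof.
  intros H1 H2. apply Clim_parts.
  - apply is_lim_seq_minus'; now apply Clim_Re.
  - apply is_lim_seq_minus'; now apply Clim_Im.
Qed.

Lemma csum_ext f g n : (forall k, (k < n)%nat -> f k = g k) -> csum f n = csum g n.
Proof.
  induction n as [|n IH]; intros H; [reflexivity|]. simpl. rewrite IH, H; auto.
Qed.

Lemma csum_plus f g n : csum (fun k => f k + g k)%C n = (csum f n + csum g n)%C.
Proof. induction n as [|n IH]; simpl; [ring|]. rewrite IH. ring. Qed.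

Lemma csum_scal c f n : csum (fun k => c * f k)%C n = (c * csum f n)%C.
Proof. induction n as [|n IH]; simpl; [ring|]. rewrite IH. ring. Qed.

Lemma csum_RtoC f n : csum (fun k => RtoC (f k)) n = RtoC (rsum f n).
Proof. induction n as [|n IH]; simpl; [reflexivity|]. rewrite IH. now rewrite RtoC_plus. Qed.

Lemma rsum_sum_n f n : rsum f (S n) = sum_n f n.
Proof.
  induction n as [|n IH]; [simpl; rewrite sum_O; ring|].
  rewrite sum_n_S, <- IH. reflexivity.
Qed.

Lemma Re_csum f n : Re (csum f n) = rsum (fun k => Re (f k)) n.
Proof. induction n as [|n IH]; simpl; [reflexivity|]. unfold Re in *. simpl. now rewrite IH. Qed.

Lemma Im_csum f n : Im (csum f n) = rsum (fun k => Im (f k)) n.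
Proof. induction n as [|n IH]; simpl; [reflexivity|]. unfold Im in *. simpl. now rewrite IH. Qed.

Lemma Clim_csum (u : nat -> nat -> C) (l : nat -> C) (N : nat) :
  (forall j, (j < N)%nat -> Clim (fun n => u n j) (l j)) ->
  Clim (fun n => csum (u n) N) (csum l N).
Proof.
  induction N as [|N IH]; intros H; simpl; [apply Clim_const|].
  apply Clim_plus; auto.
Qed.

Lemma csum_csum_swap (u : nat -> nat -> C) M N :
  csum (fun n => csum (u n) N) M = csum (fun j => csum (fun n => u n j) M) N.
Proof.
  induction M as [|M IH]; simpl.
  - induction N as [|N IHN]; simpl; [reflexivity|]. rewrite <- IHN. ring.
  - rewrite IH. now rewrite <- csum_plus.
Qed.

Definition Cder (f : R -> C) (x : R) (l : C) : Prop :=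
  is_derive (fun u => Re (f u)) x (Re l) /\ is_derive (fun u => Im (f u)) x (Im l).

Lemma Cder_eq f x l l' : Cder f x l -> l = l' -> Cder f x l'.
Proof. now intros H <-. Qed.

Lemma Cder_const c x : Cder (fun _ => c) x 0%C.
Proof. split; apply (is_derive_const (V := R_NormedModule)). Qed.

Lemma Cder_plus f g x l k : Cder f x l -> Cder g x k -> Cder (fun u => f u + g u)%C x (l + k)%C.
Proof. intros [H1 H2] [H3 H4]. split; now apply (is_derive_plus (V := R_NormedModule)). Qed.

Lemma Cder_minus f g x l k : Cder f x l -> Cder g x k -> Cder (fun u => f u - g u)%C x (l - k)%C.
Proof. intros [H1 H2] [H3 H4]. split; now apply (is_derive_minus (V := R_NormedModule)). Qed.

Lemma is_derive_Rmult (f g : R -> R) x l k :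
  is_derive f x l -> is_derive g x k -> is_derive (fun u => f u * g u) x (l * g x + f x * k).
Proof.
  intros Hf Hg. apply (is_derive_mult f g x l k Hf Hg). intros; apply Rmult_comm.
Qed.

Lemma Cder_mult f g x l k :
  Cder f x l -> Cder g x k -> Cder (fun u => f u * g u)%C x (l * g x + f x * k)%C.
Proof.
  intros [H1 H2] [H3 H4]. split; simpl.
  - evar_last.
    + apply (is_derive_minus (V := R_NormedModule)); apply is_derive_Rmult; eassumption.
    + unfold minus, plus, opp, Re, Im; simpl. ring.
  - evar_last.
    + apply (is_derive_plus (V := R_NormedModule)); apply is_derive_Rmult; eassumption.
    + unfold minus, plus, opp, Re, Im; simpl. ring.
Qed.

Lemma Cder_RtoC f x l : is_derive f x l -> Cder (fun u => RtoC (f u)) x (RtoC l).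
Proof. intros H. split; simpl; auto. apply (is_derive_const (V := R_NormedModule)). Qed.

Lemma Cder_Rmult f k x l : is_derive f x l -> Cder (fun u => RtoC (f u) * k)%C x (RtoC l * k)%C.
Proof.
  intros H. eapply Cder_eq.
  - apply Cder_mult; [apply Cder_RtoC; eassumption|apply Cder_const].
  - cbv beta; ring.
Qed.

Lemma Cder_csum (u v : nat -> R -> C) x M :
  (forall m, (m < M)%nat -> Cder (u m) x (v m x)) ->
  Cder (fun x => csum (fun m => u m x) M) x (csum (fun m => v m x) M).
Proof.
  induction M as [|M IH]; intros H; simpl; [apply Cder_const|].
  apply Cder_plus; auto.
Qed.

Lemma is_derive_rsum (u v : nat -> R -> R) x M :
  (forall m, is_derive (u m) x (v m x)) ->
  is_derive (fun x => rsum (fun m => u m x) M) x (rsum (fun m => v m x) M).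
Proof.
  intros H. induction M as [|M IH]; simpl; [apply (is_derive_const (V := R_NormedModule))|].
  now apply (is_derive_plus (V := R_NormedModule)).
Qed.

Lemma Cder_Cexp (t : C) x : Cder (fun u => Cexp (t * RtoC u)) x (t * Cexp (t * RtoC x))%C.
Proof.
  destruct t as [al be]. split; unfold Cexp; simpl.
  - auto_derive; trivial. unfold Rminus. ring.
  - auto_derive; trivial. unfold Rminus. ring.
Qed.

Lemma Cexp_plus z w : Cexp (z + w) = (Cexp z * Cexp w)%C.
Proof.
  unfold Cexp, Cmult; simpl. unfold Re, Im; simpl. rewrite exp_plus, cos_plus, sin_plus. f_equal; ring.
Qed.

Lemma Cexp_0 : Cexp 0 = RtoC 1.
Proof. unfold Cexp; simpl. rewrite exp_0, cos_0, sin_0. apply injective_projections; simpl; ring. Qed.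

Lemma Cmod_Cexp z : Cmod (Cexp z) = exp (Re z).
Proof.
  unfold Cmod, Cexp; simpl.
  replace (_ + _) with (exp (Re z) * exp (Re z)).
  - apply sqrt_square. left; apply exp_pos.
  - generalize (sin2_cos2 (Im z)). unfold Rsqr. intros H.
    transitivity (exp (Re z) * exp (Re z) * (sin (Im z) * sin (Im z) + cos (Im z) * cos (Im z))).
    + rewrite H. ring.
    + ring.
Qed.

Lemma Cexp_neq_0 z : Cexp z <> 0%C.
Proof.
  intros H. assert (H1 := Cmod_Cexp z). rewrite H, Cmod_0 in H1. generalize (exp_pos (Re z)). lra.
Qed.

Lemma Cexp_RtoC x : Cexp (RtoC x) = RtoC (exp x).
Proof. unfold Cexp; simpl. unfold RtoC. rewrite cos_0, sin_0. f_equal; ring. Qed.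

Lemma complex_mean_value_bound (f : R -> C) (f' : R -> C) (a b K : R) :
  (forall x, Rmin a b <= x <= Rmax a b -> Cder f x (f' x)) ->
  (forall x, Rmin a b <= x <= Rmax a b -> Cmod (f' x) <= K) ->
  Cmod (f b - f a)%C <= 2 * K * Rabs (b - a).
Proof.
  intros Hd HK.
  assert (H1 := mean_value_bound (fun u => Re (f u)) (fun u => Re (f' u)) a b K
     (fun x Hx => proj1 (Hd x Hx)) (fun x Hx => Rle_trans _ _ _ (Re_abs_le _) (HK x Hx))).
  assert (H2 := mean_value_bound (fun u => Im (f u)) (fun u => Im (f' u)) a b K
     (fun x Hx => proj2 (Hd x Hx)) (fun x Hx => Rle_trans _ _ _ (Im_abs_le _) (HK x Hx))).
  eapply Rle_trans; [apply Cmod_le_parts|].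
  change (Re (f b - f a)%C) with (Re (f b) - Re (f a)).
  change (Im (f b - f a)%C) with (Im (f b) - Im (f a)). lra.
Qed.

Section ComplexFourier.
Variable t : C.
Hypothesis t_neq_0 : t <> 0%C.
Hypothesis t_regular : forall m, (t * t + RtoC (freq m ^ 2))%C <> 0%C.
Hypothesis exp_regular : (1 - Cexp (- t))%C <> 0%C.

(** The modes m+1 and -(m+1) of the Fourier series of e^(-ta)/(1-e^(-t)), with the sawtooth term
    removed: 2w sin/(t^2+w^2) = 2 sin/w - (2 t^2 sin/w)/(t^2+w^2) for w = [freq m]. The sum then
    takes equal values at 0 and 1, and the expansion holds at the endpoints too. *)
Definition fourier_term (m : nat) (a : R) : C :=
  (RtoC (cos (freq m * a)) * (2 * t / (t * t + RtoC (freq m ^ 2)))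
   - RtoC (sin (freq m * a) / freq m) * (t * (2 * t / (t * t + RtoC (freq m ^ 2)))))%C.

Definition fourier_sum (a : R) : C :=
  (Cexp (- t * RtoC a) / (1 - Cexp (- t)) - / t - RtoC (1 / 2 - a))%C.

(** The derivative of the plain partial sum contains -t times a partial sum of the sawtooth series,
    which does not converge uniformly near the endpoints. Adding t times the partial sums of
    [cos_defect] cancels it and leaves a uniformly convergent series instead. *)
Definition fourier_error (M : nat) (a : R) : C :=
  (csum (fun m => fourier_term m a) M + t * RtoC (rsum (fun m => cos_defect m a) M)
   - (fourier_sum a + t * RtoC ((a - a ^ 2) / 2)))%C.

Lemma RtoC_freq_neq_0 m : RtoC (freq m) <> 0%C.
Proof. intros H. apply RtoC_inj in H. generalize (freq_pos m). lra. Qed.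

(* X = fourier_error satisfies X' + t X = t^2 (sum c_m - c), whose right side is uniformly small. *)
Lemma Cder_fourier_error M a :
  Cder (fun a => Cexp (t * RtoC a) * fourier_error M a)%C a
    (Cexp (t * RtoC a) * (t * t * RtoC (rsum (fun m => cos_defect m a) M - (a - a ^ 2) / 2)))%C.
Proof.
  eapply Cder_eq.
  - apply Cder_mult; [apply Cder_Cexp|].
    unfold fourier_error. apply Cder_minus; [apply Cder_plus|apply Cder_plus].
    + apply (Cder_csum fourier_term (fun m a =>
       (- (RtoC (2 * sin (freq m * a) / freq m) * t) - t * fourier_term m a)%C)).
      intros m _. unfold fourier_term. assert (Hf := freq_pos m). eapply Cder_eq.
      * apply Cder_minus; apply Cder_Rmult.
        -- auto_derive; trivial.
        -- auto_derive; trivial.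
      * assert (Hr := t_regular m). assert (Hf' := RtoC_freq_neq_0 m).
        replace (freq m * 1 * cos (freq m * a) * / freq m) with (cos (freq m * a)) by (field; lra).
        replace (freq m * 1 * - sin (freq m * a)) with
           (- (freq m ^ 2 * (sin (freq m * a) / freq m))) by (field; lra).
        replace (2 * sin (freq m * a) / freq m) with (2 * (sin (freq m * a) / freq m)) by (field; lra).
        set (s := sin (freq m * a) / freq m). rewrite RtoC_opp, !RtoC_mult.
        unfold Cdiv. set (iv := (/ (t * t + RtoC (freq m ^ 2)))%C).
        assert (Hiv : ((t * t + RtoC (freq m ^ 2)) * iv = 1)%C) by (apply Cinv_r; auto).
        assert (Hw : (RtoC (freq m ^ 2) * iv = 1 - t * t * iv)%C) by (rewrite <- Hiv; ring).
        transitivity (- (RtoC s * (2 * t) * (RtoC (freq m ^ 2) * iv))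
              - RtoC (cos (freq m * a)) * (t * (2 * t * iv)))%C; [ring|].
        rewrite Hw. ring.
    + apply Cder_mult; [apply Cder_const|]. apply Cder_RtoC.
      apply (is_derive_rsum cos_defect (fun m a => 2 * sin (freq m * a) / freq m)).
      intros m; apply is_derive_cos_defect.
    + unfold fourier_sum. apply Cder_minus; [apply Cder_minus|].
      * unfold Cdiv. apply Cder_mult; [apply (Cder_Cexp (- t))|apply Cder_const].
      * apply Cder_const.
      * apply Cder_RtoC. auto_derive; trivial.
    + apply Cder_mult; [apply Cder_const|]. apply Cder_RtoC. auto_derive; trivial.
  - cbv beta. unfold fourier_error, fourier_sum.
    rewrite (csum_ext (fun m => - (RtoC (2 * sin (freq m * a) / freq m) * t) - t * fourier_term m a)%C
               (fun m => (- t) * RtoC (2 * sin (freq m * a) / freq m)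
               + (- t) * fourier_term m a)%C) by (intros; cbv beta; ring).
    rewrite csum_plus, !csum_scal, csum_RtoC.
    replace ((1 + - (1 * ((1 + 1) * (a * 1)))) * / 2) with (1 / 2 - a) by field.
    rewrite (RtoC_minus (rsum _ _)), RtoC_opp.
    unfold Cdiv. set (it := (/ t)%C).
    assert (Hit : (t * it = 1)%C) by (apply Cinv_r; auto).
    match goal with |- _ = ?rhs =>
      transitivity (rhs + Cexp (t * RtoC a) * (t * it - 1))%C; [ring|rewrite Hit; ring] end.
Qed.

Lemma fourier_term_periodic m : fourier_term m 1 = fourier_term m 0.
Proof.
  unfold fourier_term, freq. rewrite !Rmult_0_r, Rmult_1_r.
  replace (2 * PI * INR (S m)) with (0 + 2 * INR (S m) * PI) by ring.
  now rewrite cos_period, sin_period.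
Qed.

Lemma cos_defect_1 m : cos_defect m 1 = 0.
Proof.
  unfold cos_defect, freq. replace (2 * PI * INR (S m) * 1) with (0 + 2 * INR (S m) * PI) by ring.
  rewrite cos_period, cos_0. unfold Rdiv. ring.
Qed.

Lemma fourier_error_periodic M : fourier_error M 1 = fourier_error M 0.
Proof.
  unfold fourier_error, fourier_sum.
  rewrite (csum_ext (fun m => fourier_term m 1) (fun m => fourier_term m 0)) by
    (intros; apply fourier_term_periodic).
  replace (rsum (fun m => cos_defect m 1) M) with (rsum (fun m => cos_defect m 0) M).
  2:{ induction M as [|M IH]; simpl; [reflexivity|]. now rewrite IH, cos_defect_0, cos_defect_1. }
  replace ((1 - 1 ^ 2) / 2) with 0 by field. replace ((0 - 0 ^ 2) / 2) with 0 by field.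
  replace (1 / 2 - 1) with (1 / 2 - 0 - 1) by ring. rewrite !RtoC_minus.
  replace (- t * RtoC 1)%C with (- t)%C by ring.
  replace (- t * RtoC 0)%C with (RtoC 0) by ring. rewrite Cexp_0.
  field. auto.
Qed.

(** With X the corrected error, e^(ta) X(a) is nearly constant on [0,1]. As X(1) = X(0) while e^t <>
    1, X(0) must be small, and then X is small throughout. *)
Lemma fourier_complex a :
  0 <= a <= 1 -> Clim (fun M => csum (fun m => fourier_term m a) M) (fourier_sum a).
Proof.
  intros Ha.
  set (eps := fun M => Series (fun k => 4 * / freq (S M + k) ^ 2)).
  assert (Heps : is_lim_seq eps 0) by (apply (tail_lim _ ex_series_cos_defect_bound)).
  assert (Hc : forall M x, 0 <= x <= 1 ->
     Rabs (rsum (fun m => cos_defect m x) (S M) - (x - x ^ 2) / 2) <= eps M).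
  { intros M x Hx. rewrite <- (Series_cos_defect x Hx), rsum_sum_n.
    rewrite (Series_split (fun m => cos_defect m x) M) by apply ex_series_cos_defect.
    replace (_ - _) with (- Series (fun k => cos_defect (S M + k) x)) by ring.
    rewrite Rabs_Ropp. apply Series_abs_le.
    - apply (ex_series_shift (fun m => 4 * / freq m ^ 2)), ex_series_cos_defect_bound.
    - intros k. apply cos_defect_bound. }
  set (E := exp (Rabs (Re t))). assert (HE : 0 < E) by apply exp_pos.
  assert (Hexp : forall x, -1 <= x <= 1 -> Cmod (Cexp (t * RtoC x)) <= E).
  { intros x Hx. rewrite Cmod_Cexp.
    replace (Re (t * RtoC x)%C) with (Re t * x) by (unfold Re; simpl; ring).
    assert (Hle : Re t * x <= Rabs (Re t)).
    { apply Rle_trans with (Rabs (Re t * x)); [apply Rle_abs|]. rewrite Rabs_mult.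
      assert (Rabs x <= 1) by (apply Rabs_le; lra). generalize (Rabs_pos (Re t)). nra. }
    destruct Hle as [Hlt|Heq]; [left; now apply exp_increasing|right; unfold E; now rewrite Heq]. }
  set (K := E * (Cmod t * Cmod t)).
  assert (HK : 0 <= K) by (generalize (Cmod_ge_0 t); unfold K; nra).
  set (D := fun M x => (Cexp (t * RtoC x) * fourier_error (S M) x)%C).
  assert (Heps0 : forall M, 0 <= eps M).
  { intros M. eapply Rle_trans; [apply Rabs_pos|apply (Hc M 0); lra]. }
  assert (HD : forall M x, 0 <= x <= 1 -> Cmod (D M x - D M 0)%C <= 2 * (K * eps M)).
  { intros M x Hx.
    apply Rle_trans with (2 * (K * eps M) * Rabs (x - 0)).
    - apply (complex_mean_value_bound (D M) (fun a => (Cexp (t * RtoC a) * (t * t *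
         RtoC (rsum (fun m => cos_defect m a) (S M) - (a - a ^ 2) / 2)))%C));
        intros u Hu; rewrite Rmin_left, Rmax_right in Hu by lra.
      + apply Cder_fourier_error.
      + rewrite !Cmod_mult, Cmod_R. unfold K.
        assert (H1 := Hexp u ltac:(lra)). assert (H2 := Hc M u ltac:(lra)).
        assert (H3 := Cmod_ge_0 t). assert (H4 := Cmod_ge_0 (Cexp (t * RtoC u))).
        replace (E * (Cmod t * Cmod t) * eps M) with (E * (Cmod t * Cmod t * eps M)) by ring.
        apply Rmult_le_compat; auto.
        * apply Rmult_le_pos; [nra|apply Rabs_pos].
        * apply Rmult_le_compat_l; [nra|auto].
    - rewrite Rminus_0_r, Rabs_pos_eq by lra. assert (0 <= K * eps M) by (apply Rmult_le_pos; auto). nra. }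
  assert (HD0 : forall M, D M 0 = fourier_error (S M) 0).
  { intros M. unfold D. replace (t * RtoC 0)%C with (RtoC 0) by ring. rewrite Cexp_0. ring. }
  assert (Hne : (Cexp t - 1)%C <> 0%C).
  { intros H. apply exp_regular.
    assert (Hm : (Cexp t * Cexp (- t) = 1)%C).
    { rewrite <- Cexp_plus. replace (t + - t)%C with (RtoC 0) by ring. apply Cexp_0. }
    assert (H1 : Cexp t = 1%C) by (replace (Cexp t) with (Cexp t - 1 + 1)%C by ring; rewrite H; ring).
    rewrite H1 in Hm. replace (Cexp (- t)) with (1 * Cexp (- t))%C by ring. rewrite Hm. ring. }
  set (delta := Cmod (Cexp t - 1)%C). assert (Hdelta : 0 < delta) by (now apply Cmod_gt_0).
  assert (Herr0 : forall M, Cmod (fourier_error (S M) 0) <= 2 * (K * eps M) / delta).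
  { intros M. assert (H := HD M 1 ltac:(lra)). rewrite HD0 in H. unfold D in H.
    rewrite fourier_error_periodic in H. replace (t * RtoC 1)%C with t in H by ring.
    replace (Cexp t * fourier_error (S M) 0 - fourier_error (S M) 0)%C with
      ((Cexp t - 1) * fourier_error (S M) 0)%C in H by ring.
    rewrite Cmod_mult in H. fold delta in H.
    apply Rmult_le_reg_l with delta; auto. replace (delta * (2 * (K * eps M) / delta)) with (2 * (K * eps M)); auto.
    field. lra. }
  assert (Herr : forall M, Cmod (fourier_error (S M) a) <=
     E * (2 * (K * eps M) + 2 * (K * eps M) / delta)).
  { intros M.
    replace (fourier_error (S M) a) with (Cexp (t * RtoC (- a)) * D M a)%C.
    2:{ unfold D. rewrite Cmult_assoc, <- Cexp_plus, RtoC_opp.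
        replace (t * - RtoC a + t * RtoC a)%C with (RtoC 0) by ring. rewrite Cexp_0. ring. }
    rewrite Cmod_mult. apply Rmult_le_compat; [apply Cmod_ge_0|apply Cmod_ge_0|apply Hexp; lra|].
    replace (D M a) with ((D M a - D M 0) + D M 0)%C by ring.
    eapply Rle_trans; [apply Cmod_triangle|]. apply Rplus_le_compat.
    - apply HD; auto.
    - rewrite HD0. apply Herr0. }
  unfold Clim. apply is_lim_seq_incr_1.
  apply (Clim_squeeze (fun M => csum (fun m => fourier_term m a) (S M)) (fourier_sum a)
     (fun M => (E * (2 * K + 2 * K / delta) + Cmod t) * eps M)).
  - intros M.
    replace (csum (fun m => fourier_term m a) (S M) - fourier_sum a)%C with
      (fourier_error (S M) a - t * RtoC (rsum (fun m => cos_defect m a) (S M) - (a - a ^ 2) / 2))%C.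
    2:{ unfold fourier_error. rewrite RtoC_minus. ring. }
    unfold Cminus. eapply Rle_trans; [apply Cmod_triangle|]. rewrite Cmod_opp, Cmod_mult, Cmod_R.
    specialize (Herr M). assert (H1 := Hc M a Ha). assert (H2 := Cmod_ge_0 t).
    assert (Cmod t * Rabs (rsum (fun m => cos_defect m a) (S M) - (a - a ^ 2) / 2) <= Cmod t * eps M)
      by (apply Rmult_le_compat_l; auto).
    unfold Rdiv in *. lra.
  - replace 0 with ((E * (2 * K + 2 * K / delta) + Cmod t) * 0) by ring.
    apply is_lim_seq_mult'; [apply is_lim_seq_const|assumption].
Qed.
End ComplexFourier.

(** * Bernoulli polynomials and the Taylor remainders *)

Lemma bern_list_length n : length (bern_list n) = S n.
Proof.
  induction n as [|n IH]; [reflexivity|]. cbn [bern_list].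
  rewrite length_app, IH. simpl. lia.
Qed.

Lemma bern_list_nth n k : (k <= n)%nat -> nth k (bern_list n) 0 = bern0 k.
Proof.
  intros H. induction n as [|n IH].
  - replace k with 0%nat by lia. reflexivity.
  - destruct (Nat.eq_dec k (S n)) as [->|Hne]; [reflexivity|].
    cbn [bern_list]. rewrite app_nth1; [apply IH; lia|].
    rewrite bern_list_length. lia.
Qed.

Lemma fold_right_map_seq (f : nat -> R) n :
  fold_right Rplus 0 (map f (seq 0 (S n))) = sum_f_R0 f n.
Proof.
  assert (H : forall l s, fold_right Rplus s (map f l) = fold_right Rplus 0 (map f l) + s).
  { induction l as [|x l IH]; intros s; simpl; [ring|]. rewrite IH. ring. }
  induction n as [|n IH]; [simpl; ring|].
  rewrite seq_S, map_app, fold_right_app, H, IH. simpl. ring.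
Qed.

(** The recurrence behind [bern_list], in the form that yields B_n(1) = B_n(0) for n >= 2. *)
Lemma bern0_rec n :
  sum_f_R0 (fun k => Binomial.C (n + 2) k * bern0 k) (S n) = 0.
Proof.
  rewrite tech5.
  assert (Hb : bern0 (S n) = - sum_f_R0 (fun k => Binomial.C (n + 2) k * bern0 k) n / INR (n + 2)).
  { unfold bern0 at 1. cbn [bern_list]. rewrite app_nth2; rewrite bern_list_length; [|lia].
    rewrite Nat.sub_diag. cbn [nth]. rewrite fold_right_map_seq.
    replace (S n + 1)%nat with (n + 2)%nat by lia. f_equal. f_equal. apply sum_eq.
    intros i Hi. now rewrite bern_list_nth by lia. }
  rewrite Hb.
  replace (Binomial.C (n + 2) (S n)) with (INR (n + 2)).
  - field. apply not_0_INR. lia.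
  - replace (n + 2)%nat with (S (S n)) by lia.
    unfold Binomial.C. replace (S (S n) - S n)%nat with 1%nat by lia.
    rewrite (fact_simpl (S n)), mult_INR. simpl (fact 1). simpl (INR 1). field. apply INR_fact_neq_0.
Qed.

Lemma bernpoly_0 n : bernpoly n 0 = bern0 n.
Proof.
  unfold bernpoly. destruct n as [|n].
  - simpl. unfold Binomial.C. simpl. field.
  - rewrite tech5. rewrite (sum_eq _ (fun _ => 0)).
    + rewrite Nat.sub_diag.
      replace (Binomial.C (S n) (S n)) with 1.
      * rewrite sum_cte. simpl. ring.
      * unfold Binomial.C. rewrite Nat.sub_diag. simpl (INR (fact 0)). field. apply INR_fact_neq_0.
    + intros i Hi. rewrite pow_i by lia. ring.
Qed.

Lemma bernpoly_1 n : (2 <= n)%nat -> bernpoly n 1 = bern0 n.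
Proof.
  intros Hn. destruct n as [|[|n]]; [lia|lia|]. unfold bernpoly. rewrite tech5.
  rewrite (sum_eq _ (fun k => Binomial.C (n + 2) k * bern0 k)).
  - rewrite bern0_rec, pow1.
    replace (Binomial.C (S (S n)) (S (S n))) with 1; [ring|].
    unfold Binomial.C. rewrite Nat.sub_diag. simpl (INR (fact 0)). field. apply INR_fact_neq_0.
  - intros i Hi. rewrite pow1. replace (S (S n)) with (n + 2)%nat by lia. ring.
Qed.

Lemma binom_absorb n k : (k <= n)%nat ->
  Binomial.C (S n) k * INR (S n - k) = INR (S n) * Binomial.C n k.
Proof.
  intros H. unfold Binomial.C.
  replace (S n - k)%nat with (S (n - k)) by lia.
  rewrite !fact_simpl, !mult_INR. field.
  repeat split; try apply INR_fact_neq_0; apply not_0_INR; lia.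
Qed.

Lemma is_derive_sum_f_R0 (u v : nat -> R -> R) x n :
  (forall k, (k <= n)%nat -> is_derive (u k) x (v k x)) ->
  is_derive (fun x => sum_f_R0 (fun k => u k x) n) x (sum_f_R0 (fun k => v k x) n).
Proof.
  induction n as [|n IH]; intros H; simpl; [apply H; lia|].
  apply (is_derive_plus (V := R_NormedModule)); auto.
Qed.

Lemma is_derive_bernpoly n a :
  is_derive (bernpoly (S n)) a (INR (S n) * bernpoly n a).
Proof.
  unfold bernpoly.
  evar_last.
  - apply (is_derive_sum_f_R0 (fun k a => Binomial.C (S n) k * bern0 k * a ^ (S n - k))
      (fun k a => Binomial.C (S n) k * bern0 k * (INR (S n - k) * a ^ pred (S n - k)))).
    intros k Hk. generalize (S n - k)%nat. intros j. auto_derive; trivial. ring.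
  - cbv beta. rewrite tech5, Nat.sub_diag.
    rewrite (sum_eq _ (fun k => (Binomial.C n k * bern0 k * a ^ (n - k)) * INR (S n))).
    + rewrite <- scal_sum. simpl (INR 0). ring.
    + intros k Hk. replace (pred (S n - k)) with (n - k)%nat by lia.
      transitivity (Binomial.C (S n) k * INR (S n - k) * (bern0 k * a ^ (n - k))); [ring|].
      rewrite binom_absorb by lia. ring.
Qed.

(* The coefficients of t e^(-at)/(1-e^(-t)) in powers of t; the sign comes from writing e^(-at) instead of e^(at). *)
Definition bern_coef (n : nat) (a : R) : R := (-1) ^ n * (bernpoly n a / INR (fact n)).

Lemma is_derive_bern_coef n a :
  is_derive (bern_coef (S n)) a (- bern_coef n a).
Proof.
  apply (is_derive_ext_R (fun a => ((-1) ^ S n / INR (fact (S n))) * bernpoly (S n) a)).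
  - intros u. unfold bern_coef, Rdiv. ring.
  - evar_last; [apply is_derive_Rscal, is_derive_bernpoly|].
    unfold bern_coef. rewrite fact_simpl, mult_INR. simpl pow.
    field. split; [apply INR_fact_neq_0|apply not_0_INR; lia].
Qed.

Lemma bern_coef_periodic n : (2 <= n)%nat -> bern_coef n 1 = bern_coef n 0.
Proof. intros H. unfold bern_coef. now rewrite bernpoly_0, bernpoly_1. Qed.

Lemma bern_coef_0 a : bern_coef 0 a = 1.
Proof. unfold bern_coef, bernpoly, Binomial.C, bern0. simpl. field. Qed.

Lemma bern_coef_1 a : bern_coef 1 a = 1 / 2 - a.
Proof. unfold bern_coef, bernpoly, Binomial.C, bern0. simpl. unfold Binomial.C. simpl. field. Qed.

Lemma bern_coef_2 a : bern_coef 2 a = (a ^ 2 - a + 1 / 6) / 2.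
Proof. unfold bern_coef, bernpoly, Binomial.C, bern0. simpl. unfold Binomial.C. simpl. field. Qed.

(* The signs make [osc e m a / freq m ^ S e] the Fourier terms of [bern_coef (S e)]. *)
Fixpoint osc (e m : nat) (a : R) : R :=
  match e with
  | O => 2 * sin (freq m * a)
  | S e' => match e' with O => 2 * cos (freq m * a) | S e'' => - osc e'' m a end
  end.

Lemma osc_SS e m a : osc (S (S e)) m a = - osc e m a.
Proof. reflexivity. Qed.

Lemma nat_ind2 (P : nat -> Prop) :
  P O -> P 1%nat -> (forall n, P n -> P (S (S n))) -> forall n, P n.
Proof.
  intros H0 H1 H2 n. assert (H : P n /\ P (S n)); [|tauto].
  induction n; intuition.
Qed.

Lemma osc_bound e m a : Rabs (osc e m a) <= 2.
Proof.
  revert e. apply nat_ind2.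
  - simpl. generalize (SIN_bound (freq m * a)). intros. apply Rabs_le. lra.
  - simpl. generalize (COS_bound (freq m * a)). intros. apply Rabs_le. lra.
  - intros e IH. rewrite osc_SS, Rabs_Ropp. exact IH.
Qed.

Lemma is_derive_osc e m a : is_derive (osc (S e) m) a (- (freq m * osc e m a)).
Proof.
  revert e. apply nat_ind2.
  - simpl. auto_derive; trivial. ring.
  - simpl. auto_derive; trivial. ring.
  - intros e IH. rewrite osc_SS.
    apply (is_derive_ext (fun a => - osc (S e) m a)); [reflexivity|].
    evar_last; [apply (is_derive_opp (V := R_NormedModule)); exact IH|].
    unfold opp; simpl. ring.
Qed.

Lemma osc_periodic e m : osc e m 1 = osc e m 0.
Proof.
  revert e. apply nat_ind2; simpl.
  - unfold freq. rewrite Rmult_0_r. replace (2 * PI * INR (S m) * 1) with (0 + 2 * INR (S m) * PI) by ring.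
    now rewrite sin_period.
  - unfold freq. rewrite Rmult_0_r. replace (2 * PI * INR (S m) * 1) with (0 + 2 * INR (S m) * PI) by ring.
    now rewrite cos_period.
  - intros n ->. reflexivity.
Qed.

Definition osc_sum (e : nat) (a : R) : R := Series (fun m => osc e m a / freq m ^ S e).

Lemma osc_sum_bound e m a : Rabs (osc e m a / freq m ^ S e) <= 2 * / freq m ^ S e.
Proof.
  unfold Rdiv. rewrite Rabs_mult. assert (H := freq_pos m).
  assert (0 < / freq m ^ S e) by (apply Rinv_0_lt_compat, pow_lt; auto).
  rewrite (Rabs_pos_eq (/ _)) by lra. generalize (osc_bound e m a). nra.
Qed.

Lemma ex_series_osc e a : (1 <= e)%nat -> ex_series (fun m => osc e m a / freq m ^ S e).
Proof.
  intros He. apply ex_series_dominated with (fun m => 2 * / freq m ^ S e).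
  - apply ex_series_Rscal, ex_series_inv_freq_pow. lia.
  - intros; apply osc_sum_bound.
Qed.

Lemma is_derive_osc_sum e a :
  (1 <= e)%nat -> is_derive (osc_sum (S e)) a (- osc_sum e a).
Proof.
  intros He. unfold osc_sum. rewrite <- Series_opp.
  apply (derive_Series (fun m a => osc (S e) m a / freq m ^ S (S e))
          (fun m a => - (osc e m a / freq m ^ S e)) (fun m => 2 * / freq m ^ S e) a 1); [lra| | | |].
  - apply ex_series_Rscal, ex_series_inv_freq_pow. lia.
  - intros m x _. assert (H := freq_pos m).
    apply (is_derive_ext_R (fun a => / freq m ^ S (S e) * osc (S e) m a)).
    { intros; unfold Rdiv; ring. }
    evar_last; [apply is_derive_Rscal, is_derive_osc|].
    simpl pow. field. split; [apply pow_nonzero|]; lra.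
  - intros m x _. rewrite Rabs_Ropp. apply osc_sum_bound.
  - intros x _. apply ex_series_osc. lia.
Qed.

Lemma osc_sum_periodic e : osc_sum e 1 = osc_sum e 0.
Proof. unfold osc_sum. apply Series_ext. intros m. now rewrite osc_periodic. Qed.

(** Differentiation lowers both families by one index with the sign -1, so the difference one level
    up has derivative -k. Its equal values at 0 and 1 force k = 0: each level determines the
    constant of the level below. *)
Lemma osc_sum_step e k :
  (1 <= e)%nat ->
  (forall a, 0 <= a <= 1 -> osc_sum e a - bern_coef (S e) a = k) ->
  k = 0 /\ exists k', forall a, 0 <= a <= 1 -> osc_sum (S e) a - bern_coef (S (S e)) a = k'.
Proof.
  intros He H.
  set (g := fun a => osc_sum (S e) a - bern_coef (S (S e)) a + k * a).
  assert (Hg : forall a, 0 <= a <= 1 -> g a = g 0).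
  { intros a Ha.
    assert (Hb := mean_value_bound g (fun _ => 0) 0 a 0).
    rewrite Rmult_0_l in Hb.
    assert (Rabs (g a - g 0) <= 0).
    { apply Hb; intros x Hx; rewrite Rmin_left, Rmax_right in Hx by lra; [|rewrite Rabs_R0; lra].
      unfold g. evar_last.
      - apply (is_derive_plus (V := R_NormedModule)).
        + apply (is_derive_minus (V := R_NormedModule)).
          * now apply is_derive_osc_sum.
          * apply is_derive_bern_coef.
        + auto_derive; trivial.
      - unfold minus, plus, opp; simpl. generalize (H x ltac:(lra)). lra. }
    generalize (Rabs_pos (g a - g 0)). intros.
    assert (Rabs (g a - g 0) = 0) by lra. apply Rabs_eq_0 in H2. lra. }
  assert (Hk : k = 0).
  { generalize (Hg 1 ltac:(lra)). unfold g. rewrite osc_sum_periodic, bern_coef_periodic by lia. lra. }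
  split; [exact Hk|]. exists (g 0). intros a Ha. rewrite <- (Hg a Ha). unfold g. rewrite Hk. ring.
Qed.

Lemma osc_sum_eq e a : (1 <= e)%nat -> 0 <= a <= 1 -> osc_sum e a = bern_coef (S e) a.
Proof.
  intros He Ha.
  assert (H : exists k, forall a, 0 <= a <= 1 -> osc_sum e a - bern_coef (S e) a = k).
  { clear a Ha. induction e as [|e IH]; [lia|]. destruct e as [|e].
    (* The constant contains [osc_sum 1 0], a multiple of zeta(2); that it is 0 comes out of the
       later application of [osc_sum_step]. *)
    - exists (osc_sum 1 0 - 1 / 12). intros a Ha.
      rewrite bern_coef_2. unfold osc_sum at 1.
      replace (Series _) with (osc_sum 1 0 - (a - a ^ 2) / 2); [field|].
      rewrite <- (Series_cos_defect a Ha). unfold osc_sum.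
      rewrite <- Series_minus.
      + apply Series_ext. intros m. unfold cos_defect. simpl osc.
        rewrite Rmult_0_r, cos_0. field. apply Rgt_not_eq, freq_pos.
      + now apply ex_series_osc.
      + apply ex_series_cos_defect.
    - destruct IH as [k Hk]; [lia|]. now apply osc_sum_step in Hk; [|lia]. }
  destruct H as [k Hk]. destruct (osc_sum_step e k He Hk) as [H0 _].
  generalize (Hk a Ha). lra.
Qed.

(** One Fourier mode of the remainder of order e in the expansion of e^(-at)/(1-e^(-t)). For real t,
    [fourier_term] is [vterm 1] plus [vterm 2], so odd e carries cosines and even e carries sines;
    up to sign, raising e by 2 multiplies by (t/[freq m])^2. *)
Definition vterm (e m : nat) (t a : R) : R :=
  osc e m a * ((t / freq m) ^ e * (freq m / (t ^ 2 + freq m ^ 2))).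

Definition vsum (e : nat) (t a : R) : R := Series (fun m => vterm e m t a).

Lemma vterm_kernel_bound e m t :
  0 < t -> 0 <= (t / freq m) ^ e * (freq m / (t ^ 2 + freq m ^ 2)) <= t ^ e * / freq m ^ S e.
Proof.
  intros Ht. assert (H := freq_pos m). assert (Hw : 0 < freq m ^ 2) by (apply pow_lt; auto).
  assert (0 <= (t / freq m) ^ e) by (apply pow_le, Rlt_le, Rdiv_lt_0_compat; auto).
  split.
  - apply Rmult_le_pos; auto. apply Rlt_le, Rdiv_lt_0_compat; nra.
  - replace (t ^ e * / freq m ^ S e) with ((t / freq m) ^ e * (freq m * / freq m ^ 2)).
    + apply Rmult_le_compat_l; auto. apply Rmult_le_compat_l; [lra|].
      apply Rinv_le_contravar; nra.
    + unfold Rdiv. rewrite Rpow_mult_distr, pow_inv. simpl. field. repeat split; try apply pow_nonzero; lra.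
Qed.

Lemma vterm_bound e m t a :
  0 < t -> Rabs (vterm e m t a) <= 2 * t ^ e * / freq m ^ S e.
Proof.
  intros Ht. unfold vterm. rewrite Rabs_mult. destruct (vterm_kernel_bound e m t Ht).
  rewrite (Rabs_pos_eq (_ * _)) by auto. rewrite Rmult_assoc.
  apply Rmult_le_compat; auto using Rabs_pos, osc_bound.
Qed.

Lemma ex_series_vterm e t a : (1 <= e)%nat -> 0 < t -> ex_series (fun m => vterm e m t a).
Proof.
  intros He Ht. apply ex_series_dominated with (fun m => 2 * t ^ e * / freq m ^ S e).
  - apply ex_series_Rscal, ex_series_inv_freq_pow. lia.
  - intros; now apply vterm_bound.
Qed.

Lemma vsum_bound e t a : (1 <= e)%nat -> 0 < t ->
  Rabs (vsum e t a) <= 2 * Series (fun m => / freq m ^ S e) * t ^ e.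
Proof.
  intros He Ht. unfold vsum.
  replace (2 * Series (fun m => / freq m ^ S e) * t ^ e) with (Series (fun m => 2 * t ^ e * / freq m ^ S e)).
  - apply Series_abs_le; [|intros; now apply vterm_bound].
    apply ex_series_Rscal, ex_series_inv_freq_pow. lia.
  - rewrite Series_scal_l. ring.
Qed.

(** Termwise, 1/(t^2+w^2) = 1/w^2 - (t^2/w^2)/(t^2+w^2) with w = [freq m]; the first part sums to a
    Bernoulli polynomial by [osc_sum_eq]. *)
Lemma vsum_step e t a : (1 <= e)%nat -> 0 < t -> 0 <= a <= 1 ->
  vsum e t a = bern_coef (S e) a * t ^ e + vsum (S (S e)) t a.
Proof.
  intros He Ht Ha. rewrite <- osc_sum_eq by auto. unfold vsum, osc_sum.
  rewrite <- Series_scal_r, <- Series_plus.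
  - apply Series_ext. intros m. unfold vterm. rewrite osc_SS.
    assert (H := freq_pos m). simpl pow. unfold Rdiv. rewrite !Rpow_mult_distr, !pow_inv.
    field. repeat split; try apply pow_nonzero; nra.
  - apply ex_series_scal_r. now apply ex_series_osc.
  - apply ex_series_vterm; auto.
Qed.

Lemma exp_neg_lt_1 t : 0 < t -> 0 < exp (- t) < 1.
Proof.
  intros Ht. split; [apply exp_pos|]. rewrite <- exp_0. apply exp_increasing. lra.
Qed.

Lemma vsum_base t a : 0 < t -> 0 <= a <= 1 ->
  vsum 1 t a + vsum 2 t a = exp (- a * t) / (1 - exp (- t)) - 1 / t - (1 / 2 - a).
Proof.
  intros Ht Ha. assert (He := exp_neg_lt_1 t Ht).
  assert (H := fourier_complex (RtoC t)).
  unfold vsum. rewrite <- Series_plus by (apply ex_series_vterm; auto).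
  apply is_series_unique.
  assert (Hlim : is_lim_seq (fun M => Re (csum (fun m => fourier_term (RtoC t) m a) M))
            (Re (fourier_sum (RtoC t) a))).
  { apply Clim_Re. apply H; auto.
    - intros E. apply RtoC_inj in E. lra.
    - intros m E. rewrite <- RtoC_mult, <- RtoC_plus in E. apply RtoC_inj in E.
      generalize (pow_lt _ 2 (freq_pos m)). nra.
    - rewrite <- RtoC_opp, Cexp_RtoC, <- RtoC_minus. intros E. apply RtoC_inj in E. lra. }
  apply is_lim_seq_incr_1 in Hlim.
  replace (Re (fourier_sum (RtoC t) a)) with
    (exp (- a * t) / (1 - exp (- t)) - 1 / t - (1 / 2 - a)) in Hlim.
  2:{ unfold fourier_sum. rewrite <- RtoC_opp, <- RtoC_mult, !Cexp_RtoC, <- RtoC_minus.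
      rewrite <- RtoC_inv by lra. rewrite <- RtoC_div by lra. rewrite <- !RtoC_minus.
      simpl. replace (- t * a) with (- a * t) by ring. unfold Rdiv. ring. }
  revert Hlim. apply is_lim_seq_ext. intros M.
  rewrite Re_csum, rsum_sum_n. apply sum_n_ext_R. intros m.
  unfold fourier_term, vterm. assert (Hf := freq_pos m).
  assert (Hd : 0 < t * t + freq m ^ 2) by (generalize (pow_lt _ 2 (freq_pos m)); nra).
  rewrite <- !RtoC_mult, <- RtoC_plus, <- RtoC_div by lra.
  rewrite <- !RtoC_mult, <- RtoC_minus. simpl. field. split; nra.
Qed.

(** Passing from J to J+1 splits a Taylor term off [vsum (J-1)], which becomes [vsum (J+1)]. The two
    remainders therefore always have consecutive orders, hence one of each parity. *)
Lemma generating_expansion J t a : (2 <= J)%nat -> 0 < t -> 0 <= a <= 1 ->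
  t * (exp (- a * t) / (1 - exp (- t))) =
  rsum (fun l => bern_coef l a * t ^ l) J + t * (vsum (J - 1) t a + vsum J t a).
Proof.
  intros HJ Ht Ha. induction J as [|J IH]; [lia|].
  destruct (Nat.eq_dec J 1) as [->|Hne].
  - simpl rsum. replace (2 - 1)%nat with 1%nat by lia. rewrite vsum_base by auto.
    rewrite bern_coef_0, bern_coef_1. field. generalize (exp_neg_lt_1 t Ht). lra.
  - rewrite IH by lia. simpl rsum. replace (S J - 1)%nat with J by lia.
    destruct J as [|J]; [lia|]. replace (S J - 1)%nat with J by lia.
    rewrite (vsum_step J t a) by (auto; lia). simpl pow. ring.
Qed.

(** * The defect between a sum and an integral *)

Lemma lim_inv_INR : is_lim_seq (fun n => / INR n) 0.
Proof. evar_last; [apply is_lim_seq_inv; [apply is_lim_seq_INR|easy]|reflexivity]. Qed.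

Lemma lim_inv_INR_S : is_lim_seq (fun n => / INR (S n)) 0.
Proof. exact (proj1 (is_lim_seq_incr_1 (fun n => / INR n) 0) lim_inv_INR). Qed.

Lemma is_lim_seq_ex_derive (f : R -> R) (u : nat -> R) (l l' : R) :
  ex_derive f l -> f l = l' -> is_lim_seq u l -> is_lim_seq (fun n => f (u n)) l'.
Proof.
  intros Hf <- Hu. apply is_lim_seq_continuous; auto.
  now apply derivable_continuous_pt, ex_derive_Reals_0.
Qed.

Lemma lim_half_ln_quadratic (c rho : R) :
  is_lim_seq (fun n => / 2 * ln ((INR n + c) ^ 2 + rho ^ 2) - ln (INR n)) 0.
Proof.
  apply is_lim_seq_incr_1.
  set (q := fun x => (1 + c * x) ^ 2 + (rho * x) ^ 2).
  assert (Hq : is_lim_seq (fun n => q (/ INR (S n))) 1).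
  { apply is_lim_seq_ex_derive with 0; [unfold q; auto_derive; trivial|unfold q; ring|apply lim_inv_INR_S]. }
  apply is_lim_seq_ext_loc with (fun n => / 2 * ln (q (/ INR (S n)))).
  - apply is_lim_seq_spec in Hq. destruct (Hq (mkposreal (1/2) ltac:(lra))) as [n0 Hn0].
    exists n0. intros n Hn. specialize (Hn0 n Hn). cbn [pos] in Hn0.
    apply Rabs_def2 in Hn0.
    assert (Hp : 0 < INR (S n)) by (apply lt_0_INR; lia).
    replace ((INR (S n) + c) ^ 2 + rho ^ 2) with (INR (S n) ^ 2 * q (/ INR (S n))) by (unfold q; field; lra).
    rewrite ln_mult; [|now apply pow_lt|lra].
    rewrite ln_pow by auto. simpl (INR 2). field.
  - apply (is_lim_seq_ex_derive (fun x => / 2 * ln x) _ 1); auto.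
    + auto_derive. lra.
    + rewrite ln_1. ring.
Qed.

Lemma lim_atan_shift (c rho : R) : 0 < rho ->
  is_lim_seq (fun n => atan ((INR n + c) / rho)) (PI / 2).
Proof.
  intros Hr.
  apply is_lim_seq_ext_loc with (fun n => PI / 2 - atan (rho / (INR n + c))).
  - destruct (nfloor_ex (Rmax 0 (- c))) as [n0 Hn0]; [apply Rmax_l|].
    exists (S n0). intros n Hn.
    assert (Hp : 0 < INR n + c).
    { apply le_INR in Hn. rewrite S_INR in Hn. generalize (Rmax_r 0 (- c)). lra. }
    replace (rho / (INR n + c)) with (/ ((INR n + c) / rho)) by (field; lra).
    rewrite atan_inv; [ring|]. now apply Rdiv_lt_0_compat.
  - apply (is_lim_seq_ex_derive (fun x => PI / 2 - atan (rho * x)) (fun n => / (INR n + c)) 0).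
    + auto_derive. trivial.
    + rewrite Rmult_0_r, atan_0. ring.
    + evar_last.
      * apply is_lim_seq_inv.
        -- apply is_lim_seq_plus with p_infty c; [apply is_lim_seq_INR|apply is_lim_seq_const|reflexivity].
        -- easy.
      * reflexivity.
Qed.

(** From n = 1 on the sequence increases and stays below 0, since 1/(n+1) <= ln(n+1) - ln n <= 1/n.
    The limit is minus Euler's constant. *)
Lemma harmonic_lim : exists g : R, is_lim_seq (fun n => ln (INR n) - rsum (fun k => / INR (S k)) n) g.
Proof.
  set (u := fun n => ln (INR (S n)) - rsum (fun k => / INR (S k)) (S n)).
  assert (Hln : forall n, 0 < ln (INR (S (S n))) - ln (INR (S n)) /\
            / INR (S (S n)) <= ln (INR (S (S n))) - ln (INR (S n)) <= / INR (S n)).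
  { intros n. assert (Hp : 0 < INR (S n)) by (apply lt_0_INR; lia).
    rewrite (S_INR (S n)). set (y := INR (S n)) in *.
    destruct (MVT_gen ln y (y + 1) (fun x => / x)) as [c [Hc Heq]].
    - intros x Hx. rewrite Rmin_left, Rmax_right in Hx by lra. apply is_derive_ln. lra.
    - intros x Hx. rewrite Rmin_left, Rmax_right in Hx by lra.
      apply derivable_continuous_pt, ex_derive_Reals_0. exists (/ x). apply is_derive_ln. lra.
    - rewrite Rmin_left, Rmax_right in Hc by lra. rewrite Heq.
      replace (y + 1 - y) with 1 by ring. rewrite Rmult_1_r.
      split; [apply Rinv_0_lt_compat; lra|split; apply Rinv_le_contravar; lra]. }
  destruct (ex_finite_lim_seq_incr u 0) as [g Hg].
  - intros n. unfold u. cbn [rsum]. specialize (Hln n). lra.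
  - assert (H : forall n, ln (INR (S n)) <= rsum (fun k => / INR (S k)) n).
    { induction n as [|n IH]; [simpl; rewrite ln_1; lra|].
      cbn [rsum]. specialize (Hln n). lra. }
    intros n. unfold u. specialize (H n). cbn [rsum].
    assert (0 < / INR (S n)) by (apply Rinv_0_lt_compat, lt_0_INR; lia). lra.
  - exists g. apply is_lim_seq_incr_1. exact Hg.
Qed.

(* Branches of log(u + iz) and log(u - iz) for real u and Re z > 0; the numbers u + iz and u - iz stay in the
   upper and lower half plane respectively, so that [atan] gives smooth arguments. *)
Definition log_above (z : C) (u : R) : C :=
  (/ 2 * ln ((u + - Im z) ^ 2 + Re z ^ 2), PI / 2 - atan ((u + - Im z) / Re z)).

Definition log_below (z : C) (u : R) : C :=
  (/ 2 * ln ((u + Im z) ^ 2 + Re z ^ 2), atan ((u + Im z) / Re z) - PI / 2).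

Lemma Cinv_eq (z w : C) : (z * w = 1)%C -> w = (/ z)%C.
Proof.
  intros H. assert (Hz : z <> 0%C).
  { intros ->. rewrite Cmult_0_l in H. apply RtoC_inj in H. lra. }
  replace w with (/ z * (z * w))%C by (field; auto). rewrite H. ring.
Qed.

Lemma Cder_log_above z u : 0 < Re z -> Cder (log_above z) u (/ (RtoC u + Ci * z))%C.
Proof.
  destruct z as [rho eta]; simpl; intros Hr.
  assert (Hd : 0 < (u + - eta) ^ 2 + rho ^ 2) by (generalize (pow2_ge_0 (u + - eta)); nra).
  apply Cder_eq with ((u + - eta) / ((u + - eta) ^ 2 + rho ^ 2), - rho / ((u + - eta) ^ 2 + rho ^ 2)).
  - split; simpl.
    + auto_derive; [simpl in Hd; lra|]. field. simpl in Hd. nra.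
    + auto_derive; [lra|]. field. split; nra.
  - apply Cinv_eq. apply injective_projections; simpl; field; nra.
Qed.

Lemma Cder_log_below z u : 0 < Re z -> Cder (log_below z) u (/ (RtoC u - Ci * z))%C.
Proof.
  destruct z as [rho eta]; simpl; intros Hr.
  assert (Hd : 0 < (u + eta) ^ 2 + rho ^ 2) by (generalize (pow2_ge_0 (u + eta)); nra).
  apply Cder_eq with ((u + eta) / ((u + eta) ^ 2 + rho ^ 2), rho / ((u + eta) ^ 2 + rho ^ 2)).
  - split; simpl.
    + auto_derive; [simpl in Hd; lra|]. field. simpl in Hd. nra.
    + auto_derive; [lra|]. field. split; nra.
  - apply Cinv_eq. apply injective_projections; simpl; field; nra.
Qed.

Lemma log_above_lim z : 0 < Re z ->
  Clim (fun n => log_above z (INR n) - RtoC (ln (INR n)))%C 0%C.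
Proof.
  intros Hr. apply Clim_parts; simpl.
  - apply lim_half_ln_quadratic.
  - apply is_lim_seq_ext with (fun n => PI / 2 - atan ((INR n + - Im z) / Re z)); [intros; ring|].
    replace 0 with (PI / 2 - PI / 2) by ring.
    apply is_lim_seq_minus'; [apply is_lim_seq_const|]. now apply lim_atan_shift.
Qed.

Lemma log_below_lim z : 0 < Re z ->
  Clim (fun n => log_below z (INR n) - RtoC (ln (INR n)))%C 0%C.
Proof.
  intros Hr. apply Clim_parts; simpl.
  - apply lim_half_ln_quadratic.
  - apply is_lim_seq_ext with (fun n => atan ((INR n + Im z) / Re z) - PI / 2); [intros; ring|].
    replace 0 with (PI / 2 - PI / 2) by ring.
    apply is_lim_seq_minus'; [|apply is_lim_seq_const]. now apply lim_atan_shift.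
Qed.

Lemma log_at_0_sum z : 0 < Re z -> (log_below z 0 + log_above z 0 = 2 * Clog z)%C.
Proof.
  destruct z as [rho eta]; simpl; intros Hr. unfold log_below, log_above, Clog, Carg; simpl.
  destruct (Rlt_dec 0 rho) as [_|]; [|lra].
  apply injective_projections; simpl.
  - unfold Cmod. simpl.
    replace (ln (sqrt (rho * (rho * 1) + eta * (eta * 1)))) with (/ 2 * ln (rho * (rho * 1) + eta * (eta * 1))).
    + replace ((0 + eta) * ((0 + eta) * 1)) with (eta * (eta * 1)) by ring.
      replace ((0 + - eta) * ((0 + - eta) * 1)) with (eta * (eta * 1)) by ring.
      rewrite (Rplus_comm (eta * (eta * 1))). field.
    + set (X := rho * (rho * 1) + eta * (eta * 1)). assert (HX : 0 < X) by (unfold X; nra).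
      rewrite <- (sqrt_sqrt X) at 1 by lra. rewrite ln_mult by (now apply sqrt_lt_R0). field.
  - rewrite Rplus_0_l. replace ((0 + - eta) / rho) with (- (eta / rho)) by (field; lra).
    rewrite atan_opp. ring.
Qed.

(** Divided by 2iz, this jump is the source of the value pi/(2z) of the integral of 1/(u^2+z^2) over
    u > 0. *)
Lemma log_at_0_diff z : 0 < Re z -> (log_below z 0 - log_above z 0 = - (Ci * RtoC PI))%C.
Proof.
  destruct z as [rho eta]; simpl; intros Hr. unfold log_below, log_above; simpl.
  apply injective_projections; simpl.
  - replace ((0 + eta) * ((0 + eta) * 1)) with (eta * (eta * 1)) by ring.
    replace ((0 + - eta) * ((0 + - eta) * 1)) with (eta * (eta * 1)) by ring. ring.
  - rewrite Rplus_0_l. replace ((0 + - eta) / rho) with (- (eta / rho)) by (field; lra).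
    rewrite atan_opp. field.
Qed.

Lemma C_neq_0_Re z : Re z <> 0 -> z <> 0%C.
Proof. intros H ->. apply H. reflexivity. Qed.

Lemma C_neq_0_Im z : Im z <> 0 -> z <> 0%C.
Proof. intros H ->. apply H. reflexivity. Qed.

Lemma factor_plus_neq_0 z u : 0 < Re z -> (RtoC u + Ci * z)%C <> 0%C.
Proof.
  intros H. apply C_neq_0_Im. destruct z as [a b]; simpl in *. lra.
Qed.

Lemma factor_minus_neq_0 z u : 0 < Re z -> (RtoC u - Ci * z)%C <> 0%C.
Proof.
  intros H. apply C_neq_0_Im. destruct z as [a b]; simpl in *. lra.
Qed.

Lemma Ci_sqr : (Ci * Ci = - (1))%C.
Proof. apply injective_projections; simpl; ring. Qed.

Lemma sum_squares_factor z u :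
  ((RtoC u + Ci * z) * (RtoC u - Ci * z) = RtoC (u ^ 2) + z * z)%C.
Proof.
  transitivity (RtoC u * RtoC u - (Ci * Ci) * (z * z))%C; [ring|].
  rewrite Ci_sqr, RtoC_pow. ring.
Qed.

Lemma sum_squares_neq_0 z u : 0 < Re z -> (RtoC (u ^ 2) + z * z)%C <> 0%C.
Proof.
  intros H. rewrite <- sum_squares_factor.
  apply Cmult_neq_0; [now apply factor_plus_neq_0|now apply factor_minus_neq_0].
Qed.

Lemma Ci_neq_0 : Ci <> 0%C.
Proof. apply C_neq_0_Im. simpl. lra. Qed.

Definition kernel (odd : bool) (z : C) (u : R) : C :=
  ((if odd then RtoC u else 1) / (RtoC (u ^ 2) + z * z))%C.

Definition kernel_primitive (odd : bool) (z : C) (u : R) : C :=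
  if odd then (/ 2 * (log_below z u + log_above z u))%C
  else ((log_below z u - log_above z u) / (2 * (Ci * z)))%C.

Lemma RtoC_2_neq_0 : RtoC 2 <> 0%C.
Proof. intros H. apply RtoC_inj in H. lra. Qed.

Lemma Cder_kernel_primitive odd z u :
  0 < Re z -> Cder (kernel_primitive odd z) u (kernel odd z u).
Proof.
  intros H. assert (Hz : z <> 0%C) by (apply C_neq_0_Re; lra).
  assert (H1 := factor_plus_neq_0 z u H). assert (H2 := factor_minus_neq_0 z u H).
  unfold kernel, kernel_primitive. rewrite <- sum_squares_factor.
  assert (Ha := Cder_log_above z u H). assert (Hb := Cder_log_below z u H).
  assert (Hi := Ci_neq_0). assert (H20 := RtoC_2_neq_0). destruct odd.
  - eapply Cder_eq.
    + apply Cder_mult; [apply Cder_const|apply Cder_plus; eassumption].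
    + cbv beta. field. repeat split; auto.
  - eapply Cder_eq.
    + unfold Cdiv. apply Cder_mult; [apply Cder_minus; eassumption|apply Cder_const].
    + cbv beta. field. repeat split; auto.
Qed.

(* The limit of [sum_(n=1)^M kernel n - int_0^M kernel]; this is the source of both the exponential and the
   digamma terms of S. *)
Definition summation_defect (odd : bool) (z : C) : C :=
  if odd then (Clog z - / 2 * (digamma (Ci * z) + digamma (- (Ci * z))))%C
  else (RtoC PI / z / (Cexp (2 * RtoC PI * z) - 1) - / (2 * (z * z)))%C.

Lemma Cexp_neq_1 z : 0 < Re z -> (Cexp z - 1)%C <> 0%C.
Proof.
  intros H E. assert (Hm := Cmod_Cexp z).
  replace (Cexp z) with ((Cexp z - 1) + 1)%C in Hm by ring. rewrite E, Cplus_0_l, Cmod_1 in Hm.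
  assert (Hl := exp_increasing 0 (Re z) H). rewrite exp_0 in Hl. lra.
Qed.

Lemma Cexp_opp z : Cexp (- z) = (/ Cexp z)%C.
Proof.
  apply Cinv_eq. rewrite <- Cexp_plus. replace (z + - z)%C with (RtoC 0) by ring. apply Cexp_0.
Qed.

(** This is [fourier_complex] at a = 0 and t = 2 pi z, the partial fraction expansion of the
    hyperbolic cotangent, since 1/2 + 1/(e^t-1) = coth(t/2)/2. *)
Lemma kernel_even_sum z : 0 < Re z ->
  Clim (fun M => csum (fun n => kernel false z (INR (S n))) M)
    (RtoC PI / z * (/ 2 + / (Cexp (2 * RtoC PI * z) - 1)) - / (2 * (z * z)))%C.
Proof.
  intros H. assert (Hz : z <> 0%C) by (apply C_neq_0_Re; lra). assert (HPI := PI_RGT_0).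
  assert (HPIc : RtoC PI <> 0%C) by (intros E; apply RtoC_inj in E; lra).
  assert (H20 := RtoC_2_neq_0).
  set (t := (2 * RtoC PI * z)%C).
  assert (Ht : 0 < Re t) by (unfold t; destruct z; simpl in *; nra).
  assert (Ht0 : t <> 0%C) by (apply C_neq_0_Re; lra).
  assert (He := Cexp_neq_1 t Ht). assert (He0 := Cexp_neq_0 t).
  assert (Hreg : forall m, (t * t + RtoC (freq m ^ 2))%C <> 0%C).
  { intros m. rewrite Cplus_comm. now apply sum_squares_neq_0. }
  assert (He2 : (1 - Cexp (- t))%C <> 0%C).
  { rewrite Cexp_opp. intros E. apply He.
    transitivity (Cexp t * (1 - / Cexp t))%C; [field; auto|rewrite E; ring]. }
  assert (Hl := fourier_complex t Ht0 Hreg He2 0 ltac:(lra)).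
  apply (Clim_scal (RtoC PI / z)%C) in Hl.
  replace (RtoC PI / z * (/ 2 + / (Cexp t - 1)) - / (2 * (z * z)))%C with
    (RtoC PI / z * fourier_sum t 0)%C.
  - revert Hl. apply Clim_ext. intros M. rewrite <- csum_scal. apply csum_ext. intros m _.
    unfold fourier_term, kernel. rewrite Rmult_0_r, cos_0, sin_0.
    unfold Rdiv. rewrite Rmult_0_l.
    assert (Hm := Hreg m). assert (Hs := sum_squares_neq_0 z (INR (S m)) H).
    replace (t * t + RtoC (freq m ^ 2))%C with ((2 * RtoC PI) * (2 * RtoC PI) * (RtoC (INR (S m) ^ 2) + z * z))%C in *.
    2:{ unfold t, freq. rewrite !RtoC_pow, !RtoC_mult. ring. }
    unfold t. field. repeat split; auto.
  - unfold fourier_sum. replace (- t * RtoC 0)%C with (RtoC 0) by ring. rewrite Cexp_0, Cexp_opp.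
    replace (1 / 2 - 0) with (/ 2) by lra. rewrite RtoC_inv by lra.
    assert (He2' := He2). rewrite Cexp_opp in He2'.
    fold t. unfold t at 2. set (X := Cexp t) in *. clearbody X. clear -Hz HPIc H20 He He0.
    field. repeat split; auto.
Qed.

(** The primitive vanishes at infinity, and the integral pi/(2z) cancels the 1/2 beside 1/(exp(2 pi
    z)-1), which leaves an exponentially small term and -1/(2z^2). *)
Lemma kernel_even_defect z : 0 < Re z ->
  Clim (fun M => csum (fun n => kernel false z (INR (S n))) M
          - (kernel_primitive false z (INR M) - kernel_primitive false z 0))%C
    (summation_defect false z).
Proof.
  intros H. assert (Hz : z <> 0%C) by (apply C_neq_0_Re; lra).
  assert (Hi := Ci_neq_0). assert (H20 := RtoC_2_neq_0).
  assert (He := Cexp_neq_1 (2 * RtoC PI * z)%C).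
  assert (Ht : 0 < Re (2 * RtoC PI * z)%C) by (generalize PI_RGT_0; destruct z; simpl in *; nra).
  specialize (He Ht).
  assert (H1 := kernel_even_sum z H).
  assert (H2 : Clim (fun M => kernel_primitive false z (INR M)) 0%C).
  { unfold kernel_primitive.
    assert (Hd := Clim_minus _ _ _ _ (log_below_lim z H) (log_above_lim z H)).
    apply (Clim_scal (/ (2 * (Ci * z)))%C) in Hd.
    replace (/ (2 * (Ci * z)) * (0 - 0))%C with (RtoC 0) in Hd by ring.
    revert Hd. apply Clim_ext. intros n. unfold Cdiv. ring. }
  assert (H3 := Clim_minus _ _ _ _ H1 (Clim_minus _ _ _ _ H2 (Clim_const (kernel_primitive false z 0)))).
  replace (summation_defect false z) with
    (RtoC PI / z * (/ 2 + / (Cexp (2 * RtoC PI * z) - 1)) - / (2 * (z * z)) -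
     (0 - kernel_primitive false z 0))%C; [exact H3|].
  unfold kernel_primitive, summation_defect. rewrite log_at_0_diff by auto.
  field. repeat split; auto.
Qed.

(** Shifts beyond about 2(|z|+1) dominate z; for the finitely many smaller ones |Im z| bounds the
    modulus from below. *)
Lemma shifted_modulus_bound (z : C) : Im z <> 0 ->
  exists c, 0 < c /\ forall k, c * INR (S k) <= Cmod (z + RtoC (INR k)).
Proof.
  intros H.
  assert (Hi : 0 < Rabs (Im z)) by now apply Rabs_pos_lt.
  assert (Hm := Cmod_ge_0 z).
  exists (Rmin (1 / 2) (Rabs (Im z) / (2 * (Cmod z + 1)))).
  assert (Hc : 0 < Rabs (Im z) / (2 * (Cmod z + 1))) by (apply Rdiv_lt_0_compat; lra).
  split; [apply Rmin_pos; lra|].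
  intros k. assert (Hk := pos_INR k). rewrite S_INR.
  destruct (Rle_lt_dec (2 * (Cmod z + 1)) (INR k + 1)) as [Hl|Hl].
  - apply Rle_trans with (1 / 2 * (INR k + 1)).
    + apply Rmult_le_compat_r; [lra|apply Rmin_l].
    + assert (Ht := Cmod_triangle (z + RtoC (INR k)) (- z)).
      replace (z + RtoC (INR k) + - z)%C with (RtoC (INR k)) in Ht by ring.
      rewrite Cmod_opp, Cmod_R, Rabs_pos_eq in Ht by lra. lra.
  - apply Rle_trans with (Rabs (Im z) / (2 * (Cmod z + 1)) * (INR k + 1)).
    + apply Rmult_le_compat_r; [lra|apply Rmin_r].
    + apply Rle_trans with (Rabs (Im (z + RtoC (INR k))%C)); [|apply Im_abs_le].
      replace (Im (z + RtoC (INR k))%C) with (Im z) by (unfold Im; simpl; ring).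
      replace (Rabs (Im z) / (2 * (Cmod z + 1)) * (INR k + 1)) with
        (Rabs (Im z) * ((INR k + 1) / (2 * (Cmod z + 1)))) by (field; lra).
      rewrite <- (Rmult_1_r (Rabs (Im z))) at 2. apply Rmult_le_compat_l; [lra|].
      apply Rle_div_l; lra.
Qed.

Lemma Clim_series_dominated (u : nat -> C) (d : nat -> R) :
  ex_series d -> (forall n, Cmod (u n) <= d n) ->
  exists l, Clim (fun M => csum u M) l.
Proof.
  intros Hd H.
  assert (H1 : ex_series (fun n => Re (u n))).
  { apply ex_series_dominated with d; auto. intros n. eapply Rle_trans; [apply Re_abs_le|auto]. }
  assert (H2 : ex_series (fun n => Im (u n))).
  { apply ex_series_dominated with d; auto. intros n. eapply Rle_trans; [apply Im_abs_le|auto]. }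
  exists (Series (fun n => Re (u n)), Series (fun n => Im (u n))).
  apply Clim_parts.
  - apply (is_lim_seq_incr_1 (fun M => Re (csum u M))).
    apply is_lim_seq_ext with (sum_n (fun n => Re (u n))).
    + intros n. now rewrite Re_csum, rsum_sum_n.
    + now apply Series_correct.
  - apply (is_lim_seq_incr_1 (fun M => Im (csum u M))).
    apply is_lim_seq_ext with (sum_n (fun n => Im (u n))).
    + intros n. now rewrite Im_csum, rsum_sum_n.
    + now apply Series_correct.
Qed.

(** [digamma] is defined through [Lim_seq], which has a value even for divergent sequences, so
    convergence has to be established first: 1/(z+k) differs from 1/(k+1) by O(k^(-2)), and
    [harmonic_lim] compares the harmonic sum with ln n. *)
Lemma digamma_lim (z : C) : Im z <> 0 ->
  Clim (fun n => RtoC (ln (INR n)) - csum (fun k => / (z + RtoC (INR k))) (S n))%C (digamma z).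
Proof.
  intros H.
  assert (Hex : exists l, Clim (fun n => RtoC (ln (INR n)) - csum (fun k => / (z + RtoC (INR k))) (S n))%C l).
  { destruct (shifted_modulus_bound z H) as [c [Hc Hb]].
    assert (Hne : forall k, (z + RtoC (INR k))%C <> 0%C).
    { intros k. apply C_neq_0_Im. unfold Im in *; simpl; lra. }
    destruct (Clim_series_dominated (fun k => / (z + RtoC (INR k)) - RtoC (/ INR (S k)))%C
       (fun k => (Cmod (1 - z) / c) * / INR (S k) ^ 2)) as [l Hl].
    - apply ex_series_Rscal. now apply ex_series_inv_pow.
    - intros k. assert (Hk : 0 < INR (S k)) by (apply lt_0_INR; lia).
      specialize (Hb k). specialize (Hne k).
      assert (HkC : RtoC (INR (S k)) <> 0%C) by (intros E; apply RtoC_inj in E; lra).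
      replace (/ (z + RtoC (INR k)) - RtoC (/ INR (S k)))%C with
        ((1 - z) * (/ (z + RtoC (INR k)) * / RtoC (INR (S k))))%C.
      2:{ rewrite RtoC_inv by lra. rewrite S_INR, RtoC_plus in *. field. split; auto. }
      rewrite !Cmod_mult, !Cmod_inv, Cmod_R, Rabs_pos_eq by (auto; lra).
      unfold Rdiv. rewrite !Rmult_assoc. apply Rmult_le_compat_l; [apply Cmod_ge_0|].
      replace (/ c * / INR (S k) ^ 2) with (/ (c * INR (S k)) * / INR (S k)) by (field; split; lra).
      apply Rmult_le_compat_r; [left; now apply Rinv_0_lt_compat|].
      apply Rinv_le_contravar; auto. now apply Rmult_lt_0_compat.
    - destruct harmonic_lim as [g Hg].
      assert (Hg' : is_lim_seq (fun n => ln (INR n) - rsum (fun k => / INR (S k)) (S n)) g).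
      { apply is_lim_seq_ext with (fun n => (ln (INR n) - rsum (fun k => / INR (S k)) n) - / INR (S n)).
        - intros n. cbn [rsum]. ring.
        - evar_last; [apply is_lim_seq_minus'; [exact Hg|apply lim_inv_INR_S]|f_equal; ring]. }
      exists (RtoC g - l)%C.
      assert (Hl' := proj1 (is_lim_seq_incr_1 _ _) Hl).
      apply Clim_ext with (fun n => RtoC (ln (INR n) - rsum (fun k => / INR (S k))%R (S n)) -
         csum (fun k => / (z + RtoC (INR k)) - RtoC (/ INR (S k))) (S n))%C.
      + intros n.
        rewrite (csum_ext (fun k => / (z + RtoC (INR k)) - RtoC (/ INR (S k)))%C
           (fun k => / (z + RtoC (INR k)) + (- (1)) * RtoC (/ INR (S k)))%C) by (intros; cbv beta; ring).
        rewrite csum_plus, csum_scal, csum_RtoC, RtoC_minus. ring.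
      + apply Clim_minus; [|exact Hl'].
        apply Clim_parts; simpl; [exact Hg'|apply is_lim_seq_const]. }
  destruct Hex as [l Hl].
  replace (digamma z) with l; [exact Hl|].
  unfold digamma. apply injective_projections; simpl fst; simpl snd.
  - assert (H1 := Clim_Re _ _ Hl). apply is_lim_seq_unique in H1.
    change (fst l) with (real (Finite (Re l))). rewrite <- H1. reflexivity.
  - assert (H1 := Clim_Im _ _ Hl). apply is_lim_seq_unique in H1.
    change (snd l) with (real (Finite (Im l))). rewrite <- H1. f_equal. apply Lim_seq_ext.
    intros n. simpl. ring.
Qed.

Lemma Im_Ci_mult z : Im (Ci * z)%C = Re z.
Proof. unfold Im, Re; simpl. ring. Qed.

(** The terms with k = 0 cancel, and for k >= 1 the two fractions add up to 2k/(k^2+z^2). *)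
Lemma digamma_pair_sum z n : 0 < Re z ->
  (csum (fun k => / (Ci * z + RtoC (INR k))) (S n) + csum (fun k => / (- (Ci * z) + RtoC (INR k))) (S n)
   = 2 * csum (fun m => kernel true z (INR (S m))) n)%C.
Proof.
  intros H. assert (Hz : z <> 0%C) by (apply C_neq_0_Re; lra).
  assert (Hi := Ci_neq_0). induction n as [|n IH].
  - cbn [csum INR]. replace (Ci * z + RtoC 0)%C with (Ci * z)%C by ring.
    replace (- (Ci * z) + RtoC 0)%C with (- (Ci * z))%C by ring. field. auto.
  - change (csum ?f (S (S n))) with (csum f (S n) + f (S n))%C.
    change (csum (fun m => kernel true z (INR (S m))) (S n)) with
      (csum (fun m => kernel true z (INR (S m))) n + kernel true z (INR (S n)))%C.
    cbv beta. set (k := INR (S n)).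
    transitivity (csum (fun k => / (Ci * z + RtoC (INR k))) (S n) + csum (fun k => / (- (Ci * z) + RtoC (INR k))) (S n)
       + (/ (Ci * z + RtoC k) + / (- (Ci * z) + RtoC k)))%C; [ring|].
    rewrite IH. unfold kernel. rewrite <- sum_squares_factor.
    assert (H1 := factor_plus_neq_0 z k H). assert (H2 := factor_minus_neq_0 z k H).
    replace (Ci * z + RtoC k)%C with (RtoC k + Ci * z)%C by ring.
    replace (- (Ci * z) + RtoC k)%C with (RtoC k - Ci * z)%C by ring.
    field. auto.
Qed.

Lemma digamma_pair_lim z : 0 < Re z ->
  Clim (fun n => csum (fun m => kernel true z (INR (S m))) n - RtoC (ln (INR n)))%C
    (- (/ 2 * (digamma (Ci * z) + digamma (- (Ci * z)))))%C.
Proof.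
  intros H. assert (H20 := RtoC_2_neq_0).
  assert (H1 := digamma_lim (Ci * z)%C). assert (H2 := digamma_lim (- (Ci * z))%C).
  rewrite Im_Ci_mult in H1. specialize (H1 ltac:(lra)).
  replace (Im (- (Ci * z))%C) with (- Re z) in H2 by (rewrite <- Im_Ci_mult; reflexivity).
  specialize (H2 ltac:(lra)).
  assert (H3 := Clim_scal (- / 2)%C _ _ (Clim_plus _ _ _ _ H1 H2)).
  replace (- (/ 2 * (digamma (Ci * z) + digamma (- (Ci * z)))))%C with
    (- / 2 * (digamma (Ci * z) + digamma (- (Ci * z))))%C by ring.
  revert H3. apply Clim_ext. intros n. assert (Hs := digamma_pair_sum z n H).
  match type of Hs with (?a + ?b = _)%C =>
    transitivity (/ 2 * (a + b) - RtoC (ln (INR n)))%C end.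
  - field. auto.
  - rewrite Hs. field.
Qed.

Lemma kernel_odd_defect z : 0 < Re z ->
  Clim (fun M => csum (fun n => kernel true z (INR (S n))) M
          - (kernel_primitive true z (INR M) - kernel_primitive true z 0))%C
    (summation_defect true z).
Proof.
  intros H. assert (H20 := RtoC_2_neq_0).
  assert (H1 := digamma_pair_lim z H).
  assert (H2 := Clim_scal (/ 2)%C _ _ (Clim_plus _ _ _ _ (log_below_lim z H) (log_above_lim z H))).
  assert (H3 := Clim_plus _ _ _ _ (Clim_minus _ _ _ _ H1 H2) (Clim_const (Clog z))).
  unfold kernel_primitive, summation_defect. rewrite log_at_0_sum by auto.
  replace (Clog z - / 2 * (digamma (Ci * z) + digamma (- (Ci * z))))%C with
    (- (/ 2 * (digamma (Ci * z) + digamma (- (Ci * z)))) - / 2 * (0 + 0) + Clog z)%C by ring.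
  revert H3. apply Clim_ext. intros n. field.
Qed.

Lemma kernel_defect odd z : 0 < Re z ->
  Clim (fun M => csum (fun n => kernel odd z (INR (S n))) M
          - (kernel_primitive odd z (INR M) - kernel_primitive odd z 0))%C
    (summation_defect odd z).
Proof. destruct odd; [apply kernel_odd_defect|apply kernel_even_defect]. Qed.

Lemma Clim_bound u l B : Clim u l -> (forall n, Cmod (u n) <= B) -> Cmod l <= B.
Proof.
  intros H HB. apply Rnot_lt_le. intros Hlt.
  apply is_lim_seq_spec in H. destruct (H (mkposreal (Cmod l - B) ltac:(lra))) as [n Hn].
  specialize (Hn n (le_n n)). cbn [pos] in Hn. rewrite Rminus_0_r, Rabs_pos_eq in Hn by apply Cmod_ge_0.
  assert (Ht := Cmod_triangle (u n) (- (u n - l))).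
  replace (u n + - (u n - l))%C with l in Ht by ring. rewrite Cmod_opp in Ht. specialize (HB n). lra.
Qed.

Lemma ln_abs_bound r : 0 < r -> Rabs (ln r) <= r + / r.
Proof.
  intros H. assert (Hi : 0 < / r) by now apply Rinv_0_lt_compat.
  assert (H1 := exp_ineq1_le (ln r)). assert (H2 := exp_ineq1_le (ln (/ r))).
  rewrite exp_ln in H1, H2 by auto. rewrite ln_Rinv in H2 by auto.
  apply Rabs_le. lra.
Qed.

(** Each of k+iz and k-iz has squared modulus k^2 + |z|^2 plus or minus 2k Im z. The number [kappa]
    measures how far z stays from the imaginary axis, where a factor may vanish, and (k-|z|)^2 >= 0
    gives the rest. *)
Lemma sum_squares_lower_bound (z : C) (kappa k : R) :
  0 < kappa <= 1 -> Rabs (Im z) <= (1 - kappa) * Cmod z -> 0 < k ->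
  2 * kappa * (k * Cmod z) <= Cmod (RtoC (k ^ 2) + z * z).
Proof.
  intros Hk Hz Hp. rewrite <- sum_squares_factor, Cmod_mult.
  set (r := Cmod z). assert (Hr : 0 <= r) by apply Cmod_ge_0.
  assert (Hr2 : r ^ 2 = Re z ^ 2 + Im z ^ 2).
  { unfold r, Cmod. rewrite <- Rsqr_pow2, Rsqr_sqrt; [reflexivity|].
    generalize (pow2_ge_0 (fst z)) (pow2_ge_0 (snd z)). lra. }
  assert (Habs : forall c : C, (Cmod c) ^ 2 = Re c ^ 2 + Im c ^ 2).
  { intros c. unfold Cmod. rewrite <- Rsqr_pow2, Rsqr_sqrt; [reflexivity|].
    generalize (pow2_ge_0 (fst c)) (pow2_ge_0 (snd c)). lra. }
  assert (H1 : 2 * kappa * (k * r) <= Cmod (RtoC k + Ci * z) ^ 2).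
  { rewrite Habs. replace (Re (RtoC k + Ci * z)%C) with (k - Im z) by (unfold Re, Im; simpl; ring).
    replace (Im (RtoC k + Ci * z)%C) with (Re z) by (unfold Re, Im; simpl; ring).
    assert (Im z <= (1 - kappa) * r) by (eapply Rle_trans; [apply Rle_abs|exact Hz]).
    assert (k * Im z <= k * ((1 - kappa) * r)) by (apply Rmult_le_compat_l; lra).
    generalize (pow2_ge_0 (k - r)). nra. }
  assert (H2 : 2 * kappa * (k * r) <= Cmod (RtoC k - Ci * z) ^ 2).
  { rewrite Habs. replace (Re (RtoC k - Ci * z)%C) with (k + Im z) by (unfold Re, Im; simpl; ring).
    replace (Im (RtoC k - Ci * z)%C) with (- Re z) by (unfold Re, Im; simpl; ring).
    assert (- Im z <= (1 - kappa) * r).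
    { eapply Rle_trans; [|exact Hz]. rewrite <- Rabs_Ropp. apply Rle_abs. }
    assert (k * - Im z <= k * ((1 - kappa) * r)) by (apply Rmult_le_compat_l; lra).
    generalize (pow2_ge_0 (k - r)). nra. }
  set (A := Cmod (RtoC k + Ci * z)) in *. set (B := Cmod (RtoC k - Ci * z)) in *.
  assert (HA : 0 <= A) by apply Cmod_ge_0. assert (HB : 0 <= B) by apply Cmod_ge_0.
  assert (HX : 0 <= 2 * kappa * (k * r)).
  { apply Rmult_le_pos; [lra|]. apply Rmult_le_pos; lra. }
  apply Rsqr_incr_0_var; [|now apply Rmult_le_pos]. unfold Rsqr.
  replace (A * B * (A * B)) with (A ^ 2 * B ^ 2) by ring. now apply Rmult_le_compat.
Qed.

Lemma Cmod_csum_le (u : nat -> C) (d : nat -> R) n :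
  (forall k, Cmod (u k) <= d k) -> Cmod (csum u n) <= rsum d n.
Proof.
  intros H. induction n as [|n IH]; simpl; [rewrite Cmod_0; lra|].
  eapply Rle_trans; [apply Cmod_triangle|]. specialize (H n). lra.
Qed.

Lemma rsum_le_Series d n : ex_series d -> (forall k, 0 <= d k) -> rsum d n <= Series d.
Proof.
  intros H H0. destruct n as [|n].
  - simpl. rewrite <- (Rmult_0_l (Series d)), <- Series_scal_l.
    apply Series_le; auto. intros k. specialize (H0 k). lra.
  - rewrite rsum_sum_n, (Series_split d n H).
    assert (0 <= Series (fun k => d (S n + k)%nat)); [|lra].
    rewrite <- (Rmult_0_l (Series (fun k => d (S n + k)%nat))), <- Series_scal_l.
    apply Series_le; [intros k; specialize (H0 (S n + k)%nat); lra|now apply ex_series_shift].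
Qed.

Lemma rsum_scal c f n : rsum (fun k => c * f k) n = c * rsum f n.
Proof. induction n as [|n IH]; simpl; [ring|]. rewrite IH. ring. Qed.

(** The digamma pair is compared with the harmonic sum through 1/k - k/(k^2+z^2) = z^2/(k(k^2+z^2)),
    whose denominator is bounded below by [sum_squares_lower_bound]. Linear growth in |z| is far
    from sharp, but |z| will be only of order m^(1/N), so it costs the summation over m little. *)
Lemma summation_defect_odd_bound (kappa : R) : 0 < kappa <= 1 ->
  exists B, 0 <= B /\ forall z, 0 < Re z -> Rabs (Im z) <= (1 - kappa) * Cmod z ->
    Cmod (summation_defect true z) <= B * (1 + Cmod z + / Cmod z).
Proof.
  intros Hk. destruct harmonic_lim as [g Hg].
  assert (Hbd : exists G, forall n, Rabs (ln (INR n) - rsum (fun k => / INR (S k)) n) <= G).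
  { apply is_lim_seq_spec in Hg. destruct (Hg (mkposreal 1 Rlt_0_1)) as [n0 Hn0]. cbn [pos] in Hn0.
    set (u := fun n => Rabs (ln (INR n) - rsum (fun k => / INR (S k)) n)).
    assert (Hm : exists M, forall n, (n < n0)%nat -> u n <= M).
    { clear Hn0. induction n0 as [|n0 [M HM]]; [exists 0; lia|].
      exists (Rmax M (u n0)). intros n Hn. destruct (Nat.eq_dec n n0) as [->|].
      - apply Rmax_r.
      - eapply Rle_trans; [apply HM; lia|apply Rmax_l]. }
    destruct Hm as [M HM]. exists (Rmax M (Rabs g + 1)). intros n.
    destruct (le_lt_dec n0 n) as [Hn|Hn].
    - eapply Rle_trans; [|apply Rmax_r]. specialize (Hn0 n Hn).
      replace (ln (INR n) - rsum (fun k => / INR (S k)) n) with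
        ((ln (INR n) - rsum (fun k => / INR (S k)) n - g) + g) by ring.
      eapply Rle_trans; [apply Rabs_triang|]. lra.
    - eapply Rle_trans; [|apply Rmax_l]. now apply HM. }
  destruct Hbd as [G HG].
  assert (HG0 : 0 <= G) by (eapply Rle_trans; [apply Rabs_pos|apply (HG O)]).
  set (Z2 := Series (fun k => / INR (S k) ^ 2)).
  assert (HZ : forall n, rsum (fun k => / INR (S k) ^ 2) n <= Z2).
  { intros n. apply rsum_le_Series; [now apply ex_series_inv_pow|].
    intros k. left. apply Rinv_0_lt_compat, pow_lt, lt_0_INR. lia. }
  assert (HZ0 : 0 <= Z2) by apply (HZ O).
  assert (Hk0 : 0 < / (2 * kappa)) by (apply Rinv_0_lt_compat; lra).
  exists (1 + PI / 2 + G + / (2 * kappa) * Z2).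
  assert (HPI := PI_RGT_0). assert (Hkz : 0 <= / (2 * kappa) * Z2) by (apply Rmult_le_pos; lra).
  split; [lra|]. intros z Hz Him.
  assert (Hz0 : z <> 0%C) by (apply C_neq_0_Re; lra).
  set (r := Cmod z) in *. assert (Hr : 0 < r) by now apply Cmod_gt_0.
  assert (Hri : 0 < / r) by now apply Rinv_0_lt_compat.
  assert (H1 : Cmod (Clog z) <= r + / r + PI / 2).
  { eapply Rle_trans; [apply Cmod_le_parts|]. unfold Clog; simpl. apply Rplus_le_compat.
    - now apply ln_abs_bound.
    - unfold Carg. destruct (Rlt_dec 0 (Re z)) as [_|]; [|lra].
      generalize (atan_bound (Im z / Re z)). intros. apply Rabs_le. lra. }
  assert (H2 : Cmod (- (/ 2 * (digamma (Ci * z) + digamma (- (Ci * z)))))%C <= G + / (2 * kappa) * Z2 * r).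
  { apply (Clim_bound _ _ _ (digamma_pair_lim z Hz)). intros n.
    replace (csum (fun m => kernel true z (INR (S m))) n - RtoC (ln (INR n)))%C with
      (csum (fun m => kernel true z (INR (S m)) - RtoC (/ INR (S m))) n
       - RtoC (ln (INR n) - rsum (fun k => / INR (S k))%R n))%C.
    2:{ rewrite (csum_ext (fun m => kernel true z (INR (S m)) - RtoC (/ INR (S m)))%C
         (fun m => kernel true z (INR (S m)) + (- (1)) * RtoC (/ INR (S m)))%C) by (intros; cbv beta; ring).
        rewrite csum_plus, csum_scal, csum_RtoC, RtoC_minus. ring. }
    unfold Cminus at 1. eapply Rle_trans; [apply Cmod_triangle|]. rewrite Cmod_opp, Cmod_R, Rplus_comm.
    apply Rplus_le_compat; [apply HG|].
    apply Rle_trans with (rsum (fun k => / (2 * kappa) * r * / INR (S k) ^ 2) n).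
    - apply Cmod_csum_le. intros k.
      assert (Hp : 0 < INR (S k)) by (apply lt_0_INR; lia). set (m := INR (S k)) in *.
      assert (HmC : RtoC m <> 0%C) by (intros E; apply RtoC_inj in E; lra).
      assert (Hs := sum_squares_neq_0 z m Hz).
      replace (kernel true z m - RtoC (/ m))%C with (- (z * z * / (RtoC m * (RtoC (m ^ 2) + z * z))))%C.
      2:{ unfold kernel. rewrite RtoC_inv by lra. rewrite RtoC_pow in *. field. auto. }
      rewrite Cmod_opp, Cmod_mult, Cmod_mult, Cmod_inv by (now apply Cmult_neq_0).
      rewrite Cmod_mult, Cmod_R, (Rabs_pos_eq m) by lra. fold r.
      assert (Hl := sum_squares_lower_bound z kappa m Hk Him Hp). fold r in Hl.
      assert (Hq : 0 < 2 * kappa * (m * r)).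
      { apply Rmult_lt_0_compat; [lra|now apply Rmult_lt_0_compat]. }
      replace (/ (2 * kappa) * r * / m ^ 2) with (r * r * / (m * (2 * kappa * (m * r)))).
      2:{ field. repeat split; lra. }
      apply Rmult_le_compat_l; [nra|]. apply Rinv_le_contravar.
      + now apply Rmult_lt_0_compat.
      + apply Rmult_le_compat_l; lra.
    - rewrite rsum_scal. replace (/ (2 * kappa) * Z2 * r) with (/ (2 * kappa) * r * Z2) by ring.
      apply Rmult_le_compat_l; [|apply HZ]. apply Rmult_le_pos; lra. }
  unfold summation_defect.
  replace (Clog z - / 2 * (digamma (Ci * z) + digamma (- (Ci * z))))%C with
    (Clog z + - (/ 2 * (digamma (Ci * z) + digamma (- (Ci * z)))))%C by ring.
  eapply Rle_trans; [apply Cmod_triangle|].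
  set (D := / (2 * kappa) * Z2) in *. nra.
Qed.

(** * Partial fractions over the roots A_(N,j)/pi *)

Definition root_angle (N k : nat) : R := PI * (INR k - (INR N - 1) / 2) / INR N.

(* With r = y^(1/N) these are the numbers A_(N,j)(y/(2 pi))/pi of the paper, j = k - (N-1)/2. *)
Definition root (N : nat) (r : R) (k : nat) : C := (RtoC r * Cexp (0, root_angle N k))%C.

Lemma Cexp_imag_pow t n : (Cexp (0, t) ^ n)%C = Cexp (0, INR n * t).
Proof.
  induction n as [|n IH].
  - simpl. rewrite Rmult_0_l. symmetry; apply Cexp_0.
  - rewrite Cpow_S, IH, <- Cexp_plus. f_equal. rewrite S_INR.
    apply injective_projections; simpl; ring.
Qed.

Lemma root_angle_bound N k : (k < N)%nat ->
  Rabs (root_angle N k) <= PI * (INR N - 1) / (2 * INR N).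
Proof.
  intros H. assert (HPI := PI_RGT_0).
  assert (Hk : INR k + 1 <= INR N) by (rewrite <- S_INR; apply le_INR; lia).
  assert (Hk0 := pos_INR k). assert (HN : 0 < INR N) by lra.
  unfold root_angle. apply Rabs_le.
  replace (PI * (INR N - 1) / (2 * INR N)) with (PI / INR N * ((INR N - 1) / 2)) by (field; lra).
  replace (PI * (INR k - (INR N - 1) / 2) / INR N) with (PI / INR N * (INR k - (INR N - 1) / 2)) by (field; lra).
  assert (0 < PI / INR N) by (now apply Rdiv_lt_0_compat). split; nra.
Qed.

(** The largest modulus of an angle [root_angle N k]. As it stays below pi/2, its cosine bounds the
    real parts of all roots from below, and 1 minus its sine serves as [kappa] in the digamma
    estimate. *)
Definition angle_margin (N : nat) : R := PI * (INR N - 1) / (2 * INR N).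

Lemma angle_margin_range N : (0 < N)%nat -> 0 <= angle_margin N < PI / 2.
Proof.
  intros H. assert (HPI := PI_RGT_0). unfold angle_margin.
  assert (H1 : 1 <= INR N) by (apply (le_INR 1); lia). split.
  - apply Rmult_le_pos; [nra|]. left. apply Rinv_0_lt_compat. lra.
  - apply Rlt_div_l; [lra|]. nra.
Qed.

Lemma cos_root_angle N k : (k < N)%nat ->
  0 < cos (angle_margin N) <= cos (root_angle N k).
Proof.
  intros H. assert (Hr := angle_margin_range N ltac:(lia)). assert (Hb := root_angle_bound N k H).
  fold (angle_margin N) in Hb. assert (HPI := PI_RGT_0).
  split; [apply cos_gt_0; lra|].
  replace (cos (root_angle N k)) with (cos (Rabs (root_angle N k))).
  - apply cos_decr_1; try lra; apply Rabs_pos.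
  - unfold Rabs. destruct (Rcase_abs _); [apply cos_neg|reflexivity].
Qed.

Lemma sin_root_angle N k : (k < N)%nat ->
  Rabs (sin (root_angle N k)) <= sin (angle_margin N).
Proof.
  intros H. assert (Hr := angle_margin_range N ltac:(lia)). assert (Hb := root_angle_bound N k H).
  fold (angle_margin N) in Hb. assert (HPI := PI_RGT_0). apply Rabs_le_between in Hb.
  apply Rabs_le. rewrite <- sin_neg. split; apply sin_incr_1; lra.
Qed.

Lemma Re_root N r k : Re (root N r k) = r * cos (root_angle N k).
Proof. unfold root, Cexp, Re, Im; simpl. rewrite exp_0. ring. Qed.

Lemma Im_root N r k : Im (root N r k) = r * sin (root_angle N k).
Proof. unfold root, Cexp, Re, Im; simpl. rewrite exp_0. ring. Qed.

Lemma Cmod_root N r k : 0 < r -> Cmod (root N r k) = r.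
Proof.
  intros H. unfold root. rewrite Cmod_mult, Cmod_Cexp, Cmod_R, Rabs_pos_eq by lra.
  simpl. rewrite exp_0. ring.
Qed.

Lemma Re_root_pos N r k : (k < N)%nat -> 0 < r -> 0 < Re (root N r k).
Proof.
  intros H Hr. rewrite Re_root. generalize (cos_root_angle N k H). intros. nra.
Qed.

Lemma csum_zero (f : nat -> C) n : (forall k, (k < n)%nat -> f k = 0%C) -> csum f n = 0%C.
Proof.
  induction n as [|n IH]; intros H; simpl; [reflexivity|]. rewrite IH, H by auto. ring.
Qed.

Lemma csum_single (f : nat -> C) n i : (i < n)%nat -> (forall k, (k < n)%nat -> k <> i -> f k = 0%C) ->
  csum f n = f i.
Proof.
  induction n as [|n IH]; intros Hi H; [lia|]. simpl.
  destruct (Nat.eq_dec i n) as [->|Hne].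
  - rewrite csum_zero; [ring|]. intros k Hk. apply H; lia.
  - rewrite IH by (auto; lia). rewrite (H n) by lia. ring.
Qed.

Lemma csum_geometric (z : C) n : ((z - 1) * csum (fun k => z ^ k) n = z ^ n - 1)%C.
Proof.
  induction n as [|n IH]; simpl csum; [simpl; ring|].
  rewrite Cmult_plus_distr_l, IH, Cpow_S. ring.
Qed.

Lemma Cpow_sub_factor (X Y : C) n :
  (X ^ n - Y ^ n = (X - Y) * csum (fun i => X ^ (n - 1 - i) * Y ^ i) n)%C.
Proof.
  induction n as [|n IH]; [simpl; ring|].
  cbn [csum]. replace (S n - 1 - n)%nat with O by lia.
  rewrite (csum_ext _ (fun i => X * (X ^ (n - 1 - i) * Y ^ i))%C).
  - rewrite csum_scal. rewrite !Cpow_S.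
    transitivity (X * (X ^ n - Y ^ n) + (X - Y) * Y ^ n)%C; [ring|]. rewrite IH. simpl. ring.
  - intros k Hk. replace (S n - 1 - k)%nat with (S (n - 1 - k)) by lia. rewrite Cpow_S. ring.
Qed.

Lemma root_pow N r k n :
  (root N r k ^ n = RtoC (r ^ n) * Cexp (0, (INR n * root_angle N k)%R))%C.
Proof. unfold root. now rewrite Cpow_mult_l, Cexp_imag_pow, RtoC_pow. Qed.

Lemma root_pow_2N N r k : (0 < N)%nat ->
  (root N r k ^ (2 * N) = RtoC ((-1) ^ (N - 1) * r ^ (2 * N)))%C.
Proof.
  intros H. rewrite root_pow, (Rmult_comm ((-1) ^ _)), RtoC_mult. f_equal.
  assert (HN : 0 < INR N) by (apply lt_0_INR; lia).
  replace (INR (2 * N) * root_angle N k) with (2 * INR k * PI - INR (N - 1) * PI).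
  2:{ unfold root_angle. rewrite mult_INR, minus_INR by lia. simpl (INR 2). simpl (INR 1). field. lra. }
  generalize (N - 1)%nat. intros n. unfold Cexp; simpl. rewrite exp_0.
  assert (Hc : cos (2 * INR k * PI - INR n * PI) = (-1) ^ n /\ sin (2 * INR k * PI - INR n * PI) = 0).
  { induction n as [|n [IHc IHs]].
    - simpl. replace (2 * INR k * PI - 0 * PI) with (0 + 2 * INR k * PI) by ring.
      rewrite cos_period, sin_period, cos_0, sin_0. auto.
    - rewrite S_INR. replace (2 * INR k * PI - (INR n + 1) * PI) with (2 * INR k * PI - INR n * PI - PI) by ring.
      set (A := 2 * INR k * PI - INR n * PI) in *. clearbody A.
      rewrite cos_minus, sin_minus, cos_PI, sin_PI, IHc, IHs. simpl. split; ring. }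
  destruct Hc as [-> ->]. apply injective_projections; simpl; ring.
Qed.

(** The summands form a geometric progression whose ratio w = exp(2 pi i l/N) is an N-th root of
    unity, and w = 1 only if N divides l. *)
Lemma root_power_sum N r l : (0 < l < 2 * N)%nat -> l <> N ->
  csum (fun k => root N r k ^ (2 * l))%C N = 0%C.
Proof.
  intros Hl Hne. assert (HN : 0 < INR N) by (apply lt_0_INR; lia). assert (HPI := PI_RGT_0).
  set (w := Cexp (0, 2 * PI * INR l / INR N)).
  rewrite (csum_ext _ (fun k => (RtoC (r ^ (2 * l)) * Cexp (0, (- INR l * PI * (INR N - 1) / INR N)%R)) * w ^ k)%C).
  - rewrite csum_scal.
    assert (Hw1 : (w ^ N = 1)%C).
    { unfold w. rewrite Cexp_imag_pow.
      replace (INR N * (2 * PI * INR l / INR N)) with (0 + 2 * INR l * PI) by (field; lra).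
      unfold Cexp; simpl. rewrite cos_period, sin_period, cos_0, sin_0, exp_0.
      apply injective_projections; simpl; ring. }
    assert (Hw : (w - 1)%C <> 0%C).
    { apply C_neq_0_Re. unfold w, Cexp; simpl. rewrite exp_0.
      set (x := PI * INR l / INR N).
      replace (2 * PI * INR l / INR N) with (2 * x) by (unfold x; field; lra).
      rewrite cos_2a_sin.
      assert (Hs : sin x <> 0).
      { assert (Hl1 : 0 < INR l < 2 * INR N).
        { split; [apply lt_0_INR; lia|]. replace (2 * INR N) with (INR (2 * N)) by (rewrite mult_INR; simpl; ring).
          apply lt_INR; lia. }
        destruct (Nat.lt_total l N) as [Hlt|[Heq|Hgt]]; [|lia|].
        - apply Rgt_not_eq. apply lt_INR in Hlt. apply sin_gt_0.
          + apply Rdiv_lt_0_compat; [nra|lra].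
          + unfold x. apply Rlt_div_l; [lra|]. now apply Rmult_lt_compat_l.
        - apply Rlt_not_eq. apply lt_INR in Hgt. apply sin_lt_0.
          + unfold x. apply (Rlt_div_r PI (PI * INR l) (INR N)); [lra|]. now apply Rmult_lt_compat_l.
          + unfold x. apply Rlt_div_l; [lra|]. replace (2 * PI * INR N) with (PI * (2 * INR N)) by ring.
            now apply Rmult_lt_compat_l. }
      assert (0 < sin x * sin x) by (generalize (Rsqr_pos_lt _ Hs); unfold Rsqr; lra). lra. }
    assert (Hg := csum_geometric w N). rewrite Hw1 in Hg.
    assert (HS : csum (fun k => w ^ k)%C N = 0%C).
    { transitivity (/ (w - 1) * ((w - 1) * csum (fun k => w ^ k) N))%C; [field; auto|].
      rewrite Hg. ring. }
    change (csum (Cpow w) N) with (csum (fun k => w ^ k)%C N).     rewrite HS. ring.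
  - intros k Hk. rewrite root_pow. unfold w. rewrite Cexp_imag_pow, <- Cmult_assoc, <- Cexp_plus.
    replace (INR (2 * l) * root_angle N k) with
      (- INR l * PI * (INR N - 1) / INR N + INR k * (2 * PI * INR l / INR N)).
    + f_equal. f_equal. apply injective_projections; simpl; ring.
    + unfold root_angle. rewrite mult_INR. simpl (INR 2). field. lra.
Qed.

(** The residue of w^q/(w^N + r^(2N)) at w = -z^2 for z = [root N r k], simplified with (-z^2)^N =
    -r^(2N). *)
Definition root_coef (N q : nat) (r : R) (k : nat) : C :=
  (RtoC ((-1) ^ q / (INR N * r ^ (2 * N))) * root N r k ^ (2 * q + 2))%C.

Lemma Cpow_opp_sqr (z : C) n : ((- (z * z)) ^ n = RtoC ((-1) ^ n) * z ^ (2 * n))%C.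
Proof.
  replace (- (z * z))%C with ((-1) * z ^ 2)%C by (simpl; ring).
  rewrite Cpow_mult_l, <- Cpow_mult_r, RtoC_pow. reflexivity.
Qed.

(** The factorisation of (u^2)^N - (-z^2)^N writes every 1/(u^2+z^2) as a polynomial in u^2 over the
    common denominator. After summation over the roots, [root_power_sum] leaves a single power of
    u. *)
Lemma partial_fractions N q r u : (q < N)%nat -> 0 < r ->
  csum (fun k => root_coef N q r k * / (RtoC (u ^ 2) + root N r k * root N r k))%C N =
  RtoC (u ^ (2 * q) / (u ^ (2 * N) + r ^ (2 * N))).
Proof.
  intros Hq Hr.
  assert (HN : 0 < INR N) by (apply lt_0_INR; lia).
  assert (HrN : 0 < r ^ (2 * N)) by now apply pow_lt.
  assert (Hu : 0 <= u ^ (2 * N)) by (rewrite pow_mult; apply pow_le, pow2_ge_0).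
  set (D := RtoC (u ^ (2 * N) + r ^ (2 * N))).
  assert (HD : D <> 0%C) by (intros E; apply RtoC_inj in E; lra).
  rewrite RtoC_div by lra. fold D.
  assert (Hs : forall k, (k < N)%nat -> (RtoC (u ^ 2) + root N r k * root N r k)%C <> 0%C).
  { intros k Hk. apply sum_squares_neq_0. now apply Re_root_pos. }
  assert (Hfac : forall k, (k < N)%nat -> (/ (RtoC (u ^ 2) + root N r k * root N r k) =
     / D * csum (fun i => RtoC (u ^ 2) ^ (N - 1 - i) * (- (root N r k * root N r k)) ^ i) N)%C).
  { intros k Hk. specialize (Hs k Hk).
    assert (HF := Cpow_sub_factor (RtoC (u ^ 2)) (- (root N r k * root N r k))%C N).
    assert (HDe : (RtoC (u ^ 2) ^ N - (- (root N r k * root N r k)) ^ N = D)%C).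
    { rewrite Cpow_opp_sqr, root_pow_2N, <- RtoC_pow, <- RtoC_mult, <- RtoC_minus by lia.
      unfold D. f_equal. rewrite <- pow_mult.
      replace ((-1) ^ N * ((-1) ^ (N - 1) * r ^ (2 * N))) with (((-1) ^ N * (-1) ^ (N - 1)) * r ^ (2 * N)) by ring.
      rewrite <- pow_add. replace (N + (N - 1))%nat with (S (2 * (N - 1)))%nat by lia.
      rewrite pow_1_odd. ring. }
    rewrite HDe in HF.
    set (G := csum _ N) in *.
    replace (RtoC (u ^ 2) - - (root N r k * root N r k))%C with (RtoC (u ^ 2) + root N r k * root N r k)%C in HF by ring.
    set (s := (RtoC (u ^ 2) + root N r k * root N r k)%C) in *.
    transitivity (/ D * (/ s * D))%C; [field; auto|]. rewrite HF at 2. field. auto. }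
  rewrite (csum_ext _ (fun k => / D * (csum (fun i => root_coef N q r k *
       (RtoC (u ^ 2) ^ (N - 1 - i) * (- (root N r k * root N r k)) ^ i)) N))%C).
  2:{ intros k Hk. rewrite Hfac by auto. rewrite csum_scal. ring. }
  rewrite csum_scal, csum_csum_swap.
  (* The root occurs with the exponent 2(q+1+i), which equals 2N, where the power no longer depends
     on k, only for i = N-1-q. *)
  match goal with |- (_ * csum ?f N)%C = _ => rewrite (csum_single f N (N - 1 - q)%nat); [|lia|] end; cbv beta.
  - rewrite (csum_ext _ (fun k => RtoC (u ^ 2) ^ q * RtoC (/ INR N))%C).
    + assert (Hconst : forall c n, csum (fun _ => c) n = (RtoC (INR n) * c)%C).
      { intros c n. induction n as [|n IH]; [simpl; ring|]. simpl csum. rewrite IH, S_INR, RtoC_plus. ring. }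
      rewrite Hconst, <- RtoC_pow, <- pow_mult, RtoC_inv by lra.
      assert (HNC : RtoC (INR N) <> 0%C) by (intros E; apply RtoC_inj in E; lra).
      unfold Cdiv. field. auto.
    + intros k Hk. replace (N - 1 - (N - 1 - q))%nat with q by lia.
      rewrite Cpow_opp_sqr. unfold root_coef.
      transitivity (RtoC (u ^ 2) ^ q * (RtoC ((-1) ^ q / (INR N * r ^ (2 * N))) * RtoC ((-1) ^ (N - 1 - q)) *
         (root N r k ^ (2 * q + 2) * root N r k ^ (2 * (N - 1 - q)))))%C; [ring|].
      f_equal. rewrite <- Cpow_add_r. replace (2 * q + 2 + 2 * (N - 1 - q))%nat with (2 * N)%nat by lia.
      rewrite root_pow_2N by lia. rewrite <- !RtoC_mult. f_equal.
      replace ((-1) ^ q / (INR N * r ^ (2 * N)) * (-1) ^ (N - 1 - q) * ((-1) ^ (N - 1) * r ^ (2 * N))) with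
        (((-1) ^ q * (-1) ^ (N - 1 - q) * (-1) ^ (N - 1)) * / INR N) by (field; lra).
      rewrite <- !pow_add. replace (q + (N - 1 - q) + (N - 1))%nat with (2 * (N - 1))%nat by lia.
      rewrite pow_1_even. ring.
  - intros i Hi Hne.
    rewrite (csum_ext _ (fun k => (RtoC (u ^ 2) ^ (N - 1 - i) * RtoC ((-1) ^ q / (INR N * r ^ (2 * N))) * RtoC ((-1) ^ i))
        * root N r k ^ (2 * (q + 1 + i)))%C).
    + rewrite csum_scal, root_power_sum by lia. ring.
    + intros k Hk. rewrite Cpow_opp_sqr. unfold root_coef.
      replace (2 * (q + 1 + i))%nat with (2 * q + 2 + 2 * i)%nat by lia. rewrite (Cpow_add_r (root N r k) (2 * q + 2) (2 * i)).
      generalize (root N r k ^ (2 * q + 2))%C (root N r k ^ (2 * i))%C (RtoC (u ^ 2) ^ (N - 1 - i))%C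
        (RtoC ((-1) ^ i)) (RtoC ((-1) ^ q / (INR N * r ^ (2 * N)))). intros; ring.
Qed.

Definition rational_term (N p : nat) (r u : R) : R := u ^ p / (u ^ (2 * N) + r ^ (2 * N)).

Definition defect_sum (N p : nat) (r : R) : C :=
  csum (fun k => root_coef N (p / 2) r k * summation_defect (Nat.odd p) (root N r k))%C N.

Definition primitive_sum (N p : nat) (r u : R) : C :=
  csum (fun k => root_coef N (p / 2) r k * kernel_primitive (Nat.odd p) (root N r k) u)%C N.

Lemma half_decomposition p : p = (2 * (p / 2) + (if Nat.odd p then 1 else 0))%nat.
Proof.
  assert (H := Nat.div2_odd p). rewrite Nat.div2_div in H. unfold Nat.b2n in H. exact H.
Qed.

Lemma kernel_combination N p r u : (p < 2 * N)%nat -> 0 < r ->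
  csum (fun k => root_coef N (p / 2) r k * kernel (Nat.odd p) (root N r k) u)%C N =
  RtoC (rational_term N p r u).
Proof.
  intros Hp Hr.
  assert (Hq : (p / 2 < N)%nat) by (apply Nat.Div0.div_lt_upper_bound; lia).
  rewrite (csum_ext _ (fun k => (if Nat.odd p then RtoC u else 1) * (root_coef N (p / 2) r k *
      / (RtoC (u ^ 2) + root N r k * root N r k)))%C).
  - rewrite csum_scal, partial_fractions by auto. unfold rational_term.
    replace (u ^ p) with ((if Nat.odd p then u else 1) * u ^ (2 * (p / 2))).
    + unfold Rdiv. rewrite !RtoC_mult. destruct (Nat.odd p); ring.
    + rewrite (half_decomposition p) at 3. rewrite pow_add. destruct (Nat.odd p); simpl pow; ring.
  - intros k Hk. unfold kernel, Cdiv. ring.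
Qed.

Lemma Cder_primitive_sum N p r u : (p < 2 * N)%nat -> 0 < r ->
  Cder (primitive_sum N p r) u (RtoC (rational_term N p r u)).
Proof.
  intros Hp Hr. rewrite <- kernel_combination by auto.
  apply (Cder_csum (fun k u => root_coef N (p / 2) r k * kernel_primitive (Nat.odd p) (root N r k) u)%C
     (fun k u => root_coef N (p / 2) r k * kernel (Nat.odd p) (root N r k) u)%C).
  intros k Hk. eapply Cder_eq.
  - apply Cder_mult; [apply Cder_const|apply Cder_kernel_primitive]. now apply Re_root_pos.
  - cbv beta. ring.
Qed.

Lemma rational_sum_lim N p r : (p < 2 * N)%nat -> 0 < r ->
  Clim (fun M => RtoC (rsum (fun n => rational_term N p r (INR (S n))) M)
       - (primitive_sum N p r (INR M) - primitive_sum N p r 0))%C (defect_sum N p r).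
Proof.
  intros Hp Hr. unfold defect_sum, primitive_sum.
  assert (H := Clim_csum (fun M k => root_coef N (p / 2) r k *
     (csum (fun n => kernel (Nat.odd p) (root N r k) (INR (S n))) M
          - (kernel_primitive (Nat.odd p) (root N r k) (INR M) - kernel_primitive (Nat.odd p) (root N r k) 0)))%C
     (fun k => root_coef N (p / 2) r k * summation_defect (Nat.odd p) (root N r k))%C N).
  refine (Clim_ext _ _ _ _ (H _)).
  - intros M. rewrite <- csum_RtoC.
    rewrite (csum_ext _ _ M (fun n _ => eq_sym (kernel_combination N p r (INR (S n)) Hp Hr))).
    rewrite csum_csum_swap.
    rewrite (csum_ext _ (fun k => (csum (fun n => root_coef N (p / 2) r k * kernel (Nat.odd p) (root N r k) (INR (S n))) M
       + ((-1) * (root_coef N (p / 2) r k * kernel_primitive (Nat.odd p) (root N r k) (INR M))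
       + root_coef N (p / 2) r k * kernel_primitive (Nat.odd p) (root N r k) 0)))%C).
    + rewrite !csum_plus, csum_scal. ring.
    + intros k _. rewrite csum_scal. ring.
  - intros k Hk. apply Clim_scal, kernel_defect. now apply Re_root_pos.
Qed.

Lemma rational_term_nonneg N p r u : 0 <= u -> 0 < r -> 0 <= rational_term N p r u.
Proof.
  intros Hu Hr. unfold rational_term. apply Rmult_le_pos; [now apply pow_le|].
  left. apply Rinv_0_lt_compat. assert (0 <= u ^ (2 * N)) by now apply pow_le.
  assert (0 < r ^ (2 * N)) by now apply pow_lt. lra.
Qed.

Lemma ex_series_rational N p r : (p + 2 <= 2 * N)%nat -> 0 < r ->
  ex_series (fun n => rational_term N p r (INR (S n))).
Proof.
  intros Hp Hr. apply ex_series_dominated with (fun n => / INR (S n) ^ 2).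
  - now apply ex_series_inv_pow.
  - intros n. assert (Hn : 1 <= INR (S n)) by (apply (le_INR 1); lia).
    rewrite Rabs_pos_eq by (apply rational_term_nonneg; lra).
    unfold rational_term. set (u := INR (S n)) in *.
    assert (HrN : 0 < r ^ (2 * N)) by now apply pow_lt.
    assert (Hup : 0 < u ^ p) by (apply pow_lt; lra).
    assert (Hu2 : 0 < u ^ 2) by (apply pow_lt; lra).
    replace (/ u ^ 2) with (u ^ p / (u ^ (p + 2))).
    + apply Rmult_le_compat_l; [lra|]. apply Rinv_le_contravar; [apply pow_lt; lra|].
      assert (u ^ (p + 2) <= u ^ (2 * N)) by (apply Rle_pow; auto). lra.
    + rewrite pow_add. field. lra.
Qed.

(** The derivative of [primitive_sum] is real, so its imaginary part is constant and drops out of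
    the difference. This is why complex sums over the roots can be handled as real numbers. *)
Lemma rational_sum_eval N p r : (p + 2 <= 2 * N)%nat -> 0 < r ->
  Im (defect_sum N p r) = 0 /\
  is_lim_seq (fun M => Re (primitive_sum N p r (INR M)) - Re (primitive_sum N p r 0))
    (Series (fun n => rational_term N p r (INR (S n))) - Re (defect_sum N p r)).
Proof.
  intros Hp Hr. assert (H := rational_sum_lim N p r ltac:(lia) Hr). split.
  - assert (HI := Clim_Im _ _ H). simpl in HI.
    assert (H0 : is_lim_seq (fun n : nat => 0 + - (snd (primitive_sum N p r (INR n)) + - snd (primitive_sum N p r 0))) 0).
    { apply is_lim_seq_ext with (fun _ => 0); [|apply is_lim_seq_const].
      intros n. assert (Hb := mean_value_bound (fun u => Im (primitive_sum N p r u)) (fun _ => 0) 0 (INR n) 0).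
      assert (Hz : Rabs (Im (primitive_sum N p r (INR n)) - Im (primitive_sum N p r 0)) <= 0 * Rabs (INR n - 0)).
      { apply Hb; intros x _; [|rewrite Rabs_R0; lra].
        apply (Cder_primitive_sum N p r x ltac:(lia) Hr). }
      rewrite Rmult_0_l in Hz. unfold Im in Hz. apply Rabs_le_between in Hz. lra. }
    apply is_lim_seq_unique in HI. apply is_lim_seq_unique in H0. rewrite HI in H0.
    now injection H0.
  - assert (HR := Clim_Re _ _ H).
    assert (HS : is_lim_seq (fun M => rsum (fun n => rational_term N p r (INR (S n))) M)
      (Series (fun n => rational_term N p r (INR (S n))))).
    { apply is_lim_seq_incr_1. eapply is_lim_seq_ext; [intros n; symmetry; apply rsum_sum_n|].
      apply Series_correct. now apply ex_series_rational. }
    eapply is_lim_seq_ext; [|exact (is_lim_seq_minus' _ _ _ _ HS HR)].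
    intros n. simpl. unfold Re. ring.
Qed.

(** * Integrals over the real line *)

(** The two endpoints tend to infinity independently, so this gives improper integrals rather than
    principal values. *)
Definition line_filter : (R * R -> Prop) -> Prop :=
  filter_prod (Rbar_locally m_infty) (Rbar_locally p_infty).

#[global] Instance line_filter_proper : ProperFilter line_filter.
Proof. apply filter_prod_proper. Qed.

(* Mellin transforms become integrals over the line under t = e^v. *)
Definition int_line (f : R -> R) (I : R) : Prop :=
  filterlim (fun ab => RInt f (fst ab) (snd ab)) line_filter (locally I).

Lemma line_filter_large (A B : R) : line_filter (fun ab => fst ab <= A /\ B <= snd ab).
Proof.
  exists (fun a => a <= A) (fun b => B <= b).
  - exists A. intros; lra.
  - exists B. intros; lra.
  - simpl; auto.
Qed.

Lemma line_filter_le : line_filter (fun ab => fst ab <= snd ab).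
Proof.
  generalize (line_filter_large 0 0). apply filter_imp. intros ab H. lra.
Qed.

Lemma ex_RInt_continuous_all (f : R -> R) (a b : R) :
  (forall v, continuous f v) -> ex_RInt f a b.
Proof. intros H. apply (ex_RInt_continuous (V := R_CompleteNormedModule)). auto. Qed.

Lemma int_line_unique f I J : int_line f I -> int_line f J -> I = J.
Proof. intros H1 H2. eapply (filterlim_locally_unique (F := line_filter)); eassumption. Qed.

Lemma int_line_ext f g I : (forall v, f v = g v) -> int_line f I -> int_line g I.
Proof.
  intros H. apply filterlim_ext. intros ab. apply RInt_ext. auto.
Qed.

Lemma int_line_plus f g I J :
  (forall v, continuous f v) -> (forall v, continuous g v) ->
  int_line f I -> int_line g J -> int_line (fun v => f v + g v) (I + J).
Proof.
  intros Hf Hg HI HJ. unfold int_line.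
  apply filterlim_ext with (fun ab => RInt f (fst ab) (snd ab) + RInt g (fst ab) (snd ab)).
  - intros ab. symmetry. apply (RInt_plus (V := R_CompleteNormedModule)); apply ex_RInt_continuous_all; auto.
  - apply filterlim_Rplus; auto. apply line_filter_proper.
Qed.

Lemma int_line_scal c f I :
  (forall v, continuous f v) -> int_line f I -> int_line (fun v => c * f v) (c * I).
Proof.
  intros Hf HI. unfold int_line.
  apply filterlim_ext with (fun ab => c * RInt f (fst ab) (snd ab)).
  - intros ab. symmetry. apply (RInt_scal (V := R_CompleteNormedModule)). apply ex_RInt_continuous_all; auto.
  - apply filterlim_Rscal; auto. apply line_filter_proper.
Qed.

Lemma continuous_Rplus (f g : R -> R) v : continuous f v -> continuous g v -> continuous (fun v => f v + g v) v.
Proof. apply (continuous_plus (V := R_NormedModule)). Qed.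

Lemma continuous_Rscal c (f : R -> R) v : continuous f v -> continuous (fun v => c * f v) v.
Proof. apply (continuous_scal_r (K := R_AbsRing) (V := R_NormedModule) c f). Qed.

Lemma continuous_Rmult (f g : R -> R) v : continuous f v -> continuous g v -> continuous (fun v => f v * g v) v.
Proof. apply (continuous_mult (K := R_AbsRing)). Qed.

Lemma continuous_Rminus (f g : R -> R) v : continuous f v -> continuous g v -> continuous (fun v => f v - g v) v.
Proof. apply (continuous_minus (V := R_NormedModule)). Qed.

Lemma continuous_ex_derive (f : R -> R) v : ex_derive f v -> continuous f v.
Proof. apply (ex_derive_continuous f v). Qed.

Lemma int_line_minus f g I J :
  (forall v, continuous f v) -> (forall v, continuous g v) ->
  int_line f I -> int_line g J -> int_line (fun v => f v - g v) (I - J).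
Proof.
  intros Hf Hg HI HJ. apply int_line_ext with (fun v => f v + (-1) * g v); [intros; ring|].
  replace (I - J) with (I + (-1) * J) by ring.
  apply int_line_plus; auto; [intros; apply continuous_Rscal; auto|].
  apply int_line_scal; auto.
Qed.

Lemma int_line_rsum (f : nat -> R -> R) (I : nat -> R) n :
  (forall k v, continuous (f k) v) -> (forall k, (k < n)%nat -> int_line (f k) (I k)) ->
  int_line (fun v => rsum (fun k => f k v) n) (rsum I n) /\
  (forall v, continuous (fun v => rsum (fun k => f k v) n) v).
Proof.
  intros Hc. induction n as [|n IH]; intros H; simpl.
  - split; [|intros; apply continuous_const].
    apply filterlim_ext with (fun _ => 0); [|apply filterlim_const].
    intros ab. rewrite RInt_const. unfold scal; simpl. unfold mult; simpl. ring.
  - destruct IH as [H1 H2]; [auto|]. split.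
    + apply int_line_plus; auto.
    + intros v. apply continuous_Rplus; auto.
Qed.

Lemma int_line_shift f c I : (forall v, continuous f v) ->
  int_line f I -> int_line (fun v => f (v + c)) I.
Proof.
  intros Hc H. unfold int_line.
  apply filterlim_ext with (fun ab => RInt f (fst ab + c) (snd ab + c)).
  - intros ab.
    assert (Hl := RInt_comp_lin (V := R_CompleteNormedModule) f 1 c (fst ab) (snd ab)
       (ex_RInt_continuous_all f _ _ Hc)).
    rewrite !Rmult_1_l in Hl. rewrite <- Hl.
    apply RInt_ext. intros x _. unfold scal; simpl; unfold mult; simpl. now rewrite !Rmult_1_l.
  - apply (filterlim_comp _ _ _ (fun ab => (fst ab + c, snd ab + c)) (fun ab => RInt f (fst ab) (snd ab)) _ line_filter);
      [|exact H].
    intros P [Q1 Q2 [A HA] [B HB] HP].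
    exists (fun a => a < A - c) (fun b => B - c < b).
    + exists (A - c). auto.
    + exists (B - c). auto.
    + intros a b Ha Hb. apply HP; [apply HA|apply HB]; simpl; lra.
Qed.

Lemma RInt_le_window (f : R -> R) a b a' b' :
  (forall v, continuous f v) -> (forall v, 0 <= f v) -> a' <= a -> a <= b -> b <= b' ->
  RInt f a b <= RInt f a' b'.
Proof.
  intros Hc H0 H1 H2 H3.
  assert (Hex : forall x y, ex_RInt f x y) by (intros; now apply ex_RInt_continuous_all).
  rewrite <- (RInt_Chasles f a' a b') by auto. rewrite <- (RInt_Chasles f a b b') by auto.
  assert (0 <= RInt f a' a) by (apply RInt_ge_0; auto).
  assert (0 <= RInt f b b') by (apply RInt_ge_0; auto).
  unfold plus; simpl. lra.
Qed.

Lemma int_line_upper (f : R -> R) I a b :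
  (forall v, continuous f v) -> (forall v, 0 <= f v) -> int_line f I -> a <= b -> RInt f a b <= I.
Proof.
  intros Hc H0 H Hab. apply Rnot_lt_le. intros Hlt.
  assert (He := proj2 (filterlim_R_eps line_filter _ _) H (RInt f a b - I) ltac:(lra)).
  destruct (filter_ex _ (filter_and _ _ He (line_filter_large a b))) as [[a' b'] [H1 [H2 H3]]].
  simpl in *. assert (Hw := RInt_le_window f a b a' b' Hc H0 H2 Hab H3).
  apply Rabs_def2 in H1. lra.
Qed.

Lemma int_line_nonneg (f : R -> R) I :
  (forall v, continuous f v) -> (forall v, 0 <= f v) -> int_line f I -> 0 <= I.
Proof.
  intros Hc H0 H. assert (Hu := int_line_upper f I 0 0 Hc H0 H (Rle_refl 0)).
  rewrite RInt_point in Hu. exact Hu.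
Qed.

Lemma int_line_pos (f : R -> R) I :
  (forall v, continuous f v) -> (forall v, 0 < f v) -> int_line f I -> 0 < I.
Proof.
  intros Hc H0 H.
  assert (Hu := int_line_upper f I 0 1 Hc (fun v => Rlt_le _ _ (H0 v)) H Rle_0_1).
  assert (0 < RInt f 0 1) by (apply RInt_gt_0; auto; lra). lra.
Qed.

Lemma int_line_le (f g : R -> R) I J :
  (forall v, continuous f v) -> (forall v, continuous g v) -> (forall v, f v <= g v) ->
  int_line f I -> int_line g J -> I <= J.
Proof.
  intros Hf Hg Hle HI HJ.
  assert (H := int_line_minus g f J I Hg Hf HJ HI).
  apply int_line_nonneg in H; [lra| |].
  - intros v. now apply continuous_Rminus.
  - intros v. specialize (Hle v). lra.
Qed.

(** For a nonnegative integrand the integral over the line is the supremum over bounded windows. *)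
Lemma int_line_exists_nonneg (f : R -> R) B :
  (forall v, continuous f v) -> (forall v, 0 <= f v) ->
  (forall a b, a <= b -> RInt f a b <= B) -> exists I, int_line f I /\ I <= B.
Proof.
  intros Hc H0 HB.
  destruct (completeness (fun y => exists a b, a <= b /\ y = RInt f a b)) as [I [HI1 HI2]].
  - exists B. intros y [a [b [Hab ->]]]. auto.
  - exists (RInt f 0 0), 0, 0. split; [lra|reflexivity].
  - exists I. split.
    + apply filterlim_R_eps; [apply line_filter_proper|]. intros eps Heps.
      destruct (classic (exists a b, a <= b /\ I - eps < RInt f a b)) as [[a [b [Hab Hl]]]|Hn].
      * generalize (line_filter_large a b). apply filter_imp. intros [a' b'] [H1 H2]; simpl in *.
        assert (Hw := RInt_le_window f a b a' b' Hc H0 H1 Hab H2).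
        assert (RInt f a' b' <= I) by (apply HI1; exists a', b'; split; [lra|reflexivity]).
        apply Rabs_def1; lra.
      * exfalso. assert (I <= I - eps); [|lra]. apply HI2. intros y [a [b [Hab ->]]].
        apply Rnot_lt_le. intros Hl. apply Hn. exists a, b. auto.
    + apply HI2. intros y [a [b [Hab ->]]]. auto.
Qed.

(** The function f + g lies between 0 and 2g, which reduces the claim to a nonnegative integrand. *)
Lemma int_line_exists_dominated (f g : R -> R) J :
  (forall v, continuous f v) -> (forall v, continuous g v) ->
  (forall v, Rabs (f v) <= g v) -> int_line g J -> exists I, int_line f I /\ Rabs I <= J.
Proof.
  intros Hf Hg Hle HJ.
  assert (Hle2 : forall v, - g v <= f v <= g v) by (intros v; apply Rabs_le_between, Hle).
  assert (H2 : int_line (fun v => 2 * g v) (2 * J)) by (now apply int_line_scal).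
  assert (Hc2 : forall v, continuous (fun v => 2 * g v) v) by (intros; now apply continuous_Rscal).
  destruct (int_line_exists_nonneg (fun v => f v + g v) (2 * J)) as [I [HI HIle]].
  - intros v. now apply continuous_Rplus.
  - intros v. specialize (Hle2 v). lra.
  - intros a b Hab. apply Rle_trans with (RInt (fun v => 2 * g v) a b).
    + apply RInt_le; auto.
      * apply ex_RInt_continuous_all. intros v. now apply continuous_Rplus.
      * now apply ex_RInt_continuous_all.
      * intros v _. specialize (Hle2 v). lra.
    + apply int_line_upper; auto. intros v. specialize (Hle2 v). lra.
  - assert (Hm : int_line f (I - J)).
    { apply int_line_ext with (fun v => (f v + g v) - g v); [intros; ring|].
      apply int_line_minus; auto. intros v. now apply continuous_Rplus. }
    exists (I - J). split; [exact Hm|]. apply Rabs_le. split.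
    + assert (0 <= I); [|lra]. eapply int_line_nonneg; [| |exact HI].
      * intros v. now apply continuous_Rplus.
      * intros v. simpl. specialize (Hle2 v). lra.
    + eapply int_line_le; [exact Hf|exact Hg| |exact Hm|exact HJ]. intros v. apply Hle2.
Qed.

Lemma int_line_FTC (H f : R -> R) la lb :
  (forall v, is_derive H v (f v)) -> (forall v, continuous f v) ->
  filterlim H (Rbar_locally m_infty) (locally la) ->
  filterlim H (Rbar_locally p_infty) (locally lb) -> int_line f (lb - la).
Proof.
  intros Hd Hc Ha Hb. unfold int_line.
  apply filterlim_ext with (fun ab => H (snd ab) - H (fst ab)).
  - intros ab. symmetry. apply is_RInt_unique. apply (is_RInt_derive H f); auto.
  - apply filterlim_Rminus; [apply line_filter_proper| |].
    + apply (filterlim_comp _ _ _ snd H _ (Rbar_locally p_infty)); [apply filterlim_snd|exact Hb].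
    + apply (filterlim_comp _ _ _ fst H _ (Rbar_locally m_infty)); [apply filterlim_fst|exact Ha].
Qed.

Lemma continuous_Series_local (g : nat -> R -> R) v :
  (forall n v, continuous (g n) v) ->
  (exists d, ex_series d /\ forall n u, v - 1 <= u <= v + 1 -> Rabs (g n u) <= d n) ->
  continuous (fun v => Series (fun n => g n v)) v.
Proof.
  intros Hc [d [Hd Hb]].
  apply (tannery (locally v) (fun v n => g n v) (fun n => g n v) d Hd).
  - exists (mkposreal 1 Rlt_0_1). intros u Hu n. change (Rabs (u - v) < 1) in Hu.
    apply Rabs_def2 in Hu. apply Hb. lra.
  - intros n. apply Hc.
Qed.

Lemma RInt_Series (g : nat -> R -> R) (a b : R) (d : nat -> R) :
  (forall n v, continuous (g n) v) -> (forall v, continuous (fun v => Series (fun n => g n v)) v) ->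
  a <= b -> ex_series d -> (forall n v, a <= v <= b -> Rabs (g n v) <= d n) ->
  RInt (fun v => Series (fun n => g n v)) a b = Series (fun n => RInt (g n) a b).
Proof.
  intros Hc HcS Hab Hd Hb. symmetry.
  set (u := (fun n => RInt (g n) a b) : nat -> R). change (Series (fun n => RInt (g n) a b)) with (Series u).
  apply is_series_unique.
  assert (Hcs : forall M v, continuous (fun v => sum_n (fun n => g n v) M) v).
  { intros M v. induction M as [|M IH].
    - apply continuous_ext with (g O); [intros; now rewrite sum_O|auto].
    - apply continuous_ext with (fun v => sum_n (fun n => g n v) M + g (S M) v); [intros; now rewrite sum_n_S|].
      now apply continuous_Rplus. }
  assert (Hsum : forall M, sum_n u M = RInt (fun v => sum_n (fun n => g n v) M) a b).
  { induction M as [|M IH].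
    - rewrite sum_O. unfold u. apply RInt_ext. intros v _. now rewrite sum_O.
    - rewrite sum_n_S, IH. rewrite (RInt_ext (fun v => sum_n (fun n => g n v) (S M)) (fun v => sum_n (fun n => g n v) M + g (S M) v)).
      + symmetry. apply (RInt_plus (V := R_CompleteNormedModule)); apply ex_RInt_continuous_all; auto.
      + intros v _. now rewrite sum_n_S. }
  change (is_lim_seq (sum_n u) (RInt (fun v => Series (fun n => g n v)) a b)).
  apply is_lim_seq_minus_0.
  apply is_lim_seq_squeeze0 with (fun M => (b - a) * Series (fun k => d (S M + k)%nat)).
  - intros M. rewrite Hsum.
    replace (RInt (fun v => sum_n (fun n => g n v) M) a b - RInt (fun v => Series (fun n => g n v)) a b)
      with (RInt (fun v => sum_n (fun n => g n v) M - Series (fun n => g n v)) a b).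
    2:{ apply (RInt_minus (V := R_CompleteNormedModule)); apply ex_RInt_continuous_all; auto. }
    rewrite <- (Rabs_pos_eq (b - a)) by lra. rewrite (Rabs_pos_eq (b - a)) by lra.
    apply abs_RInt_le_const; auto.
    + apply ex_RInt_continuous_all. intros v. now apply continuous_Rminus.
    + intros v Hv. rewrite (Series_split (fun n => g n v) M).
      * replace (_ - _) with (- Series (fun k => g (S M + k)%nat v)) by ring.
        rewrite Rabs_Ropp. apply Series_abs_le; [now apply ex_series_shift|]. intros k. now apply Hb.
      * apply ex_series_dominated with d; auto.
  - replace 0 with ((b - a) * 0) by ring.
    apply is_lim_seq_mult'; [apply is_lim_seq_const|now apply tail_lim].
Qed.

(** Two dominations are at work: on a bounded window a summable bound on the terms allows termwise
    integration, and the summable integrals [J] of the absolute values let [tannery] pass to the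
    whole line. *)
Theorem int_line_Series (g : nat -> R -> R) (I J : nat -> R) :
  (forall n v, continuous (g n) v) ->
  (forall a b, exists d, ex_series d /\ forall n v, a <= v <= b -> Rabs (g n v) <= d n) ->
  (forall n, int_line (g n) (I n)) ->
  (forall n, int_line (fun v => Rabs (g n v)) (J n)) -> ex_series J ->
  ex_series I /\ int_line (fun v => Series (fun n => g n v)) (Series I) /\
  (forall v, continuous (fun v => Series (fun n => g n v)) v).
Proof.
  intros Hc Hd HI HJ HexJ.
  assert (HcS : forall v, continuous (fun v => Series (fun n => g n v)) v).
  { intros v. apply continuous_Series_local; auto. }
  assert (Hca : forall n v, continuous (fun v => Rabs (g n v)) v).
  { intros n v. apply (continuous_comp (g n) Rabs); [auto|apply continuous_Rabs]. }
  destruct (tannery line_filter (fun ab n => RInt (g n) (fst ab) (snd ab)) I J HexJ) as [_ [H1 H2]].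
  - generalize line_filter_le. apply filter_imp. intros [a b] Hab n; simpl in *.
    eapply Rle_trans; [apply abs_RInt_le; [exact Hab|now apply ex_RInt_continuous_all]|].
    apply (int_line_upper (fun v => Rabs (g n v))); auto. intros; apply Rabs_pos.
  - exact HI.
  - split; [exact H1|]. split; [|exact HcS].
    unfold int_line. eapply filterlim_ext_loc; [|exact H2].
    generalize line_filter_le. apply filter_imp. intros [a b] Hab; simpl in *.
    destruct (Hd a b) as [d [Hd1 Hd2]]. symmetry. now apply RInt_Series with d.
Qed.

Lemma nondecreasing_of_derive (f f' : R -> R) (a b : R) :
  a <= b -> (forall x, a <= x <= b -> is_derive f x (f' x)) ->
  (forall x, a <= x <= b -> 0 <= f' x) -> f a <= f b.
Proof.
  intros Hab Hd H0.
  destruct (MVT_gen f a b f') as [c [Hc Heq]].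
  - intros x Hx. rewrite Rmin_left, Rmax_right in Hx by lra. apply Hd. lra.
  - intros x Hx. rewrite Rmin_left, Rmax_right in Hx by lra.
    apply derivable_continuous_pt, ex_derive_Reals_0. exists (f' x). now apply Hd.
  - rewrite Rmin_left, Rmax_right in Hc by lra.
    assert (0 <= f' c * (b - a)) by (apply Rmult_le_pos; [now apply H0|lra]). lra.
Qed.

(** Limits of the primitives come from sums over n and are known along the integers only;
    monotonicity extends them to a real variable. *)
Lemma filterlim_monotone_INR (f : R -> R) (l : R) :
  (forall x y, 0 <= x -> x <= y -> f x <= f y) -> is_lim_seq (fun n => f (INR n)) l ->
  filterlim f (Rbar_locally p_infty) (locally l).
Proof.
  intros Hm Hl. apply filterlim_R_eps; [apply Rbar_locally_filter|]. intros eps Heps.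
  assert (Hle : forall x, 0 <= x -> f x <= l).
  { intros x Hx. destruct (nfloor_ex x Hx) as [n Hn].
    assert (Hinc : forall m, f (INR (S n)) <= f (INR (S n + m))).
    { intros m. apply Hm; [apply pos_INR|apply le_INR; lia]. }
    apply Rle_trans with (f (INR (S n))); [apply Hm; [auto|rewrite S_INR; lra]|].
    assert (Hl2 := proj1 (is_lim_seq_incr_n (fun n => f (INR n)) (S n) l) Hl).
    refine (is_lim_seq_le (fun _ => f (INR (S n))) _ (Finite _) (Finite _) _ (is_lim_seq_const _) Hl2).
    intros m. rewrite Nat.add_comm. apply Hinc. }
  apply is_lim_seq_spec in Hl. destruct (Hl (mkposreal eps Heps)) as [n0 Hn0].
  specialize (Hn0 n0 (le_n n0)). cbn [pos] in Hn0. apply Rabs_def2 in Hn0.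
  exists (INR n0). intros x Hx. assert (H0 := pos_INR n0).
  assert (f (INR n0) <= f x) by (apply Hm; lra).
  assert (f x <= l) by (apply Hle; lra). apply Rabs_def1; lra.
Qed.

Lemma exp_pow x n : exp x ^ n = exp (INR n * x).
Proof.
  induction n as [|n IH]; [simpl; now rewrite Rmult_0_l, exp_0|].
  rewrite <- tech_pow_Rmult, IH, <- exp_plus, S_INR. f_equal. ring.
Qed.

Lemma filterlim_exp_scal_p (c r : R) : 0 < c -> 0 < r ->
  filterlim (fun v => r * exp (v * c)) (Rbar_locally p_infty) (Rbar_locally p_infty).
Proof.
  intros Hc Hr P [M HM]. exists (ln (Rmax M 1 / r) / c). intros v Hv. apply HM.
  apply Rle_lt_trans with (Rmax M 1); [apply Rmax_l|].
  assert (Hp : 0 < Rmax M 1 / r).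
  { apply Rdiv_lt_0_compat; auto. apply Rlt_le_trans with 1; [lra|apply Rmax_r]. }
  apply Rlt_div_l in Hv; auto. apply exp_increasing in Hv. rewrite exp_ln in Hv by auto.
  apply Rlt_div_l in Hv; auto. lra.
Qed.

Lemma filterlim_exp_scal_m (c r : R) : 0 < c -> 0 < r ->
  filterlim (fun v => r * exp (v * c)) (Rbar_locally m_infty) (locally 0).
Proof.
  intros Hc Hr. apply filterlim_R_eps; [apply Rbar_locally_filter|]. intros eps Heps.
  exists (ln (eps / r) / c). intros v Hv.
  assert (Hp : 0 < eps / r) by (now apply Rdiv_lt_0_compat).
  apply Rlt_div_r in Hv; auto. apply exp_increasing in Hv. rewrite exp_ln in Hv by auto.
  apply Rlt_div_r in Hv; auto. rewrite Rminus_0_r, Rabs_pos_eq; [lra|].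
  assert (H := exp_pos (v * c)). nra.
Qed.

(** * Mellin transforms of the rational kernels *)

Definition beta_kernel (mu v : R) : R := exp (mu * v) / (1 + exp (2 * v)).

Lemma continuous_beta_kernel mu v : continuous (beta_kernel mu) v.
Proof.
  apply continuous_ex_derive. unfold beta_kernel. auto_derive.
  generalize (exp_pos (2 * v)). lra.
Qed.

(** The substitution u = r exp(v/N) turns the integral of u^p/(u^(2N)+r^(2N)) over u > 0 into this
    one, up to a power of r and the factor N. The increment of the primitive from 0 to infinity is
    the sum minus the defect, by [rational_sum_eval]. *)
Lemma rational_integral N p r : (0 < N)%nat -> (p + 2 <= 2 * N)%nat -> 0 < r ->
  int_line (beta_kernel ((INR p + 1) / INR N))
    (INR N * r ^ (2 * N) / r ^ (p + 1) *
     (Series (fun n => rational_term N p r (INR (S n))) - Re (defect_sum N p r))).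
Proof.
  intros HN Hp Hr.
  destruct (rational_sum_eval N p r Hp Hr) as [_ Hlim].
  set (X := Series _ - Re _) in *.
  set (H := fun u => Re (primitive_sum N p r u)) in *.
  assert (Hd : forall u, is_derive H u (rational_term N p r u)).
  { intros u. apply (Cder_primitive_sum N p r u ltac:(lia) Hr). }
  assert (HNR : 0 < INR N) by (apply lt_0_INR; lia).
  assert (HrN : 0 < r ^ (2 * N)) by now apply pow_lt.
  assert (Hrp : 0 < r ^ (p + 1)) by now apply pow_lt.
  set (c := INR N * r ^ (2 * N) / r ^ (p + 1)).
  replace (c * X) with (c * (H 0 + X) - c * H 0) by ring.
  assert (Hin : 0 < / INR N) by now apply Rinv_0_lt_compat.
  apply int_line_FTC with (fun v => c * H (r * exp (v * / INR N))).
  - intros v.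
    assert (He : is_derive (fun v => r * exp (v * / INR N)) v (r * exp (v * / INR N) * / INR N)).
    { auto_derive; trivial. ring. }
    assert (Hcomp := is_derive_comp H (fun v => r * exp (v * / INR N)) v _ _ (Hd _) He).
    evar_last; [apply is_derive_Rscal, Hcomp|].
    unfold scal; simpl; unfold mult; simpl.
    unfold rational_term, beta_kernel, c.
    set (E := exp (v * / INR N)).
    assert (HEp : exp ((INR p + 1) / INR N * v) = E ^ (p + 1)).
    { unfold E. rewrite exp_pow. f_equal. rewrite plus_INR. simpl (INR 1). field. lra. }
    assert (HE2 : exp (2 * v) = E ^ (2 * N)).
    { unfold E. rewrite exp_pow. f_equal. rewrite mult_INR. simpl (INR 2). field. lra. }
    rewrite HEp, HE2, !Rpow_mult_distr.
    assert (0 < E ^ (2 * N)) by (apply pow_lt, exp_pos).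
    rewrite (pow_add r), (pow_add E), !pow_1.
    assert (0 < r ^ p) by now apply pow_lt.
    field. repeat split; try lra. nra.
  - intros v. apply continuous_beta_kernel.
  - apply filterlim_Rscal; [apply Rbar_locally_filter|].
    apply (filterlim_comp _ _ _ (fun v => r * exp (v * / INR N)) H _ (locally 0)).
    + now apply filterlim_exp_scal_m.
    + apply (continuous_ex_derive H 0). eexists; apply Hd.
  - apply filterlim_Rscal; [apply Rbar_locally_filter|].
    apply (filterlim_comp _ _ _ (fun v => r * exp (v * / INR N)) H _ (Rbar_locally p_infty)).
    + now apply filterlim_exp_scal_p.
    + apply filterlim_monotone_INR.
      * intros x y Hx Hxy. apply nondecreasing_of_derive with (rational_term N p r); auto.
        intros z Hz. apply rational_term_nonneg; lra.
      * apply is_lim_seq_ext with (fun n => H 0 + (H (INR n) - H 0)); [intros; ring|].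
        apply is_lim_seq_plus'; [apply is_lim_seq_const|exact Hlim].
Qed.

(** The integrand of [rational_integral] does not involve r, so the number obtained at r = 1 is the
    same for every r; the whole dependence of the integral on r is an explicit power. *)
Lemma rational_sum_beta N p : (0 < N)%nat -> (p + 2 <= 2 * N)%nat ->
  exists beta, int_line (beta_kernel ((INR p + 1) / INR N)) beta /\
    forall r, 0 < r -> Series (fun n => rational_term N p r (INR (S n))) =
       r ^ (p + 1) / (INR N * r ^ (2 * N)) * beta + Re (defect_sum N p r).
Proof.
  intros HN Hp. eexists. split; [exact (rational_integral N p 1 HN Hp Rlt_0_1)|].
  intros r Hr.
  rewrite (int_line_unique _ _ _ (rational_integral N p 1 HN Hp Rlt_0_1) (rational_integral N p r HN Hp Hr)).
  assert (HNR : 0 < INR N) by (apply lt_0_INR; lia).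
  field. repeat split; try (apply pow_nonzero); lra.
Qed.

(** Translating v by ln w replaces the 1 in the denominator by w^2. *)
Lemma beta_kernel_scaled mu beta w : 0 < w -> int_line (beta_kernel mu) beta ->
  int_line (fun v => exp (mu * v) / (exp (2 * v) + w ^ 2)) (exp ((mu - 2) * ln w) * beta).
Proof.
  intros Hw H.
  apply int_line_ext with (fun v => exp ((mu - 2) * ln w) * beta_kernel mu (v + - ln w)).
  - intros v. unfold beta_kernel.
    replace (mu * (v + - ln w)) with (mu * v + - (mu * ln w)) by ring.
    replace (2 * (v + - ln w)) with (2 * v + - (ln w + ln w)) by ring.
    replace ((mu - 2) * ln w) with (mu * ln w + - (ln w + ln w)) by ring.
    rewrite !exp_plus, !exp_Ropp, !exp_plus, !exp_ln by auto.
    assert (H1 := exp_pos (2 * v)). assert (H2 := exp_pos (mu * ln w)).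
    assert (0 < w * w) by nra. field. repeat split; try lra; simpl; nra.
  - apply int_line_scal.
    + intros v. apply (continuous_comp (fun v => v + - ln w) (beta_kernel mu)).
      * apply continuous_ex_derive. auto_derive. trivial.
      * apply continuous_beta_kernel.
    + apply int_line_shift; auto. apply continuous_beta_kernel.
Qed.

(** * The Gamma function as an integral *)

Definition gamma_kernel (mu v : R) : R := exp (mu * v - exp v).

Lemma continuous_gamma_kernel mu v : continuous (gamma_kernel mu) v.
Proof. apply continuous_ex_derive. unfold gamma_kernel. auto_derive. trivial. Qed.

Lemma gamma_kernel_pos mu v : 0 < gamma_kernel mu v.
Proof. apply exp_pos. Qed.

Lemma filterlim_squeeze_0 (F : (R -> Prop) -> Prop) {FF : Filter F} (f g : R -> R) :
  F (fun v => Rabs (f v) <= g v) -> filterlim g F (locally 0) -> filterlim f F (locally 0).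
Proof.
  intros H Hg. apply filterlim_R_eps; auto. intros eps Heps.
  assert (He := proj2 (filterlim_R_eps F g 0) Hg eps Heps).
  generalize (filter_and _ _ H He). apply filter_imp. intros v [H1 H2].
  rewrite Rminus_0_r in *. assert (H3 := Rle_abs (g v)). lra.
Qed.

Lemma filterlim_to (F : (R -> Prop) -> Prop) (f : R -> R) (l l' : R) :
  filterlim f F (locally l) -> l = l' -> filterlim f F (locally l').
Proof. now intros H <-. Qed.

Lemma filterlim_exp_m (c : R) : 0 < c -> filterlim (fun v => exp (c * v)) (Rbar_locally m_infty) (locally 0).
Proof.
  intros Hc. apply filterlim_ext with (fun v => 1 * exp (v * c)).
  - intros v. rewrite Rmult_1_l. f_equal. ring.
  - apply filterlim_exp_scal_m; lra.
Qed.

Lemma filterlim_exp_p (c : R) : c < 0 -> filterlim (fun v => exp (c * v)) (Rbar_locally p_infty) (locally 0).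
Proof.
  intros Hc.
  apply filterlim_ext with (fun v => exp (- c * (- v))).
  - intros v. f_equal. ring.
  - apply (filterlim_comp _ _ _ Ropp (fun v => exp (- c * v)) _ (Rbar_locally m_infty)).
    + intros P [M HM]. exists (- M). intros v Hv. apply HM. lra.
    + apply filterlim_exp_m. lra.
Qed.

Lemma exp_quadratic_bound x : 0 <= x -> (1 + x) ^ 2 <= 4 * exp x.
Proof.
  intros Hx.
  assert (H := exp_ineq1_le (x / 2)).
  replace (exp x) with (exp (x / 2) * exp (x / 2)) by (rewrite <- exp_plus; f_equal; field).
  assert ((1 + x / 2) * (1 + x / 2) <= exp (x / 2) * exp (x / 2)) by (apply Rmult_le_compat; lra).
  nra.
Qed.

(** The bound is 4/mu times the derivative of a logistic function, so its integral is explicit. For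
    v <= 0 it rests on exp(mu v) <= 1, for v > 0 on exp(mu v) <= exp v and (1+y)^2 <= 4 e^y. *)
Lemma gamma_kernel_dominated mu v : 0 < mu <= 1 ->
  gamma_kernel mu v <= 4 * (exp (mu * v) / (1 + exp (mu * v)) ^ 2).
Proof.
  intros Hmu. unfold gamma_kernel, Rminus. rewrite exp_plus, exp_Ropp.
  assert (H1 := exp_pos (mu * v)). assert (H2 := exp_pos v). assert (H3 := exp_pos (exp v)).
  assert (Hsq : 0 < (1 + exp (mu * v)) ^ 2) by (apply pow_lt; lra).
  replace (4 * (exp (mu * v) / (1 + exp (mu * v)) ^ 2)) with
    (exp (mu * v) * / ((1 + exp (mu * v)) ^ 2 / 4)) by (field; lra).
  apply Rmult_le_compat_l; [lra|]. apply Rinv_le_contravar; [lra|].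
  assert ((1 + exp (mu * v)) ^ 2 <= 4 * exp (exp v)); [|lra].
  destruct (Rle_lt_dec v 0) as [Hv|Hv].
  - assert (exp (mu * v) <= 1).
    { rewrite <- exp_0. destruct (Req_dec (mu * v) 0) as [->|Hne]; [lra|].
      left. apply exp_increasing. nra. }
    assert (1 <= exp (exp v)) by (generalize (exp_ineq1_le (exp v)); lra). nra.
  - assert (exp (mu * v) <= exp v).
    { destruct (Req_dec (mu * v) v) as [->|Hne]; [lra|]. left. apply exp_increasing. nra. }
    apply Rle_trans with ((1 + exp v) ^ 2); [|apply exp_quadratic_bound; lra].
    apply pow_incr. lra.
Qed.

Lemma int_line_logistic mu : 0 < mu ->
  int_line (fun v => 4 * (exp (mu * v) / (1 + exp (mu * v)) ^ 2)) (4 / mu).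
Proof.
  intros Hmu. replace (4 / mu) with (4 / mu - 4 / mu * 0) by ring.
  apply int_line_FTC with (fun v => 4 / mu * (1 - / (1 + exp (mu * v)))).
  - intros v. assert (H := exp_pos (mu * v)). auto_derive; [lra|]. field. lra.
  - intros v. apply continuous_ex_derive. assert (H := exp_pos (mu * v)). auto_derive.
    apply Rgt_not_eq. nra.
  - apply filterlim_Rscal; [apply Rbar_locally_filter|].
    apply (filterlim_comp _ _ _ (fun v => exp (mu * v)) (fun x => 1 - / (1 + x)) _ (locally 0)).
    + now apply filterlim_exp_m.
    + apply filterlim_to with (1 - / (1 + 0)); [|field].
      apply (continuous_ex_derive (fun x => 1 - / (1 + x))). auto_derive. lra.
  - apply filterlim_to with (4 / mu * 1); [|ring].
    apply filterlim_Rscal; [apply Rbar_locally_filter|].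
    apply filterlim_ext with (fun v => 1 - exp (- mu * v) / (1 + exp (- mu * v))).
    + intros v. replace (- mu * v) with (- (mu * v)) by ring. rewrite exp_Ropp.
      assert (H := exp_pos (mu * v)). field. split; lra.
    + apply (filterlim_comp _ _ _ (fun v => exp (- mu * v)) (fun x => 1 - x / (1 + x)) _ (locally 0)).
      * apply filterlim_exp_p. lra.
      * apply filterlim_to with (1 - 0 / (1 + 0)); [|field].
        apply (continuous_ex_derive (fun x => 1 - x / (1 + x))). auto_derive. lra.
Qed.

Lemma gamma_kernel_m_infty mu : 0 < mu -> filterlim (gamma_kernel mu) (Rbar_locally m_infty) (locally 0).
Proof.
  intros Hmu. apply filterlim_squeeze_0 with (fun v => exp (mu * v)); [apply Rbar_locally_filter| |now apply filterlim_exp_m].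
  apply filter_forall. intros v. rewrite Rabs_pos_eq by (left; apply gamma_kernel_pos).
  left. apply exp_increasing. generalize (exp_pos v). lra.
Qed.

Lemma exp_dominates_linear (c v : R) : 0 <= v -> 2 * c * v - 4 * c ^ 2 <= exp v.
Proof.
  intros Hv. assert (H := exp_ineq1_le (v / 2)).
  replace (exp v) with (exp (v / 2) * exp (v / 2)) by (rewrite <- exp_plus; f_equal; field).
  assert ((1 + v / 2) * (1 + v / 2) <= exp (v / 2) * exp (v / 2)) by (apply Rmult_le_compat; lra).
  generalize (pow2_ge_0 (v - 4 * c)). intros. nra.
Qed.

Lemma gamma_kernel_p_infty mu : 0 < mu -> filterlim (gamma_kernel mu) (Rbar_locally p_infty) (locally 0).
Proof.
  intros Hmu.
  apply filterlim_squeeze_0 with (fun v => exp (4 * mu ^ 2) * exp (- mu * v)); [apply Rbar_locally_filter| |].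
  - exists 0. intros v Hv. rewrite Rabs_pos_eq by (left; apply gamma_kernel_pos).
    rewrite <- exp_plus. unfold gamma_kernel.
    assert (H := exp_dominates_linear mu v ltac:(lra)).
    assert (Hle : mu * v - exp v <= 4 * mu ^ 2 + - mu * v) by nra.
    destruct Hle as [Hlt|Heq]; [left; now apply exp_increasing|right; now rewrite Heq].
  - apply filterlim_to with (exp (4 * mu ^ 2) * 0); [|ring].
    apply filterlim_Rscal; [apply Rbar_locally_filter|]. apply filterlim_exp_p. lra.
Qed.

(** Integration by parts: [gamma_kernel mu] vanishes at both ends and has derivative mu times itself
    minus [gamma_kernel (mu + 1)]. *)
Lemma gamma_integral_step mu I : 0 < mu ->
  int_line (gamma_kernel mu) I -> int_line (gamma_kernel (mu + 1)) (mu * I).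
Proof.
  intros Hmu HI.
  assert (H0 : int_line (fun v => mu * gamma_kernel mu v - gamma_kernel (mu + 1) v) (0 - 0)).
  { apply int_line_FTC with (gamma_kernel mu).
    - intros v. unfold gamma_kernel. unfold Rminus. auto_derive; trivial.
      replace (exp ((mu + 1) * v + - exp v)) with (exp v * exp (mu * v + - exp v)) by (rewrite <- exp_plus; f_equal; ring).
      ring.
    - intros v. apply continuous_Rminus; [apply continuous_Rscal|]; apply continuous_gamma_kernel.
    - now apply gamma_kernel_m_infty.
    - now apply gamma_kernel_p_infty. }
  replace (mu * I) with (mu * I - (0 - 0)) by ring.
  apply int_line_ext with (fun v => mu * gamma_kernel mu v - (mu * gamma_kernel mu v - gamma_kernel (mu + 1) v));
    [intros; ring|].
  apply int_line_minus; auto.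
  - intros v. apply continuous_Rscal, continuous_gamma_kernel.
  - intros v. apply continuous_Rminus; [apply continuous_Rscal|]; apply continuous_gamma_kernel.
  - apply int_line_scal; auto. apply continuous_gamma_kernel.
Qed.

(** Domination settles mu <= 1, and the functional equation then raises mu by 1 at a time. *)
Lemma gamma_integral_exists mu : 0 < mu -> exists I, int_line (gamma_kernel mu) I /\ 0 < I.
Proof.
  intros Hmu.
  assert (H : exists I, int_line (gamma_kernel mu) I).
  { destruct (nfloor_ex mu) as [n Hn]; [lra|]. destruct Hn as [_ Hn].
    apply Rlt_le in Hn. revert mu Hmu Hn. induction n as [|n IH]; intros mu Hmu Hn.
    - simpl in Hn. rewrite Rplus_0_l in Hn.
      destruct (int_line_exists_dominated (gamma_kernel mu)
         (fun v => 4 * (exp (mu * v) / (1 + exp (mu * v)) ^ 2)) (4 / mu)) as [I [HI _]].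
      + apply continuous_gamma_kernel.
      + intros v. apply continuous_ex_derive. assert (H := exp_pos (mu * v)). auto_derive.
        apply Rgt_not_eq. nra.
      + intros v. rewrite Rabs_pos_eq by (left; apply gamma_kernel_pos).
        apply gamma_kernel_dominated. lra.
      + now apply int_line_logistic.
      + now exists I.
    - rewrite S_INR in Hn. destruct (Rle_lt_dec mu 1) as [Hle|Hgt].
      + apply IH; [auto|]. generalize (pos_INR n). lra.
      + destruct (IH (mu - 1)) as [I HI]; [lra|lra|].
        exists ((mu - 1) * I). replace mu with (mu - 1 + 1) by ring.
        replace (mu - 1 + 1 - 1) with (mu - 1) by ring.
        apply gamma_integral_step; [lra|auto]. }
  destruct H as [I HI]. exists I. split; auto.
  eapply int_line_pos; [apply continuous_gamma_kernel|apply gamma_kernel_pos|exact HI].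
Qed.

Lemma gamma_integral_1 : int_line (gamma_kernel 1) 1.
Proof.
  replace 1 with (- 0 - - (1)) at 2 by ring.
  apply int_line_FTC with (fun v => - exp (- exp v)).
  - intros v. unfold gamma_kernel, Rminus. auto_derive; trivial. rewrite exp_plus, !Rmult_1_l. ring.
  - apply continuous_gamma_kernel.
  - apply filterlim_ext with (fun v => - exp (- exp (1 * v))); [intros; now rewrite Rmult_1_l|].
    apply (filterlim_comp _ _ _ (fun v => exp (1 * v)) (fun x => - exp (- x)) _ (locally 0)).
    + apply filterlim_exp_m. lra.
    + apply filterlim_to with (- exp (- 0)); [|rewrite Ropp_0, exp_0; ring].
      apply (continuous_ex_derive (fun x => - exp (- x))). auto_derive. trivial.
  - rewrite Ropp_0. apply filterlim_squeeze_0 with (fun v => exp (-1 * v)); [apply Rbar_locally_filter| |apply filterlim_exp_p; lra].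
    apply filter_forall. intros v. rewrite Rabs_Ropp, Rabs_pos_eq by (left; apply exp_pos).
    left. apply exp_increasing. generalize (exp_ineq1_le v). lra.
Qed.

Lemma gamma_integral_fact n : int_line (gamma_kernel (INR (S n))) (INR (fact n)).
Proof.
  induction n as [|n IH]; [exact gamma_integral_1|].
  rewrite S_INR, fact_simpl, mult_INR. apply gamma_integral_step; auto.
  apply lt_0_INR. lia.
Qed.

Lemma gamma_integral_prod mu I n : 0 < mu -> int_line (gamma_kernel mu) I ->
  int_line (gamma_kernel (mu + INR (S n))) (prod_f_R0 (fun k => mu + INR k) n * I).
Proof.
  intros Hmu HI. induction n as [|n IH].
  - simpl. rewrite Rplus_0_r. now apply gamma_integral_step.
  - replace (mu + INR (S (S n))) with (mu + INR (S n) + 1) by (rewrite (S_INR (S n)); ring).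
    change (prod_f_R0 (fun k => mu + INR k) (S n)) with (prod_f_R0 (fun k => mu + INR k) n * (mu + INR (S n))).
    replace (prod_f_R0 (fun k => mu + INR k) n * (mu + INR (S n)) * I) with
      ((mu + INR (S n)) * (prod_f_R0 (fun k => mu + INR k) n * I)) by ring.
    refine (gamma_integral_step _ _ _ IH). generalize (pos_INR (S n)). lra.
Qed.

Lemma exp_convex mu x : 0 <= mu <= 1 -> exp (mu * x) <= (1 - mu) + mu * exp x.
Proof.
  intros Hmu. assert (H1 := exp_ineq1_le (- (mu * x))). assert (H2 := exp_ineq1_le ((1 - mu) * x)).
  assert (Hp := exp_pos (mu * x)).
  apply Rmult_le_reg_l with (exp (- (mu * x))); [apply exp_pos|].
  rewrite <- exp_plus. replace (- (mu * x) + mu * x) with 0 by ring. rewrite exp_0.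
  rewrite Rmult_plus_distr_l.
  replace (exp (- (mu * x)) * (mu * exp x)) with (mu * exp ((1 - mu) * x)).
  - nra.
  - replace ((1 - mu) * x) with (- (mu * x) + x) by ring. rewrite exp_plus. ring.
Qed.

Lemma exp_tangent nu x : 0 <= nu -> 1 + nu - nu * exp x <= exp (- nu * x).
Proof.
  intros Hnu. assert (H1 := exp_ineq1_le (- nu * x)). assert (H2 := exp_ineq1_le x). nra.
Qed.

(* As in the Bohr-Mollerup theorem, convexity of exp compares the integral at n + mu with those at integers, and
   Gauss' limit follows. *)
Lemma gamma_integral_upper mu I n : 0 < mu < 1 -> int_line (gamma_kernel mu) I ->
  prod_f_R0 (fun k => mu + INR k) n * I <= exp (mu * ln (INR (S n))) * INR (fact n).
Proof.
  (* The convexity bound is taken about v = g, where e^g = n+1 is the ratio of (n+1)! to n!; the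
     weights 1-mu and mu then recombine to a plain n!. *)
  intros Hmu HI. set (g := ln (INR (S n))).
  assert (Hp : 0 < INR (S n)) by (apply lt_0_INR; lia).
  assert (Hg : exp (- g) * INR (S n) = 1).
  { unfold g. rewrite exp_Ropp, exp_ln by auto. field. lra. }
  assert (H := gamma_integral_prod mu I n ltac:(lra) HI).
  replace (exp (mu * g) * INR (fact n)) with
    (exp (mu * g) * ((1 - mu) * INR (fact n) + mu * exp (- g) * INR (fact (S n)))).
  2:{ rewrite fact_simpl, mult_INR.
      replace (mu * exp (- g) * (INR (S n) * INR (fact n))) with (mu * (exp (- g) * INR (S n)) * INR (fact n)) by ring.
      rewrite Hg. ring. }
  refine (int_line_le _ (fun v => exp (mu * g) * ((1 - mu) * gamma_kernel (INR (S n)) v +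
      mu * exp (- g) * gamma_kernel (INR (S (S n))) v)) _ _ _ _ _ H _).
  - apply continuous_gamma_kernel.
  - intros v. apply continuous_Rscal, continuous_Rplus; apply continuous_Rscal, continuous_gamma_kernel.
  - intros v. unfold gamma_kernel.
    replace ((mu + INR (S n)) * v - exp v) with (mu * g + (mu * (v - g) + (INR (S n) * v - exp v))) by ring.
    replace (INR (S (S n)) * v - exp v) with (v + (INR (S n) * v - exp v)) by (rewrite (S_INR (S n)); ring).
    rewrite !exp_plus.
    assert (Hc := exp_convex mu (v - g) ltac:(lra)).
    replace (exp (v - g)) with (exp v * exp (- g)) in Hc by (rewrite <- exp_plus; f_equal; ring).
    assert (H1 := exp_pos (mu * g)). assert (H2 := exp_pos (INR (S n) * v - exp v)).
    set (K := exp (INR (S n) * v - exp v)) in *.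
    apply Rmult_le_compat_l; [lra|].
    replace ((1 - mu) * K + mu * exp (- g) * (exp v * K)) with ((1 - mu + mu * (exp v * exp (- g))) * K) by ring.
    apply Rmult_le_compat_r; [lra|]. exact Hc.
  - apply int_line_scal.
    + intros v. apply continuous_Rplus; apply continuous_Rscal, continuous_gamma_kernel.
    + apply int_line_plus; try (intros v; apply continuous_Rscal, continuous_gamma_kernel);
        apply int_line_scal; try apply continuous_gamma_kernel; apply gamma_integral_fact.
Qed.

(** The counterpart of the upper bound: with nu = 1-mu, [exp_tangent] bounds the integrand at mu+n+1
    from below by a combination of those at n+2 and n+3, taken about v = ln(n+2). *)
Lemma gamma_integral_lower mu I n : 0 < mu < 1 -> int_line (gamma_kernel mu) I ->
  exp (- (1 - mu) * ln (INR (S (S n)))) * INR (fact (S n)) <= prod_f_R0 (fun k => mu + INR k) n * I.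
Proof.
  intros Hmu HI. set (g := ln (INR (S (S n)))). set (nu := 1 - mu).
  assert (Hp : 0 < INR (S (S n))) by (apply lt_0_INR; lia).
  assert (Hg : exp (- g) * INR (S (S n)) = 1).
  { unfold g. rewrite exp_Ropp, exp_ln by auto. field. lra. }
  assert (H := gamma_integral_prod mu I n ltac:(lra) HI).
  replace (exp (- nu * g) * INR (fact (S n))) with
    (exp (- nu * g) * ((1 + nu) * INR (fact (S n)) + (- nu * exp (- g)) * INR (fact (S (S n))))).
  2:{ rewrite (fact_simpl (S n)), mult_INR.
      replace (- nu * exp (- g) * (INR (S (S n)) * INR (fact (S n)))) with
        (- nu * (exp (- g) * INR (S (S n))) * INR (fact (S n))) by ring.
      rewrite Hg. ring. }
  refine (int_line_le (fun v => exp (- nu * g) * ((1 + nu) * gamma_kernel (INR (S (S n))) v +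
      (- nu * exp (- g)) * gamma_kernel (INR (S (S (S n)))) v)) _ _ _ _ _ _ _ H).
  - intros v. apply continuous_Rscal, continuous_Rplus; apply continuous_Rscal, continuous_gamma_kernel.
  - apply continuous_gamma_kernel.
  - intros v. unfold gamma_kernel.
    replace ((mu + INR (S n)) * v - exp v) with (- nu * g + (- nu * (v - g) + (INR (S (S n)) * v - exp v)))
      by (unfold nu; rewrite (S_INR (S n)); ring).
    replace (INR (S (S (S n))) * v - exp v) with (v + (INR (S (S n)) * v - exp v)) by (rewrite (S_INR (S (S n))); ring).
    rewrite !exp_plus.
    assert (Hc := exp_tangent nu (v - g) ltac:(unfold nu; lra)).
    replace (exp (v - g)) with (exp v * exp (- g)) in Hc by (rewrite <- exp_plus; f_equal; ring).
    assert (H1 := exp_pos (- nu * g)). assert (H2 := exp_pos (INR (S (S n)) * v - exp v)).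
    set (K := exp (INR (S (S n)) * v - exp v)) in *.
    apply Rmult_le_compat_l; [lra|].
    replace ((1 + nu) * K + - nu * exp (- g) * (exp v * K)) with ((1 + nu - nu * (exp v * exp (- g))) * K) by ring.
    apply Rmult_le_compat_r; [lra|]. exact Hc.
  - apply int_line_scal.
    + intros v. apply continuous_Rplus; apply continuous_Rscal, continuous_gamma_kernel.
    + apply int_line_plus; try (intros v; apply continuous_Rscal, continuous_gamma_kernel);
        apply int_line_scal; try apply continuous_gamma_kernel; apply gamma_integral_fact.
Qed.

Definition gauss_term (s : R) (n : nat) : R :=
  INR (fact n) * Rpower (INR n) s / prod_f_R0 (fun k => s + INR k) n.

Lemma ln_shift_lim c : 0 <= c -> is_lim_seq (fun n => ln (INR n + c) - ln (INR n)) 0.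
Proof.
  intros Hc. apply is_lim_seq_ext_loc with (2 := lim_half_ln_quadratic c 0).
  exists 1%nat. intros n Hn. apply (le_INR 1) in Hn. simpl in Hn.
  replace (/ 2 * ln ((INR n + c) ^ 2 + 0 ^ 2)) with (ln (INR n + c)); [reflexivity|].
  replace ((INR n + c) ^ 2 + 0 ^ 2) with ((INR n + c) ^ 2) by ring.
  rewrite ln_pow by lra. simpl (INR 2). field.
Qed.

(** Relative to I, the two bounds for the Gauss term are products of powers of (n+1)/n and (n+2)/n,
    and these tend to 1. *)
Lemma gauss_lim mu I : 0 < mu < 1 -> int_line (gamma_kernel mu) I -> is_lim_seq (gauss_term mu) I.
Proof.
  intros Hmu HI.
  assert (HI0 : 0 < I) by (eapply int_line_pos; [apply continuous_gamma_kernel|apply gamma_kernel_pos|exact HI]).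
  assert (Hprod : forall n, 0 < prod_f_R0 (fun k => mu + INR k) n).
  { induction n as [|n IH]; [simpl; lra|].
    change (prod_f_R0 (fun k => mu + INR k) (S n)) with (prod_f_R0 (fun k => mu + INR k) n * (mu + INR (S n))).
    apply Rmult_lt_0_compat; auto. generalize (pos_INR (S n)). lra. }
  apply is_lim_seq_le_le_loc with
    (fun n => I * exp (- mu * (ln (INR n + 1) - ln (INR n))))
    (fun n => I * exp ((1 - mu) * (ln (INR n + 2) - ln (INR n)) - (ln (INR n + 1) - ln (INR n)))).
  - exists 1%nat. intros n Hn. apply (le_INR 1) in Hn. simpl in Hn.
    assert (Hu := gamma_integral_upper mu I n Hmu HI). assert (Hl := gamma_integral_lower mu I n Hmu HI).
    assert (Hf := INR_fact_lt_0 n). specialize (Hprod n).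
    unfold gauss_term, Rpower. set (Pn := prod_f_R0 _ n) in *.
    rewrite (S_INR n) in Hu. rewrite fact_simpl, mult_INR, (S_INR (S n)), (S_INR n) in Hl.
    replace (INR n + 1 + 1) with (INR n + 2) in Hl by ring.
    split.
    + apply Rmult_le_reg_r with Pn; auto.
      replace (INR (fact n) * exp (mu * ln (INR n)) / Pn * Pn) with (INR (fact n) * exp (mu * ln (INR n))) by (field; lra).
      apply Rle_trans with (exp (- mu * (ln (INR n + 1) - ln (INR n))) * (exp (mu * ln (INR n + 1)) * INR (fact n))).
      * replace (I * exp (- mu * (ln (INR n + 1) - ln (INR n))) * Pn) with
          (exp (- mu * (ln (INR n + 1) - ln (INR n))) * (Pn * I)) by ring.
        apply Rmult_le_compat_l; [left; apply exp_pos|exact Hu].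
      * rewrite <- Rmult_assoc, <- exp_plus. right. rewrite Rmult_comm. do 2 f_equal. ring.
    + apply Rmult_le_reg_r with Pn; auto.
      replace (INR (fact n) * exp (mu * ln (INR n)) / Pn * Pn) with (INR (fact n) * exp (mu * ln (INR n))) by (field; lra).
      set (E := exp ((1 - mu) * (ln (INR n + 2) - ln (INR n)) - (ln (INR n + 1) - ln (INR n)))).
      apply Rle_trans with (E * (exp (- (1 - mu) * ln (INR n + 2)) * ((INR n + 1) * INR (fact n)))).
      * replace ((INR n + 1) * INR (fact n)) with (exp (ln (INR n + 1)) * INR (fact n)) by (rewrite exp_ln; [reflexivity|lra]).
        replace (E * (exp (- (1 - mu) * ln (INR n + 2)) * (exp (ln (INR n + 1)) * INR (fact n)))) with
          (INR (fact n) * (E * exp (- (1 - mu) * ln (INR n + 2)) * exp (ln (INR n + 1)))) by ring.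
        unfold E. rewrite <- !exp_plus. right. do 2 f_equal. ring.
      * replace (I * E * Pn) with (E * (Pn * I)) by ring.
        apply Rmult_le_compat_l; [left; apply exp_pos|exact Hl].
  - apply (is_lim_seq_ex_derive (fun x => I * exp (- mu * x)) _ 0).
    + auto_derive. trivial.
    + rewrite Rmult_0_r, exp_0. ring.
    + apply ln_shift_lim. lra.
  - apply (is_lim_seq_ex_derive (fun x => I * exp x) _ 0).
    + auto_derive. trivial.
    + rewrite exp_0. ring.
    + replace 0 with ((1 - mu) * 0 - 0) by ring.
      apply is_lim_seq_minus'; [apply is_lim_seq_mult'; [apply is_lim_seq_const|]|]; apply ln_shift_lim; lra.
Qed.

(** The Gauss terms at s and s+1 differ by the factor (1+(s+1)/n)/s, which tends to 1/s. This
    carries the limit to negative non-integral s. *)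
Lemma gauss_shift (s L : R) :
  (forall k, s + INR k <> 0) -> is_lim_seq (gauss_term (s + 1)) L -> is_lim_seq (gauss_term s) (L / s).
Proof.
  intros Hs HL.
  assert (Hs0 : s <> 0) by (specialize (Hs O); simpl in Hs; lra).
  assert (Hprod : forall n, prod_f_R0 (fun k => s + INR k) n <> 0 /\
    prod_f_R0 (fun k => s + INR k) n * (s + INR (S n)) = s * prod_f_R0 (fun k => s + 1 + INR k) n).
  { induction n as [|n [IH1 IH2]].
    - split; [apply (Hs O)|]. simpl. ring.
    - split.
      + change (prod_f_R0 (fun k => s + INR k) (S n)) with (prod_f_R0 (fun k => s + INR k) n * (s + INR (S n))).
        apply Rmult_integral_contrapositive_currified; auto.
      + change (prod_f_R0 (fun k => s + INR k) (S n)) with (prod_f_R0 (fun k => s + INR k) n * (s + INR (S n))).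
        change (prod_f_R0 (fun k => s + 1 + INR k) (S n)) with (prod_f_R0 (fun k => s + 1 + INR k) n * (s + 1 + INR (S n))).
        rewrite IH2. rewrite (S_INR (S n)). ring. }
  apply is_lim_seq_ext_loc with (fun n => gauss_term (s + 1) n * ((1 + (s + 1) * / INR n) / s)).
  - exists 1%nat. intros n Hn. assert (Hn0 : 0 < INR n) by (apply lt_0_INR; lia).
    destruct (Hprod n) as [H1 H2]. unfold gauss_term.
    rewrite Rpower_plus, Rpower_1 by auto.
    assert (HS := Hs (S n)). rewrite S_INR in *.
    set (P := prod_f_R0 (fun k => s + INR k) n) in *.
    set (P' := prod_f_R0 (fun k => s + 1 + INR k) n) in *.
    replace P' with (P * (s + (INR n + 1)) / s) by (rewrite H2; field; auto).
    field. repeat split; auto; lra.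
  - replace (Finite (L / s)) with (Finite (L * ((1 + (s + 1) * 0) / s))) by (f_equal; field; auto).
    apply is_lim_seq_mult'; auto.
    apply (is_lim_seq_ex_derive (fun x => (1 + (s + 1) * x) / s) _ 0); [auto_derive; auto|reflexivity|apply lim_inv_INR].
Qed.

(** * Taylor remainders of e^(-t) and the regularised Gamma integral *)

Definition exp_rem (J : nat) (t : R) : R :=
  exp (- t) - rsum (fun k => (- t) ^ k / INR (fact k)) J.

Lemma is_derive_pow_fact J x :
  is_derive (fun x => x ^ S J / INR (fact (S J))) x (x ^ J / INR (fact J)).
Proof.
  apply (is_derive_ext_R (fun x => / INR (fact (S J)) * x ^ S J)); [intros; unfold Rdiv; ring|].
  evar_last.
  - apply is_derive_Rscal. apply (is_derive_Reals (fun x => x ^ S J)). apply derivable_pt_lim_pow.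
  - rewrite fact_simpl, mult_INR. change (pred (S J)) with J.
    assert (INR (S J) <> 0) by (apply not_0_INR; lia). assert (Hf := INR_fact_neq_0 J).
    field. auto.
Qed.

Lemma neg_pow u n : (- u) ^ n = (-1) ^ n * u ^ n.
Proof. rewrite <- Rpow_mult_distr. f_equal. ring. Qed.

Lemma is_derive_exp_rem J t : is_derive (exp_rem (S J)) t (- exp_rem J t).
Proof.
  unfold exp_rem. induction J as [|J IH].
  - simpl. auto_derive; trivial. field.
  - apply (is_derive_ext_R (fun t => (exp (- t) - rsum (fun k => (- t) ^ k / INR (fact k)) (S J)) -
       (- t) ^ S J / INR (fact (S J)))).
    { intros u. change (rsum ?f (S (S J))) with (rsum f (S J) + f (S J)). cbv beta. ring. }
    evar_last.
    + apply (is_derive_minus (V := R_NormedModule)); [exact IH|].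
      apply (is_derive_ext_R (fun t => (-1) ^ S J * (t ^ S J / INR (fact (S J))))).
      { intros u. rewrite (neg_pow u). unfold Rdiv. ring. }
      apply is_derive_Rscal, is_derive_pow_fact.
    + unfold minus, plus, opp; cbn [AbelianGroup.opp].
      change (rsum ?f (S J)) with (rsum f J + f J). cbv beta. rewrite (neg_pow t J).
      simpl. unfold Rdiv. ring.
Qed.

Lemma exp_rem_0 J : exp_rem (S J) 0 = 0.
Proof.
  unfold exp_rem. rewrite Ropp_0, exp_0. induction J as [|J IH].
  - simpl. field.
  - change (rsum ?f (S (S J))) with (rsum f (S J) + f (S J)). cbv beta.
    rewrite pow_i by lia. unfold Rdiv at 2. rewrite Rmult_0_l. lra.
Qed.

(** Differentiation lowers J by one and flips the sign, so both inequalities follow by induction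
    from monotonicity on [0, t]. *)
Lemma exp_rem_sign_bound J t : 0 <= t -> 0 <= (-1) ^ J * exp_rem J t <= t ^ J / INR (fact J).
Proof.
  revert t. induction J as [|J IH]; intros t Ht.
  - unfold exp_rem. simpl. assert (H := exp_pos (- t)).
    assert (exp (- t) <= 1). { rewrite <- exp_0. destruct Ht as [Ht| <-]; [left; apply exp_increasing; lra|rewrite Ropp_0; lra]. }
    lra.
  - assert (Hd : forall x, is_derive (fun x => (-1) ^ S J * exp_rem (S J) x) x ((-1) ^ J * exp_rem J x)).
    { intros x. evar_last; [apply is_derive_Rscal, is_derive_exp_rem|]. simpl. ring. }
    split.
    + replace 0 with ((-1) ^ S J * exp_rem (S J) 0) by (rewrite exp_rem_0; ring).
      apply (nondecreasing_of_derive (fun x => (-1) ^ S J * exp_rem (S J) x) (fun x => (-1) ^ J * exp_rem J x)); auto.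
      intros x Hx. apply IH. lra.
    + set (G := fun x => x ^ S J / INR (fact (S J)) - (-1) ^ S J * exp_rem (S J) x).
      assert (H : G 0 <= G t).
      { apply nondecreasing_of_derive with (fun x => x ^ J / INR (fact J) - (-1) ^ J * exp_rem J x); auto.
        - intros x _. evar_last.
          + apply (is_derive_minus (V := R_NormedModule)); [apply is_derive_pow_fact|apply Hd].
          + reflexivity.
        - intros x Hx. generalize (IH x ltac:(lra)). lra. }
      unfold G in H. rewrite exp_rem_0, pow_i in H by lia. unfold Rdiv in H at 1. lra.
Qed.

Lemma exp_rem_bound J t : 0 <= t -> Rabs (exp_rem J t) <= t ^ J / INR (fact J).
Proof.
  intros Ht. generalize (exp_rem_sign_bound J t Ht). intros H.
  replace (Rabs (exp_rem J t)) with (Rabs ((-1) ^ J * exp_rem J t)).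
  - rewrite Rabs_pos_eq; lra.
  - rewrite Rabs_mult, pow_1_abs. ring.
Qed.

Lemma exp_rem_S J t : exp_rem (S J) t = exp_rem J t - (- t) ^ J / INR (fact J).
Proof. unfold exp_rem. simpl rsum. ring. Qed.

(** The order t^J, one less than the order of vanishing at 0, is what controls this remainder at
    infinity. *)
Lemma exp_rem_S_bound J t : 0 <= t -> Rabs (exp_rem (S J) t) <= 2 * (t ^ J / INR (fact J)).
Proof.
  intros Ht. rewrite exp_rem_S. unfold Rminus. eapply Rle_trans; [apply Rabs_triang|].
  rewrite Rabs_Ropp. unfold Rdiv at 1. rewrite Rabs_mult, <- RPow_abs, Rabs_Ropp, (Rabs_pos_eq t) by auto.
  rewrite (Rabs_pos_eq (/ _)) by (left; apply Rinv_0_lt_compat, INR_fact_lt_0).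
  generalize (exp_rem_bound J t Ht). unfold Rdiv. lra.
Qed.

(* Subtracting J Taylor terms of e^(-t) extends the Gamma integral to -J < Re s < 1 - J. *)
Definition reg_kernel (J : nat) (sigma b v : R) : R := exp (- sigma * v) * exp_rem J (b * exp v).

Lemma continuous_exp_rem J t : continuous (exp_rem J) t.
Proof.
  destruct J as [|J].
  - apply continuous_ex_derive. unfold exp_rem. simpl. auto_derive. trivial.
  - apply continuous_ex_derive. eexists; apply is_derive_exp_rem.
Qed.

Lemma continuous_reg_kernel J sigma b v : continuous (reg_kernel J sigma b) v.
Proof.
  unfold reg_kernel. apply continuous_Rmult.
  - apply continuous_ex_derive. auto_derive. trivial.
  - apply (continuous_comp (fun v => b * exp v) (exp_rem J)); [|apply continuous_exp_rem].
    apply continuous_ex_derive. auto_derive. trivial.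
Qed.

Lemma reg_integral_0 sigma : sigma < 0 ->
  exists L, 0 < L /\ int_line (reg_kernel 0 sigma 1) L /\ int_line (gamma_kernel (- sigma)) L.
Proof.
  intros H. destruct (gamma_integral_exists (- sigma)) as [L [HL HL0]]; [lra|].
  exists L. repeat split; auto. eapply int_line_ext; [|exact HL].
  intros v. unfold gamma_kernel, reg_kernel, exp_rem. simpl. rewrite Rminus_0_r, <- exp_plus. f_equal. ring.
Qed.

(** Integration by parts. The boundary terms vanish at -infinity by the bound of order J+1, as sigma
    < J+1, and at +infinity by the bound of order J, as sigma > J. *)
Lemma reg_integral_step J sigma L : INR J < sigma < INR J + 1 ->
  int_line (reg_kernel J (sigma - 1) 1) L -> int_line (reg_kernel (S J) sigma 1) (L / - sigma).
Proof.
  intros Hs HL. assert (HJ := pos_INR J).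
  assert (H0 : int_line (fun v => - sigma * reg_kernel (S J) sigma 1 v - reg_kernel J (sigma - 1) 1 v) (0 - 0)).
  { apply int_line_FTC with (reg_kernel (S J) sigma 1).
    - intros v.
      assert (Hc : is_derive (fun v => exp_rem (S J) (1 * exp v)) v (exp v * - exp_rem J (1 * exp v))).
      { apply (is_derive_comp (exp_rem (S J)) (fun v => 1 * exp v)); [apply is_derive_exp_rem|].
        auto_derive; trivial. ring. }
      assert (He : is_derive (fun v => exp (- sigma * v)) v (- sigma * exp (- sigma * v))).
      { auto_derive; trivial. ring. }
      evar_last; [exact (is_derive_Rmult _ _ _ _ _ He Hc)|].
      unfold reg_kernel.
      replace (exp (- (sigma - 1) * v)) with (exp (- sigma * v) * exp v) by (rewrite <- exp_plus; f_equal; ring).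
      ring.
    - intros v. apply continuous_Rminus; [apply continuous_Rscal|]; apply continuous_reg_kernel.
    - apply filterlim_squeeze_0 with (fun v => / INR (fact (S J)) * exp ((INR (S J) - sigma) * v)); [apply Rbar_locally_filter| |].
      + apply filter_forall. intros v. unfold reg_kernel. rewrite Rmult_1_l, Rabs_mult, Rabs_pos_eq by (left; apply exp_pos).
        replace ((INR (S J) - sigma) * v) with (- sigma * v + INR (S J) * v) by ring.
        rewrite exp_plus, <- exp_pow.
        replace (/ INR (fact (S J)) * (exp (- sigma * v) * exp v ^ S J)) with
          (exp (- sigma * v) * (exp v ^ S J / INR (fact (S J)))) by (unfold Rdiv; ring).
        apply Rmult_le_compat_l; [left; apply exp_pos|]. apply exp_rem_bound. left; apply exp_pos.
      + apply filterlim_to with (/ INR (fact (S J)) * 0); [|ring].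
        apply filterlim_Rscal; [apply Rbar_locally_filter|]. apply filterlim_exp_m. rewrite S_INR. lra.
    - apply filterlim_squeeze_0 with (fun v => (2 / INR (fact J)) * exp ((INR J - sigma) * v)); [apply Rbar_locally_filter| |].
      + apply filter_forall. intros v. unfold reg_kernel. rewrite Rmult_1_l, Rabs_mult, Rabs_pos_eq by (left; apply exp_pos).
        replace ((INR J - sigma) * v) with (- sigma * v + INR J * v) by ring.
        rewrite exp_plus, <- exp_pow.
        replace (2 / INR (fact J) * (exp (- sigma * v) * exp v ^ J)) with
          (exp (- sigma * v) * (2 * (exp v ^ J / INR (fact J)))) by (unfold Rdiv; ring).
        apply Rmult_le_compat_l; [left; apply exp_pos|]. apply exp_rem_S_bound. left; apply exp_pos.
      + apply filterlim_to with (2 / INR (fact J) * 0); [|ring].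
        apply filterlim_Rscal; [apply Rbar_locally_filter|]. apply filterlim_exp_p. lra. }
  apply int_line_ext with (fun v => / - sigma * ((- sigma * reg_kernel (S J) sigma 1 v - reg_kernel J (sigma - 1) 1 v) + reg_kernel J (sigma - 1) 1 v)).
  { intros v. field. lra. }
  replace (L / - sigma) with (/ - sigma * ((0 - 0) + L)) by (field; lra).
  assert (Hc1 : forall v, continuous (fun v => - sigma * reg_kernel (S J) sigma 1 v - reg_kernel J (sigma - 1) 1 v) v).
  { intros v. apply continuous_Rminus; [apply continuous_Rscal|]; apply continuous_reg_kernel. }
  apply int_line_scal.
  - intros v. apply continuous_Rplus; auto. apply continuous_reg_kernel.
  - apply int_line_plus; auto. apply continuous_reg_kernel.
Qed.

(** L is Gamma(-sigma). It is reached from the parameter sigma-J in (-1, 0) by J integrations by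
    parts, with [gauss_shift] carrying Gauss' limit along. That L is nonzero allows division by it
    when Hasse's series is integrated. *)
Lemma reg_integral J sigma : INR J - 1 < sigma < INR J ->
  exists L, L <> 0 /\ int_line (reg_kernel J sigma 1) L /\ is_lim_seq (gauss_term (- sigma)) L /\
    ((0 < J)%nat -> is_lim_seq (gauss_term (1 - sigma)) (- sigma * L)).
Proof.
  revert sigma. induction J as [|J IH]; intros sigma Hs.
  - simpl in Hs. destruct (reg_integral_0 sigma) as [L [H0 [H1 H2]]]; [lra|].
    exists L. repeat split; auto; [lra| |lia]. apply gauss_lim; auto. lra.
  - rewrite S_INR in Hs. assert (HJ := pos_INR J).
    destruct (IH (sigma - 1)) as [L [H0 [H1 [H2 _]]]]; [lra|].
    replace (- (sigma - 1)) with (- sigma + 1) in H2 by ring.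
    exists (L / - sigma). split.
    { apply Rmult_integral_contrapositive_currified; auto. apply Rinv_neq_0_compat. lra. }
    split; [apply reg_integral_step; auto; lra|]. split.
    + apply gauss_shift; auto. intros k E.
      assert (Hk : sigma = INR k) by lra.
      assert (INR J < INR k) by lra. assert (INR k < INR (S J)) by (rewrite S_INR; lra).
      apply INR_lt in H. apply INR_lt in H3. lia.
    + intros _. replace (1 - sigma) with (- sigma + 1) by ring.
      replace (- sigma * (L / - sigma)) with L by (field; lra). exact H2.
Qed.

Lemma reg_integral_scaled J sigma L b : 0 < b ->
  int_line (reg_kernel J sigma 1) L -> int_line (reg_kernel J sigma b) (Rpower b sigma * L).
Proof.
  intros Hb HL.
  apply int_line_ext with (fun v => Rpower b sigma * reg_kernel J sigma 1 (v + ln b)).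
  - intros v. unfold reg_kernel, Rpower. rewrite Rmult_1_l, (exp_plus v), exp_ln by auto.
    rewrite <- Rmult_assoc, <- exp_plus. f_equal; f_equal; ring.
  - apply int_line_scal.
    + intros v. apply (continuous_comp (fun v => v + ln b) (reg_kernel J sigma 1)); [|apply continuous_reg_kernel].
      apply continuous_ex_derive. auto_derive. trivial.
    + apply int_line_shift; auto. apply continuous_reg_kernel.
Qed.

(** * Finite differences and the logarithm series *)

Definition fdiff (n : nat) (f : nat -> R) : R := rsum (fun k => (-1) ^ k * Binomial.C n k * f k) (S n).

Lemma rsum_ext f g n : (forall k, (k < n)%nat -> f k = g k) -> rsum f n = rsum g n.
Proof.
  induction n as [|n IH]; intros H; [reflexivity|]. simpl. rewrite IH, H; auto.
Qed.

Lemma rsum_plus f g n : rsum (fun k => f k + g k) n = rsum f n + rsum g n.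
Proof. induction n as [|n IH]; simpl; [ring|]. rewrite IH. ring. Qed.

Lemma rsum_first f n : rsum f (S n) = f O + rsum (fun k => f (S k)) n.
Proof. induction n as [|n IH]; simpl in *; [ring|]. rewrite IH. ring. Qed.

Lemma rsum_swap (u : nat -> nat -> R) M N :
  rsum (fun n => rsum (u n) N) M = rsum (fun j => rsum (fun n => u n j) M) N.
Proof.
  induction M as [|M IH]; simpl.
  - induction N as [|N IHN]; simpl; [reflexivity|]. rewrite <- IHN. ring.
  - rewrite IH. now rewrite <- rsum_plus.
Qed.

Lemma binom_n_n n : Binomial.C n n = 1.
Proof. unfold Binomial.C. rewrite Nat.sub_diag. simpl (INR (fact 0)). field. apply INR_fact_neq_0. Qed.

Lemma binom_n_0 n : Binomial.C n 0 = 1.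
Proof. unfold Binomial.C. rewrite Nat.sub_0_r. simpl (INR (fact 0)). field. apply INR_fact_neq_0. Qed.

Lemma fdiff_S n f : fdiff (S n) f = fdiff n f - fdiff n (fun k => f (S k)).
Proof.
  unfold fdiff. rewrite rsum_first.
  change (rsum (fun k => (-1) ^ S k * Binomial.C (S n) (S k) * f (S k)) (S n)) with
    (rsum (fun k => (-1) ^ S k * Binomial.C (S n) (S k) * f (S k)) n +
     (-1) ^ S n * Binomial.C (S n) (S n) * f (S n)).
  rewrite (rsum_first (fun k => (-1) ^ k * Binomial.C n k * f k)).
  change (rsum (fun k => (-1) ^ k * Binomial.C n k * f (S k)) (S n)) with
    (rsum (fun k => (-1) ^ k * Binomial.C n k * f (S k)) n + (-1) ^ n * Binomial.C n n * f (S n)).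
  rewrite !binom_n_n, !binom_n_0.
  rewrite (rsum_ext (fun k => (-1) ^ S k * Binomial.C (S n) (S k) * f (S k))
    (fun k => (-1) ^ S k * Binomial.C n (S k) * f (S k) + (-1) * ((-1) ^ k * Binomial.C n k * f (S k)))).
  - rewrite rsum_plus, rsum_scal. simpl pow. ring.
  - intros k Hk. rewrite <- Binomial.pascal by lia. simpl pow. ring.
Qed.

Lemma fdiff_ext n f g : (forall k, f k = g k) -> fdiff n f = fdiff n g.
Proof. intros H. apply rsum_ext. intros k _. now rewrite H. Qed.

Lemma fdiff_minus n f g : fdiff n (fun k => f k - g k) = fdiff n f - fdiff n g.
Proof.
  unfold fdiff. rewrite (rsum_ext _ (fun k => (-1) ^ k * Binomial.C n k * f k + (-1) * ((-1) ^ k * Binomial.C n k * g k))) by (intros; ring).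
  rewrite rsum_plus, rsum_scal. ring.
Qed.

Lemma fdiff_scal n c f : fdiff n (fun k => c * f k) = c * fdiff n f.
Proof. unfold fdiff. rewrite <- rsum_scal. apply rsum_ext. intros; ring. Qed.

Lemma fdiff_pow n q : fdiff n (fun k => q ^ k) = (1 - q) ^ n.
Proof.
  induction n as [|n IH]; [unfold fdiff; simpl; rewrite binom_n_0; ring|].
  rewrite (fdiff_S n (fun k => q ^ k)), IH.
  rewrite (fdiff_ext n (fun k => q ^ S k) (fun k => q * q ^ k)) by reflexivity.
  rewrite (fdiff_scal n q (fun k => q ^ k)), IH. simpl. ring.
Qed.

(* [f] is a polynomial of degree less than [d], expressed by the vanishing of its d-th difference. *)
Fixpoint poly_seq (d : nat) (f : nat -> R) : Prop :=
  match d with O => forall k, f k = 0 | S d => poly_seq d (fun k => f k - f (S k)) end.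

Lemma poly_seq_ext d f g : (forall k, f k = g k) -> poly_seq d f -> poly_seq d g.
Proof.
  revert f g. induction d as [|d IH]; simpl; intros f g H Hf.
  - intros k. now rewrite <- H.
  - eapply IH; [|exact Hf]. intros k. simpl. now rewrite !H.
Qed.

Lemma poly_seq_minus d f g : poly_seq d f -> poly_seq d g -> poly_seq d (fun k => f k - g k).
Proof.
  revert f g. induction d as [|d IH]; simpl; intros f g Hf Hg.
  - intros k. rewrite Hf, Hg. ring.
  - eapply poly_seq_ext; [|exact (IH _ _ Hf Hg)]. intros k. simpl. ring.
Qed.

Lemma poly_seq_shift d f : poly_seq d f -> poly_seq d (fun k => f (S k)).
Proof. revert f. induction d as [|d IH]; simpl; intros f Hf; auto. exact (IH _ Hf). Qed.

Lemma poly_seq_mult d f a : poly_seq d f -> poly_seq (S d) (fun k => (a + INR k) * f k).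
Proof.
  revert f. induction d as [|d IH]; intros f Hf.
  - simpl in *. intros k. rewrite !Hf. ring.
  - change (poly_seq (S d) (fun k => (a + INR k) * f k - (a + INR (S k)) * f (S k))).
    eapply poly_seq_ext; [|exact (poly_seq_minus (S d) _ _ (IH _ Hf) (poly_seq_shift (S d) f Hf))].
    intros k. cbv beta. rewrite S_INR. ring.
Qed.

Lemma poly_seq_pow j a : poly_seq (S j) (fun k => (a + INR k) ^ j).
Proof.
  induction j as [|j IH]; [simpl; intros; ring|].
  exact (poly_seq_mult (S j) (fun k => (a + INR k) ^ j) a IH).
Qed.

Lemma fdiff_poly_seq n d f : (d <= n)%nat -> poly_seq d f -> fdiff n f = 0.
Proof.
  revert d f. induction n as [|n IH]; intros d f Hd Hf.
  - replace d with O in Hf by lia. unfold fdiff. simpl. rewrite (Hf O). ring.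
  - destruct d as [|d].
    + unfold fdiff. rewrite (rsum_ext _ (fun k => 0 * 0)) by (intros; rewrite (Hf k); ring).
      rewrite rsum_scal. ring.
    + rewrite fdiff_S, <- fdiff_minus. apply IH with d; [lia|exact Hf].
Qed.

(** The derivative of the error is a tail of the geometric series, which the mean value theorem
    bounds on [0, u]. *)
Lemma log_series u : 0 <= u < 1 -> is_series (fun n => u ^ S n / INR (S n)) (- ln (1 - u)).
Proof.
  intros Hu. change (is_lim_seq (sum_n (fun n => u ^ S n / INR (S n))) (- ln (1 - u))).
  apply is_lim_seq_minus_0.
  apply is_lim_seq_squeeze0 with (fun M => u / (1 - u) * u ^ S M).
  - intros M.
    set (f := fun x => sum_n (fun n => x ^ S n / INR (S n)) M - - ln (1 - x)).
    assert (Hb := mean_value_bound f (fun x => sum_n (fun n => x ^ n) M - / (1 - x)) 0 u (u ^ S M / (1 - u))).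
    assert (Hf0 : f 0 = 0).
    { unfold f. rewrite Rminus_0_r, ln_1. rewrite (sum_n_ext_R _ (fun _ => 0)).
      - rewrite sum_n_const. ring.
      - intros k. rewrite pow_i by lia. unfold Rdiv. ring. }
    assert (Hgeom : forall x M, x < 1 -> sum_n (fun n => x ^ n) M = (1 - x ^ S M) / (1 - x)).
    { intros x m Hx. induction m as [|m IH]; [rewrite sum_O; simpl; field; lra|].
      rewrite sum_n_S, IH. simpl. field. lra. }
    replace (sum_n _ M - - ln (1 - u)) with (f u - f 0) by (rewrite Hf0; unfold f; ring).
    rewrite Rminus_0_r, (Rabs_pos_eq u) in Hb by lra.
    replace (u / (1 - u) * u ^ S M) with (u ^ S M / (1 - u) * u) by (field; lra).
    apply Hb; intros x Hx; rewrite Rmin_left, Rmax_right in Hx by lra.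
    + unfold f. evar_last.
      * apply (is_derive_minus (V := R_NormedModule)).
        -- apply (is_derive_sum_n_R (fun n x => x ^ S n / INR (S n)) (fun n x => x ^ n)).
           intros n. assert (Hn : INR (S n) <> 0) by (apply not_0_INR; lia).
           apply (is_derive_ext_R (fun x => / INR (S n) * x ^ S n)); [intros; unfold Rdiv; ring|].
           evar_last; [apply is_derive_Rscal; apply (is_derive_Reals (fun x => x ^ S n)); apply derivable_pt_lim_pow|].
           change (pred (S n)) with n. field. auto.
        -- auto_derive; [lra|reflexivity].
      * unfold minus, plus, opp; simpl. field. lra.
    + rewrite Hgeom by lra.
      replace ((1 - x ^ S M) / (1 - x) - / (1 - x)) with (- (x ^ S M / (1 - x))) by (field; lra).
      rewrite Rabs_Ropp, Rabs_pos_eq.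
      * apply Rmult_le_compat.
        -- apply pow_le; lra.
        -- left. apply Rinv_0_lt_compat. lra.
        -- apply pow_incr; lra.
        -- apply Rinv_le_contravar; lra.
      * apply Rmult_le_pos; [apply pow_le; lra|left; apply Rinv_0_lt_compat; lra].
  - replace (Finite 0) with (Finite (u / (1 - u) * 0)) by (f_equal; ring).
    apply is_lim_seq_mult'; [apply is_lim_seq_const|].
    apply (is_lim_seq_incr_1 (fun n => u ^ n)). apply is_lim_seq_geom. rewrite Rabs_pos_eq; lra.
Qed.

(** * Hasse's series *)

Definition generating (a t : R) : R := t * (exp (- a * t) / (1 - exp (- t))).

Definition hasse_term (sigma a : R) (n : nat) : R :=
  / INR (S n) * fdiff n (fun k => Rpower (a + INR k) sigma).

Definition hasse_poly (J n : nat) (a t : R) : R :=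
  fdiff n (fun k => rsum (fun j => (- ((a + INR k) * t)) ^ j / INR (fact j)) J).

Lemma fdiff_rsum n (u : nat -> nat -> R) J :
  fdiff n (fun k => rsum (u k) J) = rsum (fun j => fdiff n (fun k => u k j)) J.
Proof.
  unfold fdiff. rewrite <- rsum_swap. apply rsum_ext. intros k _. now rewrite rsum_scal.
Qed.

Lemma hasse_poly_coef J n a t :
  hasse_poly J n a t =
  rsum (fun j => ((-1) ^ j / INR (fact j) * fdiff n (fun k => (a + INR k) ^ j)) * t ^ j) J.
Proof.
  unfold hasse_poly. rewrite fdiff_rsum. apply rsum_ext. intros j _.
  rewrite (fdiff_ext n _ (fun k => ((-1) ^ j / INR (fact j) * t ^ j) * (a + INR k) ^ j)).
  - rewrite fdiff_scal. ring.
  - intros k. rewrite neg_pow, Rpow_mult_distr. unfold Rdiv. ring.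
Qed.

(** An n-th difference kills polynomials in k of degree below n, so only the terms n < J of Hasse's
    series are affected by the subtracted Taylor polynomial. *)
Lemma hasse_poly_vanish J n a t : (J <= n)%nat -> hasse_poly J n a t = 0.
Proof.
  intros H. rewrite hasse_poly_coef, (rsum_ext _ (fun _ => 0 * 0)).
  - rewrite rsum_scal. ring.
  - intros j Hj. rewrite (fdiff_poly_seq n (S j)); [ring|lia|apply poly_seq_pow].
Qed.

(** In the variable k the exponential is a multiple of q^k with q = e^(-t), and the n-th difference
    of q^k is (1-q)^n. *)
Lemma fdiff_exp_rem J n a t :
  fdiff n (fun k => exp_rem J ((a + INR k) * t)) =
  exp (- a * t) * (1 - exp (- t)) ^ n - hasse_poly J n a t.
Proof.
  unfold exp_rem. rewrite (fdiff_minus n (fun k => exp (- ((a + INR k) * t)))). unfold hasse_poly. f_equal.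
  rewrite (fdiff_ext n _ (fun k => exp (- a * t) * exp (- t) ^ k)).
  - rewrite (fdiff_scal n _ (fun k => exp (- t) ^ k)). now rewrite fdiff_pow.
  - intros k. rewrite exp_pow, <- exp_plus. f_equal. ring.
Qed.

(** Its integral over the line is the n-th term of Hasse's series times Gamma(-sigma), in the strip
    where J Taylor terms regularise the Gamma integral. *)
Definition hasse_kernel (J n : nat) (sigma a v : R) : R :=
  exp (- sigma * v) * (/ INR (S n) *
    (exp (- a * exp v) * (1 - exp (- exp v)) ^ n - hasse_poly J n a (exp v))).

Lemma hasse_kernel_eq J n sigma a v :
  hasse_kernel J n sigma a v =
  rsum (fun k => (/ INR (S n) * ((-1) ^ k * Binomial.C n k)) * reg_kernel J sigma (a + INR k) v) (S n).
Proof.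
  unfold hasse_kernel. rewrite <- fdiff_exp_rem. unfold fdiff.
  rewrite <- !rsum_scal. apply rsum_ext. intros k _. unfold reg_kernel. ring.
Qed.

Lemma hasse_kernel_integral J n sigma a L : 0 < a ->
  int_line (reg_kernel J sigma 1) L ->
  int_line (hasse_kernel J n sigma a) (hasse_term sigma a n * L) /\
  (forall v, continuous (hasse_kernel J n sigma a) v).
Proof.
  intros Ha HL.
  destruct (int_line_rsum (fun k v => (/ INR (S n) * ((-1) ^ k * Binomial.C n k)) * reg_kernel J sigma (a + INR k) v)
     (fun k => (/ INR (S n) * ((-1) ^ k * Binomial.C n k)) * (Rpower (a + INR k) sigma * L)) (S n)) as [H1 H2].
  - intros k v. apply continuous_Rscal, continuous_reg_kernel.
  - intros k _. apply int_line_scal; [apply continuous_reg_kernel|].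
    apply reg_integral_scaled; auto. generalize (pos_INR k). lra.
  - split.
    + eapply int_line_ext; [intros v; symmetry; apply hasse_kernel_eq|].
      replace (hasse_term sigma a n * L) with
        (rsum (fun k => / INR (S n) * ((-1) ^ k * Binomial.C n k) * (Rpower (a + INR k) sigma * L)) (S n)); [exact H1|].
      unfold hasse_term, fdiff. rewrite <- rsum_scal, (Rmult_comm _ L), <- rsum_scal.
      apply rsum_ext. intros; ring.
    + intros v. eapply continuous_ext; [intros u; symmetry; apply hasse_kernel_eq|]. apply H2.
Qed.

Lemma one_minus_exp_bounds t : 0 < t -> 0 < 1 - exp (- t) < 1 /\ 1 - exp (- t) <= t /\ t <= (1 + t) * (1 - exp (- t)).
Proof.
  intros Ht. assert (H := exp_neg_lt_1 t Ht). assert (H1 := exp_ineq1_le (- t)). assert (H2 := exp_ineq1_le t).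
  assert (H3 : exp (- t) * exp t = 1) by (rewrite <- exp_plus; replace (- t + t) with 0 by ring; apply exp_0).
  repeat split; try lra. nra.
Qed.

(** For u = 1-e^(-t) one has -ln(1-u) = t. Thus the factors 1/(n+1) of Hasse's series are precisely
    what sums the powers of u to t/(1-e^(-t)). *)
Lemma log_series_generating t : 0 < t ->
  is_series (fun n => (1 - exp (- t)) ^ n / INR (S n)) (t / (1 - exp (- t))).
Proof.
  intros Ht. destruct (one_minus_exp_bounds t Ht) as [H _].
  assert (Hs := log_series (1 - exp (- t)) ltac:(lra)).
  replace (1 - (1 - exp (- t))) with (exp (- t)) in Hs by ring. rewrite ln_exp in Hs.
  assert (Hs2 := is_series_scal_l (K := R_AbsRing) (/ (1 - exp (- t))) _ _ Hs).
  unfold scal in Hs2; simpl in Hs2; unfold mult in Hs2; simpl in Hs2.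
  replace (t / (1 - exp (- t))) with (/ (1 - exp (- t)) * - - t) by (field; lra).
  revert Hs2. apply is_series_ext. intros n. change (match n with O => 1 | S _ => INR n + 1 end) with (INR (S n)).
  match goal with |- ?x = ?y => change (x = y :> R) end.
  field. split; first [lra|apply not_0_INR; lia].
Qed.

Lemma log_series_tail J t : 0 < t ->
  Series (fun n => (1 - exp (- t)) ^ (J + n) / INR (S (J + n))) =
  t / (1 - exp (- t)) - rsum (fun n => (1 - exp (- t)) ^ n / INR (S n)) J.
Proof.
  intros Ht. assert (H := log_series_generating t Ht).
  assert (Hex : ex_series (fun n => (1 - exp (- t)) ^ n / INR (S n))) by (eexists; exact H).
  rewrite <- (is_series_unique _ _ H). destruct J as [|J]; [simpl rsum; rewrite Rminus_0_r; reflexivity|].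
  rewrite (Series_split _ J Hex), <- rsum_sum_n. ring.
Qed.

(** From 1-e^(-t) <= t the first J factors contribute at most t^J, and the remaining series is at
    most t/(1-e^(-t)) <= 1+t. For sigma < J the two summands of the bound are convergent Gamma
    integrands. *)
Lemma hasse_tail_dominated sigma J a M v : 0 < a ->
  rsum (fun n => exp (- sigma * v) * (exp (- a * exp v) * ((1 - exp (- exp v)) ^ (J + n) / INR (S (J + n))))) M
  <= exp ((INR J - sigma) * v) * exp (- a * exp v) + exp ((INR J - sigma + 1) * v) * exp (- a * exp v).
Proof.
  intros Ha. set (t := exp v). assert (Ht : 0 < t) by apply exp_pos.
  destruct (one_minus_exp_bounds t Ht) as [[H1 H2] [H3 H4]]. set (u := 1 - exp (- t)) in *.
  assert (Hex := log_series_generating t Ht). fold u in Hex.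
  assert (Hpos : forall n, 0 <= u ^ n / INR (S n)).
  { intros n. apply Rmult_le_pos; [apply pow_le; lra|]. left. apply Rinv_0_lt_compat, lt_0_INR. lia. }
  assert (Hb : rsum (fun n => u ^ (J + n) / INR (S (J + n))) M <= t ^ J * (1 + t)).
  { apply Rle_trans with (u ^ J * rsum (fun n => u ^ n / INR (S n)) M).
    - rewrite <- rsum_scal. clear Hex. induction M as [|M IH]; cbn [rsum]; [lra|].
      apply Rplus_le_compat; [exact IH|]. rewrite pow_add. unfold Rdiv. rewrite <- Rmult_assoc.
      apply Rmult_le_compat_l.
      + apply Rmult_le_pos; apply pow_le; lra.
      + apply Rinv_le_contravar; [apply lt_0_INR; lia|apply le_INR; lia].
    - assert (Hs : rsum (fun n => u ^ n / INR (S n)) M <= t / u).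
      { rewrite <- (is_series_unique _ _ Hex). apply rsum_le_Series; [eexists; exact Hex|exact Hpos]. }
      assert (t / u <= 1 + t) by (apply Rle_div_l; lra).
      apply Rmult_le_compat; [apply pow_le; lra| |apply pow_incr; lra|lra].
      clear Hex Hs. induction M as [|M IH]; cbn [rsum]; [lra|]. specialize (Hpos M). lra. }
  rewrite !rsum_scal.
  replace (exp ((INR J - sigma) * v) * exp (- a * t) + exp ((INR J - sigma + 1) * v) * exp (- a * t)) with
    (exp (- sigma * v) * (exp (- a * t) * (t ^ J * (1 + t)))).
  - apply Rmult_le_compat_l; [left; apply exp_pos|]. apply Rmult_le_compat_l; [left; apply exp_pos|exact Hb].
  - replace ((INR J - sigma) * v) with (- sigma * v + INR J * v) by ring.
    replace ((INR J - sigma + 1) * v) with (- sigma * v + INR J * v + v) by ring.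
    rewrite !exp_plus, <- (exp_pow v). fold t. ring.
Qed.

Lemma scaled_gamma_exists mu a : 0 < mu -> 0 < a ->
  exists I, int_line (fun v => exp (mu * v) * exp (- a * exp v)) I.
Proof.
  intros Hmu Ha. destruct (reg_integral_0 (- mu)) as [L [_ [HL _]]]; [lra|].
  exists (Rpower a (- mu) * L). eapply int_line_ext; [|exact (reg_integral_scaled 0 (- mu) L a Ha HL)].
  intros v. unfold reg_kernel, exp_rem. simpl. rewrite Rminus_0_r, Ropp_involutive. do 2 f_equal. ring.
Qed.

Lemma generating_decomposition J a t : 0 < t ->
  rsum (fun n => / INR (S n) * (exp (- a * t) * (1 - exp (- t)) ^ n - hasse_poly J n a t)) J
  + exp (- a * t) * Series (fun n => (1 - exp (- t)) ^ (J + n) / INR (S (J + n))) =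
  generating a t - rsum (fun n => / INR (S n) * hasse_poly J n a t) J.
Proof.
  intros Ht. rewrite log_series_tail by auto. unfold generating.
  rewrite (rsum_ext _ (fun n => exp (- a * t) * ((1 - exp (- t)) ^ n / INR (S n)) +
     (-1) * (/ INR (S n) * hasse_poly J n a t))) by (intros; unfold Rdiv; ring).
  rewrite rsum_plus, !rsum_scal. unfold Rdiv. ring.
Qed.

(** The kernels with n >= J are nonnegative, so [hasse_tail_dominated] bounds the partial sums of
    their integrals; this gives the convergence of Hasse's series as well as the exchange of sum and
    integral. The first J terms are added as a finite sum. *)
Theorem hasse_integral J sigma a L : 0 < a -> sigma < INR J -> L <> 0 ->
  int_line (reg_kernel J sigma 1) L ->
  int_line (fun v => exp (- sigma * v) * (generating a (exp v) -
      rsum (fun n => / INR (S n) * hasse_poly J n a (exp v)) J)) (L * Series (hasse_term sigma a)).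
Proof.
  intros Ha Hs HL0 HL.
  assert (Hc : forall n v, continuous (hasse_kernel J n sigma a) v).
  { intros n. apply (hasse_kernel_integral J n sigma a L Ha HL). }
  assert (HI : forall n, int_line (hasse_kernel J n sigma a) (hasse_term sigma a n * L)).
  { intros n. apply (hasse_kernel_integral J n sigma a L Ha HL). }
  assert (Hform : forall n v, hasse_kernel J (J + n) sigma a v =
     exp (- sigma * v) * (exp (- a * exp v) * ((1 - exp (- exp v)) ^ (J + n) / INR (S (J + n))))).
  { intros n v. unfold hasse_kernel. rewrite hasse_poly_vanish by lia. unfold Rdiv. ring. }
  assert (Hu : forall v, 0 < 1 - exp (- exp v) < 1).
  { intros v. apply (one_minus_exp_bounds (exp v) (exp_pos v)). }
  assert (Hpos : forall n v, 0 <= hasse_kernel J (J + n) sigma a v).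
  { intros n v. rewrite Hform. apply Rmult_le_pos; [left; apply exp_pos|].
    apply Rmult_le_pos; [left; apply exp_pos|]. apply Rmult_le_pos.
    - apply pow_le. generalize (Hu v). lra.
    - left. apply Rinv_0_lt_compat, lt_0_INR. lia. }
  destruct (scaled_gamma_exists (INR J - sigma) a) as [B1 HB1]; [lra|auto|].
  destruct (scaled_gamma_exists (INR J - sigma + 1) a) as [B2 HB2]; [lra|auto|].
  assert (Hcd : forall mu v, continuous (fun v => exp (mu * v) * exp (- a * exp v)) v).
  { intros mu v. apply continuous_ex_derive. auto_derive. trivial. }
  assert (HexI : ex_series (fun n => hasse_term sigma a (J + n) * L)).
  { apply is_series_nonneg_bounded with (B1 + B2).
    - intros n. eapply int_line_nonneg; [apply (Hc (J + n)%nat)|apply Hpos|apply HI].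
    - intros n. rewrite <- rsum_sum_n.
      destruct (int_line_rsum (fun k v => hasse_kernel J (J + k) sigma a v)
         (fun k => hasse_term sigma a (J + k) * L) (S n)) as [H1 H2].
      + intros k v. apply Hc.
      + intros k _. apply HI.
      + eapply int_line_le; [exact H2| | |exact H1|
          exact (int_line_plus _ _ _ _ (Hcd _) (Hcd _) HB1 HB2)].
        * intros v. apply continuous_Rplus; apply Hcd.
        * intros v. cbv beta. rewrite (rsum_ext _ _ _ (fun k _ => Hform k v)).
          apply (hasse_tail_dominated sigma J a (S n) v Ha). }
  destruct (int_line_Series (fun n v => hasse_kernel J (J + n) sigma a v)
     (fun n => hasse_term sigma a (J + n) * L) (fun n => hasse_term sigma a (J + n) * L)) as [_ [Hsw Hcsw]].
  - intros n v. apply Hc.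
  - intros A B.
    (* For v <= B the factor 1-exp(-e^v) is at most q < 1, so a geometric series dominates on the
       window. *)
    set (q := 1 - exp (- exp B)). assert (Hq : 0 < q < 1) by apply Hu.
    set (C := exp (Rabs sigma * (Rabs A + Rabs B))).
    exists (fun n => C * q ^ n). split.
    { apply ex_series_Rscal. exists (/ (1 - q)). apply is_series_geom. rewrite Rabs_pos_eq; lra. }
    intros n v Hv. rewrite Rabs_pos_eq by apply Hpos. rewrite Hform.
    assert (Huq : 1 - exp (- exp v) <= q).
    { unfold q. assert (exp (- exp B) <= exp (- exp v)); [|lra].
      destruct (Req_dec v B) as [->|Hne]; [lra|]. left. apply exp_increasing.
      assert (exp v < exp B) by (apply exp_increasing; lra). lra. }
    assert (Hpw : (1 - exp (- exp v)) ^ (J + n) / INR (S (J + n)) <= q ^ n).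
    { apply Rle_trans with ((1 - exp (- exp v)) ^ (J + n) * 1).
      - apply Rmult_le_compat_l; [apply pow_le; generalize (Hu v); lra|].
        rewrite <- Rinv_1. apply Rinv_le_contravar; [lra|]. apply (le_INR 1). lia.
      - rewrite Rmult_1_r, pow_add.
        assert (H1 : (1 - exp (- exp v)) ^ J <= 1).
        { apply Rle_trans with (1 ^ J); [apply pow_incr; generalize (Hu v); lra|rewrite pow1; lra]. }
        assert (H2 : (1 - exp (- exp v)) ^ n <= q ^ n) by (apply pow_incr; generalize (Hu v); lra).
        assert (0 <= (1 - exp (- exp v)) ^ J) by (apply pow_le; generalize (Hu v); lra).
        assert (0 <= (1 - exp (- exp v)) ^ n) by (apply pow_le; generalize (Hu v); lra).
        nra. }
    assert (He1 : exp (- sigma * v) <= C).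
    { unfold C. assert (Hle : - sigma * v <= Rabs sigma * (Rabs A + Rabs B)).
      { apply Rle_trans with (Rabs (- sigma * v)); [apply Rle_abs|].
        rewrite Rabs_mult, Rabs_Ropp. apply Rmult_le_compat_l; [apply Rabs_pos|].
        assert (HA := Rle_abs (- A)). rewrite Rabs_Ropp in HA. assert (HB := Rle_abs B).
        assert (HA2 := Rabs_pos A). assert (HB2' := Rabs_pos B). apply Rabs_le. lra. }
      destruct Hle as [Hlt|Heq]; [left; now apply exp_increasing|right; now rewrite Heq]. }
    assert (He2 : exp (- a * exp v) <= 1).
    { rewrite <- exp_0. left. apply exp_increasing. generalize (exp_pos v). nra. }
    assert (H0 : 0 <= (1 - exp (- exp v)) ^ (J + n) / INR (S (J + n))).
    { apply Rmult_le_pos; [apply pow_le; generalize (Hu v); lra|left; apply Rinv_0_lt_compat, lt_0_INR; lia]. }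
    apply Rmult_le_compat; auto.
    + left; apply exp_pos.
    + apply Rmult_le_pos; auto. left; apply exp_pos.
    + assert (H1 := exp_pos (- a * exp v)). nra.
  - intros n. apply HI.
  - intros n. eapply int_line_ext; [|apply HI]. intros v. symmetry. apply Rabs_pos_eq, Hpos.
  - exact HexI.
  - destruct (int_line_rsum (fun n v => hasse_kernel J n sigma a v) (fun n => hasse_term sigma a n * L) J) as [Hf Hcf].
    + intros k v. apply Hc.
    + intros k _. apply HI.
    + replace (L * Series (hasse_term sigma a)) with
        (rsum (fun n => hasse_term sigma a n * L) J + Series (fun n => hasse_term sigma a (J + n) * L)).
      * eapply int_line_ext; [|exact (int_line_plus _ _ _ _ Hcf Hcsw Hf Hsw)].
        intros v. cbv beta. rewrite <- generating_decomposition by apply exp_pos.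
        rewrite Rmult_plus_distr_l. f_equal.
        -- unfold hasse_kernel. now rewrite rsum_scal.
        -- rewrite <- !Series_scal_l. apply Series_ext. intros n. apply Hform.
      * rewrite Series_scal_r.
        (* Division by the nonzero L turns summability of the integrals into summability of Hasse's
           terms. *)
        assert (Hex : ex_series (hasse_term sigma a)).
        { apply (ex_series_incr_n _ J). apply ex_series_ext with (fun n => / L * (hasse_term sigma a (J + n) * L)).
          - intros n. match goal with |- ?x = ?y => change (x = y :> R) end. field. auto.
          - now apply ex_series_Rscal. }
        destruct J as [|J']; [simpl rsum; change (fun n => hasse_term sigma a (0 + n)) with (hasse_term sigma a); ring|].
        rewrite (Series_split _ J' Hex), <- rsum_sum_n.
        rewrite (rsum_ext (fun n => hasse_term sigma a n * L) (fun n => L * hasse_term sigma a n)) by (intros; ring).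
        rewrite rsum_scal. ring.
Qed.

Lemma hurwitz_zeta_hasse s a :
  hurwitz_zeta s a = / (s - 1) * Series (hasse_term (1 - s) a).
Proof.
  unfold hurwitz_zeta. f_equal. apply Series_ext. intros n. unfold hasse_term, fdiff.
  replace (n + 1)%nat with (S n) by lia. rewrite rsum_sum_n, sum_n_Reals. reflexivity.
Qed.

Definition bigO_pow (J : nat) (f : R -> R) : Prop :=
  exists K, forall t, 0 < t <= 1 -> Rabs (f t) <= K * t ^ J.

Lemma bigO_plus J f g : bigO_pow J f -> bigO_pow J g -> bigO_pow J (fun t => f t + g t).
Proof.
  intros [K HK] [K' HK']. exists (K + K'). intros t Ht.
  eapply Rle_trans; [apply Rabs_triang|]. specialize (HK t Ht). specialize (HK' t Ht). lra.
Qed.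

Lemma bigO_scal J c f : bigO_pow J f -> bigO_pow J (fun t => c * f t).
Proof.
  intros [K HK]. exists (Rabs c * K). intros t Ht. rewrite Rabs_mult, Rmult_assoc.
  apply Rmult_le_compat_l; [apply Rabs_pos|auto].
Qed.

Lemma bigO_rsum J (f : nat -> R -> R) n : (forall k, bigO_pow J (f k)) -> bigO_pow J (fun t => rsum (fun k => f k t) n).
Proof.
  intros H. induction n as [|n IH]; cbn [rsum].
  - exists 0. intros t _. rewrite Rabs_R0. lra.
  - now apply bigO_plus.
Qed.

Lemma bigO_ext J f g : (forall t, 0 < t -> f t = g t) -> bigO_pow J f -> bigO_pow J g.
Proof. intros H [K HK]. exists K. intros t Ht. rewrite <- H by lra. auto. Qed.

(** Uniqueness of asymptotic expansions: t -> 0 gives c 0 = 0, and after division by t the induction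
    continues. *)
Lemma bigO_poly_0 J (c : nat -> R) : bigO_pow J (fun t => rsum (fun j => c j * t ^ j) J) ->
  forall j, (j < J)%nat -> c j = 0.
Proof.
  revert c. induction J as [|J IH]; intros c [K HK] j Hj; [lia|].
  assert (Hsplit : forall t, rsum (fun j => c j * t ^ j) (S J) = c O + t * rsum (fun j => c (S j) * t ^ j) J).
  { intros t. rewrite rsum_first, <- rsum_scal. simpl pow at 1. rewrite Rmult_1_r. f_equal.
    apply rsum_ext. intros k _. simpl pow. ring. }
  assert (Hb : exists B, 0 <= B /\ forall t, 0 < t <= 1 -> Rabs (rsum (fun j => c (S j) * t ^ j) J) <= B).
  { exists (rsum (fun j => Rabs (c (S j))) J). split.
    - clear. induction J as [|J IH]; cbn [rsum]; [lra|]. generalize (Rabs_pos (c (S J))). lra.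
    - intros t Ht. clear -Ht. induction J as [|J IH]; cbn [rsum]; [rewrite Rabs_R0; lra|].
      eapply Rle_trans; [apply Rabs_triang|]. apply Rplus_le_compat; auto.
      rewrite Rabs_mult, (Rabs_pos_eq (t ^ J)) by (apply pow_le; lra).
      rewrite <- (Rmult_1_r (Rabs (c (S J)))) at 2. apply Rmult_le_compat_l; [apply Rabs_pos|].
      apply Rle_trans with (1 ^ J); [apply pow_incr; lra|rewrite pow1; lra]. }
  destruct Hb as [B [HB0 HB]].
  assert (Hc0 : c O = 0).
  { assert (HK0 : 0 <= K).
    { specialize (HK 1 ltac:(lra)). rewrite pow1, Rmult_1_r in HK. eapply Rle_trans; [apply Rabs_pos|exact HK]. }
    assert (Hle : forall t, 0 < t <= 1 -> Rabs (c O) <= (K + B) * t).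
    { intros t Ht. specialize (HK t Ht). rewrite Hsplit in HK. specialize (HB t Ht).
      set (X := rsum _ J) in *.
      replace (c O) with ((c O + t * X) + - (t * X)) by ring.
      eapply Rle_trans; [apply Rabs_triang|]. rewrite Rabs_Ropp, Rabs_mult, (Rabs_pos_eq t) by lra.
      assert (t ^ S J <= t).
      { simpl. apply Rle_trans with (t * 1); [|lra]. apply Rmult_le_compat_l; [lra|].
        apply Rle_trans with (1 ^ J); [apply pow_incr; lra|rewrite pow1; lra]. }
      assert (K * t ^ S J <= K * t) by (apply Rmult_le_compat_l; auto). nra. }
    apply NNPP. intros Hne. assert (Hp : 0 < Rabs (c O)) by now apply Rabs_pos_lt.
    (* For this t the bound (K+B)t is at most half of |c 0|, which contradicts [Hle]. *)
    set (t := Rmin 1 (Rabs (c O) / (2 * (K + B + 1)))).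
    assert (Hq : 0 < Rabs (c O) / (2 * (K + B + 1))) by (apply Rdiv_lt_0_compat; lra).
    assert (Ht : 0 < t <= 1).
    { split; [apply Rmin_pos; lra|apply Rmin_l]. }
    specialize (Hle t Ht).
    assert (Ht2 : t <= Rabs (c O) / (2 * (K + B + 1))) by apply Rmin_r.
    assert ((K + B) * t <= (K + B) * (Rabs (c O) / (2 * (K + B + 1)))) by (apply Rmult_le_compat_l; lra).
    assert ((K + B) * (Rabs (c O) / (2 * (K + B + 1))) <= Rabs (c O) / 2).
    { replace ((K + B) * (Rabs (c O) / (2 * (K + B + 1)))) with (Rabs (c O) / 2 * ((K + B) / (K + B + 1))) by (field; lra).
      rewrite <- (Rmult_1_r (Rabs (c O) / 2)) at 2. apply Rmult_le_compat_l; [lra|]. apply Rle_div_l; lra. }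
    lra. }
  destruct j as [|j]; [exact Hc0|].
  apply (IH (fun j => c (S j))); [|lia]. exists K. intros t Ht.
  specialize (HK t Ht). rewrite Hsplit, Hc0, Rplus_0_l, Rabs_mult, (Rabs_pos_eq t) in HK by lra.
  simpl in HK. apply Rmult_le_reg_l with t; lra.
Qed.

(** [vsum (J-1)] is O(t^(J-1)) and the factor t supplies the missing power. For J = 1 the expansion
    with J = 2 is used, since [vsum_bound] starts at e = 1. *)
Lemma bigO_bernoulli J a : (1 <= J)%nat -> 0 <= a <= 1 ->
  bigO_pow J (fun t => generating a t - rsum (fun l => bern_coef l a * t ^ l) J).
Proof.
  intros HJ Ha. unfold generating.
  assert (H2 : forall J, (2 <= J)%nat -> bigO_pow J (fun t => t * (vsum (J - 1) t a + vsum J t a))).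
  { clear J HJ. intros J HJ. apply (bigO_ext J (fun t => t * vsum (J - 1) t a + t * vsum J t a)); [intros; ring|].
    apply bigO_plus.
    - exists (2 * Series (fun m => / freq m ^ S (J - 1))). intros t Ht.
      rewrite Rabs_mult, (Rabs_pos_eq t) by lra.
      assert (Hb := vsum_bound (J - 1) t a ltac:(lia) ltac:(lra)).
      replace (t ^ J) with (t * t ^ (J - 1)) by (rewrite tech_pow_Rmult; f_equal; lia).
      replace (2 * Series (fun m => / freq m ^ S (J - 1)) * (t * t ^ (J - 1))) with
        (t * (2 * Series (fun m => / freq m ^ S (J - 1)) * t ^ (J - 1))) by ring.
      apply Rmult_le_compat_l; lra.
    - exists (2 * Series (fun m => / freq m ^ S J)). intros t Ht.
      rewrite Rabs_mult, (Rabs_pos_eq t) by lra.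
      assert (Hb := vsum_bound J t a ltac:(lia) ltac:(lra)).
      assert (H0 := Rabs_pos (vsum J t a)). nra. }
  destruct (Nat.eq_dec J 1) as [->|Hne].
  - destruct (H2 2%nat (le_n 2)) as [K HK].
    exists (Rabs (bern_coef 1 a) + Rabs K). intros t Ht.
    rewrite (generating_expansion 2) by (auto; lra). specialize (HK t Ht). cbn [rsum].
    match goal with |- Rabs (0 + ?x + ?y + ?z - (0 + ?x)) <= _ => replace (0 + x + y + z - (0 + x)) with (y + z) by ring end.
    eapply Rle_trans; [apply Rabs_triang|]. simpl pow in *. rewrite Rabs_mult, !Rmult_1_r, (Rabs_pos_eq t) by lra.
    rewrite Rmult_1_r in HK.
    assert (K * (t * t) <= Rabs K * t).
    { apply Rle_trans with (Rabs K * (t * t)); [apply Rmult_le_compat_r; [nra|apply Rle_abs]|].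
      apply Rmult_le_compat_l; [apply Rabs_pos|nra]. }
    lra.
  - eapply bigO_ext; [|apply (H2 J); lia]. intros t Ht. rewrite (generating_expansion J) by (auto; lia). ring.
Qed.

Lemma bigO_hasse J a : 0 < a ->
  bigO_pow J (fun t => generating a t - rsum (fun n => / INR (S n) * hasse_poly J n a t) J).
Proof.
  intros Ha.
  apply (bigO_ext J (fun t => rsum (fun n => / INR (S n) * fdiff n (fun k => exp_rem J ((a + INR k) * t))) J +
    exp (- a * t) * Series (fun n => (1 - exp (- t)) ^ (J + n) / INR (S (J + n))))).
  { intros t Ht. rewrite <- generating_decomposition by auto. f_equal. apply rsum_ext. intros n _.
    now rewrite fdiff_exp_rem. }
  apply bigO_plus.
  - apply bigO_rsum. intros n. apply bigO_scal. unfold fdiff. apply bigO_rsum. intros k. apply bigO_scal.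
    exists ((a + INR k) ^ J / INR (fact J)). intros t Ht.
    assert (Hk := pos_INR k). eapply Rle_trans; [apply exp_rem_bound; apply Rmult_le_pos; lra|].
    rewrite Rpow_mult_distr. unfold Rdiv. lra.
  - exists 2. intros t Ht. destruct (one_minus_exp_bounds t ltac:(lra)) as [[H1 H2] [H3 H4]].
    set (u := 1 - exp (- t)) in *.
    assert (Hs := log_series_generating t ltac:(lra)). fold u in Hs.
    assert (Hle : 0 <= Series (fun n => u ^ (J + n) / INR (S (J + n))) <= t ^ J * (t / u)).
    { rewrite <- (is_series_unique _ _ Hs), <- Series_scal_l.
      assert (Hcmp : forall n, 0 <= u ^ (J + n) / INR (S (J + n)) <= t ^ J * (u ^ n / INR (S n))).
      { intros n. split.
        - apply Rmult_le_pos; [apply pow_le; lra|left; apply Rinv_0_lt_compat, lt_0_INR; lia].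
        - rewrite pow_add. unfold Rdiv. rewrite Rmult_assoc. apply Rmult_le_compat.
          + apply pow_le; lra.
          + apply Rmult_le_pos; [apply pow_le; lra|left; apply Rinv_0_lt_compat, lt_0_INR; lia].
          + apply pow_incr; lra.
          + apply Rmult_le_compat_l; [apply pow_le; lra|]. apply Rinv_le_contravar; [apply lt_0_INR; lia|apply le_INR; lia]. }
      assert (Hex : ex_series (fun n => t ^ J * (u ^ n / INR (S n)))) by (apply ex_series_Rscal; eexists; exact Hs).
      split.
      - rewrite <- (Rmult_0_l (Series (fun n => u ^ (J + n) / INR (S (J + n))))), <- Series_scal_l. apply Series_le.
        + intros n. specialize (Hcmp n). lra.
        + apply ex_series_dominated with (2 := fun n => eq_ind_r (fun x => x <= _) (proj2 (Hcmp n)) (Rabs_pos_eq _ (proj1 (Hcmp n)))). exact Hex.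
      - apply Series_le; auto. }
    assert (Htu : t / u <= 2) by (apply Rle_div_l; nra).
    assert (He : 0 < exp (- a * t) <= 1).
    { split; [apply exp_pos|]. rewrite <- exp_0. left. apply exp_increasing. nra. }
    assert (HtJ : 0 <= t ^ J) by (apply pow_le; lra).
    rewrite Rabs_mult, !Rabs_pos_eq by lra. nra.
Qed.

(* Both sides are polynomials of degree less than J in t agreeing with [generating a] up to O(t^J). *)
Lemma hasse_poly_bernoulli J a t : (1 <= J)%nat -> 0 < a <= 1 ->
  rsum (fun n => / INR (S n) * hasse_poly J n a t) J = rsum (fun l => bern_coef l a * t ^ l) J.
Proof.
  intros HJ Ha.
  set (q := fun j => rsum (fun n => / INR (S n) * ((-1) ^ j / INR (fact j) * fdiff n (fun k => (a + INR k) ^ j))) J).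
  assert (Hq : forall t, rsum (fun n => / INR (S n) * hasse_poly J n a t) J = rsum (fun j => q j * t ^ j) J).
  { intros u. rewrite (rsum_ext _ (fun n => rsum (fun j => (/ INR (S n) * ((-1) ^ j / INR (fact j) *
       fdiff n (fun k => (a + INR k) ^ j))) * u ^ j) J)).
    - rewrite rsum_swap. apply rsum_ext. intros j _. unfold q. rewrite Rmult_comm, <- rsum_scal.
      apply rsum_ext. intros; ring.
    - intros n _. rewrite hasse_poly_coef, <- rsum_scal. apply rsum_ext. intros; ring. }
  assert (H : forall j, (j < J)%nat -> q j - bern_coef j a = 0).
  { apply (bigO_poly_0 J (fun j => q j - bern_coef j a)).
    assert (H1 := bigO_bernoulli J a HJ ltac:(lra)). assert (H2 := bigO_hasse J a ltac:(lra)).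
    refine (bigO_ext _ _ _ _ (bigO_plus _ _ _ H1 (bigO_scal _ (-1) _ H2))).
    intros u Hu. cbv beta. rewrite Hq.
    rewrite (rsum_ext (fun j => (q j - bern_coef j a) * u ^ j) (fun j => q j * u ^ j + (-1) * (bern_coef j a * u ^ j))) by (intros; ring).
    rewrite rsum_plus, rsum_scal. ring. }
  rewrite Hq. apply rsum_ext. intros j Hj. specialize (H j Hj). f_equal. lra.
Qed.

(** By Hasse's series zeta(1-sigma, a) is -1/sigma times the sum of [hasse_term], while
    Gamma(1-sigma) = -sigma L; the factors cancel and leave L times that sum. *)
Theorem gamma_zeta_integral J sigma a : (1 <= J)%nat -> INR J - 1 < sigma < INR J -> 0 < a <= 1 ->
  int_line (fun v => exp (- sigma * v) * (generating a (exp v) -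
      rsum (fun l => bern_coef l a * exp v ^ l) J)) (Gamma (1 - sigma) * hurwitz_zeta (1 - sigma) a).
Proof.
  intros HJ Hs Ha.
  destruct (reg_integral J sigma Hs) as [L [HL0 [HL [_ HG]]]].
  assert (Hsig : 0 < sigma) by (apply le_INR in HJ; simpl in HJ; lra).
  replace (Gamma (1 - sigma) * hurwitz_zeta (1 - sigma) a) with (L * Series (hasse_term sigma a)).
  - eapply int_line_ext; [|exact (hasse_integral J sigma a L ltac:(lra) ltac:(lra) HL0 HL)].
    intros v. cbv beta. now rewrite hasse_poly_bernoulli.
  - rewrite hurwitz_zeta_hasse. replace (1 - (1 - sigma)) with sigma by ring.
    assert (HGam : Gamma (1 - sigma) = - sigma * L).
    { unfold Gamma. fold (gauss_term (1 - sigma)). now rewrite (is_lim_seq_unique _ _ (HG ltac:(lia))). }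
    rewrite HGam. field. lra.
Qed.

(** With exponent 1 the differences in Hasse's series vanish from n = 2 on; the terms 1 and -1/2
    remain, and the factor in front is -1. *)
Lemma hurwitz_zeta_0 : hurwitz_zeta 0 1 = - (1 / 2).
Proof.
  rewrite hurwitz_zeta_hasse. rewrite Rminus_0_r.
  assert (Hf : forall n, hasse_term 1 1 n = / INR (S n) * fdiff n (fun k => (1 + INR k) ^ 1)).
  { intros n. unfold hasse_term. f_equal. apply fdiff_ext. intros k. generalize (pos_INR k). intros.
    rewrite Rpower_1, pow_1; lra. }
  assert (H0 : forall n, hasse_term 1 1 (2 + n) = 0).
  { intros n. rewrite Hf, (fdiff_poly_seq (2 + n) 2); [ring|lia|apply (poly_seq_pow 1)]. }
  rewrite (Series_incr_n _ 2); [|lia|].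
  - rewrite (Series_ext _ (fun _ => 0 * 0)) by (intros n; rewrite H0; ring).
    rewrite Series_scal_l. simpl sum_f_R0. rewrite !Hf. unfold fdiff. cbn [rsum].
    unfold Binomial.C. simpl. field.
  - apply (ex_series_incr_n _ 2). apply ex_series_ext with (fun _ => 0 * 0); [intros n; rewrite H0|].
    + match goal with |- ?x = ?y => change (x = y :> R) end. ring.
    + apply ex_series_Rscal. exists 0. apply filterlim_ext with (fun _ => 0); [|apply filterlim_const].
      intros n. rewrite sum_n_const. ring.
Qed.

(** The integral of t^(s-1) e^(-t)/(1-e^(-t)) dt over t > 0 is evaluated twice: by Hasse's series
    with J = 0, and by expanding the geometric series. *)
Lemma hurwitz_zeta_series s : 1 < s ->
  hurwitz_zeta s 1 = Series (fun m => Rpower (INR (S m)) (- s)).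
Proof.
  intros Hs. rewrite hurwitz_zeta_hasse.
  set (sigma := 1 - s).
  destruct (reg_integral_0 sigma) as [L [HL0 [HL HLg]]]; [unfold sigma; lra|].
  assert (HH := hasse_integral 0 sigma 1 L ltac:(lra) ltac:(simpl; unfold sigma; lra) ltac:(lra) HL).
  assert (HI : int_line (gamma_kernel s) ((s - 1) * L)).
  { replace s with (- sigma + 1) at 1 by (unfold sigma; ring). replace (s - 1) with (- sigma) by (unfold sigma; ring).
    apply gamma_integral_step; auto. unfold sigma; lra. }
  assert (HIr : int_line (reg_kernel 0 (- s) 1) ((s - 1) * L)).
  { eapply int_line_ext; [|exact HI]. intros v. unfold gamma_kernel, reg_kernel, exp_rem. simpl.
    rewrite Rminus_0_r, <- exp_plus. f_equal. ring. }
  assert (Hk : forall k, 0 < INR (S k)) by (intros; apply lt_0_INR; lia).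
  assert (Hg : forall k v, reg_kernel 0 (- s) (INR (S k)) v = exp (s * v) * exp (- (INR (S k) * exp v))).
  { intros k v. unfold reg_kernel, exp_rem. cbn [rsum]. rewrite Rminus_0_r, Ropp_involutive. reflexivity. }
  destruct (int_line_Series (fun k => reg_kernel 0 (- s) (INR (S k)))
    (fun k => Rpower (INR (S k)) (- s) * ((s - 1) * L)) (fun k => Rpower (INR (S k)) (- s) * ((s - 1) * L))) as [_ [Hsw _]].
  - intros; apply continuous_reg_kernel.
  - intros A B. set (q := exp (- exp A)). assert (Hq := exp_neg_lt_1 (exp A) (exp_pos A)). fold q in Hq.
    exists (fun n => exp (s * B) * q ^ n). split.
    { apply ex_series_Rscal. exists (/ (1 - q)). apply is_series_geom. rewrite Rabs_pos_eq; lra. }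
    intros n v Hv. rewrite Hg, Rabs_pos_eq by (apply Rmult_le_pos; left; apply exp_pos).
    apply Rmult_le_compat; try (left; apply exp_pos).
    + assert (Hle : s * v <= s * B) by (apply Rmult_le_compat_l; lra).
      destruct Hle as [Hlt|Heq]; [left; now apply exp_increasing|right; now rewrite Heq].
    + unfold q. rewrite exp_pow.
      assert (Hle : - (INR (S n) * exp v) <= INR n * - exp A).
      { rewrite S_INR. assert (exp A <= exp v).
        { destruct (Req_dec A v) as [->|]; [lra|]. left. apply exp_increasing. lra. }
        generalize (pos_INR n) (exp_pos A) (exp_pos v). intros. nra. }
      destruct Hle as [Hlt|Heq]; [left; now apply exp_increasing|right; now rewrite Heq].
  - intros k. apply reg_integral_scaled; auto.
  - intros k. eapply int_line_ext; [|apply reg_integral_scaled; [apply Hk|exact HIr]].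
    intros v. symmetry. apply Rabs_pos_eq. rewrite Hg. apply Rmult_le_pos; left; apply exp_pos.
  - apply ex_series_ext with (fun k => ((s - 1) * L) * Rpower (INR (S k)) (- s)).
    + intros k. match goal with |- ?x = ?y => change (x = y :> R) end. ring.
    + apply ex_series_Rscal. now apply ex_series_Rpower.
  - rewrite Series_scal_r in Hsw.
    assert (Heq : L * Series (hasse_term sigma 1) = Series (fun k => Rpower (INR (S k)) (- s)) * ((s - 1) * L)).
    { refine (int_line_unique _ _ _ HH _). eapply int_line_ext; [|exact Hsw].
      intros v. cbv beta. cbn [rsum]. rewrite Rminus_0_r. unfold generating.
      assert (He := exp_neg_lt_1 (exp v) (exp_pos v)). set (q := exp (- exp v)) in *.
      rewrite (Series_ext _ (fun k => (exp (s * v) * q) * q ^ k)).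
      - rewrite Series_scal_l, Series_geom by (rewrite Rabs_pos_eq; lra).
        replace (exp (- (1) * exp v)) with q by (unfold q; f_equal; ring).
        replace (s * v) with (- sigma * v + v) by (unfold sigma; ring). rewrite exp_plus. field. lra.
      - intros k. rewrite Hg. unfold q. rewrite exp_pow.
        replace (- (INR (S k) * exp v)) with (- exp v + INR k * - exp v) by (rewrite S_INR; ring).
        rewrite (exp_plus (- exp v)). ring. }
    apply Rmult_eq_reg_l with (L * (s - 1)); [|apply Rmult_integral_contrapositive_currified; lra].
    transitivity (L * Series (hasse_term sigma 1)); [field; lra|]. rewrite Heq. ring.
Qed.

Lemma riemann_zeta_nat k : (2 <= k)%nat -> riemann_zeta (INR k) = Series (fun m => / INR (S m) ^ k).
Proof.
  intros Hk. unfold riemann_zeta. rewrite hurwitz_zeta_series by (apply (lt_INR 1); lia).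
  apply Series_ext. intros m. apply Rpower_neg_pow. apply lt_0_INR. lia.
Qed.

(** * Exchanging the two sums *)

(** [tannery] is applied to the partial sums over n, viewed as a series over m. *)
Theorem double_series_swap (u : nat -> nat -> R) (c : nat -> R) :
  (forall m, ex_series (fun n => Rabs (u n m))) ->
  (forall m, Series (fun n => Rabs (u n m)) <= c m) -> ex_series c ->
  ex_series (fun m => Series (fun n => u n m)) /\
  is_series (fun n => Series (fun m => u n m)) (Series (fun m => Series (fun n => u n m))).
Proof.
  intros H1 Hc H2.
  assert (Hle : forall m n, Rabs (u n m) <= c m).
  { intros m n. eapply Rle_trans; [|apply Hc].
    destruct n as [|n].
    - rewrite (Series_incr_1 (fun n => Rabs (u n m))) by auto.
      assert (0 <= Series (fun n => Rabs (u (S n) m))); [|lra].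
      eapply Rle_trans; [apply Rabs_pos|apply (Series_abs_le (fun n => u (S n) m))].
      + apply (ex_series_incr_1 (fun n => Rabs (u n m))). auto.
      + intros; lra.
    - eapply Rle_trans; [|apply (rsum_le_Series (fun n => Rabs (u n m)) (S (S n))); auto; intros; apply Rabs_pos].
      cbn [rsum]. assert (0 <= rsum (fun n => Rabs (u n m)) (S n)).
      { generalize (S n). intros k. induction k as [|k IH]; cbn [rsum]; [lra|]. generalize (Rabs_pos (u k m)). lra. }
      cbn [rsum] in H. lra. }
  assert (Hex : forall n, ex_series (fun m => u n m)).
  { intros n. apply ex_series_dominated with c; auto. }
  destruct (tannery eventually (fun M m => sum_n (fun n => u n m) M) (fun m => Series (fun n => u n m)) c H2)
    as [_ [H3 H4]].
  - apply filter_forall. intros M m. eapply Rle_trans; [|apply Hc].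
    rewrite <- rsum_sum_n. apply Rle_trans with (rsum (fun n => Rabs (u n m)) (S M)).
    + generalize (S M). intros k. induction k as [|k IH]; cbn [rsum]; [rewrite Rabs_R0; lra|].
      eapply Rle_trans; [apply Rabs_triang|]. lra.
    + apply (rsum_le_Series (fun n => Rabs (u n m))); auto. intros; apply Rabs_pos.
  - intros m. assert (He : ex_series (fun n => u n m)) by (apply ex_series_Rabs; auto).
    apply (Series_correct _ He).
  - split; [exact H3|].
    assert (Hexs : forall M, ex_series (fun m => sum_n (fun n => u n m) M)).
    { induction M as [|M IHM].
      - apply ex_series_ext with (fun m => u O m); [intros; now rewrite sum_O|auto].
      - apply ex_series_ext with (fun m => sum_n (fun n => u n m) M + u (S M) m); [intros; now rewrite sum_n_S|].
        apply (ex_series_plus (V := R_NormedModule)); auto. }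
    assert (Hsum : forall M, Series (fun m => sum_n (fun n => u n m) M) = rsum (fun n => Series (fun m => u n m)) (S M)).
    { induction M as [|M IH].
      - cbn [rsum]. rewrite Rplus_0_l. apply Series_ext. intros m. now rewrite sum_O.
      - change (rsum ?f (S (S M))) with (rsum f (S M) + f (S M)). cbv beta. rewrite <- IH, <- Series_plus; auto.
        apply Series_ext. intros m. now rewrite sum_n_S. }
    refine (filterlim_ext _ _ _ H4). intros M. rewrite Hsum. apply rsum_sum_n.
Qed.

Lemma exp_le_compat x y : x <= y -> exp x <= exp y.
Proof. intros [H| ->]; [left; now apply exp_increasing|lra]. Qed.

Lemma pow_exp_ln x n : 0 < x -> x ^ n = exp (INR n * ln x).
Proof. intros Hx. rewrite <- exp_pow, exp_ln; auto. Qed.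

(* Weighted AM-GM on the denominator, with weights chosen so that n^(-3/2) remains. *)
Lemma rational_term_bound N p r n : (p + 2 <= 2 * N)%nat -> 0 < r ->
  rational_term N p r (INR (S n)) <=
  exp ((INR p + 3 / 2 - 2 * INR N) * ln r) * Rpower (INR (S n)) (- (3 / 2)).
Proof.
  intros Hp Hr. unfold rational_term, Rpower. assert (Hn : 0 < INR (S n)) by (apply lt_0_INR; lia).
  set (A := ln (INR (S n))). set (B := ln r).
  rewrite (pow_exp_ln _ p Hn), (pow_exp_ln _ (2 * N) Hn), (pow_exp_ln _ (2 * N) Hr). fold A B.
  rewrite mult_INR. simpl (INR 2). replace (1 + 1) with 2 by ring.
  apply le_INR in Hp. rewrite plus_INR, mult_INR in Hp. simpl (INR 2) in Hp.
  assert (HE : exp ((INR p + 3 / 2) * A + (2 * INR N - INR p - 3 / 2) * B) <= exp (2 * INR N * A) + exp (2 * INR N * B)).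
  { destruct (Rle_lt_dec A B) as [H|H].
    - apply Rle_trans with (exp (2 * INR N * B)); [|generalize (exp_pos (2 * INR N * A)); lra].
      apply exp_le_compat. assert (0 <= INR p) by apply pos_INR.
      assert ((INR p + 3 / 2) * A <= (INR p + 3 / 2) * B) by (apply Rmult_le_compat_l; lra). lra.
    - apply Rle_trans with (exp (2 * INR N * A)); [|generalize (exp_pos (2 * INR N * B)); lra].
      apply exp_le_compat.
      assert ((2 * INR N - INR p - 3 / 2) * B <= (2 * INR N - INR p - 3 / 2) * A) by (apply Rmult_le_compat_l; lra). lra. }
  apply Rle_div_l; [generalize (exp_pos (2 * INR N * A)) (exp_pos (2 * INR N * B)); lra|].
  rewrite <- exp_plus.
  eapply Rle_trans; [|apply Rmult_le_compat_l; [left; apply exp_pos|exact HE]].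
  rewrite <- exp_plus. right. f_equal. ring.
Qed.

Lemma ex_series_freq_Rpower x tau : 0 < x -> 1 < tau -> ex_series (fun m => Rpower (freq m / x) (- tau)).
Proof.
  intros Hx Ht. apply ex_series_ext with (fun m => Rpower (2 * PI / x) (- tau) * Rpower (INR (S m)) (- tau)).
  - intros m. assert (HPI := PI_RGT_0). rewrite Rpower_mult_distr.
    + f_equal. unfold freq. field. lra.
    + apply Rdiv_lt_0_compat; lra.
    + apply lt_0_INR. lia.
  - apply ex_series_Rscal. now apply ex_series_Rpower.
Qed.

Section Core.
(* [H] stands for 2h. Writing [vterm e m (n^N x)] over n^(2N) + (freq m / x)^2 leaves the power n^p in the numerator. *)
Variables (N H p e : nat) (x a : R).
Hypothesis N_pos : (0 < N)%nat.
Hypothesis H_large : (N + 2 <= H)%nat.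
Hypothesis p_def : (p + H = N + N * e)%nat.
Hypothesis p_small : (p + 2 <= 2 * N)%nat.
Hypothesis e_pos : (1 <= e)%nat.
Hypothesis x_pos : 0 < x.

Definition decay_exponent : R := (INR H - 1) / INR N.

Definition scaled_freq (m : nat) : R := freq m / x.

Definition radius (m : nat) : R := exp (ln (scaled_freq m) / INR N).

Lemma N_pos_R : 0 < INR N.
Proof. apply lt_0_INR. exact N_pos. Qed.

Lemma scaled_freq_pos m : 0 < scaled_freq m.
Proof. apply Rdiv_lt_0_compat; [apply freq_pos|exact x_pos]. Qed.

Lemma radius_pos m : 0 < radius m.
Proof. apply exp_pos. Qed.

Lemma radius_pow m : radius m ^ (2 * N) = scaled_freq m ^ 2.
Proof.
  unfold radius. rewrite exp_pow, (pow_exp_ln (scaled_freq m)) by apply scaled_freq_pos.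
  f_equal. rewrite mult_INR. field. generalize N_pos_R. lra.
Qed.

Lemma p_INR : INR p + INR H = INR N + INR N * INR e.
Proof. rewrite <- plus_INR, <- mult_INR, <- plus_INR. f_equal. exact p_def. Qed.

Definition weight (m : nat) : R := scaled_freq m / scaled_freq m ^ e / x.

Lemma weight_pos m : 0 < weight m.
Proof.
  unfold weight. assert (Hs := scaled_freq_pos m).
  apply Rdiv_lt_0_compat; [apply Rdiv_lt_0_compat; [exact Hs|now apply pow_lt]|exact x_pos].
Qed.

Lemma weight_exp m : weight m = exp ((1 - INR e) * ln (scaled_freq m)) / x.
Proof.
  unfold weight. assert (Hs := scaled_freq_pos m). rewrite (pow_exp_ln _ e Hs).
  replace ((1 - INR e) * ln (scaled_freq m)) with (ln (scaled_freq m) + - (INR e * ln (scaled_freq m))) by ring.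
  rewrite exp_plus, exp_Ropp, exp_ln by auto. reflexivity.
Qed.

(** At t = n^N x, with y = [scaled_freq m], one has t/[freq m] = n^N/y and [freq m]/(t^2 +
    [freq m]^2) = (y/x)/(n^(2N)+y^2); the powers of n collect to N-H+Ne = p. *)
Lemma vterm_rational n m :
  INR (S n) ^ N / INR (S n) ^ H * vterm e m (INR (S n) ^ N * x) a =
  osc e m a * weight m * rational_term N p (radius m) (INR (S n)).
Proof.
  unfold vterm, weight, rational_term. rewrite radius_pow.
  assert (Hn : 0 < INR (S n)) by (apply lt_0_INR; lia). set (k := INR (S n)) in *.
  assert (Hw := freq_pos m). unfold scaled_freq. set (w := freq m) in *.
  assert (HkN : 0 < k ^ N) by now apply pow_lt. assert (HkH : 0 < k ^ H) by now apply pow_lt.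
  assert (Hp : k ^ p = k ^ N * k ^ (N * e) / k ^ H).
  { rewrite <- pow_add, <- p_def, pow_add. field. lra. }
  rewrite Hp, (pow_mult k N e). replace (k ^ (2 * N)) with ((k ^ N) ^ 2) by (rewrite <- pow_mult; f_equal; lia).
  set (T := k ^ N) in *. unfold Rdiv. rewrite !Rpow_mult_distr, !pow_inv.
  assert (0 < x ^ e) by now apply pow_lt. assert (0 < w ^ e) by now apply pow_lt.
  assert (0 < T ^ 2 * x ^ 2 + w ^ 2) by (generalize (pow_lt _ 2 Hw) (pow2_ge_0 (T * x)); rewrite Rpow_mult_distr; lra).
  simpl in *. field. repeat split; lra.
Qed.

(** Each mode of [vsum] is a scaled [beta_kernel] with mu = 1-sigma+e, so its Mellin transform is
    the same [beta] times [freq m]^(-sigma). As H >= N+2 makes sigma > 1, the series over m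
    converges absolutely. *)
Lemma kernel_integral beta : int_line (beta_kernel ((INR p + 1) / INR N)) beta ->
  exists G, int_line (fun v => exp ((1 - decay_exponent) * v) * vsum e (exp v) a) G /\
    (forall v, continuous (fun v => exp ((1 - decay_exponent) * v) * vsum e (exp v) a) v) /\
    G = Series (fun m => osc e m a * exp (- decay_exponent * ln (freq m)) * beta) /\
    ex_series (fun m => osc e m a * exp (- decay_exponent * ln (freq m)) * beta).
Proof.
  intros Hb. set (sigma := decay_exponent). assert (HN := N_pos_R).
  set (mu := (INR p + 1) / INR N) in *.
  assert (Hmu : mu = 1 - sigma + INR e).
  { unfold mu, sigma, decay_exponent. generalize p_INR. intros E.
    replace (INR p) with (INR N + INR N * INR e - INR H) by lra. field. lra. }
  assert (Hsig : 1 < sigma).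
  { unfold sigma, decay_exponent. apply Rlt_div_r; [lra|]. apply le_INR in H_large.
    rewrite plus_INR in H_large. simpl in H_large. lra. }
  set (g := fun m v => (osc e m a * exp ((1 - INR e) * ln (freq m))) * (exp (mu * v) / (exp (2 * v) + freq m ^ 2))).
  assert (Hk0 : forall m v, 0 <= exp (mu * v) / (exp (2 * v) + freq m ^ 2)).
  { intros m v. assert (Hw := pow_lt _ 2 (freq_pos m)). left.
    apply Rdiv_lt_0_compat; [apply exp_pos|]. generalize (exp_pos (2 * v)). lra. }
  assert (Hcb : forall m v, continuous (fun v => exp (mu * v) / (exp (2 * v) + freq m ^ 2)) v).
  { intros m v. assert (Hw := pow_lt _ 2 (freq_pos m)). apply continuous_ex_derive. auto_derive.
    generalize (exp_pos (2 * v)). simpl in Hw. lra. }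
  assert (Hint : forall m c, int_line (fun v => (c * exp ((1 - INR e) * ln (freq m))) * (exp (mu * v) / (exp (2 * v) + freq m ^ 2)))
     (c * exp (- sigma * ln (freq m)) * beta)).
  { intros m c. replace (c * exp (- sigma * ln (freq m)) * beta) with
      ((c * exp ((1 - INR e) * ln (freq m))) * (exp ((mu - 2) * ln (freq m)) * beta)).
    - apply int_line_scal; auto. apply beta_kernel_scaled; auto. apply freq_pos.
    - replace (- sigma * ln (freq m)) with ((1 - INR e) * ln (freq m) + (mu - 2) * ln (freq m)) by (rewrite Hmu; ring).
      rewrite exp_plus. ring. }
  assert (Hg : forall m v, g m v = exp ((1 - sigma) * v) * vterm e m (exp v) a).
  { intros m v. unfold g, vterm. assert (Hw := freq_pos m).
    unfold Rdiv at 2. rewrite Rpow_mult_distr, pow_inv, (pow_exp_ln (freq m) e) by auto.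
    rewrite <- (exp_ln (freq m)) at 5 by auto.
    replace ((1 - INR e) * ln (freq m)) with (ln (freq m) + - (INR e * ln (freq m))) by ring.
    rewrite exp_plus, exp_Ropp, exp_ln by auto.
    rewrite exp_pow, Hmu.
    replace ((1 - sigma + INR e) * v) with ((1 - sigma) * v + INR e * v) by ring. rewrite exp_plus.
    replace (exp v ^ 2) with (exp (2 * v)) by (rewrite exp_pow; f_equal; simpl; ring).
    unfold Rdiv. ring. }
  destruct (int_line_Series g (fun m => osc e m a * exp (- sigma * ln (freq m)) * beta)
     (fun m => Rabs (osc e m a) * exp (- sigma * ln (freq m)) * beta)) as [H1 [H2 H3]].
  - intros m v. apply continuous_Rscal. auto.
  - intros A B. exists (fun m => exp (Rabs (1 - sigma) * (Rabs A + Rabs B)) * (2 * exp B ^ e * / freq m ^ S e)). split.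
    + apply ex_series_Rscal, ex_series_Rscal, ex_series_inv_freq_pow. lia.
    + intros m v Hv. rewrite Hg, Rabs_mult, (Rabs_pos_eq (exp _)) by (left; apply exp_pos).
      apply Rmult_le_compat; [left; apply exp_pos|apply Rabs_pos| |].
      * apply exp_le_compat. apply Rle_trans with (Rabs ((1 - sigma) * v)); [apply Rle_abs|].
        rewrite Rabs_mult. apply Rmult_le_compat_l; [apply Rabs_pos|].
        assert (HA := Rle_abs (- A)). rewrite Rabs_Ropp in HA. assert (HB := Rle_abs B).
        assert (HA2 := Rabs_pos A). assert (HB2 := Rabs_pos B). apply Rabs_le. lra.
      * eapply Rle_trans; [apply vterm_bound, exp_pos|].
        apply Rmult_le_compat_r; [left; apply Rinv_0_lt_compat, pow_lt, freq_pos|].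
        apply Rmult_le_compat_l; [lra|]. apply pow_incr. split; [left; apply exp_pos|]. now apply exp_le_compat.
  - intros m. apply Hint.
  - intros m. eapply int_line_ext; [|apply (Hint m (Rabs (osc e m a)))].
    intros v. unfold g. rewrite !Rabs_mult, (Rabs_pos_eq (exp ((1 - INR e) * _))) by (left; apply exp_pos).
    rewrite (Rabs_pos_eq (_ / _)) by auto. reflexivity.
  - apply ex_series_dominated with (fun m => (2 * Rabs beta) * Rpower (freq m / 1) (- sigma)).
    + apply ex_series_Rscal, ex_series_freq_Rpower; lra.
    + intros m. rewrite !Rabs_mult, Rabs_Rabsolu, (Rabs_pos_eq (exp _)) by (left; apply exp_pos).
      unfold Rpower, Rdiv. rewrite Rinv_1, Rmult_1_r.
      assert (Ho := osc_bound e m a). assert (H0 := exp_pos (- sigma * ln (freq m))). assert (Hb0 := Rabs_pos beta).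
      assert (0 <= exp (- sigma * ln (freq m)) * Rabs beta) by (apply Rmult_le_pos; lra). nra.
  - exists (Series (fun m => osc e m a * exp (- sigma * ln (freq m)) * beta)).
    assert (Heq : forall v, Series (fun m => g m v) = exp ((1 - sigma) * v) * vsum e (exp v) a).
    { intros v. unfold vsum. rewrite <- Series_scal_l. apply Series_ext. intros; apply Hg. }
    repeat split; auto.
    + eapply int_line_ext; [exact Heq|exact H2].
    + intros v. eapply continuous_ext; [exact Heq|apply H3].
Qed.

(** After the exchange of sums, the integral part of the inner sum over n is again [beta] times a
    power of the frequency. These parts add up to x^(sigma-1)/N times the Mellin transform G, and
    the defects remain. *)
Lemma core_sum beta G : int_line (beta_kernel ((INR p + 1) / INR N)) beta ->
  (forall r, 0 < r -> Series (fun n => rational_term N p r (INR (S n))) =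
       r ^ (p + 1) / (INR N * r ^ (2 * N)) * beta + Re (defect_sum N p r)) ->
  int_line (fun v => exp ((1 - decay_exponent) * v) * vsum e (exp v) a) G ->
  ex_series (fun m => osc e m a * weight m * Re (defect_sum N p (radius m))) /\
  is_series (fun n => INR (S n) ^ N / INR (S n) ^ H * vsum e (INR (S n) ^ N * x) a)
    (/ INR N * Rpower x (decay_exponent - 1) * G +
     Series (fun m => osc e m a * weight m * Re (defect_sum N p (radius m)))).
Proof.
  intros Hb Hsum HG. assert (HN := N_pos_R).
  destruct (kernel_integral beta Hb) as [G' [HG' [_ [HGe HexG]]]].
  assert (HGG : G = G') by (eapply int_line_unique; eassumption).
  set (sigma := decay_exponent) in *.
  assert (Hpi := p_INR).
  set (c := fun m => 2 * / x * Series (fun n => Rpower (INR (S n)) (- (3 / 2))) *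
      Rpower (freq m / x) (- ((INR H - 3 / 2) / INR N))).
  assert (Hbound : forall m n, Rabs (osc e m a * weight m * rational_term N p (radius m) (INR (S n))) <=
     (2 * / x * Rpower (freq m / x) (- ((INR H - 3 / 2) / INR N))) * Rpower (INR (S n)) (- (3 / 2))).
  { intros m n. assert (Hw := weight_pos m). assert (Hs := scaled_freq_pos m).
    assert (Hr0 := rational_term_nonneg N p (radius m) (INR (S n)) (pos_INR _) (radius_pos m)).
    rewrite !Rabs_mult, (Rabs_pos_eq (weight m)), (Rabs_pos_eq (rational_term _ _ _ _)) by lra.
    assert (Hrb := rational_term_bound N p (radius m) n p_small (radius_pos m)).
    unfold radius at 2 in Hrb. rewrite ln_exp in Hrb.
    replace (2 * / x * Rpower (freq m / x) (- ((INR H - 3 / 2) / INR N)) * Rpower (INR (S n)) (- (3 / 2))) with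
      (2 * weight m * (exp ((INR p + 3 / 2 - 2 * INR N) * (ln (scaled_freq m) / INR N)) * Rpower (INR (S n)) (- (3 / 2)))).
    - apply Rmult_le_compat; auto.
      + apply Rmult_le_pos; [apply Rabs_pos|lra].
      + apply Rmult_le_compat_r; [lra|apply osc_bound].
    - rewrite weight_exp. unfold Rpower at 2. fold (scaled_freq m).
      replace (- ((INR H - 3 / 2) / INR N) * ln (scaled_freq m)) with
        ((1 - INR e) * ln (scaled_freq m) + (INR p + 3 / 2 - 2 * INR N) * (ln (scaled_freq m) / INR N)).
      + rewrite exp_plus. unfold Rdiv. ring.
      + replace (INR p) with (INR N + INR N * INR e - INR H) by lra. field. lra. }
  assert (Hex32 : ex_series (fun n => Rpower (INR (S n)) (- (3 / 2)))) by (apply ex_series_Rpower; lra).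
  destruct (double_series_swap (fun n m => osc e m a * weight m * rational_term N p (radius m) (INR (S n))) c) as [H1 H2].
  - intros m. apply ex_series_dominated with (fun n => (2 * / x * Rpower (freq m / x) (- ((INR H - 3 / 2) / INR N))) * Rpower (INR (S n)) (- (3 / 2))).
    + now apply ex_series_Rscal.
    + intros n. rewrite Rabs_Rabsolu. apply Hbound.
  - intros m. unfold c.
    replace (2 * / x * Series (fun n => Rpower (INR (S n)) (- (3 / 2))) * Rpower (freq m / x) (- ((INR H - 3 / 2) / INR N)))
      with (Series (fun n => (2 * / x * Rpower (freq m / x) (- ((INR H - 3 / 2) / INR N))) * Rpower (INR (S n)) (- (3 / 2)))).
    + apply Series_le; [|now apply ex_series_Rscal]. intros n. split; [apply Rabs_pos|apply Hbound].
    + rewrite Series_scal_l. ring.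
  (* The exponent is (H-3/2)/N, where 3/2 is what [rational_term_bound] spends on n; it exceeds 1
     because H >= N+2. *)
  - apply ex_series_Rscal, ex_series_freq_Rpower; auto. apply Rlt_div_r; [lra|].
    apply le_INR in H_large. rewrite plus_INR in H_large. simpl in H_large. lra.
  - assert (Hterm : forall m, Series (fun n => osc e m a * weight m * rational_term N p (radius m) (INR (S n))) =
       (/ INR N * Rpower x (sigma - 1)) * (osc e m a * exp (- sigma * ln (freq m)) * beta) +
       osc e m a * weight m * Re (defect_sum N p (radius m))).
    { intros m. rewrite Series_scal_l, Hsum by apply radius_pos. rewrite Rmult_plus_distr_l. f_equal.
      rewrite weight_exp. unfold radius. rewrite !exp_pow. unfold Rpower.
      assert (Hl : ln (scaled_freq m) = ln (freq m) - ln x).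
      { unfold scaled_freq, Rdiv. rewrite ln_mult; [|apply freq_pos|now apply Rinv_0_lt_compat].
        rewrite ln_Rinv by exact x_pos. ring. }
      replace (exp ((sigma - 1) * ln x) ) with (exp (sigma * ln x) / x).
      2:{ replace ((sigma - 1) * ln x) with (sigma * ln x + - ln x) by ring. rewrite exp_plus, exp_Ropp, exp_ln; auto. }
      replace (exp ((1 - INR e) * ln (scaled_freq m))) with
        (exp (sigma * ln x) * exp (- sigma * ln (freq m)) * exp (INR (2 * N) * (ln (scaled_freq m) / INR N)) / exp (INR (p + 1) * (ln (scaled_freq m) / INR N))).
      - assert (H3 := exp_pos (INR (2 * N) * (ln (scaled_freq m) / INR N))).
        assert (H4 := exp_pos (INR (p + 1) * (ln (scaled_freq m) / INR N))). field. repeat split; lra.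
      - unfold Rdiv at 1. rewrite <- exp_Ropp, <- !exp_plus. f_equal. rewrite Hl, mult_INR, plus_INR. simpl (INR 2). simpl (INR 1).
        replace (INR p) with (INR N + INR N * INR e - INR H) by lra. unfold sigma, decay_exponent. field. lra. }
    assert (HexD : ex_series (fun m => osc e m a * weight m * Re (defect_sum N p (radius m)))).
    { apply ex_series_ext with (fun m => Series (fun n => osc e m a * weight m * rational_term N p (radius m) (INR (S n))) -
         (/ INR N * Rpower x (sigma - 1)) * (osc e m a * exp (- sigma * ln (freq m)) * beta)).
      - intros m. rewrite Hterm. match goal with |- ?x = ?y => change (x = y :> R) end. ring.
      - apply (ex_series_minus (V := R_NormedModule)); [exact H1|]. now apply ex_series_Rscal. }
    split; [exact HexD|].
    replace (/ INR N * Rpower x (sigma - 1) * G + Series (fun m => osc e m a * weight m * Re (defect_sum N p (radius m)))) with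
      (Series (fun m => Series (fun n => osc e m a * weight m * rational_term N p (radius m) (INR (S n))))).
    + revert H2. apply is_series_ext. intros n. unfold vsum. rewrite <- Series_scal_l.
      apply Series_ext. intros m. symmetry. apply vterm_rational.
    + rewrite (Series_ext _ _ Hterm), Series_plus; auto; [|now apply ex_series_Rscal].
      rewrite Series_scal_l, HGG, HGe. reflexivity.
Qed.
End Core.

(** The summand of the left side with H = 2h as a natural number, hence the quotient of powers in
    place of n^(N-2h). *)
Definition lambert_term (N H : nat) (x a : R) (n : nat) : R :=
  INR (S n) ^ N / INR (S n) ^ H *
  (exp (- a * (INR (S n) ^ N * x)) / (1 - exp (- (INR (S n) ^ N * x)))).

Definition defect_series (N e p : nat) (x a : R) : R :=
  Series (fun m => osc e m a * weight e x m * Re (defect_sum N p (radius N x m))).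

Lemma is_series_Rplus (u v : nat -> R) (l k : R) :
  is_series u l -> is_series v k -> is_series (fun n => u n + v n) (l + k).
Proof. apply (is_series_plus (V := R_NormedModule)). Qed.

Lemma is_series_Rscal (c : R) (u : nat -> R) (l : R) :
  is_series u l -> is_series (fun n => c * u n) (c * l).
Proof. intros H. exact (is_series_scal_l (K := R_AbsRing) c u l H). Qed.

Lemma is_series_rsum (u : nat -> nat -> R) (l : nat -> R) J :
  (forall j, (j < J)%nat -> is_series (fun n => u n j) (l j)) ->
  is_series (fun n => rsum (u n) J) (rsum l J).
Proof.
  induction J as [|J IH]; intros H; cbn [rsum].
  - apply filterlim_ext with (fun _ => 0); [|apply filterlim_const].
    intros n. rewrite sum_n_const. match goal with |- ?x = ?y => change (x = y :> R) end. ring.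
  - apply is_series_Rplus; auto.
Qed.

(** The bound N(J-1) <= H keeps the natural-number subtraction H - N l exact for every l < J. *)
Lemma lambert_decomposition N H J x a n : (2 <= J)%nat -> (N * (J - 1) <= H)%nat -> 0 < x -> 0 <= a <= 1 ->
  lambert_term N H x a n =
  rsum (fun l => bern_coef l a * x ^ l / x * / INR (S n) ^ (H - N * l)) J +
  (INR (S n) ^ N / INR (S n) ^ H * vsum (J - 1) (INR (S n) ^ N * x) a +
   INR (S n) ^ N / INR (S n) ^ H * vsum J (INR (S n) ^ N * x) a).
Proof.
  intros HJ HH Hx Ha. assert (Hn : 0 < INR (S n)) by (apply lt_0_INR; lia).
  assert (HnN : 0 < INR (S n) ^ N) by now apply pow_lt.
  assert (HnH : 0 < INR (S n) ^ H) by now apply pow_lt.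
  set (t := INR (S n) ^ N * x). assert (Ht : 0 < t) by now apply Rmult_lt_0_compat.
  unfold lambert_term. fold t.
  assert (Hg := generating_expansion J t a HJ Ht Ha).
  assert (Hg2 : exp (- a * t) / (1 - exp (- t)) = rsum (fun l => bern_coef l a * t ^ l) J / t + (vsum (J - 1) t a + vsum J t a)).
  { apply Rmult_eq_reg_l with t; [|lra]. rewrite Hg. field. lra. }
  rewrite Hg2, !Rmult_plus_distr_l. f_equal.
  replace (INR (S n) ^ N / INR (S n) ^ H * (rsum (fun l => bern_coef l a * t ^ l) J / t)) with
    ((/ INR (S n) ^ H * / x) * rsum (fun l => bern_coef l a * t ^ l) J).
  2:{ unfold t. field. lra. }
  rewrite <- rsum_scal. apply rsum_ext. intros l Hl. unfold t.
  assert (Hsplit : INR (S n) ^ H = INR (S n) ^ (H - N * l) * (INR (S n) ^ N) ^ l).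
  { rewrite <- pow_mult, <- pow_add. f_equal. assert (N * l <= N * (J - 1))%nat by (apply Nat.mul_le_mono_l; lia). lia. }
  rewrite Hsplit, Rpow_mult_distr. field. repeat split; try lra; apply pow_nonzero; try apply pow_nonzero; lra.
Qed.

(** The Mellin transforms G1 and G2 of the two remainders add up to Gamma times zeta, because the
    sum of their integrands is t^(-sigma) times the generating function minus its first J Taylor
    terms, the integrand of [gamma_zeta_integral]. Summability of the defect series is recorded so
    that they can be split afterwards. *)
Theorem core_large N H J x a :
  (0 < N)%nat -> (2 <= J)%nat -> (N * (J - 1) + 2 <= H)%nat -> (H <= N * J)%nat -> 0 < x -> 0 < a <= 1 ->
  (forall e, e = (J - 1)%nat \/ e = J ->
     ex_series (fun m => osc e m a * weight e x m * Re (defect_sum N (N + N * e - H) (radius N x m)))) /\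
  is_series (lambert_term N H x a)
    (rsum (fun l => bern_coef l a * x ^ l / x * Series (fun n => / INR (S n) ^ (H - N * l))) J +
     / INR N * Rpower x (decay_exponent N H - 1) *
       (Gamma (1 - decay_exponent N H) * hurwitz_zeta (1 - decay_exponent N H) a) +
     (defect_series N (J - 1) (N + N * (J - 1) - H) x a + defect_series N J (N + N * J - H) x a)).
Proof.
  intros HN HJ H1 H2 Hx Ha.
  assert (HNR : 0 < INR N) by (apply lt_0_INR; lia).
  assert (HNJ : (N * J = N * (J - 1) + N)%nat).
  { replace J with (S (J - 1)) at 1 by lia. rewrite Nat.mul_succ_r. reflexivity. }
  assert (HN1 : (N <= N * (J - 1))%nat) by (rewrite <- (Nat.mul_1_r N) at 1; apply Nat.mul_le_mono_l; lia).
  assert (Hsig : INR J - 1 < decay_exponent N H < INR J).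
  { assert (HJ1 : INR (J - 1) = INR J - 1) by (rewrite minus_INR by lia; reflexivity).
    assert (E1 : INR N * (INR J - 1) + 2 <= INR H).
    { rewrite <- HJ1, <- mult_INR. apply le_INR in H1. rewrite plus_INR in H1. simpl (INR 2) in H1. lra. }
    assert (E2 : INR H <= INR N * INR J) by (rewrite <- mult_INR; now apply le_INR).
    unfold decay_exponent. split; [apply Rlt_div_r|apply Rlt_div_l]; lra. }
  set (sigma := decay_exponent N H) in *.
  assert (Hcore : forall e, e = (J - 1)%nat \/ e = J -> exists G,
     int_line (fun v => exp ((1 - sigma) * v) * vsum e (exp v) a) G /\
     (forall v, continuous (fun v => exp ((1 - sigma) * v) * vsum e (exp v) a) v) /\
     ex_series (fun m => osc e m a * weight e x m * Re (defect_sum N (N + N * e - H) (radius N x m))) /\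
     is_series (fun n => INR (S n) ^ N / INR (S n) ^ H * vsum e (INR (S n) ^ N * x) a)
       (/ INR N * Rpower x (sigma - 1) * G + defect_series N e (N + N * e - H) x a)).
  { intros e He.
    assert (Hp : (N + N * e - H + 2 <= 2 * N)%nat) by (destruct He as [->| ->]; lia).
    assert (Hpd : (N + N * e - H + H = N + N * e)%nat) by (destruct He as [->| ->]; lia).
    destruct (rational_sum_beta N (N + N * e - H) HN Hp) as [beta [Hb Hs]].
    destruct (kernel_integral N H (N + N * e - H) e a HN ltac:(lia) Hpd Hp ltac:(destruct He; lia) beta Hb) as [G [HG [HGc _]]].
    exists G. split; [exact HG|]. split; [exact HGc|].
    apply (core_sum N H (N + N * e - H) e x a HN ltac:(lia) Hpd Hp ltac:(destruct He; lia) Hx beta G Hb Hs HG). }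
  split.
  { intros e He. destruct (Hcore e He) as [G [_ [_ [Hex _]]]]. exact Hex. }
  destruct (Hcore (J - 1)%nat (or_introl eq_refl)) as [G1 [HG1 [Hc1 [_ Hs1]]]].
  destruct (Hcore J (or_intror eq_refl)) as [G2 [HG2 [Hc2 [_ Hs2]]]].
  assert (HZ : Gamma (1 - sigma) * hurwitz_zeta (1 - sigma) a = G1 + G2).
  { refine (int_line_unique _ _ _ (gamma_zeta_integral J sigma a ltac:(lia) Hsig Ha) _).
    eapply int_line_ext; [|exact (int_line_plus _ _ _ _ Hc1 Hc2 HG1 HG2)].
    intros v. cbv beta. unfold generating. rewrite (generating_expansion J) by (auto using exp_pos; lra).
    replace ((1 - sigma) * v) with (- sigma * v + v) by ring. rewrite exp_plus. ring. }
  rewrite HZ.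
  eapply is_series_ext; [intros n; symmetry; apply (lambert_decomposition N H J x a n HJ ltac:(lia) Hx ltac:(lra))|].
  replace (rsum (fun l => bern_coef l a * x ^ l / x * Series (fun n => / INR (S n) ^ (H - N * l))) J +
    / INR N * Rpower x (sigma - 1) * (G1 + G2) + (defect_series N (J - 1) (N + N * (J - 1) - H) x a + defect_series N J (N + N * J - H) x a))
    with (rsum (fun l => bern_coef l a * x ^ l / x * Series (fun n => / INR (S n) ^ (H - N * l))) J +
      ((/ INR N * Rpower x (sigma - 1) * G1 + defect_series N (J - 1) (N + N * (J - 1) - H) x a) +
       (/ INR N * Rpower x (sigma - 1) * G2 + defect_series N J (N + N * J - H) x a))) by ring.
  apply is_series_Rplus; [|now apply is_series_Rplus].
  apply (is_series_rsum (fun n l => bern_coef l a * x ^ l / x * / INR (S n) ^ (H - N * l))).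
  intros l Hl. apply is_series_Rscal. apply Series_correct.
  apply ex_series_inv_pow. assert (N * l <= N * (J - 1))%nat by (apply Nat.mul_le_mono_l; lia). lia.
Qed.

(* The defect without -1/(2 z^2), whose contributions cancel over the roots unless p = 0. *)
Definition decaying_defect (odd : bool) (z : C) : C :=
  if odd then summation_defect true z else (RtoC PI / z / (Cexp (2 * RtoC PI * z) - 1))%C.

Definition main_sum (N p : nat) (r : R) : C :=
  csum (fun k => root_coef N (p / 2) r k * decaying_defect (Nat.odd p) (root N r k))%C N.

Lemma csum_const c n : csum (fun _ => c) n = (RtoC (INR n) * c)%C.
Proof.
  induction n as [|n IH]; [simpl; ring|]. cbn [csum]. rewrite IH, S_INR, RtoC_plus. ring.
Qed.

Lemma defect_main N p r : (p < 2 * N)%nat -> 0 < r ->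
  defect_sum N p r = (main_sum N p r - RtoC (if Nat.eqb p 0 then / (2 * r ^ (2 * N)) else 0))%C.
Proof.
  intros Hp Hr. assert (HrN : 0 < r ^ (2 * N)) by now apply pow_lt.
  assert (HNR : 0 < INR N) by (apply lt_0_INR; lia).
  unfold defect_sum, main_sum. destruct (Nat.odd p) eqn:Ho.
  - destruct p as [|p]; [discriminate|]. simpl Nat.eqb. unfold decaying_defect. ring.
  - assert (Hz : forall k, (k < N)%nat -> root N r k <> 0%C).
    { intros k Hk. apply C_neq_0_Re. generalize (Re_root_pos N r k Hk Hr). lra. }
    assert (H20 := RtoC_2_neq_0).
    rewrite (csum_ext _ (fun k => root_coef N (p / 2) r k * decaying_defect false (root N r k) +
       RtoC (- ((-1) ^ (p / 2) / (INR N * r ^ (2 * N)) / 2)) * root N r k ^ (2 * (p / 2)))%C).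
    + rewrite csum_plus, csum_scal. unfold Cminus. f_equal.
      destruct (Nat.eqb p 0) eqn:Hp0.
      * apply Nat.eqb_eq in Hp0. subst p. simpl (0 / 2)%nat.
        rewrite (csum_ext _ (fun _ => RtoC 1)) by reflexivity. rewrite csum_const.
        rewrite <- RtoC_opp, <- !RtoC_mult. f_equal. simpl pow at 1. field. split; lra.
      * apply Nat.eqb_neq in Hp0. assert (Hh := half_decomposition p). rewrite Ho in Hh.
        rewrite root_power_sum by lia. ring.
    + intros k Hk. unfold summation_defect, decaying_defect, root_coef.
      specialize (Hz k Hk). set (z := root N r k) in *. rewrite Cpow_add_r.
      replace (- ((-1) ^ (p / 2) / (INR N * r ^ (2 * N)) / 2)) with
         (- ((-1) ^ (p / 2) / (INR N * r ^ (2 * N)) * / 2)) by (unfold Rdiv; ring).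
      rewrite RtoC_opp, (RtoC_mult _ (/ 2)), RtoC_inv by lra.
      set (cc := RtoC ((-1) ^ (p / 2) / (INR N * r ^ (2 * N)))). set (zp := (z ^ (2 * (p / 2)))%C).
      simpl (z ^ 2)%C. unfold Cdiv.
      set (ex := (/ (Cexp (2 * RtoC PI * z) - 1))%C).
      transitivity (cc * (zp * (z * (z * 1))) * (RtoC PI * / z * ex) - cc * zp * (z * z * / (2 * (z * z))))%C; [ring|].
      replace (z * z * / (2 * (z * z)))%C with (/ 2)%C by (field; auto). ring.
Qed.

Definition main_series (N e p : nat) (x a : R) : R :=
  Series (fun m => osc e m a * weight e x m * Re (main_sum N p (radius N x m))).

Lemma Im_main_sum N p r : (p + 2 <= 2 * N)%nat -> 0 < r -> Im (main_sum N p r) = 0.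
Proof.
  intros Hp Hr. destruct (rational_sum_eval N p r Hp Hr) as [H _].
  rewrite defect_main in H by (auto; lia). unfold Im in *. simpl in H. lra.
Qed.

(** For p = 0 the removed part 1/(2y^2) sums over m to a Bernoulli polynomial by [osc_sum_eq]; the
    factor -1/2 is later read as zeta(0). *)
Lemma defect_series_main N e p x a : (0 < N)%nat -> (p < 2 * N)%nat -> (1 <= e)%nat -> 0 < x -> 0 <= a <= 1 ->
  ex_series (fun m => osc e m a * weight e x m * Re (defect_sum N p (radius N x m))) ->
  defect_series N e p x a = main_series N e p x a +
    (if Nat.eqb p 0 then - / 2 * (bern_coef (S e) a * x ^ S e / x) else 0).
Proof.
  intros HN Hp He Hx Ha Hex.
  assert (Hpt : forall m, osc e m a * weight e x m * Re (defect_sum N p (radius N x m)) =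
    osc e m a * weight e x m * Re (main_sum N p (radius N x m)) +
    (if Nat.eqb p 0 then (- / 2 * (x ^ S e / x)) * (osc e m a / freq m ^ S e) else 0)).
  { intros m. rewrite defect_main by (auto using radius_pos).
    assert (Hr := radius_pow N x HN Hx m).
    destruct (Nat.eqb p 0).
    - rewrite Hr. unfold Re. simpl fst. unfold weight, scaled_freq.
      assert (Hw := freq_pos m). assert (0 < freq m ^ e) by now apply pow_lt. assert (0 < x ^ e) by now apply pow_lt.
      unfold Rdiv. rewrite !Rpow_mult_distr, !pow_inv. simpl pow. field. repeat split; lra.
    - unfold Re. simpl. ring. }
  assert (Hexr : ex_series (fun m => if Nat.eqb p 0 then (- / 2 * (x ^ S e / x)) * (osc e m a / freq m ^ S e) else 0)).
  { destruct (Nat.eqb p 0).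
    - apply ex_series_Rscal. now apply ex_series_osc.
    - apply ex_series_ext with (fun m => 0 * (osc e m a / freq m ^ S e)).
      + intros m. match goal with |- ?x = ?y => change (x = y :> R) end. ring.
      + apply ex_series_Rscal. now apply ex_series_osc. }
  assert (Hexm : ex_series (fun m => osc e m a * weight e x m * Re (main_sum N p (radius N x m)))).
  { apply ex_series_ext with (fun m => osc e m a * weight e x m * Re (defect_sum N p (radius N x m)) -
      (if Nat.eqb p 0 then (- / 2 * (x ^ S e / x)) * (osc e m a / freq m ^ S e) else 0)).
    - intros m. rewrite Hpt. match goal with |- ?x = ?y => change (x = y :> R) end. ring.
    - now apply (ex_series_minus (V := R_NormedModule)). }
  unfold defect_series, main_series. rewrite (Series_ext _ _ Hpt), Series_plus by auto. f_equal.
  destruct (Nat.eqb p 0).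
  - rewrite Series_scal_l. fold (osc_sum e a). rewrite osc_sum_eq by auto. unfold Rdiv. ring.
  - rewrite (Series_ext _ (fun _ => 0 * 0)) by (intros; ring). rewrite Series_scal_l. ring.
Qed.

(* The conditional term is the zeta(0) term of P, present when N divides 2h. *)
Definition core_value (N H J : nat) (x a : R) : R :=
  rsum (fun l => bern_coef l a * x ^ l / x * Series (fun n => / INR (S n) ^ (H - N * l))) J +
  (if Nat.eqb H (N * J) then - / 2 * (bern_coef J a * x ^ J / x) else 0) +
  / INR N * Rpower x (decay_exponent N H - 1) *
    (Gamma (1 - decay_exponent N H) * hurwitz_zeta (1 - decay_exponent N H) a) +
  (main_series N (J - 1) (N + N * (J - 1) - H) x a + main_series N J (N + N * J - H) x a).

(* Here J = ceil(H/N), and the first bound also excludes H - 1 = N (J - 1), a pole of the Gamma factor. *)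
Theorem core_two N H J x a :
  (0 < N)%nat -> (2 <= J)%nat -> (N * (J - 1) + 2 <= H)%nat -> (H <= N * J)%nat -> 0 < x -> 0 < a <= 1 ->
  is_series (lambert_term N H x a) (core_value N H J x a).
Proof.
  intros HN HJ H1 H2 Hx Ha.
  assert (HNJ : (N * J = N * (J - 1) + N)%nat).
  { replace J with (S (J - 1)) at 1 by lia. rewrite Nat.mul_succ_r. reflexivity. }
  destruct (core_large N H J x a HN HJ H1 H2 Hx Ha) as [Hex Hs].
  assert (V1 := defect_series_main N (J - 1) (N + N * (J - 1) - H) x a HN ltac:(lia) ltac:(lia) Hx ltac:(lra) (Hex _ (or_introl eq_refl))).
  assert (V2 := defect_series_main N J (N + N * J - H) x a HN ltac:(lia) ltac:(lia) Hx ltac:(lra) (Hex _ (or_intror eq_refl))).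
  unfold core_value. rewrite V1, V2 in Hs.
  replace (Nat.eqb (N + N * J - H) 0) with false in Hs by (symmetry; apply Nat.eqb_neq; lia).
  replace (S (J - 1)) with J in Hs by lia.
  replace (Nat.eqb H (N * J)) with (Nat.eqb (N + N * (J - 1) - H) 0).
  2:{ destruct (Nat.eqb_spec H (N * J)); destruct (Nat.eqb_spec (N + N * (J - 1) - H) 0); auto; lia. }
  match goal with |- is_series _ ?v => match type of Hs with is_series _ ?w => replace v with w; [exact Hs|ring] end end.
Qed.

(** * The case 2h = N *)

(* Left derivatives, because at a = 1 the formula is not available to the right. *)
Definition left_deriv (f : R -> R) (a l : R) : Prop :=
  filterlim (fun h => (f (a + h) - f a) / h) (at_left 0) (locally l).

Lemma at_left_near (r : R) : 0 < r -> at_left 0 (fun h => - r < h < 0).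
Proof.
  intros Hr. exists (mkposreal r Hr). intros h Hh Hlt.
  change (Rabs (h - 0) < r) in Hh. apply Rabs_def2 in Hh. lra.
Qed.

Lemma left_deriv_unique f a l k : left_deriv f a l -> left_deriv f a k -> l = k.
Proof. intros H1 H2. eapply (filterlim_locally_unique (F := at_left 0)); eassumption. Qed.

Lemma left_deriv_plus f g a l k :
  left_deriv f a l -> left_deriv g a k -> left_deriv (fun u => f u + g u) a (l + k).
Proof.
  intros H1 H2. unfold left_deriv.
  apply filterlim_ext with (fun h => (f (a + h) - f a) / h + (g (a + h) - g a) / h).
  - intros h. unfold Rdiv. ring.
  - apply filterlim_Rplus; auto. apply at_left_proper_filter.
Qed.

Lemma left_deriv_scal c f a l : left_deriv f a l -> left_deriv (fun u => c * f u) a (c * l).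
Proof.
  intros H1. unfold left_deriv.
  apply filterlim_ext with (fun h => c * ((f (a + h) - f a) / h)).
  - intros h. unfold Rdiv. ring.
  - apply filterlim_Rscal; auto. apply at_left_proper_filter.
Qed.

Lemma left_deriv_ext f g a l : 0 < a -> (forall u, 0 < u <= a -> f u = g u) -> left_deriv f a l -> left_deriv g a l.
Proof.
  intros Ha H. apply filterlim_ext_loc. generalize (at_left_near a Ha). apply filter_imp.
  intros h Hh. rewrite !H by lra. reflexivity.
Qed.

Lemma left_deriv_is_derive f a l : is_derive f a l -> left_deriv f a l.
Proof.
  intros H. apply filterlim_R_eps; [apply at_left_proper_filter|]. intros eps Heps.
  apply is_derive_Reals in H. destruct (H eps Heps) as [d Hd].
  exists d. intros h Hh Hlt. apply Hd; [apply Rlt_not_eq; exact Hlt|].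
  change (Rabs (h - 0) < d) in Hh. now rewrite Rminus_0_r in Hh.
Qed.

Lemma left_deriv_quadratic f a l B r : 0 < r ->
  (forall h, - r < h < 0 -> Rabs (f (a + h) - f a - h * l) <= B * h ^ 2) -> left_deriv f a l.
Proof.
  intros Hr H. apply filterlim_R_eps; [apply at_left_proper_filter|]. intros eps Heps.
  assert (HB : 0 <= B).
  { specialize (H (- (r / 2)) ltac:(lra)). assert (H0 := Rabs_pos (f (a + - (r / 2)) - f a - - (r / 2) * l)).
    assert (0 < (- (r / 2)) ^ 2) by nra. nra. }
  assert (Hd : 0 < Rmin r (eps / (B + 1))) by (apply Rmin_pos; [lra|apply Rdiv_lt_0_compat; lra]).
  generalize (at_left_near _ Hd). apply filter_imp. intros h Hh.
  assert (H1 := Rmin_l r (eps / (B + 1))). assert (H2 := Rmin_r r (eps / (B + 1))).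
  specialize (H h ltac:(lra)).
  replace ((f (a + h) - f a) / h - l) with ((f (a + h) - f a - h * l) * / h) by (field; lra).
  rewrite Rabs_mult, Rabs_inv, (Rabs_left h) by lra.
  apply Rle_lt_trans with (B * (- h)).
  - apply Rmult_le_reg_r with (- h); [lra|]. rewrite Rmult_assoc, Rinv_l by lra. nra.
  - assert (Hle : - h < eps / (B + 1)) by lra. apply Rlt_div_r in Hle; [|lra]. nra.
Qed.

Lemma generating_bound b t : 0 < t -> 0 <= generating b t <= (1 + t) * exp (- b * t).
Proof.
  intros Ht. unfold generating. destruct (one_minus_exp_bounds t Ht) as [[H1 H2] [H3 H4]].
  assert (He := exp_pos (- b * t)).
  replace (t * (exp (- b * t) / (1 - exp (- t)))) with (exp (- b * t) * (t / (1 - exp (- t)))) by (field; lra).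
  assert (H0 : 0 <= t / (1 - exp (- t))) by (left; apply Rdiv_lt_0_compat; lra).
  split; [apply Rmult_le_pos; lra|]. rewrite (Rmult_comm (1 + t)).
  apply Rmult_le_compat_l; [lra|]. apply Rle_div_l; lra.
Qed.

Lemma exp_second_order x : 0 <= x -> 0 <= exp x - 1 - x <= x ^ 2 * exp x.
Proof.
  intros Hx. assert (H := exp_ineq1_le x). split; [lra|].
  assert (H2 := exp_ineq1_le (- x)).
  assert (H3 : exp (- x) * exp x = 1) by (rewrite <- exp_plus; replace (- x + x) with 0 by ring; apply exp_0).
  assert (He := exp_pos x).
  assert (exp x * (1 - x) <= 1) by nra.
  nra.
Qed.

Lemma continuous_generating a v : continuous (fun v => generating a (exp v)) v.
Proof.
  apply continuous_ex_derive. unfold generating. auto_derive.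
  generalize (exp_neg_lt_1 (exp v) (exp_pos v)). lra.
Qed.

(** Differentiating [generating] in its parameter multiplies it by -t, which turns the regularised
    integral for sigma with J = 2 into the one for sigma-1 with J = 1. The second-order error (ht)^2
    e^(-ht), with -a/2 < h < 0, is absorbed by half of the decay e^(-at), so the remainder is
    quadratic in h. *)
Lemma left_deriv_gamma_zeta sigma a : 1 < sigma < 2 -> 0 < a <= 1 ->
  left_deriv (fun b => Gamma (1 - sigma) * hurwitz_zeta (1 - sigma) b) a
    (- (Gamma (2 - sigma) * hurwitz_zeta (2 - sigma) a)).
Proof.
  intros Hs Ha.
  assert (HZ : forall b, 0 < b <= 1 -> int_line (fun v => exp (- sigma * v) * (generating b (exp v) -
      rsum (fun l => bern_coef l b * exp v ^ l) 2)) (Gamma (1 - sigma) * hurwitz_zeta (1 - sigma) b)).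
  { intros b Hb. apply gamma_zeta_integral; auto; simpl; lra. }
  assert (HZ1 : int_line (fun v => exp (- (sigma - 1) * v) * (generating a (exp v) -
      rsum (fun l => bern_coef l a * exp v ^ l) 1)) (Gamma (2 - sigma) * hurwitz_zeta (2 - sigma) a)).
  { replace (2 - sigma) with (1 - (sigma - 1)) by ring. apply gamma_zeta_integral; auto; simpl; lra. }
  destruct (scaled_gamma_exists (2 - sigma) (a / 2)) as [B1 HB1]; [lra|lra|].
  destruct (scaled_gamma_exists (3 - sigma) (a / 2)) as [B2 HB2]; [lra|lra|].
  assert (Hcd : forall mu b v, continuous (fun v => exp (mu * v) * exp (- b * exp v)) v).
  { intros mu b v. apply continuous_ex_derive. auto_derive. trivial. }
  assert (Hck : forall s b J v, continuous (fun v => exp (- s * v) * (generating b (exp v) -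
      rsum (fun l => bern_coef l b * exp v ^ l) J)) v).
  { intros s b J v. apply continuous_Rmult; [apply continuous_ex_derive; auto_derive; trivial|].
    apply continuous_Rminus; [apply continuous_generating|].
    induction J as [|J IH]; cbn [rsum]; [apply continuous_const|].
    apply continuous_Rplus; auto. apply continuous_Rscal.
    apply continuous_ex_derive. auto_derive. trivial. }
  apply left_deriv_quadratic with (B1 + B2) (a / 2); [lra|].
  intros h Hh.
  set (K := fun s b J v => exp (- s * v) * (generating b (exp v) - rsum (fun l => bern_coef l b * exp v ^ l) J)).
  assert (HcK : forall s b J v, continuous (K s b J) v) by exact Hck.
  set (D := fun v => exp ((2 - sigma) * v) * exp (- (a / 2) * exp v) + exp ((3 - sigma) * v) * exp (- (a / 2) * exp v)).
  assert (HcD : forall v, continuous D v) by (intros v; apply continuous_Rplus; apply Hcd).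
  assert (Hcf : forall v, continuous (fun v => (K sigma (a + h) 2%nat v - K sigma a 2%nat v) + h * K (sigma - 1) a 1%nat v) v).
  { intros v. apply continuous_Rplus; [apply continuous_Rminus; apply HcK|apply continuous_Rscal, HcK]. }
  assert (Hdiff : int_line (fun v => (K sigma (a + h) 2%nat v - K sigma a 2%nat v) + h * K (sigma - 1) a 1%nat v)
     ((Gamma (1 - sigma) * hurwitz_zeta (1 - sigma) (a + h) - Gamma (1 - sigma) * hurwitz_zeta (1 - sigma) a) +
       h * (Gamma (2 - sigma) * hurwitz_zeta (2 - sigma) a))).
  { apply int_line_plus.
    - intros v. apply continuous_Rminus; apply HcK.
    - intros v. apply continuous_Rscal, HcK.
    - apply int_line_minus; try apply HcK; apply HZ; lra.
    - apply int_line_scal; [apply HcK|exact HZ1]. }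
  assert (Hdom : int_line (fun v => h ^ 2 * D v) (h ^ 2 * (B1 + B2))).
  { apply int_line_scal; auto. apply int_line_plus; auto; apply Hcd. }
  assert (Hex : exists I, int_line (fun v => (K sigma (a + h) 2%nat v - K sigma a 2%nat v) + h * K (sigma - 1) a 1%nat v) I /\
     Rabs I <= h ^ 2 * (B1 + B2)).
  { apply int_line_exists_dominated with (fun v => h ^ 2 * D v);
      [exact Hcf|intros v; apply continuous_Rscal, HcD| |exact Hdom].
    intros v. unfold K, D. cbn [rsum]. set (t := exp v). assert (Ht : 0 < t) by apply exp_pos.
    rewrite !bern_coef_0, !bern_coef_1.
    assert (Hgen : generating (a + h) t = generating a t * exp (- h * t)).
    { unfold generating. replace (- (a + h) * t) with (- a * t + - h * t) by ring. rewrite exp_plus. unfold Rdiv. ring. }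
    replace (exp (- (sigma - 1) * v)) with (exp (- sigma * v) * t) by (unfold t; rewrite <- exp_plus; f_equal; ring).
    replace (exp ((2 - sigma) * v)) with (exp (- sigma * v) * t ^ 2).
    2:{ unfold t. rewrite exp_pow, <- exp_plus. f_equal. simpl. ring. }
    replace (exp ((3 - sigma) * v)) with (exp (- sigma * v) * t ^ 3).
    2:{ unfold t. rewrite exp_pow, <- exp_plus. f_equal. simpl. ring. }
    rewrite Hgen. set (S0 := exp (- sigma * v)). assert (HS0 : 0 < S0) by apply exp_pos.
    match goal with |- Rabs ?X <= _ => replace X with (S0 * (generating a t * (exp (- h * t) - 1 - (- h * t)))) by ring end.
    destruct (exp_second_order (- h * t) ltac:(nra)) as [E1 E2].
    destruct (generating_bound a t Ht) as [G1 G2].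
    rewrite Rabs_pos_eq by (apply Rmult_le_pos; [lra|apply Rmult_le_pos; lra]).
    replace (h ^ 2 * (S0 * t ^ 2 * exp (- (a / 2) * t) + S0 * t ^ 3 * exp (- (a / 2) * t))) with
      (S0 * (((1 + t) * exp (- (a / 2) * t)) * (- h * t) ^ 2)) by ring.
    apply Rmult_le_compat_l; [lra|].
    apply Rle_trans with (((1 + t) * exp (- a * t)) * ((- h * t) ^ 2 * exp (- h * t))).
    + apply Rmult_le_compat; lra.
    + replace ((1 + t) * exp (- a * t) * ((- h * t) ^ 2 * exp (- h * t))) with
        ((1 + t) * (- h * t) ^ 2 * (exp (- a * t) * exp (- h * t))) by ring.
      replace ((1 + t) * exp (- (a / 2) * t) * (- h * t) ^ 2) with ((1 + t) * (- h * t) ^ 2 * exp (- (a / 2) * t)) by ring.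
      rewrite <- exp_plus. apply Rmult_le_compat_l.
      * apply Rmult_le_pos; [lra|apply pow2_ge_0].
      * apply exp_le_compat. nra. }
  destruct Hex as [I [HI HIle]].
  assert (E := int_line_unique _ _ _ Hdiff HI). rewrite (Rmult_comm (B1 + B2)).
  match goal with |- Rabs ?X <= _ => replace X with I; [exact HIle|] end.
  rewrite <- E. ring.
Qed.

Lemma exp_minus_1_lower k y : 0 <= y -> y ^ S k / INR (fact (S k)) <= exp y - 1.
Proof.
  revert y. induction k as [|k IH]; intros y Hy.
  - generalize (exp_ineq1_le y). simpl. lra.
  - set (f := fun y => exp y - y ^ S (S k) / INR (fact (S (S k)))).
    assert (H : f 0 <= f y).
    { apply nondecreasing_of_derive with (fun y => exp y - y ^ S k / INR (fact (S k))); auto.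
      - intros u _. apply (is_derive_minus (V := R_NormedModule)); [apply is_derive_exp|apply is_derive_pow_fact].
      - intros u Hu. specialize (IH u ltac:(lra)). lra. }
    unfold f in H. rewrite exp_0, pow_i in H by lia. unfold Rdiv in H at 1. lra.
Qed.

Lemma Cexp_minus_1_lower z : 0 < Re z -> exp (Re z) - 1 <= Cmod (Cexp z - 1).
Proof.
  intros Hz. assert (H := Cmod_triangle (Cexp z - 1) 1).
  replace (Cexp z - 1 + 1)%C with (Cexp z) in H by ring. rewrite Cmod_Cexp, Cmod_1 in H. lra.
Qed.

(** From |e^w - 1| >= e^(Re w) - 1 and a single Taylor term of the exponential, decay of any
    polynomial order follows; cos([angle_margin N]) makes it uniform over the roots. *)
Lemma exponential_bound N k :
  (0 < N)%nat -> exists B, 0 < B /\ forall r j, 0 < r -> (j < N)%nat ->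
    Cmod (/ (Cexp (2 * RtoC PI * root N r j) - 1))%C <= B / r ^ S k.
Proof.
  intros HN. assert (HPI := PI_RGT_0).
  set (c := cos (angle_margin N)). assert (Hc : 0 < c) by apply (cos_root_angle N 0 HN).
  assert (Hf := INR_fact_lt_0 (S k)).
  assert (Hp : 0 < (2 * PI * c) ^ S k) by (apply pow_lt, Rmult_lt_0_compat; lra).
  exists (INR (fact (S k)) / (2 * PI * c) ^ S k). split; [now apply Rdiv_lt_0_compat|].
  intros r j Hr Hj.
  assert (Hre : 2 * PI * c * r <= Re (2 * RtoC PI * root N r j)%C).
  { replace (Re (2 * RtoC PI * root N r j)%C) with (2 * PI * Re (root N r j)) by (unfold Re; simpl; ring).
    rewrite Re_root. assert (c <= cos (root_angle N j)) by apply (cos_root_angle N j Hj). 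
    assert (r * c <= r * cos (root_angle N j)) by (apply Rmult_le_compat_l; lra). nra. }
  assert (Hy : 0 < 2 * PI * c * r) by (apply Rmult_lt_0_compat; [apply Rmult_lt_0_compat|]; lra).
  assert (Hz : 0 < Re (2 * RtoC PI * root N r j)%C) by lra.
  rewrite Cmod_inv by now apply Cexp_neq_1.
  assert (H1 := Cexp_minus_1_lower _ Hz).
  assert (H2 := exp_minus_1_lower k (2 * PI * c * r) ltac:(lra)).
  assert (H3 := exp_le_compat _ _ Hre).
  assert (Hrk : 0 < r ^ S k) by now apply pow_lt.
  replace (INR (fact (S k)) / (2 * PI * c) ^ S k / r ^ S k) with (/ ((2 * PI * c * r) ^ S k / INR (fact (S k)))).
  - apply Rinv_le_contravar; [|lra]. apply Rdiv_lt_0_compat; auto. now apply pow_lt.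
  - rewrite (Rpow_mult_distr (2 * PI * c) r).
    unfold Rdiv. rewrite !Rinv_mult, Rinv_inv. ring.
Qed.

Lemma Cmod_root_coef N q r k : (0 < N)%nat -> 0 < r ->
  Cmod (root_coef N q r k) = r ^ (2 * q + 2) / (INR N * r ^ (2 * N)).
Proof.
  intros HN Hr. assert (HNR : 0 < INR N) by (apply lt_0_INR; lia).
  assert (HrN : 0 < r ^ (2 * N)) by now apply pow_lt.
  unfold root_coef. rewrite Cmod_mult, Cmod_R, Cmod_pow, Cmod_root by auto.
  unfold Rdiv. rewrite Rabs_mult, pow_1_abs, Rabs_pos_eq.
  - ring.
  - left. apply Rinv_0_lt_compat, Rmult_lt_0_compat; auto.
Qed.

Lemma main_sum_bound N p k : (0 < N)%nat -> Nat.odd p = false ->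
  exists B, 0 < B /\ forall r, 0 < r -> Cmod (main_sum N p r) <= B * r ^ (p + 1) / (r ^ (2 * N) * r ^ S k).
Proof.
  intros HN Hp. destruct (exponential_bound N k HN) as [B [HB Hb]]. assert (HPI := PI_RGT_0).
  assert (HNR : 0 < INR N) by (apply lt_0_INR; lia).
  exists (PI * B). split; [now apply Rmult_lt_0_compat|]. intros r Hr. unfold main_sum. rewrite Hp.
  assert (HrN : 0 < r ^ (2 * N)) by now apply pow_lt. assert (Hrk : 0 < r ^ S k) by now apply pow_lt.
  assert (Hh := half_decomposition p). rewrite Hp, Nat.add_0_r in Hh.
  assert (Hterm : forall n, (n <= N)%nat -> Cmod (csum (fun k => root_coef N (p / 2) r k * decaying_defect false (root N r k))%C n)
     <= INR n * (/ INR N * (PI * B * r ^ (p + 1) / (r ^ (2 * N) * r ^ S k)))).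
  { induction n as [|n IH]; intros Hn; cbn [csum].
    - rewrite Cmod_0. simpl. lra.
    - eapply Rle_trans; [apply Cmod_triangle|]. rewrite S_INR, Rmult_plus_distr_r. apply Rplus_le_compat; [apply IH; lia|].
      rewrite Rmult_1_l, Cmod_mult, Cmod_root_coef by auto.
      unfold decaying_defect, Cdiv.
      assert (Hz : root N r n <> 0%C) by (apply C_neq_0_Re; generalize (Re_root_pos N r n ltac:(lia) Hr); lra).
      rewrite !Cmod_mult, (Cmod_inv (root N r n)), Cmod_root, Cmod_R, (Rabs_pos_eq PI) by (auto; lra).
      specialize (Hb r n Hr ltac:(lia)).
      replace (/ INR N * (PI * B * r ^ (p + 1) / (r ^ (2 * N) * r ^ S k))) with
        (r ^ (2 * (p / 2) + 2) / (INR N * r ^ (2 * N)) * (PI * / r * (B / r ^ S k))).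
      2:{ rewrite <- Hh. rewrite !pow_add. simpl (r ^ 1). simpl (r ^ 2). field. repeat split; lra. }
      apply Rmult_le_compat_l.
      + left. apply Rdiv_lt_0_compat; [now apply pow_lt|now apply Rmult_lt_0_compat].
      + apply Rmult_le_compat_l; [|exact Hb]. apply Rmult_le_pos; [lra|]. left. now apply Rinv_0_lt_compat. }
  eapply Rle_trans; [apply (Hterm N (le_n N))|]. right. field. repeat split; lra.
Qed.

Lemma pow_le_one_plus r i j : 0 < r -> (i <= j)%nat -> r ^ i <= 1 + r ^ j.
Proof.
  intros Hr Hij. assert (0 < r ^ j) by now apply pow_lt.
  destruct (Rle_lt_dec r 1) as [H1|H1].
  - apply Rle_trans with (1 ^ i); [apply pow_incr; lra|]. rewrite pow1. set (q := r ^ j) in *. lra.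
  - assert (r ^ i <= r ^ j) by (apply Rle_pow; [lra|exact Hij]). set (q := r ^ j) in *. lra.
Qed.

(** The exponential supplies r^(-4N) = y^(-4), on top of r^(-2N) = y^(-2) from the partial
    fractions. This beats the weight and r^(p+1), each at most 1+y^2, also for e = 0. *)
Lemma main_sum_weighted_bound N p x : (0 < N)%nat -> (p + 2 <= 2 * N)%nat -> Nat.odd p = false -> 0 < x ->
  exists d, ex_series d /\ forall m e, (e <= 1)%nat ->
    2 * (x * weight e x m) * Rabs (Re (main_sum N p (radius N x m))) <= d m.
Proof.
  intros HN Hp Ho Hx. destruct (main_sum_bound N p (4 * N - 1) HN Ho) as [B [HB Hb]].
  exists (fun m => (4 * B * x ^ 6) * / freq m ^ 6 + (4 * B * x ^ 2) * / freq m ^ 2). split.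
  { apply (ex_series_plus (V := R_NormedModule)); apply ex_series_Rscal, ex_series_inv_freq_pow; lia. }
  intros m e He. assert (Hw := freq_pos m). assert (Hy := scaled_freq_pos x Hx m).
  set (r := radius N x m). assert (Hr : 0 < r) by apply radius_pos.
  assert (Hr2 : r ^ (2 * N) = scaled_freq x m ^ 2) by (apply radius_pow; auto).
  assert (Hr4 : r ^ S (4 * N - 1) = scaled_freq x m ^ 4).
  { replace (S (4 * N - 1)) with (2 * N * 2)%nat by lia. rewrite pow_mult, Hr2. ring. }
  specialize (Hb r Hr). rewrite Hr2, Hr4 in Hb.
  assert (Hpow := pow_le_one_plus r (p + 1) (2 * N) Hr ltac:(lia)). rewrite Hr2 in Hpow.
  set (y := scaled_freq x m) in *.
  assert (Hwt : 0 <= x * weight e x m <= 1 + y ^ 2).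
  { unfold weight. fold y. replace (x * (y / y ^ e / x)) with (y / y ^ e) by (field; repeat split; try apply pow_nonzero; lra).
    destruct e as [|[|e]]; [| |lia]; simpl.
    - split; [left; apply Rdiv_lt_0_compat; lra|]. unfold Rdiv. rewrite Rinv_1. nra.
    - replace (y / (y * 1)) with 1 by (field; lra). split; [lra|nra]. }
  assert (Hm : Rabs (Re (main_sum N p r)) <= B * (1 + y ^ 2) / (y ^ 2 * y ^ 4)).
  { eapply Rle_trans; [apply Re_abs_le|]. eapply Rle_trans; [exact Hb|].
    apply Rmult_le_compat_r; [left; apply Rinv_0_lt_compat, Rmult_lt_0_compat; now apply pow_lt|].
    apply Rmult_le_compat_l; lra. }
  replace (4 * B * x ^ 6 * / freq m ^ 6 + 4 * B * x ^ 2 * / freq m ^ 2) with (4 * B * (1 + y ^ 4) / (y ^ 2 * y ^ 4)).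
  2:{ unfold y, scaled_freq. field. split; lra. }
  apply Rle_trans with (2 * (1 + y ^ 2) * (B * (1 + y ^ 2) / (y ^ 2 * y ^ 4))).
  - apply Rmult_le_compat; [lra|apply Rabs_pos|lra|exact Hm].
  - replace (2 * (1 + y ^ 2) * (B * (1 + y ^ 2) / (y ^ 2 * y ^ 4))) with ((2 * (1 + y ^ 2) * (B * (1 + y ^ 2))) / (y ^ 2 * y ^ 4)) by (field; lra).
    apply Rmult_le_compat_r; [left; apply Rinv_0_lt_compat, Rmult_lt_0_compat; now apply pow_lt|].
    generalize (pow2_ge_0 (y ^ 2 - 1)). simpl. intros. nra.
Qed.

Lemma weight_S e x m : 0 < x -> freq m * weight (S e) x m = x * weight e x m.
Proof.
  intros Hx. unfold weight, scaled_freq. assert (Hw := freq_pos m).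
  assert (0 < (freq m / x) ^ e) by (apply pow_lt, Rdiv_lt_0_compat; lra).
  simpl. field. repeat split; lra.
Qed.

(** Differentiation lowers e by one: the factor [freq m] produced by [osc] is absorbed by
    [weight_S]. The decay of [main_sum] for even p admits e = 0, the order at which the remainder
    series itself converges only conditionally. *)
Lemma is_derive_main_series N e p x a : (0 < N)%nat -> (p + 2 <= 2 * N)%nat -> Nat.odd p = false -> 0 < x ->
  (e <= 1)%nat ->
  is_derive (main_series N (S e) p x) a (- x * main_series N e p x a).
Proof.
  intros HN Hp Ho Hx He.
  destruct (main_sum_weighted_bound N p x HN Hp Ho Hx) as [d [Hd Hdb]].
  assert (Hbe : forall m b, Rabs (- x * (osc e m b * weight e x m * Re (main_sum N p (radius N x m)))) <= d m).
  { intros m b. eapply Rle_trans; [|apply (Hdb m e He)].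
    assert (Hwt := weight_pos e x Hx m). rewrite !Rabs_mult, Rabs_Ropp, (Rabs_pos_eq x), (Rabs_pos_eq (weight e x m)) by lra.
    assert (Ho' := osc_bound e m b). set (M := Rabs (Re _)). assert (HM : 0 <= M) by apply Rabs_pos.
    replace (x * (Rabs (osc e m b) * weight e x m * M)) with (Rabs (osc e m b) * (x * weight e x m * M)) by ring.
    replace (2 * (x * weight e x m) * M) with (2 * (x * weight e x m * M)) by ring.
    apply Rmult_le_compat_r; [|exact Ho']. apply Rmult_le_pos; [apply Rmult_le_pos; lra|lra]. }
  assert (Hex : forall b, ex_series (fun m => osc e m b * weight e x m * Re (main_sum N p (radius N x m)))).
  { intros b. apply ex_series_ext with (fun m => / - x * (- x * (osc e m b * weight e x m * Re (main_sum N p (radius N x m))))).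
    - intros m. match goal with |- ?x = ?y => change (x = y :> R) end. field. lra.
    - apply ex_series_Rscal. apply ex_series_dominated with d; auto. }
  assert (Hex2 : forall b, ex_series (fun m => osc (S e) m b * weight (S e) x m * Re (main_sum N p (radius N x m)))).
  { intros b. apply ex_series_dominated with (fun m => / freq 0 * d m); [now apply ex_series_Rscal|].
    intros m. assert (Hw := freq_pos m). assert (Hw0 := freq_pos 0).
    assert (Hwt := weight_pos (S e) x Hx m).
    rewrite !Rabs_mult, (Rabs_pos_eq (weight (S e) x m)) by lra.
    assert (Hle : / freq m <= / freq 0).
    { apply Rinv_le_contravar; auto. unfold freq. apply Rmult_le_compat_l; [generalize PI_RGT_0; lra|apply le_INR; lia]. }
    assert (Hb := Hdb m e He). rewrite <- weight_S in Hb by auto.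
    assert (Ho' := osc_bound (S e) m b). set (M := Rabs (Re _)) in *. assert (HM : 0 <= M) by apply Rabs_pos.
    assert (Hi : 0 < / freq m) by now apply Rinv_0_lt_compat.
    apply Rle_trans with (/ freq m * d m).
    - replace (Rabs (osc (S e) m b) * weight (S e) x m * M) with
        (/ freq m * (Rabs (osc (S e) m b) * (freq m * weight (S e) x m * M))) by (field; lra).
      apply Rmult_le_compat_l; [lra|]. eapply Rle_trans; [|exact Hb].
      replace (2 * (freq m * weight (S e) x m) * M) with (2 * (freq m * weight (S e) x m * M)) by ring.
      apply Rmult_le_compat_r; [|exact Ho']. apply Rmult_le_pos; [apply Rmult_le_pos; lra|lra].
    - apply Rmult_le_compat_r; [|exact Hle]. eapply Rle_trans; [|apply (Hdb m e He)].
      apply Rmult_le_pos; [|apply Rabs_pos]. assert (H1 := weight_pos e x Hx m). nra. }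
  unfold main_series. rewrite <- Series_scal_l.
  apply (derive_Series (fun m b => osc (S e) m b * weight (S e) x m * Re (main_sum N p (radius N x m)))
     (fun m b => - x * (osc e m b * weight e x m * Re (main_sum N p (radius N x m)))) d a 1); auto; [lra|].
  intros m b _.
  apply (is_derive_ext_R (fun b => (weight (S e) x m * Re (main_sum N p (radius N x m))) * osc (S e) m b)); [intros; ring|].
  evar_last; [apply is_derive_Rscal, is_derive_osc|].
  transitivity (- (freq m * weight (S e) x m) * (osc e m b * Re (main_sum N p (radius N x m)))); [ring|].
  rewrite weight_S by auto. ring.
Qed.

(** The geometric bound is uniform in c >= b, as differentiation in a requires; n^N >= n makes the
    exponent at least linear in n. *)
Lemma lambert_summable N H x b : (0 < N)%nat -> (N <= H)%nat -> 0 < x -> 0 < b ->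
  exists d, ex_series d /\ forall n c, b <= c -> 0 <= lambert_term N H x c n <= d n.
Proof.
  intros HN HH Hx Hb. assert (Hq := exp_neg_lt_1 (b * x) ltac:(nra)).
  set (q := exp (- (b * x))) in *.
  exists (fun n => (/ x + 1) * q ^ n). split.
  { apply ex_series_Rscal. exists (/ (1 - q)). apply is_series_geom. rewrite Rabs_pos_eq; lra. }
  intros n c Hc. unfold lambert_term.
  assert (Hn : 1 <= INR (S n)) by (apply (le_INR 1); lia).
  assert (HnN : INR (S n) <= INR (S n) ^ N).
  { rewrite <- (pow_1 (INR (S n))) at 1. apply Rle_pow; auto. }
  assert (HnH : INR (S n) ^ N <= INR (S n) ^ H) by (apply Rle_pow; auto).
  set (P := INR (S n) ^ N) in *. set (Q := INR (S n) ^ H) in *.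
  assert (Ht : x <= P * x) by nra. set (t := P * x) in *.
  destruct (one_minus_exp_bounds t ltac:(lra)) as [[E1 E2] [E3 E4]].
  assert (Hinv : / (1 - exp (- t)) <= / x + 1).
  { apply Rle_trans with ((1 + t) / t).
    - apply Rle_div_r; [lra|]. apply Rmult_le_reg_l with (1 - exp (- t)); [lra|].
      rewrite <- Rmult_assoc, Rinv_r, Rmult_1_l by lra. lra.
    - replace ((1 + t) / t) with (/ t + 1) by (field; lra).
      assert (/ t <= / x) by (apply Rinv_le_contravar; lra). lra. }
  assert (Hi0 : 0 < / (1 - exp (- t))) by (apply Rinv_0_lt_compat; lra).
  assert (He : exp (- c * t) <= q ^ n).
  { unfold q. rewrite exp_pow. apply exp_le_compat.
    assert (INR n * x <= t) by (unfold t; rewrite S_INR in HnN; nra).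
    assert (b * (INR n * x) <= c * t).
    { apply Rmult_le_compat; auto; try lra. apply Rmult_le_pos; [apply pos_INR|lra]. }
    lra. }
  assert (He0 := exp_pos (- c * t)).
  assert (HPQ : 0 <= P / Q <= 1).
  { split; [left; apply Rdiv_lt_0_compat; lra|]. apply Rle_div_l; lra. }
  unfold Rdiv at 2 4.
  assert (H0 : 0 <= exp (- c * t) * / (1 - exp (- t))) by (apply Rmult_le_pos; lra).
  split; [apply Rmult_le_pos; lra|].
  apply Rle_trans with (1 * (exp (- c * t) * / (1 - exp (- t)))); [apply Rmult_le_compat_r; lra|].
  rewrite Rmult_1_l, (Rmult_comm (/ x + 1)). apply Rmult_le_compat; lra.
Qed.

Lemma is_derive_lambert N x a : (0 < N)%nat -> 0 < x -> 0 < a ->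
  is_derive (fun b => Series (lambert_term N (2 * N) x b)) a (- x * Series (lambert_term N N x a)).
Proof.
  intros HN Hx Ha.
  destruct (lambert_summable N N x (a / 2) HN (le_n N) Hx ltac:(lra)) as [d1 [Hd1 H1]].
  destruct (lambert_summable N (2 * N) x (a / 2) HN ltac:(lia) Hx ltac:(lra)) as [d2 [Hd2 H2]].
  rewrite <- Series_scal_l.
  apply (derive_Series (fun n b => lambert_term N (2 * N) x b n) (fun n b => - x * lambert_term N N x b n)
    (fun n => x * d1 n) a (a / 2)); [lra|now apply ex_series_Rscal| | |].
  - intros n b Hb. unfold lambert_term.
    assert (Hn : 0 < INR (S n) ^ N) by (apply pow_lt, lt_0_INR; lia).
    replace (INR (S n) ^ (2 * N)) with (INR (S n) ^ N * INR (S n) ^ N) by (rewrite <- pow_add; f_equal; lia).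
    set (P := INR (S n) ^ N) in *. assert (He := exp_neg_lt_1 (P * x) ltac:(now apply Rmult_lt_0_compat)).
    auto_derive; trivial. field. lra.
  - intros n b Hb. apply Rabs_def2 in Hb. rewrite Rabs_mult, Rabs_Ropp, (Rabs_pos_eq x) by lra.
    apply Rmult_le_compat_l; [lra|]. destruct (H1 n b ltac:(lra)). rewrite Rabs_pos_eq; lra.
  - intros b Hb. apply Rabs_def2 in Hb. apply ex_series_dominated with d2; auto.
    intros n. destruct (H2 n b ltac:(lra)). rewrite Rabs_pos_eq; lra.
Qed.

(** [core_two] with H = 2N and J = 2 is differentiated from the left in a and divided by -x. The
    summand l = 0 is constant in a; every other term of the value at H = 2N becomes the
    corresponding term at H = N. *)
Theorem core_one N x a : Nat.odd N = false -> (0 < N)%nat -> 0 < x -> 0 < a <= 1 ->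
  is_series (lambert_term N N x a) (core_value N N 1 x a).
Proof.
  intros Ho HN Hx Ha.
  assert (HN2 : (2 <= N)%nat) by (destruct N as [|[|N]]; [lia|discriminate|lia]).
  assert (HNR : 2 <= INR N) by (apply (le_INR 2); auto).
  assert (Hd0 := is_derive_main_series N 0 0 x a HN ltac:(lia) eq_refl Hx ltac:(lia)).
  assert (Hd1 := is_derive_main_series N 1 N x a HN ltac:(lia) Ho Hx ltac:(lia)).
  set (sigma := decay_exponent N (2 * N)).
  assert (Hs2 : decay_exponent N N = sigma - 1).
  { unfold sigma, decay_exponent. rewrite mult_INR. simpl (INR 2). field. lra. }
  assert (Hsig : 1 < sigma < 2).
  { unfold sigma, decay_exponent. rewrite mult_INR. simpl (INR 2). split; [apply Rlt_div_r|apply Rlt_div_l]; lra. }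
  assert (HL : Series (lambert_term N N x a) = core_value N N 1 x a).
  { assert (Hl1 := left_deriv_is_derive _ _ _ (is_derive_lambert N x a HN Hx (proj1 Ha))).
    assert (Hval : forall b, 0 < b <= 1 -> Series (lambert_term N (2 * N) x b) =
       ((bern_coef 1 b * Series (fun n => / INR (S n) ^ N) + (- / 2 * x) * bern_coef 2 b) +
        ((/ INR N * Rpower x (sigma - 1)) * (Gamma (1 - sigma) * hurwitz_zeta (1 - sigma) b) +
         (main_series N 1 0 x b + main_series N 2 N x b))) + / x * Series (fun n => / INR (S n) ^ (2 * N))).
    { intros b Hb. assert (Hs := core_two N (2 * N) 2 x b HN (le_n 2) ltac:(lia) ltac:(lia) Hx Hb).
      rewrite (is_series_unique _ _ Hs). unfold core_value. fold sigma. cbn [rsum].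
      replace (Nat.eqb (2 * N) (N * 2)) with true by (symmetry; apply Nat.eqb_eq; lia).
      replace (2 * N - N * 0)%nat with (2 * N)%nat by lia. replace (2 * N - N * 1)%nat with N by lia.
      replace (2 - 1)%nat with 1%nat by lia.
      replace (N + N * 1 - 2 * N)%nat with 0%nat by lia. replace (N + N * 2 - 2 * N)%nat with N by lia.
      rewrite bern_coef_0. simpl pow. field. lra. }
    assert (Hl2 : left_deriv (fun b => Series (lambert_term N (2 * N) x b)) a
       (((- bern_coef 0 a) * Series (fun n => / INR (S n) ^ N) + (- / 2 * x) * (- bern_coef 1 a)) +
        ((/ INR N * Rpower x (sigma - 1)) * (- (Gamma (2 - sigma) * hurwitz_zeta (2 - sigma) a)) +
         (- x * main_series N 0 0 x a + - x * main_series N 1 N x a)) + 0)).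
    { eapply left_deriv_ext; [exact (proj1 Ha)|intros u Hu; symmetry; apply Hval; lra|].
      repeat apply left_deriv_plus.
      - apply left_deriv_is_derive. apply (is_derive_ext_R (fun b => Series (fun n => / INR (S n) ^ N) * bern_coef 1 b)); [intros; ring|].
        evar_last; [apply is_derive_Rscal, is_derive_bern_coef|]. ring.
      - apply left_deriv_scal, left_deriv_is_derive, is_derive_bern_coef.
      - apply left_deriv_scal. now apply left_deriv_gamma_zeta.
      - now apply left_deriv_is_derive.
      - now apply left_deriv_is_derive.
      - apply left_deriv_is_derive. apply (is_derive_const (V := R_NormedModule)). }
    assert (E := left_deriv_unique _ _ _ _ Hl1 Hl2).
    apply Rmult_eq_reg_l with (- x); [|lra]. rewrite E. unfold core_value. rewrite Hs2.
    replace (1 - (sigma - 1)) with (2 - sigma) by ring. cbn [rsum].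
    replace (Nat.eqb N (N * 1)) with true by (symmetry; apply Nat.eqb_eq; lia).
    replace (N - N * 0)%nat with N by lia. replace (1 - 1)%nat with 0%nat by lia.
    replace (N + N * 0 - N)%nat with 0%nat by lia. replace (N + N * 1 - N)%nat with N by lia.
    replace (Rpower x (sigma - 1)) with (x * Rpower x (sigma - 1 - 1)).
    - rewrite bern_coef_0. simpl pow. field. lra.
    - rewrite <- (Rpower_1 x) at 1 by auto. rewrite <- Rpower_plus. f_equal. ring. }
  rewrite <- HL. apply Series_correct.
  destruct (lambert_summable N N x a HN (le_n N) Hx (proj1 Ha)) as [d [Hd H1]].
  apply ex_series_dominated with d; auto. intros n. destruct (H1 n a ltac:(lra)). rewrite Rabs_pos_eq; lra.
Qed.

(** * Identification of P and S *)

Lemma floor_unique (x : R) (n : Z) : IZR n <= x < IZR n + 1 -> floor x = n.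
Proof.
  intros H. unfold floor. destruct (floor_ex x) as [m Hm]. simpl.
  assert (IZR m < IZR n + 1) by lra. assert (IZR n < IZR m + 1) by lra.
  rewrite <- plus_IZR in *. apply lt_IZR in H0, H1. lia.
Qed.

Lemma floor_div (u v n : nat) (x : R) : (0 < v)%nat -> x = INR u / INR v -> n = (u / v)%nat ->
  floor x = Z.of_nat n.
Proof.
  intros Hv -> ->. apply floor_unique. rewrite <- INR_IZR_INZ.
  assert (HvR : 0 < INR v) by now apply lt_0_INR.
  assert (E := Nat.div_mod_eq u v). assert (L := Nat.mod_upper_bound u v ltac:(lia)).
  split.
  - apply Rle_div_r; auto. rewrite <- mult_INR. apply le_INR. nia.
  - apply Rlt_div_l; auto. rewrite <- S_INR, <- mult_INR. apply lt_INR. nia.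
Qed.

Lemma osc_odd k m a : osc (2 * k + 1) m a = 2 * (-1) ^ k * cos (freq m * a).
Proof.
  induction k as [|k IH]; [simpl; ring|].
  replace (2 * S k + 1)%nat with (S (S (2 * k + 1))) by lia. rewrite osc_SS, IH. simpl pow. ring.
Qed.

Lemma osc_even k m a : osc (2 * k) m a = 2 * (-1) ^ k * sin (freq m * a).
Proof.
  induction k as [|k IH]; [simpl; ring|].
  replace (2 * S k)%nat with (S (S (2 * k))) by lia. rewrite osc_SS, IH. simpl pow. ring.
Qed.

Lemma pow_m1_sqr k : (-1) ^ k * (-1) ^ k = 1.
Proof. rewrite <- Rpow_mult_distr. replace (-1 * -1) with 1 by ring. apply pow1. Qed.

(** For k >= 1 this is [osc_sum_eq] at a = 1. The case k = 0, with zeta(0) = -1/2, is included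
    because the last term of the second sum in P meets it when N divides h. *)
Lemma zeta_even k : riemann_zeta (INR (2 * k)) =
  - (-1) ^ k * (2 * PI) ^ (2 * k) / 2 * (bernnum (2 * k) / INR (fact (2 * k))).
Proof.
  destruct k as [|k].
  - unfold riemann_zeta. simpl (INR _). rewrite hurwitz_zeta_0. unfold bernnum, bernpoly, bern0, Binomial.C. simpl. field.
  - rewrite riemann_zeta_nat by lia. assert (HPI := PI_RGT_0).
    assert (Hp : 0 < (2 * PI) ^ (2 * S k)) by (apply pow_lt; lra).
    assert (E := osc_sum_eq (2 * k + 1) 1 ltac:(lia) ltac:(lra)). unfold osc_sum in E.
    rewrite (Series_ext _ (fun m => (2 * (-1) ^ k / (2 * PI) ^ (2 * S k)) * / INR (S m) ^ (2 * S k))) in E.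
    + rewrite Series_scal_l in E. unfold bern_coef in E. fold (bernnum (S (2 * k + 1))) in E.
      replace (S (2 * k + 1)) with (2 * S k)%nat in E by lia.
      rewrite pow_1_even, Rmult_1_l in E. rewrite <- E. simpl ((-1) ^ S k).
      set (Z := Series _). assert (Hs := pow_m1_sqr k). set (P := (2 * PI) ^ (2 * S k)) in *. set (s := (-1) ^ k) in *.
      transitivity ((s * s) * Z); [rewrite Hs; ring|field; lra].
    + intros m. rewrite osc_odd. replace (S (2 * k + 1)) with (2 * S k)%nat by lia.
      replace (cos (freq m * 1)) with 1.
      * unfold freq. rewrite (Rpow_mult_distr (2 * PI)). match goal with |- ?x = ?y => change (x = y :> R) end.
        field. split; [apply pow_nonzero, not_0_INR; lia|lra].
      * unfold freq. replace (2 * PI * INR (S m) * 1) with (0 + 2 * INR (S m) * PI) by ring.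
        rewrite cos_period. symmetry. apply cos_0.
Qed.

(** The indices 0 and 1 are the separate zeta terms of P, the odd ones from 3 on its first sum, and
    the even ones from 2 on its second. *)
Lemma rsum_parity (u : nat -> R) M : (1 <= M)%nat ->
  rsum u (S M) = u 0%nat + u 1%nat + rsum (fun i => u (2 * S i + 1)%nat) ((M - 1) / 2) + rsum (fun i => u (2 * S i)%nat) (M / 2).
Proof.
  intros HM. induction M as [|M IH]; [lia|]. destruct M as [|M].
  - simpl. ring.
  - change (rsum u (S (S (S M)))) with (rsum u (S (S M)) + u (S (S M))). rewrite IH by lia.
    destruct (Nat.Even_or_Odd M) as [[i Hi]|[i Hi]]; subst M.
    + replace ((S (2 * i) - 1) / 2)%nat with i by (replace (S (2 * i) - 1)%nat with (i * 2)%nat by lia; now rewrite Nat.div_mul).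
      replace ((S (S (2 * i)) - 1) / 2)%nat with i by (replace (S (S (2 * i)) - 1)%nat with (1 + i * 2)%nat by lia; now rewrite Nat.div_add).
      replace (S (2 * i) / 2)%nat with i by (replace (S (2 * i))%nat with (1 + i * 2)%nat by lia; now rewrite Nat.div_add).
      replace (S (S (2 * i)) / 2)%nat with (S i) by (replace (S (S (2 * i)))%nat with (S i * 2)%nat by lia; now rewrite Nat.div_mul).
      cbn [rsum]. replace (2 * S i)%nat with (S (S (2 * i))) by lia. ring.
    + replace ((S (2 * i + 1) - 1) / 2)%nat with i by (replace (S (2 * i + 1) - 1)%nat with (1 + i * 2)%nat by lia; now rewrite Nat.div_add).
      replace ((S (S (2 * i + 1)) - 1) / 2)%nat with (S i) by (replace (S (S (2 * i + 1)) - 1)%nat with (S i * 2)%nat by lia; now rewrite Nat.div_mul).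
      replace (S (2 * i + 1) / 2)%nat with (S i) by (replace (S (2 * i + 1))%nat with (S i * 2)%nat by lia; now rewrite Nat.div_mul).
      replace (S (S (2 * i + 1)) / 2)%nat with (S i) by (replace (S (S (2 * i + 1)))%nat with (1 + S i * 2)%nat by lia; now rewrite Nat.div_add).
      cbn [rsum]. replace (2 * S i + 1)%nat with (S (S (2 * i + 1))) by lia. ring.
Qed.

Lemma sgnZ_of_nat n : sgnZ (Z.of_nat n) = (-1) ^ n.
Proof.
  induction n as [|n IH]; [reflexivity|].
  rewrite Nat2Z.inj_succ. unfold sgnZ in *. rewrite Z.even_succ, <- Z.negb_even. simpl pow. rewrite <- IH.
  destruct (Z.even (Z.of_nat n)); simpl; ring.
Qed.

Lemma sgnZ_plus u v : sgnZ (u + v) = sgnZ u * sgnZ v.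
Proof. unfold sgnZ. rewrite Z.even_add. destruct (Z.even u), (Z.even v); simpl; ring. Qed.

Lemma sgnZ_double u : sgnZ (2 * u) = 1.
Proof. unfold sgnZ. now rewrite Z.even_mul. Qed.

Lemma sgnZ_congr u v w : (u = v + 2 * w)%Z -> sgnZ u = sgnZ v.
Proof. intros ->. rewrite sgnZ_plus, sgnZ_double. ring. Qed.

(** If H = N J, then H/N = J and the conditional term is the summand l = J, since zeta(0) = -1/2.
    Otherwise H/N = J-1 and there is no such term. *)
Lemma core_value_closed N H J x a : (0 < N)%nat -> (N <= H)%nat -> (1 <= J)%nat ->
  (N * (J - 1) + 2 <= H)%nat -> (H <= N * J)%nat ->
  core_value N H J x a =
  rsum (fun l => bern_coef l a * x ^ l / x * riemann_zeta (INR (H - N * l))) (S (H / N)) +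
  / INR N * Rpower x (decay_exponent N H - 1) *
    (Gamma (1 - decay_exponent N H) * hurwitz_zeta (1 - decay_exponent N H) a) +
  (main_series N (J - 1) (N + N * (J - 1) - H) x a + main_series N J (N + N * J - H) x a).
Proof.
  intros HN HNH HJ H1 H2. unfold core_value. do 2 f_equal.
  assert (HNJ : (N * J = N * (J - 1) + N)%nat).
  { replace J with (S (J - 1)) at 1 by lia. rewrite Nat.mul_succ_r. reflexivity. }
  assert (E : rsum (fun l => bern_coef l a * x ^ l / x * Series (fun n => / INR (S n) ^ (H - N * l))) J =
     rsum (fun l => bern_coef l a * x ^ l / x * riemann_zeta (INR (H - N * l))) J).
  { apply rsum_ext. intros l Hl. rewrite riemann_zeta_nat; [reflexivity|].
    assert (N * l <= N * (J - 1))%nat by (apply Nat.mul_le_mono_l; lia). lia. }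
  rewrite E. destruct (Nat.eqb_spec H (N * J)) as [Heq|Hne].
  - replace (H / N)%nat with J by (rewrite Heq, Nat.mul_comm, Nat.div_mul; lia).
    cbn [rsum]. f_equal. replace (H - N * J)%nat with 0%nat by lia. unfold riemann_zeta. simpl (INR 0).
    rewrite hurwitz_zeta_0. unfold Rdiv. ring.
  - replace (S (H / N)) with J; [ring|].
    assert (H / N = J - 1)%nat by (symmetry; apply (Nat.div_unique H N (J - 1) (H - N * (J - 1))); lia). lia.
Qed.

(** With M = floor(2h/N), the limits of the two sums in P are floor(h/N - 1/2) = floor((M-1)/2) and
    floor(h/N) = floor(M/2). The even indices are then converted by Euler's formula [zeta_even]. *)
Lemma P_term_closed N h x a : (0 < N)%nat -> (Z.of_nat N <= 2 * h)%Z -> 0 < x ->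
  P_term N h x a =
  rsum (fun l => bern_coef l a * x ^ l / x * riemann_zeta (INR (Z.to_nat (2 * h) - N * l))) (S (Z.to_nat (2 * h) / N)) +
  / INR N * Rpower x (- s_exp N h) * (Gamma (s_exp N h) * hurwitz_zeta (s_exp N h) a).
Proof.
  intros HN Hh Hx. destruct (Z_of_nat_complete h ltac:(lia)) as [n ->].
  assert (HNR : 0 < INR N) by now apply lt_0_INR.
  replace (Z.to_nat (2 * Z.of_nat n)) with (2 * n)%nat by lia.
  assert (HNn : (N <= 2 * n)%nat) by lia.
  set (M := (2 * n / N)%nat).
  assert (HM : (1 <= M)%nat) by (apply Nat.div_le_lower_bound; lia).
  assert (HMN : (N * M <= 2 * n)%nat) by (apply Nat.Div0.mul_div_le).
  rewrite rsum_parity by exact HM.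
  assert (F1 : floor_hN_half N (Z.of_nat n) = Z.of_nat ((M - 1) / 2)).
  { unfold floor_hN_half. apply floor_div with (2 * n - N)%nat (N * 2)%nat; [lia| |].
    - rewrite minus_INR, !mult_INR, <- INR_IZR_INZ by lia. simpl (INR 2). field. lra.
    - rewrite <- Nat.Div0.div_div. f_equal. symmetry.
      unfold M. replace (2 * n)%nat with ((2 * n - N) + 1 * N)%nat at 2 by lia. rewrite Nat.div_add by lia. lia. }
  assert (F2 : floor_hN N (Z.of_nat n) = Z.of_nat (M / 2)).
  { unfold floor_hN. apply floor_div with (2 * n)%nat (N * 2)%nat; [lia| |].
    - rewrite !mult_INR, <- INR_IZR_INZ. simpl (INR 2). field. lra.
    - unfold M. now rewrite Nat.Div0.div_div. }
  unfold P_term. rewrite F1, F2, !Nat2Z.id.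
  assert (Ho : rsum (fun i => bern_coef (2 * S i + 1) a * x ^ (2 * S i + 1) / x * riemann_zeta (INR (2 * n - N * (2 * S i + 1)))) ((M - 1) / 2) =
     -1 * rsum (fun i => let j := S i in
        bernpoly (2 * j + 1) a / INR (fact (2 * j + 1))
        * riemann_zeta (IZR (2 * Z.of_nat n - (2 * Z.of_nat j + 1) * Z.of_nat N)) * x ^ (2 * j)) ((M - 1) / 2)).
  { rewrite <- rsum_scal. apply rsum_ext. intros i Hi. cbv zeta.
    assert (Hl : (N * (2 * S i + 1) <= 2 * n)%nat).
    { apply Nat.le_trans with (N * M)%nat; auto. apply Nat.mul_le_mono_l.
      assert (2 * ((M - 1) / 2) <= M - 1)%nat by (apply Nat.Div0.mul_div_le). lia. }
    replace (IZR (2 * Z.of_nat n - (2 * Z.of_nat (S i) + 1) * Z.of_nat N)) with (INR (2 * n - N * (2 * S i + 1))).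
    2:{ rewrite INR_IZR_INZ. f_equal. lia. }
    unfold bern_coef. replace ((-1) ^ (2 * S i + 1)) with (-1).
    2:{ rewrite Nat.add_1_r. symmetry. apply pow_1_odd. }
    rewrite (pow_add x). simpl (x ^ 1). field. split; [apply INR_fact_neq_0|lra]. }
  assert (He : rsum (fun i => bern_coef (2 * S i) a * x ^ (2 * S i) / x * riemann_zeta (INR (2 * n - N * (2 * S i)))) (M / 2) =
     sgnZ (Z.of_nat n + 1) / 2 * powerRZ (2 * PI) (2 * Z.of_nat n) * rsum (fun i => let j := S i in
        let m := Z.to_nat (2 * Z.of_nat n - 2 * Z.of_nat j * Z.of_nat N) in
        (-1 / (4 * PI ^ 2)) ^ (j * N)
        * bernpoly (2 * j) a * bernnum m / (INR (fact (2 * j)) * INR (fact m))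
        * x ^ (2 * j - 1)) (M / 2)).
  { rewrite <- rsum_scal. apply rsum_ext. intros i Hi. cbv zeta. assert (HPI := PI_RGT_0).
    assert (Hl : (N * (2 * S i) <= 2 * n)%nat).
    { apply Nat.le_trans with (N * M)%nat; auto. apply Nat.mul_le_mono_l.
      assert (2 * (M / 2) <= M)%nat by (apply Nat.Div0.mul_div_le). lia. }
    replace (Z.to_nat (2 * Z.of_nat n - 2 * Z.of_nat (S i) * Z.of_nat N)) with (2 * (n - S i * N))%nat by lia.
    replace (2 * n - N * (2 * S i))%nat with (2 * (n - S i * N))%nat by lia.
    rewrite zeta_even. set (k := (n - S i * N)%nat).
    replace n with (k + S i * N)%nat by (unfold k; nia).
    replace (2 * Z.of_nat (k + S i * N))%Z with (Z.of_nat (2 * k + 2 * (S i * N))) by lia.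
    rewrite <- pow_powerRZ. set (w := (S i * N)%nat).
    replace (sgnZ (Z.of_nat (k + w) + 1)) with (- (-1) ^ k * (-1) ^ w).
    2:{ replace (Z.of_nat (k + w) + 1)%Z with (Z.of_nat (k + w + 1)) by lia. rewrite sgnZ_of_nat, !pow_add. simpl. ring. }
    replace ((-1 / (4 * PI ^ 2)) ^ w) with ((-1) ^ w / (2 * PI) ^ (2 * w)).
    2:{ rewrite pow_mult. replace ((2 * PI) ^ 2) with (4 * PI ^ 2) by ring. unfold Rdiv. now rewrite (Rpow_mult_distr (-1)), pow_inv. }
    unfold bern_coef. rewrite pow_1_even. replace (2 * S i - 1)%nat with (2 * i + 1)%nat by lia.
    replace (x ^ (2 * S i)) with (x * x ^ (2 * i + 1)) by (replace (2 * S i)%nat with (S (2 * i + 1)) by lia; reflexivity).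
    rewrite (pow_add (2 * PI)).
    transitivity (- (-1) ^ k * ((-1) ^ w * (-1) ^ w) / 2 * (2 * PI) ^ (2 * k) * bernpoly (2 * S i) a * bernnum (2 * k) /
       (INR (fact (2 * S i)) * INR (fact (2 * k))) * x ^ (2 * i + 1)).
    - rewrite pow_m1_sqr. field. repeat split; try apply INR_fact_neq_0; lra.
    - field. repeat split; try apply INR_fact_neq_0. apply pow_nonzero. lra. }
  rewrite Ho, He. rewrite bern_coef_0, bern_coef_1.
  replace (IZR (2 * Z.of_nat n)) with (INR (2 * n - N * 0)) by (rewrite INR_IZR_INZ; f_equal; lia).
  replace (IZR (- Z.of_nat N + 2 * Z.of_nat n)) with (INR (2 * n - N * 1)) by (rewrite INR_IZR_INZ; f_equal; lia).
  cbv zeta. set (S1 := rsum _ ((M - 1) / 2)). set (S2 := rsum _ (M / 2)).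
  rewrite pow_O, pow_1. field. lra.
Qed.

(** * Series of complex numbers and the phases in S *)

Definition Csummable (f : nat -> C) : Prop :=
  ex_series (fun n => Re (f n)) /\ ex_series (fun n => Im (f n)).

Lemma Csummable_bound (f : nat -> C) d : ex_series d -> (forall n, Cmod (f n) <= d n) -> Csummable f.
Proof.
  intros Hd H. split; apply ex_series_dominated with d; auto; intros n.
  - eapply Rle_trans; [apply Re_abs_le|apply H].
  - eapply Rle_trans; [apply Im_abs_le|apply H].
Qed.

Lemma sum_n_C (f : nat -> C) n :
  sum_n (G := C_AbelianMonoid) f n = (sum_n (fun k => Re (f k)) n, sum_n (fun k => Im (f k)) n).
Proof.
  induction n as [|n IH].
  - rewrite !sum_O. apply surjective_pairing.
  - rewrite !sum_Sn, IH. reflexivity.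
Qed.

Lemma is_series_C (f : nat -> C) (l : C) :
  is_series (fun n => Re (f n)) (Re l) -> is_series (fun n => Im (f n)) (Im l) ->
  is_series (V := C_NormedModule) f l.
Proof.
  intros H1 H2. destruct l as [l1 l2].
  apply filterlim_ext with (fun n => (sum_n (fun k => Re (f k)) n, sum_n (fun k => Im (f k)) n)).
  { intros n. symmetry. apply sum_n_C. }
  intros P [eps HP].
  assert (E1 := proj1 (filterlim_locally _ _) H1 eps). assert (E2 := proj1 (filterlim_locally _ _) H2 eps).
  exact (filter_imp _ _ (fun n B => HP _ (conj (proj1 B) (proj2 B))) (filter_and _ _ E1 E2)).
Qed.

Lemma Csummable_ex_series f : Csummable f -> ex_series (V := C_NormedModule) f.
Proof.
  intros [[l1 H1] [l2 H2]]. exists (l1, l2). now apply is_series_C.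
Qed.

Lemma CSeries_ext f g : (forall n, f n = g n) -> CSeries f = CSeries g.
Proof. intros H. unfold CSeries. f_equal; apply Series_ext; intros n; now rewrite H. Qed.

Lemma Csummable_ext f g : (forall n, f n = g n) -> Csummable f -> Csummable g.
Proof.
  intros H [H1 H2]. split; [revert H1|revert H2]; apply ex_series_ext; intros n; now rewrite H.
Qed.

Lemma Csummable_plus f g : Csummable f -> Csummable g -> Csummable (fun n => f n + g n)%C.
Proof. intros [F1 F2] [G1 G2]. split; now apply (ex_series_plus (V := R_NormedModule)). Qed.

Lemma CSeries_plus f g : Csummable f -> Csummable g ->
  CSeries (fun n => f n + g n)%C = (CSeries f + CSeries g)%C.
Proof.
  intros [F1 F2] [G1 G2]. unfold CSeries. apply injective_projections; simpl; now apply Series_plus.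
Qed.

Lemma Csummable_scal c f : Csummable f -> Csummable (fun n => c * f n)%C.
Proof.
  intros [F1 F2]. split; simpl.
  - apply (ex_series_minus (V := R_NormedModule)); now apply ex_series_Rscal.
  - apply (ex_series_plus (V := R_NormedModule)); now apply ex_series_Rscal.
Qed.

Lemma CSeries_scal c f : Csummable f -> CSeries (fun n => c * f n)%C = (c * CSeries f)%C.
Proof.
  intros [F1 F2]. unfold CSeries, Re, Im in *. apply injective_projections; simpl.
  - rewrite Series_minus, !Series_scal_l; auto; now apply ex_series_Rscal.
  - rewrite Series_plus, !Series_scal_l; auto; now apply ex_series_Rscal.
Qed.

Lemma CSeries_csum (F : nat -> nat -> C) K : (forall k, (k < K)%nat -> Csummable (F k)) ->
  Csummable (fun n => csum (fun k => F k n) K) /\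
  CSeries (fun n => csum (fun k => F k n) K) = csum (fun k => CSeries (F k)) K.
Proof.
  induction K as [|K IH]; intros H; cbn [csum].
  - split.
    + split; exists 0; apply (is_series_rsum (fun _ _ => 0) (fun _ => 0) 0); intros; lia.
    + unfold CSeries. apply injective_projections; simpl;
        apply is_series_unique, (is_series_rsum (fun _ _ => 0) (fun _ => 0) 0); intros; lia.
  - destruct IH as [I1 I2]; [intros k Hk; apply H; lia|]. split.
    + apply Csummable_plus; auto.
    + rewrite CSeries_plus, I2; auto.
Qed.

Lemma Cexp_PI_Z (z : Z) : Cexp (0, PI * IZR z) = RtoC (sgnZ z).
Proof.
  unfold Cexp, sgnZ. simpl. rewrite exp_0.
  destruct (Z.even z) eqn:E.
  - apply Z.even_spec in E. destruct E as [w ->].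
    rewrite mult_IZR. replace (PI * (2 * IZR w)) with (IZR w * PI * 2) by ring.
    assert (Hs : sin (IZR w * PI) = 0) by (apply sin_eq_0_1; now exists w).
    replace (IZR w * PI * 2) with (2 * (IZR w * PI)) by ring.
    rewrite cos_2a_sin, sin_2a, Hs. apply injective_projections; simpl; ring.
  - assert (Ho : Z.odd z = true) by (rewrite <- Z.negb_even, E; reflexivity).
    apply Z.odd_spec in Ho. destruct Ho as [w ->].
    rewrite plus_IZR, mult_IZR. replace (PI * (2 * IZR w + 1)) with (2 * (IZR w * PI) + PI) by ring.
    assert (Hs : sin (IZR w * PI) = 0) by (apply sin_eq_0_1; now exists w).
    rewrite neg_cos, neg_sin, cos_2a_sin, sin_2a, Hs. apply injective_projections; simpl; ring.
Qed.

Lemma Cexp_half_PI : Cexp (0, PI * (1 / 2)) = Ci.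
Proof.
  unfold Cexp. simpl. replace (PI * (1 / 2)) with (PI / 2) by field.
  rewrite exp_0, cos_PI2, sin_PI2. apply injective_projections; simpl; ring.
Qed.

Lemma Cexp_imag_plus s t : Cexp (0, s + t) = (Cexp (0, s) * Cexp (0, t))%C.
Proof. rewrite <- Cexp_plus. f_equal. apply injective_projections; simpl; ring. Qed.

(** The index centred at (N-1)/2 is the integer j for odd N and j + 1/2 for even N, so one family of
    roots serves both parities. *)
Lemma A_N_root N k j x m : (0 < N)%nat -> 0 < x -> j = INR k - (INR N - 1) / 2 ->
  A_N N j (INR (S m) / x) = (RtoC PI * root N (radius N x m) k)%C.
Proof.
  intros HN Hx ->. unfold A_N, root, radius, root_angle, scaled_freq, freq, Rpower.
  rewrite RtoC_mult, <- Cmult_assoc. do 4 f_equal.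
  assert (0 < INR N) by now apply lt_0_INR.
  replace (2 * PI * (INR (S m) / x)) with (2 * PI * INR (S m) / x) by (field; lra). field. lra.
Qed.

Lemma pow_radius N x m n : 0 < x -> radius N x m ^ n = exp (INR n * (ln (scaled_freq x m) / INR N)).
Proof. intros Hx. unfold radius. now rewrite exp_pow. Qed.

(** The exponent of y collapses: 1-e + (p+1-2N)/N = -(2h-1)/N. Writing y = (2 pi/x)(m+1) then
    separates the prefactor of S from the power of the summation index. *)
Lemma weight_radius N (h : Z) x e p m : (0 < N)%nat -> 0 < x ->
  (Z.of_nat p + 2 * h = Z.of_nat N + Z.of_nat N * Z.of_nat e)%Z ->
  weight e x m * (radius N x m ^ (p + 1) / (INR N * radius N x m ^ (2 * N))) =
  / INR N * Rpower (2 * PI / x) (s_exp N h) / (2 * PI) / npow N h (S m).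
Proof.
  intros HN Hx Hp. assert (HNR : 0 < INR N) by now apply lt_0_INR. assert (HPI := PI_RGT_0).
  rewrite (weight_exp e x Hx), !pow_radius by auto.
  assert (Hpr : INR p = INR N + INR N * INR e - IZR (2 * h)).
  { rewrite !INR_IZR_INZ, <- mult_IZR, <- plus_IZR, <- minus_IZR. f_equal. lia. }
  assert (Hn : 0 < INR (S m)) by (apply lt_0_INR; lia).
  assert (Hc : 0 < 2 * PI / x) by (apply Rdiv_lt_0_compat; lra).
  assert (Hl : ln (scaled_freq x m) = ln (2 * PI / x) + ln (INR (S m))).
  { rewrite <- ln_mult by auto. f_equal. unfold scaled_freq, freq. field. lra. }
  unfold s_exp, npow, Rpower.
  rewrite Hl, plus_INR, mult_INR, Hpr. simpl (INR 1). simpl (INR 2).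
  set (u := ln (2 * PI / x)). set (v := ln (INR (S m))).
  replace (IZR (2 * h - 1)) with (IZR (2 * h) - 1) by (rewrite minus_IZR; reflexivity).
  replace (IZR (Z.of_nat N - 2 * h + 1)) with (INR N - IZR (2 * h) + 1).
  2:{ rewrite plus_IZR, minus_IZR, <- INR_IZR_INZ. reflexivity. }
  set (H := IZR (2 * h)).
  assert (Eu : exp u = 2 * PI / x) by (now apply exp_ln).
  set (E1 := exp ((1 - INR e) * (u + v))). set (E2 := exp ((INR N + INR N * INR e - H + 1) * ((u + v) / INR N))).
  set (E3 := exp ((1 + 1) * INR N * ((u + v) / INR N))). set (E4 := exp ((INR N - H + 1) / INR N * u)).
  set (E5 := exp ((H - 1) / INR N * v)).
  assert (P3 : 0 < E3) by apply exp_pos. assert (P5 : 0 < E5) by apply exp_pos.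
  assert (Key : E1 * E2 * E5 * exp u = E4 * E3).
  { unfold E1, E2, E3, E4, E5. rewrite <- !exp_plus. f_equal. field. lra. }
  rewrite Eu in Key.
  apply Rmult_eq_reg_r with (INR N * E3 * (2 * PI) * E5); [|apply Rgt_not_eq, Rmult_lt_0_compat; [apply Rmult_lt_0_compat; [apply Rmult_lt_0_compat|]|]; lra].
  transitivity (E1 * E2 * E5 * (2 * PI / x)); [field; lra|]. rewrite Key. field. lra.
Qed.

(** The factor pi/z of the defect lowers the power of the root to p+1 = 2q+1, and its pi cancels
    against the 1/(2 pi) of [weight_radius]. *)
Lemma main_term_even N (h : Z) x e q m k (c : R) : (0 < N)%nat -> 0 < x -> (k < N)%nat ->
  (Z.of_nat (2 * q) + 2 * h = Z.of_nat N + Z.of_nat N * Z.of_nat e)%Z ->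
  (RtoC (2 * c * weight e x m) * (root_coef N q (radius N x m) k * decaying_defect false (root N (radius N x m) k)) =
   RtoC (/ INR N * Rpower (2 * PI / x) (s_exp N h)) *
    (RtoC ((-1) ^ q) * Cexp (0, (INR (2 * q + 1) * root_angle N k)%R) *
     (RtoC (c / npow N h (S m)) * / (Cexp (2 * RtoC PI * root N (radius N x m) k) - 1))))%C.
Proof.
  intros HN Hx Hk Hq. assert (Hr := radius_pos N x m). set (r := radius N x m) in *.
  assert (HPI := PI_RGT_0). assert (HNR : 0 < INR N) by now apply lt_0_INR.
  assert (HrN : 0 < r ^ (2 * N)) by now apply pow_lt.
  assert (HW := weight_radius N h x e (2 * q) m HN Hx Hq). fold r in HW.
  assert (Hnp : 0 < npow N h (S m)) by apply exp_pos.
  assert (Hz : root N r k <> 0%C) by (apply C_neq_0_Re; generalize (Re_root_pos N r k Hk Hr); lra).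
  unfold decaying_defect, root_coef, Cdiv. set (E := (/ (Cexp (2 * RtoC PI * root N r k) - 1))%C).
  replace (2 * q + 2)%nat with (S (2 * q + 1)) by lia. rewrite Cpow_S.
  transitivity (RtoC (2 * c * weight e x m * ((-1) ^ q / (INR N * r ^ (2 * N))) * PI) * root N r k ^ (2 * q + 1) * E)%C.
  - rewrite !RtoC_mult. field. auto.
  - rewrite root_pow.
    transitivity (RtoC (2 * PI * c * (-1) ^ q * (weight e x m * (r ^ (2 * q + 1) / (INR N * r ^ (2 * N))))) *
       Cexp (0, (INR (2 * q + 1) * root_angle N k)%R) * E)%C.
    + rewrite Cmult_assoc, <- RtoC_mult. do 3 f_equal. field. lra.
    + rewrite HW.
      replace (2 * PI * c * (-1) ^ q * (/ INR N * Rpower (2 * PI / x) (s_exp N h) / (2 * PI) / npow N h (S m))) with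
        (/ INR N * Rpower (2 * PI / x) (s_exp N h) * (-1) ^ q * (c / npow N h (S m))) by (field; lra).
      rewrite !RtoC_mult. ring.
Qed.

(** Here the 1/(2 pi) of [weight_radius] meets only the factor 2 of [osc]; this is the 1/pi in front
    of the digamma sums in S. *)
Lemma main_term_odd N (h : Z) x e q m k (c : R) : (0 < N)%nat -> 0 < x -> (k < N)%nat ->
  (Z.of_nat (2 * q + 1) + 2 * h = Z.of_nat N + Z.of_nat N * Z.of_nat e)%Z ->
  (RtoC (2 * c * weight e x m) * (root_coef N q (radius N x m) k * decaying_defect true (root N (radius N x m) k)) =
   RtoC (/ INR N * Rpower (2 * PI / x) (s_exp N h)) *
    (RtoC ((-1) ^ q) * Cexp (0, (INR (2 * q + 1 + 1) * root_angle N k)%R) *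
     (RtoC (/ PI) * (RtoC (c / npow N h (S m)) * summation_defect true (root N (radius N x m) k)))))%C.
Proof.
  intros HN Hx Hk Hq. assert (Hr := radius_pos N x m). set (r := radius N x m) in *.
  assert (HPI := PI_RGT_0). assert (HNR : 0 < INR N) by now apply lt_0_INR.
  assert (HrN : 0 < r ^ (2 * N)) by now apply pow_lt.
  assert (HW := weight_radius N h x e (2 * q + 1) m HN Hx Hq). fold r in HW.
  assert (Hnp : 0 < npow N h (S m)) by apply exp_pos.
  unfold decaying_defect, root_coef. set (E := summation_defect true (root N r k)).
  replace (2 * q + 2)%nat with (2 * q + 1 + 1)%nat by lia. rewrite root_pow.
  transitivity (RtoC (2 * c * (-1) ^ q * (weight e x m * (r ^ (2 * q + 1 + 1) / (INR N * r ^ (2 * N))))) *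
     Cexp (0, (INR (2 * q + 1 + 1) * root_angle N k)%R) * E)%C.
  - replace (2 * c * (-1) ^ q * (weight e x m * (r ^ (2 * q + 1 + 1) / (INR N * r ^ (2 * N))))) with
      (2 * c * weight e x m * ((-1) ^ q / (INR N * r ^ (2 * N)) * r ^ (2 * q + 1 + 1))) by (field; lra).
    rewrite !RtoC_mult. ring.
  - rewrite HW.
    replace (2 * c * (-1) ^ q * (/ INR N * Rpower (2 * PI / x) (s_exp N h) / (2 * PI) / npow N h (S m))) with
      (/ INR N * Rpower (2 * PI / x) (s_exp N h) * (-1) ^ q * / PI * (c / npow N h (S m))) by (field; lra).
    rewrite !RtoC_mult. ring.
Qed.

(** It rests on p+1 = N(1+e) + 1-2h. The first part of the angle is the phase that S displays; the
    second is pi times an integer or half an odd integer and so contributes a sign or a sign times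
    i. *)
Lemma phase_split N (h : Z) e p k : (0 < N)%nat ->
  (Z.of_nat p + 2 * h = Z.of_nat N + Z.of_nat N * Z.of_nat e)%Z ->
  INR (p + 1) * root_angle N k = PI * IZR (1 - 2 * h) * (INR k - (INR N - 1) / 2) / INR N +
    PI * ((INR k - (INR N - 1) / 2) * (1 + INR e)).
Proof.
  intros HN Hp. assert (HNR : 0 < INR N) by now apply lt_0_INR.
  replace (INR (p + 1)) with (INR N + INR N * INR e + IZR (1 - 2 * h)).
  - unfold root_angle. field. lra.
  - rewrite !INR_IZR_INZ, <- mult_IZR, <- !plus_IZR. f_equal. lia.
Qed.

(** Since [main_sum] is real by [Im_main_sum], the real series can be summed as a complex one and
    split over the roots, where each part converges by itself. *)
Lemma main_series_csum N e p x a (K : C) (phase : nat -> C) (F : nat -> nat -> C) :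
  (0 < N)%nat -> (p + 2 <= 2 * N)%nat ->
  (forall k m, (k < N)%nat ->
     (RtoC (osc e m a * weight e x m) * (root_coef N (p / 2) (radius N x m) k *
        decaying_defect (Nat.odd p) (root N (radius N x m) k)) = K * (phase k * F k m))%C) ->
  (forall k, (k < N)%nat -> Csummable (F k)) ->
  RtoC (main_series N e p x a) = (K * csum (fun k => phase k * CSeries (F k)) N)%C.
Proof.
  intros HN Hp HF HS.
  assert (HT : forall m, RtoC (osc e m a * weight e x m * Re (main_sum N p (radius N x m))) =
     (K * csum (fun k => phase k * F k m) N)%C).
  { intros m. rewrite RtoC_mult.
    replace (RtoC (Re (main_sum N p (radius N x m)))) with (main_sum N p (radius N x m)).
    - unfold main_sum. rewrite <- !csum_scal. apply csum_ext. intros k Hk. now apply HF.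
    - apply injective_projections; [reflexivity|]. apply Im_main_sum; auto. apply radius_pos. }
  destruct (CSeries_csum (fun k m => phase k * F k m)%C N) as [I1 I2].
  { intros k Hk. now apply Csummable_scal, HS. }
  transitivity (CSeries (fun m => RtoC (osc e m a * weight e x m * Re (main_sum N p (radius N x m))))).
  - unfold CSeries, main_series. apply injective_projections; [reflexivity|]. simpl. symmetry.
    apply is_series_unique, (is_series_rsum (fun _ _ => 0) (fun _ => 0) 0); intros; lia.
  - rewrite (CSeries_ext _ _ HT), CSeries_scal, I2 by exact I1. f_equal. apply csum_ext. intros k Hk.
    apply CSeries_scal. now apply HS.
Qed.

Definition exp_part (N : nat) (h : Z) (x : R) (f : nat -> R) (k m : nat) : C :=
  (RtoC (f m / npow N h (S m)) * / (Cexp (2 * RtoC PI * root N (radius N x m) k) - 1))%C.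

Definition digamma_part (N : nat) (h : Z) (x : R) (f : nat -> R) (k m : nat) : C :=
  (RtoC (f m / npow N h (S m)) * summation_defect true (root N (radius N x m) k))%C.

Lemma npow_ge_1 N h m : (0 < N)%nat -> (1 <= 2 * h)%Z -> 1 <= npow N h (S m).
Proof.
  intros HN Hh. assert (HNR : 0 < INR N) by now apply lt_0_INR.
  assert (Hn : 1 <= INR (S m)) by (apply (le_INR 1); lia).
  unfold npow. rewrite <- (Rpower_O (INR (S m))) at 1 by lra.
  apply Rle_Rpower; auto. apply Rle_div_r; auto. rewrite Rmult_0_l. apply IZR_le. lia.
Qed.

Lemma Csummable_exp_part N h x f k : (0 < N)%nat -> (1 <= 2 * h)%Z -> 0 < x -> (k < N)%nat ->
  (forall m, Rabs (f m) <= 1) -> Csummable (exp_part N h x f k).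
Proof.
  intros HN Hh Hx Hk Hf. destruct (exponential_bound N (2 * N - 1) HN) as [B [HB Hb]].
  apply Csummable_bound with (fun m => (B * x ^ 2) * / freq m ^ 2).
  { apply ex_series_Rscal, ex_series_inv_freq_pow. lia. }
  intros m. assert (Hr := radius_pos N x m). specialize (Hb _ k Hr Hk).
  replace (S (2 * N - 1)) with (2 * N)%nat in Hb by lia. rewrite radius_pow in Hb by auto.
  assert (Hn := npow_ge_1 N h m HN Hh). assert (Hw := freq_pos m).
  unfold exp_part. rewrite Cmod_mult, Cmod_R.
  replace (B * x ^ 2 * / freq m ^ 2) with (1 * (B / scaled_freq x m ^ 2)) by (unfold scaled_freq; field; lra).
  apply Rmult_le_compat; auto using Rabs_pos, Cmod_ge_0.
  unfold Rdiv. rewrite Rabs_mult, Rabs_inv, (Rabs_pos_eq (npow _ _ _)) by lra.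
  specialize (Hf m). apply (Rle_div_l _ 1); lra.
Qed.

(** Linear growth of the defect costs one factor m^(1/N) and leaves the exponent (2h-2)/N, which
    exceeds 1 because 2h >= N+3. *)
Lemma Csummable_digamma_part N h x f k : (0 < N)%nat -> (Z.of_nat N + 3 <= 2 * h)%Z -> 0 < x -> (k < N)%nat ->
  (forall m, Rabs (f m) <= 1) -> Csummable (digamma_part N h x f k).
Proof.
  intros HN Hh Hx Hk Hf. assert (HNR : 0 < INR N) by now apply lt_0_INR. assert (HPI := PI_RGT_0).
  destruct (angle_margin_range N HN) as [M1 M2].
  assert (Hsin : 0 <= sin (angle_margin N) < 1).
  { split; [apply sin_ge_0; lra|]. rewrite <- sin_PI2. apply sin_increasing_1; lra. }
  destruct (summation_defect_odd_bound (1 - sin (angle_margin N))) as [B [HB Hb]]; [lra|].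
  set (c := exp (ln (2 * PI / x) / INR N)). assert (Hc : 0 < c) by apply exp_pos.
  set (tau := IZR (2 * h - 2) / INR N).
  assert (Htau : 1 < tau).
  { unfold tau. apply Rlt_div_r; auto. rewrite Rmult_1_l, INR_IZR_INZ. apply IZR_lt. lia. }
  apply Csummable_bound with (fun m => (B * (1 + c + / c)) * Rpower (INR (S m)) (- tau)).
  { apply ex_series_Rscal, ex_series_Rpower, Htau. }
  intros m. assert (Hr := radius_pos N x m). assert (Hw := freq_pos m).
  assert (Hn : 1 <= INR (S m)) by (apply (le_INR 1); lia).
  assert (Hz := Re_root_pos N _ k Hk Hr).
  assert (Hrc : radius N x m = c * exp (ln (INR (S m)) / INR N)).
  { unfold radius, c. rewrite <- exp_plus. f_equal.
    replace (scaled_freq x m) with (2 * PI / x * INR (S m)) by (unfold scaled_freq, freq; field; lra).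
    rewrite ln_mult by (try apply Rdiv_lt_0_compat; lra). field. lra. }
  set (g := exp (ln (INR (S m)) / INR N)) in *.
  assert (Hg : 1 <= g).
  { unfold g. rewrite <- exp_0 at 1. apply exp_le_compat. apply Rle_div_r; auto. rewrite Rmult_0_l, <- ln_1.
    apply ln_le; lra. }
  unfold digamma_part. rewrite Cmod_mult, Cmod_R.
  assert (Hd : Cmod (summation_defect true (root N (radius N x m) k)) <= B * ((1 + c + / c) * g)).
  { eapply Rle_trans; [apply Hb; auto|].
    - rewrite Im_root, Cmod_root, Rabs_mult, (Rabs_pos_eq (radius N x m)) by (auto; lra).
      rewrite Rmult_comm. apply Rmult_le_compat_r; [lra|]. generalize (sin_root_angle N k Hk). lra.
    - rewrite Cmod_root, Hrc by auto. assert (Hci : 0 < / c) by now apply Rinv_0_lt_compat.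
      assert (Hgi : / (c * g) <= / c * g).
      { rewrite Rinv_mult. apply Rmult_le_compat_l; [lra|]. apply Rle_trans with 1; [|lra].
        rewrite <- Rinv_1. apply Rinv_le_contravar; lra. }
      assert (0 < / (c * g)) by (apply Rinv_0_lt_compat, Rmult_lt_0_compat; lra).
      assert (0 <= c * g) by (apply Rmult_le_pos; lra).
      apply Rmult_le_compat_l; [exact HB|]. nra. }
  replace (B * (1 + c + / c) * Rpower (INR (S m)) (- tau)) with (/ npow N h (S m) * (B * ((1 + c + / c) * g))).
  - assert (Hnp := npow_ge_1 N h m HN ltac:(lia)).
    apply Rmult_le_compat; auto using Rabs_pos, Cmod_ge_0.
    unfold Rdiv. rewrite Rabs_mult, Rabs_inv, (Rabs_pos_eq (npow _ _ _)) by lra.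
    rewrite <- (Rmult_1_l (/ npow _ _ _)) at 2. apply Rmult_le_compat_r; [|apply Hf].
    left. apply Rinv_0_lt_compat. lra.
  - replace (Rpower (INR (S m)) (- tau)) with (/ npow N h (S m) * g); [ring|].
    unfold npow, Rpower, g, tau. rewrite <- exp_Ropp, <- exp_plus. f_equal.
    replace (IZR (2 * h - 2)) with (IZR (2 * h - 1) - 1) by (rewrite <- minus_IZR; f_equal; lia). field. lra.
Qed.

Lemma exp_freq_neq_1 N x m k : (k < N)%nat -> (Cexp (2 * RtoC PI * root N (radius N x m) k) - 1)%C <> 0%C.
Proof.
  intros Hk. apply Cexp_neq_1. assert (Hz := Re_root_pos N _ k Hk (radius_pos N x m)). assert (HPI := PI_RGT_0).
  replace (Re (2 * RtoC PI * root N (radius N x m) k)%C) with (2 * PI * Re (root N (radius N x m) k)) by (unfold Re; simpl; ring).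
  apply Rmult_lt_0_compat; lra.
Qed.

Lemma jodd_center N k : Nat.odd N = true -> IZR (jodd N k) = INR k - (INR N - 1) / 2.
Proof.
  intros Ho. apply Nat.odd_spec in Ho. destruct Ho as [n ->]. unfold jodd.
  replace (2 * n + 1 - 1)%nat with (n * 2)%nat by lia. rewrite Nat.div_mul by lia.
  rewrite minus_IZR, <- !INR_IZR_INZ, plus_INR, mult_INR. simpl (INR 2). simpl (INR 1). field.
Qed.

Lemma jeven_center N k : Nat.odd N = false -> IZR (jeven N k) + 1 / 2 = INR k - (INR N - 1) / 2.
Proof.
  intros Ho. assert (He : Nat.even N = true) by (rewrite <- Nat.negb_odd, Ho; reflexivity).
  apply Nat.even_spec in He. destruct He as [n ->]. unfold jeven.
  rewrite (Nat.mul_comm 2 n), Nat.div_mul by lia.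
  rewrite minus_IZR, <- !INR_IZR_INZ, mult_INR. simpl (INR 2). field.
Qed.

Lemma odd_series1_part N h x a k m : Nat.odd N = true -> (0 < N)%nat -> 0 < x -> (k < N)%nat ->
  odd_series1 N h x a k m = exp_part N h x (fun m => cos (freq m * a)) k m.
Proof.
  intros Ho HN Hx Hk. unfold odd_series1, exp_part. rewrite (A_N_root N k _ x m HN Hx (jodd_center N k Ho)), Cmult_assoc.
  assert (He := exp_freq_neq_1 N x m k Hk). set (E := (Cexp _ - 1)%C) in *.
  assert (Hnp : 0 < npow N h (S m)) by apply exp_pos.
  assert (Hnp' : RtoC (npow N h (S m)) <> 0%C) by (apply C_neq_0_Re; simpl; lra).
  rewrite RtoC_div by lra. unfold freq. field. now split.
Qed.

Lemma odd_series2_part N h x a k m : Nat.odd N = true -> (0 < N)%nat -> 0 < x -> (k < N)%nat ->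
  odd_series2 N h x a k m = digamma_part N h x (fun m => sin (freq m * a)) k m.
Proof.
  intros Ho HN Hx Hk. unfold odd_series2, digamma_part. cbv zeta.
  rewrite (A_N_root N k _ x m HN Hx (jodd_center N k Ho)). set (z := root N (radius N x m) k).
  assert (HPI := PI_RGT_0). assert (HP : RtoC PI <> 0%C) by (apply C_neq_0_Re; simpl; lra).
  rewrite (RtoC_inv PI) by lra.
  replace (/ RtoC PI * (RtoC PI * z))%C with z by (field; auto).
  replace (Ci * / RtoC PI * (RtoC PI * z))%C with (Ci * z)%C by (field; auto).
  replace (- Ci * / RtoC PI * (RtoC PI * z))%C with (- (Ci * z))%C by (field; auto).
  replace (RtoC (1 / 2)) with (/ 2)%C by (rewrite RtoC_div by lra; field; apply RtoC_2_neq_0).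
  reflexivity.
Qed.

Lemma even_series_part N h x a k m : Nat.odd N = false -> (0 < N)%nat -> 0 < x -> (k < N)%nat ->
  even_series N h x a k m = (exp_part N h x (fun m => cos (freq m * a)) k m +
    Ci * RtoC (sgnZ (jeven N k + Z.of_nat (N / 2) + 1)) * exp_part N h x (fun m => sin (freq m * a)) k m)%C.
Proof.
  intros Ho HN Hx Hk. unfold even_series, exp_part. rewrite (A_N_root N k _ x m HN Hx (jeven_center N k Ho)), Cmult_assoc.
  assert (He := exp_freq_neq_1 N x m k Hk). set (E := (Cexp _ - 1)%C) in *.
  assert (Hnp : 0 < npow N h (S m)) by apply exp_pos.
  assert (Hnp' : RtoC (npow N h (S m)) <> 0%C) by (apply C_neq_0_Re; simpl; lra).
  rewrite !RtoC_div, RtoC_mult by lra. unfold freq. field. now split.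
Qed.

Lemma phase_int N h e p k z : (0 < N)%nat ->
  (Z.of_nat p + 2 * h = Z.of_nat N + Z.of_nat N * Z.of_nat e)%Z ->
  (INR k - (INR N - 1) / 2) * (1 + INR e) = IZR z ->
  Cexp (0, INR (p + 1) * root_angle N k) =
    (Cexp (0, (PI * IZR (1 - 2 * h) * (INR k - (INR N - 1) / 2) / INR N)%R) * RtoC (sgnZ z))%C.
Proof. intros HN Hp Hz. now rewrite (phase_split N h e p k HN Hp), Cexp_imag_plus, Hz, Cexp_PI_Z. Qed.

Lemma phase_half_int N h e p k z : (0 < N)%nat ->
  (Z.of_nat p + 2 * h = Z.of_nat N + Z.of_nat N * Z.of_nat e)%Z ->
  (INR k - (INR N - 1) / 2) * (1 + INR e) = IZR z + 1 / 2 ->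
  Cexp (0, INR (p + 1) * root_angle N k) =
    (Cexp (0, (PI * IZR (1 - 2 * h) * (INR k - (INR N - 1) / 2) / INR N)%R) * (Ci * RtoC (sgnZ z)))%C.
Proof.
  intros HN Hp Hz. rewrite (phase_split N h e p k HN Hp), Cexp_imag_plus, Hz, Rmult_plus_distr_l, Cexp_imag_plus, Cexp_PI_Z, Cexp_half_PI.
  ring.
Qed.

Definition prefactor (N : nat) (h : Z) (x : R) : C :=
  RtoC (sgnZ (h + 1) / INR N * Rpower (2 * PI / x) (s_exp N h)).

Definition phase (N : nat) (h : Z) (k : nat) : C :=
  Cexp (0, PI * IZR (1 - 2 * h) * (INR k - (INR N - 1) / 2) / INR N).

Lemma center_double N k : INR k - (INR N - 1) / 2 = IZR (2 * Z.of_nat k - Z.of_nat N + 1) / 2.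
Proof. rewrite plus_IZR, minus_IZR, mult_IZR, <- !INR_IZR_INZ. field. Qed.

(** The signs (-1)^q from [root_coef], (-1)^i from [osc] and the one from the phase must combine to
    (-1)^(h+1); the parity condition on q+i+z says that they do. *)
Lemma prefactor_sign N h x i q z : (0 < N)%nat -> sgnZ (Z.of_nat (q + i) + z) = sgnZ (h + 1) ->
  (RtoC (/ INR N * Rpower (2 * PI / x) (s_exp N h)) * (RtoC ((-1) ^ q) * RtoC ((-1) ^ i) * RtoC (sgnZ z)) = prefactor N h x)%C.
Proof.
  intros HN Hs. unfold prefactor. rewrite <- Hs, sgnZ_plus, sgnZ_of_nat, pow_add, <- !RtoC_mult. f_equal.
  unfold Rdiv. ring.
Qed.

(** Here e is odd, so 1+e is even and the extra phase is a plain sign for either parity of N. *)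
Lemma main_series_cos N h x a i q : (0 < N)%nat -> (1 <= 2 * h)%Z -> 0 < x -> (2 * q + 2 <= 2 * N)%nat ->
  (Z.of_nat (2 * q) + 2 * h = Z.of_nat N + Z.of_nat N * Z.of_nat (2 * i + 1))%Z ->
  RtoC (main_series N (2 * i + 1) (2 * q) x a) =
  (prefactor N h x * csum (fun k => phase N h k * CSeries (exp_part N h x (fun m => cos (freq m * a)) k)) N)%C.
Proof.
  intros HN Hh Hx Hp Hq. apply main_series_csum; auto.
  2:{ intros k Hk. apply Csummable_exp_part; auto. intros m. apply Rabs_le, COS_bound. }
  intros k m Hk.
  replace (2 * q / 2)%nat with q by (rewrite Nat.mul_comm, Nat.div_mul; lia).
  rewrite Nat.odd_even, osc_odd, (Rmult_assoc 2), (main_term_even N h x (2 * i + 1) q m k) by auto.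
  set (z := ((2 * Z.of_nat k - Z.of_nat N + 1) * (Z.of_nat i + 1))%Z).
  rewrite (phase_int N h (2 * i + 1) (2 * q) k z) by
    (auto; rewrite center_double; unfold z; rewrite mult_IZR, (plus_IZR (Z.of_nat i)), plus_INR, mult_INR, <- INR_IZR_INZ; simpl (INR 2); simpl (INR 1); field).
  fold (phase N h k). rewrite <- (prefactor_sign N h x i q z HN).
  - unfold exp_part. replace ((-1) ^ i * cos (freq m * a) / npow N h (S m)) with ((-1) ^ i * (cos (freq m * a) / npow N h (S m))) by (unfold Rdiv; ring).
    rewrite (RtoC_mult ((-1) ^ i)). ring.
  - apply sgnZ_congr with (Z.of_nat i + Z.of_nat k * (Z.of_nat i + 1) - h)%Z.
    assert (E : (Z.of_nat q = Z.of_nat N * (Z.of_nat i + 1) - h)%Z) by nia.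
    rewrite Nat2Z.inj_add, E. unfold z. ring.
Qed.

Lemma main_series_sin_odd N h x a i q : Nat.odd N = true -> (0 < N)%nat -> (Z.of_nat N + 3 <= 2 * h)%Z -> 0 < x ->
  (2 * q + 1 + 2 <= 2 * N)%nat ->
  (Z.of_nat (2 * q + 1) + 2 * h = Z.of_nat N + Z.of_nat N * Z.of_nat (2 * i))%Z ->
  RtoC (main_series N (2 * i) (2 * q + 1) x a) =
  (prefactor N h x * csum (fun k => phase N h k * RtoC (sgnZ (jodd N k + Z.of_nat ((N + 1) / 2)) / PI) *
     CSeries (digamma_part N h x (fun m => sin (freq m * a)) k)) N)%C.
Proof.
  intros Ho HN Hh Hx Hp Hq. apply main_series_csum; auto.
  2:{ intros k Hk. apply Csummable_digamma_part; auto. intros m. apply Rabs_le, SIN_bound. }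
  intros k m Hk. assert (HPI := PI_RGT_0).
  replace ((2 * q + 1) / 2)%nat with q by (replace (2 * q + 1)%nat with (1 + q * 2)%nat by lia; rewrite Nat.div_add by lia; reflexivity).
  rewrite Nat.odd_odd, osc_even, (Rmult_assoc 2), (main_term_odd N h x (2 * i) q m k) by auto.
  set (z := (jodd N k * (2 * Z.of_nat i + 1))%Z).
  rewrite (phase_int N h (2 * i) (2 * q + 1) k z) by
    (auto; rewrite <- jodd_center by auto; unfold z; rewrite mult_IZR, plus_IZR, mult_IZR, mult_INR, <- INR_IZR_INZ; simpl (INR 2); ring).
  (* The sign s in front of the sine sums of S varies with k. As s^2 = 1 it can be moved into the
     prefactor, where the signs then combine to (-1)^(h+1). *)
  fold (phase N h k). set (s := sgnZ (jodd N k + Z.of_nat ((N + 1) / 2))).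
  assert (Hs : s * s = 1) by (unfold s, sgnZ; destruct (Z.even _); ring).
  replace (prefactor N h x) with (RtoC (/ INR N * Rpower (2 * PI / x) (s_exp N h)) * (RtoC ((-1) ^ q) * RtoC ((-1) ^ i) * RtoC (sgnZ z)) * RtoC s)%C.
  - unfold digamma_part. replace ((-1) ^ i * sin (freq m * a) / npow N h (S m)) with ((-1) ^ i * (sin (freq m * a) / npow N h (S m))) by (unfold Rdiv; ring).
    rewrite (RtoC_mult ((-1) ^ i)). replace (RtoC (s / PI)) with (RtoC s * RtoC (/ PI))%C by (symmetry; apply RtoC_mult).
    set (K := RtoC (/ INR N * Rpower (2 * PI / x) (s_exp N h))).
    transitivity (K * (RtoC ((-1) ^ q) * (phase N h k * RtoC (sgnZ z)) * (RtoC (/ PI) * (RtoC ((-1) ^ i) * RtoC (sin (freq m * a) / npow N h (S m)) *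
       summation_defect true (root N (radius N x m) k)))) * RtoC (s * s))%C; [rewrite Hs; ring|].
    rewrite RtoC_mult. ring.
  - rewrite <- (prefactor_sign N h x i q (z + (jodd N k + Z.of_nat ((N + 1) / 2)))%Z HN).
    + rewrite (sgnZ_plus z). fold s. rewrite (RtoC_mult (sgnZ z)). ring.
    + apply Nat.odd_spec in Ho. destruct Ho as [n Hn]. subst N.
      replace ((2 * n + 1 + 1) / 2)%nat with (n + 1)%nat by (replace (2 * n + 1 + 1)%nat with ((n + 1) * 2)%nat by lia; now rewrite Nat.div_mul).
      assert (E : (Z.of_nat q = Z.of_nat n + (2 * Z.of_nat n + 1) * Z.of_nat i - h)%Z) by nia.
      apply sgnZ_congr with (Z.of_nat n + Z.of_nat n * Z.of_nat i + Z.of_nat i - h + jodd (2 * n + 1) k * (Z.of_nat i + 1))%Z.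
      rewrite Nat2Z.inj_add, E. unfold z. rewrite Nat2Z.inj_add. ring.
Qed.

(** For even N and even e the centred index times 1+e is half an odd integer, which is where the
    factor i of S comes from. *)
Lemma main_series_sin_even N h x a i q : Nat.odd N = false -> (0 < N)%nat -> (1 <= 2 * h)%Z -> 0 < x ->
  (2 * q + 2 <= 2 * N)%nat ->
  (Z.of_nat (2 * q) + 2 * h = Z.of_nat N + Z.of_nat N * Z.of_nat (2 * i))%Z ->
  RtoC (main_series N (2 * i) (2 * q) x a) =
  (prefactor N h x * csum (fun k => phase N h k * (Ci * RtoC (sgnZ (jeven N k + Z.of_nat (N / 2) + 1))) *
     CSeries (exp_part N h x (fun m => sin (freq m * a)) k)) N)%C.
Proof.
  intros Ho HN Hh Hx Hp Hq. apply main_series_csum; auto.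
  2:{ intros k Hk. apply Csummable_exp_part; auto. intros m. apply Rabs_le, SIN_bound. }
  intros k m Hk.
  replace (2 * q / 2)%nat with q by (rewrite Nat.mul_comm, Nat.div_mul; lia).
  rewrite Nat.odd_even, osc_even, (Rmult_assoc 2), (main_term_even N h x (2 * i) q m k) by auto.
  set (z := (jeven N k * (2 * Z.of_nat i + 1) + Z.of_nat i)%Z).
  rewrite (phase_half_int N h (2 * i) (2 * q) k z) by
    (auto; rewrite <- jeven_center by auto; unfold z; rewrite plus_IZR, mult_IZR, plus_IZR, mult_IZR, mult_INR, <- INR_IZR_INZ; simpl (INR 2); field).
  fold (phase N h k). set (s := sgnZ (jeven N k + Z.of_nat (N / 2) + 1)).
  assert (Hs : s * s = 1) by (unfold s, sgnZ; destruct (Z.even _); ring).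
  replace (prefactor N h x) with (RtoC (/ INR N * Rpower (2 * PI / x) (s_exp N h)) * (RtoC ((-1) ^ q) * RtoC ((-1) ^ i) * RtoC (sgnZ z)) * RtoC s)%C.
  - unfold exp_part. replace ((-1) ^ i * sin (freq m * a) / npow N h (S m)) with ((-1) ^ i * (sin (freq m * a) / npow N h (S m))) by (unfold Rdiv; ring).
    rewrite (RtoC_mult ((-1) ^ i)).
    set (K := RtoC (/ INR N * Rpower (2 * PI / x) (s_exp N h))). set (E := (/ (Cexp _ - 1))%C).
    transitivity (K * (RtoC ((-1) ^ q) * (phase N h k * (Ci * RtoC (sgnZ z))) * (RtoC ((-1) ^ i) * RtoC (sin (freq m * a) / npow N h (S m)) *
       E)) * RtoC (s * s))%C; [rewrite Hs; ring|].
    rewrite (RtoC_mult s). ring.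
  - rewrite <- (prefactor_sign N h x i q (z + (jeven N k + Z.of_nat (N / 2) + 1))%Z HN).
    + rewrite (sgnZ_plus z). fold s. rewrite (RtoC_mult (sgnZ z)). ring.
    + assert (He : Nat.even N = true) by (rewrite <- Nat.negb_odd, Ho; reflexivity).
      apply Nat.even_spec in He. destruct He as [n Hn]. subst N.
      replace (2 * n / 2)%nat with n by (rewrite Nat.mul_comm, Nat.div_mul; lia).
      assert (E : (Z.of_nat q = Z.of_nat n + 2 * Z.of_nat n * Z.of_nat i - h)%Z) by nia.
      apply sgnZ_congr with (Z.of_nat n + Z.of_nat n * Z.of_nat i + Z.of_nat i - h + jeven (2 * n) k * (Z.of_nat i + 1))%Z.
      rewrite Nat2Z.inj_add, E. unfold z. ring.
Qed.

(** The odd one of J-1 and J is the order of the cosine remainder, the even one that of the sine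
    remainder. *)
Lemma even_or_odd_pair J : (1 <= J)%nat -> exists i l,
  (2 * i + 1 = J - 1 /\ 2 * l = J \/ 2 * l = J - 1 /\ 2 * i + 1 = J)%nat.
Proof.
  intros HJ. destruct (Nat.Even_or_Odd J) as [[l Hl]|[i Hi]].
  - exists (l - 1)%nat, l. lia.
  - exists i, i. lia.
Qed.

(** The exponent p of the cosine remainder is 2(N(i+1)-h), always even, so its defects are
    exponential. The exponent of the sine remainder has the parity of N, which is why digamma values
    occur for odd N only. *)
Theorem S_term_closed N h J x a : (0 < N)%nat -> (Z.of_nat N <= 2 * h)%Z -> (1 <= J)%nat -> 0 < x ->
  (Z.of_nat N * (Z.of_nat J - 1) + 2 <= 2 * h)%Z -> (2 * h <= Z.of_nat N * Z.of_nat J)%Z ->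
  (Nat.odd N = true -> (Z.of_nat N + 3 <= 2 * h)%Z) ->
  S_term N h x a = RtoC (main_series N (J - 1) (N + N * (J - 1) - Z.to_nat (2 * h)) x a +
    main_series N J (N + N * J - Z.to_nat (2 * h)) x a).
Proof.
  intros HN Hh HJ Hx H1 H2 Ho.
  destruct (even_or_odd_pair J HJ) as [i [l Hil]].
  set (pc := (N + N * (2 * i + 1) - Z.to_nat (2 * h))%nat).
  set (ps := (N + N * (2 * l) - Z.to_nat (2 * h))%nat).
  assert (HNJ : (Z.of_nat N * Z.of_nat J = Z.of_nat N * (Z.of_nat J - 1) + Z.of_nat N)%Z) by ring.
  assert (Hpc : (Z.of_nat pc + 2 * h = Z.of_nat N + Z.of_nat N * Z.of_nat (2 * i + 1))%Z /\ (pc + 2 <= 2 * N)%nat).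
  { unfold pc. destruct Hil as [[E1 E2]|[E1 E2]]; rewrite ?E2, ?E1.
    - replace (Z.of_nat (J - 1)) with (Z.of_nat J - 1)%Z by lia.
      assert (Z.of_nat (N * (J - 1)) = Z.of_nat N * (Z.of_nat J - 1))%Z by (rewrite Nat2Z.inj_mul; f_equal; lia). lia.
    - assert (Z.of_nat (N * J) = Z.of_nat N * Z.of_nat J)%Z by (now rewrite Nat2Z.inj_mul). lia. }
  assert (Hps : (Z.of_nat ps + 2 * h = Z.of_nat N + Z.of_nat N * Z.of_nat (2 * l))%Z /\ (ps + 2 <= 2 * N)%nat).
  { unfold ps. destruct Hil as [[E1 E2]|[E1 E2]]; rewrite ?E2, ?E1.
    - assert (Z.of_nat (N * J) = Z.of_nat N * Z.of_nat J)%Z by (now rewrite Nat2Z.inj_mul). lia.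
    - replace (Z.of_nat (J - 1)) with (Z.of_nat J - 1)%Z by lia.
      assert (Z.of_nat (N * (J - 1)) = Z.of_nat N * (Z.of_nat J - 1))%Z by (rewrite Nat2Z.inj_mul; f_equal; lia). lia. }
  replace (main_series N (J - 1) (N + N * (J - 1) - Z.to_nat (2 * h)) x a +
    main_series N J (N + N * J - Z.to_nat (2 * h)) x a) with
    (main_series N (2 * i + 1) pc x a + main_series N (2 * l) ps x a).
  2:{ unfold pc, ps. destruct Hil as [[E1 E2]|[E1 E2]]; rewrite ?E2, ?E1; ring. }
  clearbody pc ps. destruct Hpc as [Hpc Hpc2], Hps as [Hps Hps2].
  rewrite RtoC_plus.
  assert (Hc : exists q, pc = (2 * q)%nat).
  { exists (Z.to_nat (Z.of_nat N * (Z.of_nat i + 1) - h)). lia. }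
  destruct Hc as [q ->]. rewrite (main_series_cos N h x a i q) by (auto; lia).
  unfold S_term. destruct (Nat.odd N) eqn:HO.
  - assert (Hs : exists q, ps = (2 * q + 1)%nat).
    { assert (HO' := HO). apply Nat.odd_spec in HO'. destruct HO' as [n ->].
      exists (Z.to_nat (Z.of_nat n + (2 * Z.of_nat n + 1) * Z.of_nat l - h)). lia. }
    destruct Hs as [q' ->]. rewrite (main_series_sin_odd N h x a l q') by (auto; lia).
    rewrite <- Cmult_plus_distr_l, <- csum_plus. unfold S_odd, prefactor. f_equal. apply csum_ext. intros k Hk.
    rewrite jodd_center by auto. fold (phase N h k).
    rewrite (CSeries_ext _ _ (fun m => odd_series1_part N h x a k m HO HN Hx Hk)).
    rewrite (CSeries_ext _ _ (fun m => odd_series2_part N h x a k m HO HN Hx Hk)). ring.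
  - assert (Hs : exists q, ps = (2 * q)%nat).
    { assert (He : Nat.even N = true) by (rewrite <- Nat.negb_odd, HO; reflexivity).
      apply Nat.even_spec in He. destruct He as [n ->].
      exists (Z.to_nat (Z.of_nat n + 2 * Z.of_nat n * Z.of_nat l - h)). lia. }
    destruct Hs as [q' ->]. rewrite (main_series_sin_even N h x a l q') by (auto; lia).
    rewrite <- Cmult_plus_distr_l, <- csum_plus. unfold S_even, prefactor. f_equal. apply csum_ext. intros k Hk.
    rewrite jeven_center by auto. fold (phase N h k).
    rewrite (CSeries_ext _ _ (fun m => even_series_part N h x a k m HO HN Hx Hk)).
    rewrite CSeries_plus, CSeries_scal.
    + ring.
    + apply Csummable_exp_part; auto; [lia|]. intros m. apply Rabs_le, SIN_bound.
    + apply Csummable_exp_part; auto; [lia|]. intros m. apply Rabs_le, COS_bound.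
    + apply Csummable_scal, Csummable_exp_part; auto; [lia|]. intros m. apply Rabs_le, SIN_bound.
Qed.

Theorem theorem1p1 (N : nat) (h : Z) (x a : R) :
  (0 < N)%nat ->
  (Z.of_nat N <= 2 * h)%Z ->
  0 < x ->
  0 < a <= 1 ->
  s_exp N h <> -2 * IZR (floor_hN_half N h) ->
  (* the inner series defining S(x,a) converge *)
  (forall k : nat, (k < N)%nat ->
     (Nat.odd N = true ->
        ex_series (V := C_NormedModule) (odd_series1 N h x a k) /\
        ex_series (V := C_NormedModule) (odd_series2 N h x a k)) /\
     (Nat.odd N = false ->
        ex_series (V := C_NormedModule) (even_series N h x a k))) /\
  (* sum_{n>=1} n^(N-2h) e^(-a n^N x)/(1-e^(-n^N x)) = P(x,a) + S(x,a) *)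
  is_series (V := C_NormedModule) (fun n => RtoC (lhs_term N h x a n))
            (Cplus (RtoC (P_term N h x a)) (S_term N h x a)).
Proof.
  intros HN Hh Hx Ha Hs. assert (HNR : 0 < INR N) by now apply lt_0_INR.
  (* J is floor(sigma)+1, which is ceil(sigma) once [Hne] has excluded integral sigma. *)
  set (H := Z.to_nat (2 * h)). set (J := S ((H - 1) / N)).
  assert (HH : Z.of_nat H = (2 * h)%Z) by (unfold H; lia).
  assert (EJ := Nat.div_mod_eq (H - 1) N). assert (LJ := Nat.mod_upper_bound (H - 1) N ltac:(lia)).
  assert (HJ1 : (J - 1 = (H - 1) / N)%nat) by (unfold J; lia).
  (* If N divided H-1, then sigma would be an integer l, and l would be odd because H is even. For l
     = 2t+1 the floor in the hypothesis is t and (N-2h+1)/N = -2t, the excluded value. *)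
  assert (Hne : (H - 1) mod N <> 0%nat).
  { intros E. rewrite E, Nat.add_0_r in EJ. set (l := ((H - 1) / N)%nat) in *.
    destruct (Nat.Even_or_Odd l) as [[t Ht]|[t Ht]].
    { assert (H - 1 = 2 * (N * t))%nat by nia. lia. }
    apply Hs. unfold floor_hN_half. rewrite (floor_div (2 * t * N + 1) (N * 2) t).
    - unfold s_exp. rewrite <- INR_IZR_INZ.
      replace (Z.of_nat N - 2 * h + 1)%Z with (- (2 * Z.of_nat t * Z.of_nat N))%Z by nia.
      rewrite opp_IZR, !mult_IZR, <- !INR_IZR_INZ. field. lra.
    - lia.
    - replace (IZR h) with ((INR N * (2 * INR t + 1) + 1) / 2).
      + rewrite plus_INR, !mult_INR. simpl (INR 2). simpl (INR 1). field. lra.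
      + assert (Hz : (2 * h = Z.of_nat N * (2 * Z.of_nat t + 1) + 1)%Z) by nia.
        apply (f_equal IZR) in Hz. rewrite mult_IZR, plus_IZR, mult_IZR, plus_IZR, mult_IZR, <- !INR_IZR_INZ in Hz. lra.
    - apply (Nat.div_unique _ _ t 1); lia. }
  assert (H1 : (N * (J - 1) + 2 <= H)%nat) by (rewrite HJ1; lia).
  assert (H2 : (H <= N * J)%nat) by (unfold J; rewrite Nat.mul_succ_r; lia).
  (* For odd N, 2h = N is impossible by parity and 2h = N+1 is excluded by [Hne]; the next even
     number is N+3. *)
  assert (Ho3 : Nat.odd N = true -> (Z.of_nat N + 3 <= 2 * h)%Z).
  { intros Ho. apply Nat.odd_spec in Ho. destruct Ho as [n Hn].
    assert (Hm : (2 * h - 1 <> Z.of_nat N)%Z).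
    { intros E. apply Hne. replace (H - 1)%nat with N by lia. apply Nat.Div0.mod_same. }
    lia. }
  assert (Hcore : is_series (lambert_term N H x a) (core_value N H J x a)).
  (* J = 1 forces H = N, and then N = 2h is even, so [core_one] applies. *)
  { destruct (Nat.le_gt_cases 2 J) as [HJ|HJ]; [now apply core_two|].
    assert (J = 1%nat) by (unfold J in *; lia).
    assert (H = N) by nia. rewrite H0, H3. apply core_one; auto.
    destruct (Nat.odd N) eqn:Ho; auto. specialize (Ho3 eq_refl). lia. }
  split.
  - intros k Hk. split; intros Ho.
    + split; apply Csummable_ex_series.
      * eapply Csummable_ext; [intros m; symmetry; now apply odd_series1_part|].
        apply Csummable_exp_part; auto; [lia|]. intros m. apply Rabs_le, COS_bound.
      * eapply Csummable_ext; [intros m; symmetry; now apply odd_series2_part|].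
        apply Csummable_digamma_part; auto. intros m. apply Rabs_le, SIN_bound.
    + apply Csummable_ex_series.
      eapply Csummable_ext; [intros m; symmetry; now apply even_series_part|].
      apply Csummable_plus; [|apply Csummable_scal]; apply Csummable_exp_part; auto; try lia; intros m; apply Rabs_le;
        [apply COS_bound|apply SIN_bound].
  - rewrite (S_term_closed N h J x a) by (auto; try (unfold J; lia); rewrite <- HH; nia).
    fold H. rewrite <- RtoC_plus, P_term_closed by auto. fold H.
    assert (Hse : s_exp N h = 1 - decay_exponent N H).
    { unfold s_exp, decay_exponent. rewrite plus_IZR, minus_IZR, <- HH, <- !INR_IZR_INZ. field. lra. }
    rewrite Hse. replace (- (1 - decay_exponent N H)) with (decay_exponent N H - 1) by ring.
    rewrite <- core_value_closed by (auto; unfold J; lia).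
    apply is_series_C; simpl.
    + eapply is_series_ext; [|exact Hcore]. intros n. unfold lambert_term, lhs_term. cbv zeta.
      assert (Hn : INR (S n) <> 0) by (apply not_0_INR; lia).
      replace (Z.of_nat N - 2 * h)%Z with (Z.of_nat N + - Z.of_nat H)%Z by lia.
      rewrite powerRZ_add, powerRZ_neg', <- !pow_powerRZ by auto.
      replace (- INR (S n) ^ N * x) with (- (INR (S n) ^ N * x)) by ring.
      replace (- a * INR (S n) ^ N * x) with (- a * (INR (S n) ^ N * x)) by ring.
      unfold Rdiv. match goal with |- ?u = ?v => change (u = v :> R) end. ring.
    + apply (is_series_rsum (fun _ _ => 0) (fun _ => 0) 0); intros; lia.
Qed.
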